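(* Let $N\ge 1$ and, for $\beta\in(0,N)$, let $\varphi(x)=\varphi_\beta(x):=|x|^{-\beta}$ on $\mathbb{R}^N$. (i) There exist $\beta_1,\beta_2\in(0,N)$ with $\beta_1\le\beta_2$ and $$\beta_1>\begin{cases}(N+1)/2 & \text{if } N\ge 3,\\ 1/2 & \text{if } N=2,\\ 7/16 & \text{if } N=1,\end{cases}$$ such that $$[S(t)\varphi_\beta](x)>0\ \text{ for all }(x,t)\in\mathbb{R}^N\times(0,\infty)\quad\text{if }\beta\in(0,\beta_1),$$ $$\inf_{(x,t)\in\mathbb{R}^N\times(0,\infty)}[S(t)\varphi_\beta](x)<0\quad\text{if }\beta\in(\beta_2,N).$$ (ii) Let $\beta\in(0,N)$ and assume that $[S(t)\varphi_\beta](x)>0$ for all $(x,t)\in\mathbb{R}^N\times(0,\infty)$. Then there exists $K_*=K_*(N,\beta)>0$ such that $$[S(t)\varphi_\beta](x)\ge\frac{K_*}{|x|^\beta+t^{\beta/4}}\quad\text{for all }(x,t)\in\mathbb{R}^N\times(0,\infty).$$ (iii) For any $\beta\in(0,N)$ there exists $K^*=K^*(N,\beta)>0$ such that $$\bigl|[S(t)\varphi_\beta](x)\bigr|\le\frac{K^*}{|x|^\beta+t^{\beta/4}}\quad\text{for all }(x,t)\in\mathbb{R}^N\times(0,\infty).$$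
   Context: $G(x,t)$ denotes the fundamental solution of $\partial_t+(-\Delta)^2$ in $\mathbb{R}^N\times(0,\infty)$: $G(x,t)=(2\pi)^{-N}\int_{\mathbb{R}^N}e^{ix\cdot\xi-t|\xi|^4}\,d\xi$; for each $t>0$, $G(\cdot,t)$ is a Schwartz function. For $(x,t)\in\mathbb{R}^N\times(0,\infty)$, $$[S(t)\varphi](x):=\int_{\mathbb{R}^N}G(x-y,t)\varphi(y)\,dy.$$ *)

(* Defs.v *)
From HB Require Import structures.
From mathcomp Require Import all_boot all_order all_algebra.
From mathcomp Require Import all_classical all_reals all_analysis.
From mathcomp Require Import complex.

Set Implicit Arguments.
Unset Strict Implicit.
Unset Printing Implicit Defensive.

Import Order.TTheory GRing.Theory Num.Theory.
Import numFieldNormedType.Exports.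

Local Open Scope classical_set_scope.
Local Open Scope ring_scope.

Section lebesgue_measure_tuple.
Context (R : realType).

Definition tuple_cons (n : nat)
    (p : measurableTypeR R * n.-tuple (measurableTypeR R)) :
    n.+1.-tuple (measurableTypeR R) := [tuple of p.1 :: p.2].

Lemma measurable_tuple_cons n : measurable_fun [set: _] (@tuple_cons n).
Proof. exact: measurable_cons. Qed.

HB.instance Definition _ n :=
  isMeasurableFun.Build _ _ _ _ (@tuple_cons n) (@measurable_tuple_cons n).

Section successor.
Local Open Scope ereal_scope.
Variables (n : nat)
  (mu : {sigma_finite_measure set (n.-tuple (measurableTypeR R)) -> \bar R}).

Definition lebesgue_tupleS : set (n.+1.-tuple (measurableTypeR R)) -> \bar R :=
  pushforward (lebesgue_measure \x mu) (@tuple_cons n).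

Let lebesgue_tupleS0 : lebesgue_tupleS set0 = 0.
Proof. exact: measure0. Qed.

Let lebesgue_tupleS_ge0 A : 0 <= lebesgue_tupleS A.
Proof. exact: measure_ge0. Qed.

Let lebesgue_tupleS_sigma_additive : semi_sigma_additive lebesgue_tupleS.
Proof. exact: measure_semi_sigma_additive. Qed.

HB.instance Definition _ := isMeasure.Build _ _ _ lebesgue_tupleS
  lebesgue_tupleS0 lebesgue_tupleS_ge0 lebesgue_tupleS_sigma_additive.

Let lebesgue_tupleS_sigma_finite : sigma_finite setT lebesgue_tupleS.
Proof.
pose g (s : n.+1.-tuple (measurableTypeR R)) := (thead s, [tuple of behead s]).
have mg : measurable_fun [set: _] g.
  apply/measurable_fun_pair; first exact: measurable_tnth.
  exact: measurable_behead.
have gK p : g (tuple_cons p) = p by case: p => x y; congr pair; exact/val_inj.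
have /sigma_finiteP[F [TF ndF Foo]] :=
  @sigma_finiteT _ _ _ (@lebesgue_measure R : {sigma_finite_measure set _ -> \bar R}).
have /sigma_finiteP[G [TG ndG Goo]] := sigma_finiteT mu.
exists (fun k => g @^-1` (F k `*` G k)).
  rewrite -preimage_bigcup (_ : \bigcup_k _ = setT) ?preimage_setT//.
  rewrite -setXTT TF TG; apply/seteqP; split => -[x y].
    by move=> [k _ []/= ? ?]; split; exists k.
  move=> [/= [k _ Fkx] [l _ Gly]]; exists (maxn k l) => //; split.
  - by move: x Fkx; exact/subsetPset/ndF/leq_maxl.
  - by move: y Gly; exact/subsetPset/ndG/leq_maxr.
move=> k; have [mF Fk] := Foo k; have [mG Gk] := Goo k; split.
  by rewrite -[X in measurable X]setTI; apply: mg => //; exact: measurableX.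
rewrite /lebesgue_tupleS /pushforward -comp_preimage.
rewrite (_ : _ \o _ = id) ?preimage_id; last by apply/funext => p; exact: gK.
by rewrite product_measure1E// lte_mul_pinfty// ge0_fin_numE.
Qed.

HB.instance Definition _ := Measure_isSigmaFinite.Build _ _ _ lebesgue_tupleS
  lebesgue_tupleS_sigma_finite.

End successor.

Let sigma_finite_dirac_nil : sigma_finite setT
  (\d_([tuple] : 0.-tuple (measurableTypeR R)) : set _ -> \bar R).
Proof. by apply: fin_num_fun_sigma_finite => //; rewrite measure0. Qed.

(* Lebesgue measure on R^N, as an N-fold product measure. *)
Fixpoint lebesgue_tuple (N : nat) :
    {sigma_finite_measure set (N.-tuple (measurableTypeR R)) -> \bar R} :=
  if N is n.+1 then lebesgue_tupleS (lebesgue_tuple n)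
  else \d_([tuple] : 0.-tuple (measurableTypeR R)).

Lemma lebesgue_tuple_box N (A : 'I_N -> set (measurableTypeR R)) :
  (forall i, measurable (A i)) ->
  lebesgue_tuple N [set x | forall i, A i (tnth x i)] =
  (\prod_(i < N) lebesgue_measure (A i))%E.
Proof.
elim: N A => [|n IH] A mA.
  rewrite big_ord0 /= diracE mem_set//= => -[]//.
rewrite big_ord_recl -(IH (fun i => A (lift ord0 i)))// -product_measure1E//.
  rewrite /= /lebesgue_tupleS /pushforward; congr product_measure1.
  apply/seteqP; split => -[x y] /=.
    move=> h; split => [|i]; first exact: (h ord0).
    by have := h (lift ord0 i); rewrite /tuple_cons tnthS.
  move=> [h0 h] i; case: (unliftP ord0 i) => [j|] ->//.
  by rewrite /tuple_cons tnthS; exact: h.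
rewrite (_ : mkset _ = \big[setI/setT]_(i < n)
    ((fun x => tnth x i) @^-1` A (lift ord0 i))); last first.
  rewrite -bigcap_seq; apply/seteqP; split => x /=.
    by move=> h i _; exact: h.
  by move=> h i; apply: h; rewrite /= mem_index_enum.
apply: bigsetI_measurable => i _.
rewrite -[X in measurable X]setTI; exact: measurable_tnth.
Qed.

End lebesgue_measure_tuple.

Section biharmonic_heat.
Context (R : realType) (N : nat).
Local Open Scope complex_scope.

Definition row_of_tuple (y : N.-tuple (measurableTypeR R)) : 'rV[R]_N :=
  \row_i (tnth y i : R).

Definition integralRN (f : 'rV[R]_N -> R) : R :=
  \int[lebesgue_tuple R N]_(y in setT) f (row_of_tuple y).

Definition integralCN (f : 'rV[R]_N -> R[i]) : R[i] :=
  integralRN (fun y => complex.Re (f y)) +i*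
  integralRN (fun y => complex.Im (f y)).

Definition expC (z : R[i]) : R[i] :=
  (expR (complex.Re z))%:C *
  (cos (complex.Im z) +i* sin (complex.Im z)).

Definition dotRN (x y : 'rV[R]_N) : R := \sum_i x ord0 i * y ord0 i.

(* The Euclidean norm; the library norm `|x| on row vectors is the sup norm. *)
Definition normRN (x : 'rV[R]_N) : R := Num.sqrt (dotRN x x).

(* The integral is real because its integrand is conjugated by the symmetry
   xi |-> - xi. *)
Definition biheat_kernel (x : 'rV[R]_N) (t : R) : R :=
  complex.Re (((2 * pi) ^- N)%:C *
    integralCN (fun xi => expC ('i%C * (dotRN x xi)%:C - (t * normRN xi ^+ 4)%:C))).

Definition biheat (t : R) (phi : 'rV[R]_N -> R) (x : 'rV[R]_N) : R :=
  integralRN (fun y => biheat_kernel (x - y) t * phi y).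

(* At the origin this takes the junk value 0; a point is Lebesgue-negligible
   for N >= 1. *)
Definition riesz (beta : R) (x : 'rV[R]_N) : R := normRN x `^ (- beta).

End biharmonic_heat.

Definition beta_threshold (R : realType) (N : nat) : R :=
  match N with
  | 1 => 7 / 16
  | 2 => 1 / 2
  | _ => (N%:R + 1) / 2
  end.

(* Main.v *)
(* By scaling, [S(t) phi_b](x) = (2 pi)^-N t^(-b/4) U(x t^(-1/4)), where U is the solution
   at time 1 without the factor (2 pi)^-N. Writing |y|^-b as a mixture of Gaussians shows
   that U is a positive multiple of F(x) = int cos(x.xi) |xi|^(b-N) exp(-|xi|^4) dxi.

   The kernel decays faster than any power. Hence |x|^b U(x) is bounded and tends to the
   (positive) integral of the kernel at infinity, uniformly for b in compact sets. This
   gives (iii), then (ii) by compactness, and the openness of positivity in b, which makes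
   the inequality on beta1 strict.

   Near b = N, F takes negative values: its integral against e (1 - e)^2, where
   e(x) = exp(-s |x|^2) with s small, is negative.

   For b <= 1/2, F is an average over slices of int cos(r a) a^(b-1) exp(-k a^4) da, and
   int_0^t cos(a) a^(b-1) da > 0 for all t > 0.

   For N >= 3 and b <= (N+1)/2, put mu = (N-3)/2 and Y(z) = int cos(z a) (1-a^2)^mu da over
   [-1, 1]. In the variable R = |xi|^2, F(x) is up to a positive factor the integral of
   Y(|x| sqrt R) R^mu phi(R), where phi(R) = R^-c exp(-R^2) and c = (N-b-1)/2. A suitable
   derivative (-d/dR)^m phi is positive, so phi is a fractional integral of order mu+1 of a positive
   function, and it remains to integrate Y(r sqrt R) against (R (S-R))^mu over [0, S]. By the
   product formula for Y this is a positive multiple of S^(2 mu + 1) Y(r sqrt S / 2)^2. *)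

Require Import Defs.
From HB Require Import structures.
From mathcomp Require Import all_boot all_order all_algebra.
From mathcomp Require Import all_classical all_reals all_analysis.
From mathcomp Require Import measurable_realfun ring lra.
Set Implicit Arguments.
Unset Strict Implicit.
Unset Printing Implicit Defensive.
Import Order.TTheory GRing.Theory Num.Theory.
Import numFieldNormedType.Exports.
Local Open Scope classical_set_scope.
Local Open Scope ring_scope.

(** * Tonelli, rotations and polar coordinates on tuples *)

(** Spheres enter only through integrals over R^N: polar coordinates come from a scaling argument
    that fixes the radial density up to a positive factor, and averages over directions are Gaussian
    integrals of functions of y/|y|. The unknown factors are carried along and cancelled.

    The order mu + 1 = (N-1)/2 decides how many derivatives of phi are taken. For N odd it is an
    integer m, and (-d/dR)^m phi > 0 for c >= (m-1)/2, which is exactly b <= (N+1)/2. For N even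
    half a derivative too many is taken and integrated back; c may then fall short by 1/4 of what
    makes all coefficients nonnegative, and a discriminant estimate closes that gap.

    The weight is e (1-e)^2 = e - 2 e^2 + e^3. At b = N the pairing of F with e^k is a constant
    times int exp(-k^2 s^2 |y|^4 - |y|^2/4) dy, so the coefficients 1, -2, 1 cancel order 0 and
    leave -(1 - 8 + 9) = -2 at order s^2.

    The value 1/2 for small N comes from comparing the first positive arch of cos(a) a^(b-1) with
    the negative arch after it. Both thresholds are attained, and openness in b then passes strictly
    beyond them. *)

Lemma measurable_sum_fun d (T : measurableType d) (R : realType) (I : Type)
    (s : seq I) (h : I -> T -> R) :
  (forall i, measurable_fun setT (h i)) ->
  measurable_fun setT (fun x => \sum_(i <- s) h i x).
Proof.
move=> mh; elim: s => [|i s IH].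
  by under eq_fun do rewrite big_nil; exact: measurable_cst.
by under eq_fun do rewrite big_cons; apply: measurable_funD.
Qed.

Ltac mfun := repeat first
  [ exact: measurable_cst | exact: measurable_id | exact: measurable_fst | exact: measurable_snd
  | assumption
  | apply: measurable_tnth
  | apply: measurable_funD | apply: measurable_funB | apply: measurable_funN
  | apply: measurable_funM | apply: measurable_funX
  | apply: measurable_sum_fun => ?
  | apply: (measurableT_comp (@measurable_expR _))
  | apply: (measurableT_comp (@measurable_powR _ _))
  | apply: (measurableT_comp (continuous_measurable_fun (@continuous_cos _)))
  | apply: (measurableT_comp (continuous_measurable_fun (@continuous_sin _)))
  | apply: (measurableT_comp (@measurable_tnth _ _ _ _))
  | apply: (measurableT_comp (@measurable_fst _ _ _ _))
  | apply: (measurableT_comp (@measurable_snd _ _ _ _))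
  ].

Section tonelli_curried.
Context d1 d2 (T1 : measurableType d1) (T2 : measurableType d2) (R : realType).
Variables (m1 : {sigma_finite_measure set T1 -> \bar R})
  (m2 : {sigma_finite_measure set T2 -> \bar R}).
Local Open Scope ereal_scope.

Lemma tonelli_swap (f : T1 -> T2 -> \bar R) :
  measurable_fun setT (fun z => f z.1 z.2) -> (forall x y, 0 <= f x y) ->
  \int[m1]_x \int[m2]_y f x y = \int[m2]_y \int[m1]_x f x y.
Proof.
by move=> mf f0; apply: (@fubini_tonelli _ _ _ _ _ m1 m2 (fun z => f z.1 z.2)) => // -[].
Qed.

Lemma measurable_integral_snd (f : T1 -> T2 -> \bar R) :
  measurable_fun setT (fun z => f z.1 z.2) -> (forall x y, 0 <= f x y) ->
  measurable_fun setT (fun x => \int[m2]_y f x y).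
Proof.
move=> mf f0.
by apply: (@measurable_fun_fubini_tonelli_F _ _ _ _ _ m2 (fun z => f z.1 z.2)) => // -[].
Qed.

Lemma measurable_curry1 d (U : measurableType d) (f : T1 -> T2 -> U) x :
  measurable_fun setT (fun z => f z.1 z.2) -> measurable_fun setT (f x).
Proof. by move=> mf; exact: (measurableT_comp mf (pair1_measurable x)). Qed.

Lemma measurable_curry2 d (U : measurableType d) (f : T1 -> T2 -> U) y :
  measurable_fun setT (fun z => f z.1 z.2) -> measurable_fun setT (f ^~ y).
Proof. by move=> mf; exact: (measurableT_comp mf (pair2_measurable y)). Qed.

End tonelli_curried.

Section affine.
Context {R : realType}.
Notation leb := (@lebesgue_measure R).
Local Open Scope ereal_scope.

Lemma measurable_affine (k c : R) :
  measurable_fun [set: measurableTypeR R]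
    ((fun x => k * x + c)%R : measurableTypeR R -> measurableTypeR R).
Proof. by mfun. Qed.

(** The pushforward of Lebesgue measure under x -> k x + c, multiplied by |k|, agrees with Lebesgue
    measure on half-open intervals, hence everywhere. *)
Lemma ge0_integral_affine (k c : R) (f : R -> \bar R) : k != 0%R ->
  measurable_fun [set: R] f -> (forall x, 0 <= f x) ->
  \int[leb]_x f (k * x + c)%R = `|k|^-1%:E * \int[leb]_x f x.
Proof.
move=> k0 mf f0.
pose phi : measurableTypeR R -> measurableTypeR R := fun x => (k * x + c)%R.
pose nk : {nonneg R} := NngNum (normr_ge0 k).
have kk : (0 < `|k|)%R by rewrite normr_gt0.
have ab_lt (a b : R) : (a < b)%R -> leb (phi @^-1` `]a, b]) = ((b - a) / `|k|)%:E.
  move=> ab; have [k1|k1] := ltP 0%R k.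
    rewrite gtr0_norm//.
    rewrite (_ : phi @^-1` _ = `]((a - c) / k)%R, ((b - c) / k)%R]%classic).
      rewrite lebesgue_measure_itv/= lte_fin ltr_pM2r ?invr_gt0// ltrD2r ab -EFinB.
      by congr EFin; rewrite -mulrBl; congr (_ / _)%R; ring.
    apply/seteqP; split => x /=; rewrite /phi !in_itv/= ltr_pdivrMr// ler_pdivlMr//.
      by move=> /andP[? ?]; apply/andP; split; lra.
    by move=> /andP[? ?]; apply/andP; split; lra.
  have k2 : (k < 0)%R by rewrite lt_neqAle k0 k1.
  rewrite ltr0_norm//.
  rewrite (_ : phi @^-1` _ = `[((b - c) / k)%R, ((a - c) / k)%R[%classic).
    rewrite lebesgue_measure_itv/= lte_fin ltr_nM2r ?invr_lt0// ltrD2r ab -EFinB.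
    by congr EFin; rewrite -mulrBl invrN mulrN -mulNr; congr (_ / _)%R; ring.
  apply/seteqP; split => x /=; rewrite /phi !in_itv/= ler_ndivrMr// ltr_ndivlMr//.
    by move=> /andP[? ?]; apply/andP; split; lra.
  by move=> /andP[? ?]; apply/andP; split; lra.
pose m0 : {measure set (measurableTypeR R) -> \bar R} :=
  mscale nk (pushforward leb phi).
pose m := m0 (@measurable_affine k c).
have E : forall A : set (measurableTypeR R), measurable A -> leb A = m A.
  apply: lebesgue_measure_unique => _ [[a b]] _ <- /=.
  rewrite /m /m0 /= /mscale/= /pushforward lebesgue_measure_itv/= lte_fin.
  have [ab|ab] := ltP a b; first by rewrite ab_lt// -EFinB -EFinM mulrC divfK// gt_eqF.
  by rewrite set_itv_ge ?bnd_simp -?leNgt// preimage_set0 measure0 mule0.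
have -> : \int[leb]_x f x = \int[m]_x f x.
  by apply: eq_measure_integral => A mA _; exact: E.
rewrite ge0_integral_mscale// ge0_integral_pushforward//=; last exact: (measurable_affine k c).
by rewrite muleA -EFinM mulVf ?mul1e// gt_eqF.
Qed.

End affine.

Section tonelli.
Context {R : realType}.
Notation leb := (@lebesgue_measure R).
Notation lam n := (lebesgue_tuple R n).
Local Open Scope ereal_scope.

Lemma lam0E (f : 0.-tuple (measurableTypeR R) -> \bar R) :
  measurable_fun setT f ->
  \int[lam 0]_y f y = f [tuple].
Proof. by move=> mf; rewrite /= integral_dirac// diracT mul1e. Qed.

Lemma measurable_tuple_consE n (f : n.+1.-tuple (measurableTypeR R) -> \bar R) :
  measurable_fun setT f -> measurable_fun setT (fun p => f (tuple_cons p)).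
Proof. by move=> mf; apply: (measurableT_comp mf); exact: measurable_tuple_cons. Qed.

Lemma lamS_prod n (f : n.+1.-tuple (measurableTypeR R) -> \bar R) :
  measurable_fun setT f -> (forall y, 0 <= f y) ->
  \int[lam n.+1]_y f y = \int[leb \x lam n]_p f (tuple_cons p).
Proof. by move=> mf f0; rewrite /= ge0_integral_pushforward//. Qed.

Lemma lamS n (f : n.+1.-tuple (measurableTypeR R) -> \bar R) :
  measurable_fun setT f -> (forall y, 0 <= f y) ->
  \int[lam n.+1]_y f y = \int[leb]_a \int[lam n]_e f (tuple_cons (a, e)).
Proof.
move=> mf f0; rewrite lamS_prod// fubini_tonelli1//.
exact: measurable_tuple_consE.
Qed.

Lemma lamS' n (f : n.+1.-tuple (measurableTypeR R) -> \bar R) :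
  measurable_fun setT f -> (forall y, 0 <= f y) ->
  \int[lam n.+1]_y f y = \int[lam n]_e \int[leb]_a f (tuple_cons (a, e)).
Proof.
move=> mf f0; rewrite lamS_prod// fubini_tonelli2//.
exact: measurable_tuple_consE.
Qed.

End tonelli.

Section geometry.
Context {R : realType}.
Notation leb := (@lebesgue_measure R).
Notation T := (measurableTypeR R).
Notation lam n := (lebesgue_tuple R n).

Definition sqT n (y : n.-tuple T) : R := \sum_(i < n) (tnth y i : R) ^+ 2.
Definition dotT n (x y : n.-tuple T) : R :=
  \sum_(i < n) (tnth x i : R) * (tnth y i : R).
(** The map y -> k y + x. With k = -1 it is the difference x - y, with x = 0 a dilation, so one
    change of variables serves both. *)
Definition affT n (k : R) (x y : n.-tuple T) : n.-tuple T :=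
  [tuple k * (tnth y i : R) + tnth x i | i < n].

Lemma sqT_cons n (a : T) (e : n.-tuple T) :
  sqT (tuple_cons (a, e)) = (a : R) ^+ 2 + sqT e.
Proof. by rewrite /sqT big_ord_recl; congr (_ + _); apply: eq_bigr => i _; rewrite tnthS. Qed.

Lemma dotT_cons n (a b : T) (e f : n.-tuple T) :
  dotT (tuple_cons (a, e)) (tuple_cons (b, f)) = (a : R) * (b : R) + dotT e f.
Proof. by rewrite /dotT big_ord_recl; congr (_ + _); apply: eq_bigr => i _; rewrite !tnthS. Qed.

Lemma affT_cons n k (a b : T) (e f : n.-tuple T) :
  affT k (tuple_cons (a, e)) (tuple_cons (b, f)) =
  tuple_cons (k * (b : R) + (a : R) : T, affT k e f).
Proof.
apply: eq_from_tnth => i; rewrite tnth_mktuple.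
by case: (unliftP ord0 i) => [j|] ->//; rewrite !tnthS tnth_mktuple.
Qed.

Lemma tuple_consE n (y : n.+1.-tuple T) :
  y = tuple_cons (thead y, [tuple of behead y]).
Proof. by rewrite [LHS]tuple_eta. Qed.

Lemma sqT_ge0 n (y : n.-tuple T) : 0 <= sqT y.
Proof. by apply: sumr_ge0 => i _; exact: sqr_ge0. Qed.

Lemma measurable_sqT n : measurable_fun setT (@sqT n).
Proof. by rewrite /sqT; mfun. Qed.

Lemma measurable_dotT2 d (U : measurableType d) n (f g : U -> n.-tuple T) :
  measurable_fun setT f -> measurable_fun setT g ->
  measurable_fun setT (fun u => dotT (f u) (g u)).
Proof.
move=> mf mg; rewrite /dotT; apply: measurable_sum_fun => i.
by apply: measurable_funM; apply: (measurableT_comp (@measurable_tnth _ _ _ _)).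
Qed.

Lemma measurable_dotT n (x : n.-tuple T) : measurable_fun setT (dotT x).
Proof. by apply: measurable_dotT2; mfun. Qed.

Lemma measurable_affT2 d (U : measurableType d) n k (f g : U -> n.-tuple T) :
  measurable_fun setT f -> measurable_fun setT g ->
  measurable_fun setT (fun u => affT k (f u) (g u)).
Proof.
move=> mf mg; apply/measurable_fun_tnthP => i.
rewrite (_ : _ \o _ = fun u => k * (tnth (g u) i : R) + (tnth (f u) i : R)); last first.
  by apply/funext => u /=; rewrite tnth_mktuple.
apply: measurable_funD; last exact: (measurableT_comp (@measurable_tnth _ _ _ _)).
by apply: measurable_funM => //; apply: (measurableT_comp (@measurable_tnth _ _ _ _)).
Qed.

Lemma measurable_affT n k (x : n.-tuple T) : measurable_fun setT (affT k x).
Proof. by apply: measurable_affT2; mfun. Qed.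

Local Open Scope ereal_scope.

Lemma measurable_consr n a (f : n.+1.-tuple T -> \bar R) :
  measurable_fun setT f -> measurable_fun setT (fun e => f (tuple_cons (a, e))).
Proof.
move=> mf; apply: (measurableT_comp mf).
by apply: (measurableT_comp (@measurable_tuple_cons R n)); exact: pair1_measurable.
Qed.

Lemma ge0_integral_affT n (k : R) (x : n.-tuple T) (f : n.-tuple T -> \bar R) :
  k != 0%R -> measurable_fun setT f -> (forall y, 0 <= f y) ->
  \int[lam n]_y f (affT k x y) = (`|k| ^- n)%:E * \int[lam n]_y f y.
Proof.
move=> k0; elim: n x f => [|n IH] x f mf f0.
  rewrite !lam0E// ?expr0 ?invr1 ?mul1e; last by apply: (measurableT_comp mf); exact: measurable_affT.
  by congr f; apply: eq_from_tnth => -[].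
have mf' : measurable_fun setT (f \o affT k x).
  by apply: (measurableT_comp mf); exact: measurable_affT.
rewrite (lamS mf'); last by move=> y; exact: f0.
rewrite (lamS mf f0).
have mI : measurable_fun setT (fun a => \int[lam n]_e f (tuple_cons (a, e))).
  exact: (@measurable_fun_fubini_tonelli_F _ _ _ _ _ (lam n) (fun p => f (tuple_cons p))
    (measurable_tuple_consE mf)).
transitivity (\int[leb]_a ((`|k| ^- n)%:E *
    \int[lam n]_e f (tuple_cons ((k * a + thead x)%R : T, e)))).
  apply: eq_integral => a _; rewrite -(IH [tuple of behead x])//.
  - by apply: eq_integral => e _ /=; rewrite {1}(tuple_consE x) affT_cons.
  - exact: measurable_consr.
rewrite ge0_integralZl//; last 2 first.
- exact: (@measurableT_comp _ _ _ T T _ _ setT _ mI (measurable_affine k (thead x))).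
- by move=> a _; exact: integral_ge0.
rewrite (ge0_integral_affine (thead x) k0 mI); last by move=> a; exact: integral_ge0.
by rewrite muleA -EFinM exprSr invfM.
Qed.

(* For u = c p + s q the substitutions (a, b) -> (p, b), (p, a) -> (p, q) below
   are affine in one variable at a time. *)
Lemma ge0_rotation2 (c s : R) (f : R * R -> \bar R) : (c ^+ 2 + s ^+ 2 != 0)%R ->
  measurable_fun setT f -> (forall p, 0 <= f p) ->
  let r := Num.sqrt (c ^+ 2 + s ^+ 2)%R in
  \int[leb]_a \int[leb]_b f (c * a + s * b, a ^+ 2 + b ^+ 2)%R =
  \int[leb]_p \int[leb]_q f (r * p, p ^+ 2 + q ^+ 2)%R.
Proof.
move=> cs mf f0 r.
have r2 : (r ^+ 2 = c ^+ 2 + s ^+ 2)%R by rewrite sqr_sqrtr// addr_ge0// sqr_ge0.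
have r0 : (0 < r)%R.
  by rewrite sqrtr_gt0 lt_neqAle eq_sym cs addr_ge0// sqr_ge0.
(* The substitutions below divide by s. For s = 0 only the sign of c has to be absorbed, by a
   reflection. *)
have [s0|s0] := eqVneq s 0%R.
  have rc : r = `|c|%R by rewrite /r s0 expr0n/= addr0 sqrtr_sqr.
  have [c0|c0] := leP 0%R c.
    by apply: eq_integral => a _; apply: eq_integral => b _; rewrite s0 mul0r addr0 rc ger0_norm.
  have mI : measurable_fun setT (fun p => \int[leb]_q f (r * p, p ^+ 2 + q ^+ 2)%R).
    apply: (@measurable_integral_snd _ _ T T R leb
      (fun p q => f (r * p, p ^+ 2 + q ^+ 2)%R)) => //.
    by apply: (measurableT_comp mf); apply/measurable_fun_pair => /=; mfun.
  have N1 : (-1 != 0 :> R)%R by rewrite oppr_eq0 oner_eq0.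
  have := ge0_integral_affine 0%R N1 mI.
  rewrite normrN1 invr1 mul1e => <-; last by move=> a; exact: integral_ge0.
  apply: eq_integral => a _; apply: eq_integral => b _; rewrite s0 mul0r addr0 rc ltr0_norm//.
  by congr (f (_, _)); ring.
have mf2 : measurable_fun setT (fun z : T * T =>
    f (c * z.1 + s * z.2, z.1 ^+ 2 + z.2 ^+ 2)%R).
  by apply: (measurableT_comp mf); apply/measurable_fun_pair => /=; mfun.
set d := (r / s)%R.
have dE b : forall a p, (p = c / r * a + s / r * b)%R -> (r * p = c * a + s * b)%R.
  by move=> a p ->; field; rewrite gt_eqF.
have rn0 : (r != 0)%R by rewrite gt_eqF.
have sr0 : (s / r != 0)%R by rewrite mulf_neq0// invr_neq0.
have rs0 : (r / s != 0)%R by rewrite mulf_neq0// invr_neq0.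
(* At fixed a, the substitution p = (c a + s b) / r turns b into (r p - c a) / s. *)
pose g (a p : R) := f (r * p, a ^+ 2 + ((r * p - c * a) / s) ^+ 2)%R.
have mg : measurable_fun setT (fun z : T * T => g z.1 z.2).
  by apply: (measurableT_comp mf); apply/measurable_fun_pair => /=; mfun.
transitivity (\int[leb]_a (`|s / r|^-1%:E * \int[leb]_p g a p)).
  apply: eq_integral => a _.
  have mga : measurable_fun setT (g a).
    exact: (measurable_curry1 a mg).
  rewrite -(ge0_integral_affine (c / r * a)%R sr0 mga); last by move=> ?; exact: f0.
  apply: eq_integral => b _; rewrite /g; congr (f (_, _)%R).
    by field; rewrite gt_eqF.
  by congr (_ + _ ^+ 2)%R; field; rewrite s0 gt_eqF.
rewrite ge0_integralZl//; [|by apply: (@measurable_integral_snd _ _ T T R leb g) => // ? ?; exact: f0|by move=> a _; apply: integral_ge0 => ? _; exact: f0].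
rewrite (@tonelli_swap _ _ T T R leb leb g)//; last by move=> ? ?; exact: f0.
rewrite -ge0_integralZl//; last 2 first.
- apply: (@measurable_integral_snd _ _ T T R leb (fun p a => g a p)) => //; last by move=> ? ?; exact: f0.
  by apply: (measurableT_comp mf); apply/measurable_fun_pair => /=; mfun.
- by move=> a _; apply: integral_ge0 => ? _; exact: f0.
apply: eq_integral => p _.
have mh : measurable_fun setT (fun q : R => f (r * p, p ^+ 2 + q ^+ 2)%R).
  by apply: (measurableT_comp mf); apply/measurable_fun_pair => /=; mfun.
rewrite -[in RHS](mul1e (\int[leb]_q _)).
transitivity (`|s / r|^-1%:E * \int[leb]_a f (r * p, p ^+ 2 + (r / s * a + (- (p * c / s))) ^+ 2)%R).
  congr (_ * _); apply: eq_integral => a _; rewrite /g; congr (f (_, _)%R).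
  (* Since s^2 = r^2 - c^2, both numerators expand to r^2 a^2 + r^2 p^2 - 2 r c a p. *)
  have -> : (a ^+ 2 + ((r * p - c * a) / s) ^+ 2 =
             (a ^+ 2 * s ^+ 2 + (r * p - c * a) ^+ 2) / s ^+ 2)%R by field; exact: s0.
  have -> : (p ^+ 2 + (r / s * a + - (p * c / s)) ^+ 2 =
             (p ^+ 2 * s ^+ 2 + (r * a - p * c) ^+ 2) / s ^+ 2)%R by field; exact: s0.
  congr (_ / _)%R; have -> : (s ^+ 2 = r ^+ 2 - c ^+ 2)%R by rewrite r2; ring.
  by ring.
rewrite (ge0_integral_affine _ rs0 mh)//.
rewrite muleA -EFinM -invfM -normrM (_ : s / r * (r / s) = 1)%R ?normr1 ?invr1//.
by field; rewrite s0 gt_eqF.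
Qed.

End geometry.

(** Positive and negative parts transfer separately, and both sides subtract the same extended
    reals; the identity therefore also covers functions that are not integrable. *)
Lemma integral_transfer d1 d2 d (T1 : measurableType d1) (T2 : measurableType d2)
    (U : measurableType d) (R : realType)
    (m1 : {measure set T1 -> \bar R}) (m2 : {measure set T2 -> \bar R})
    (p1 : T1 -> U) (p2 : T2 -> U) :
  (forall g : U -> \bar R, measurable_fun setT g -> (forall u, (0 <= g u)%E) ->
    (\int[m1]_x g (p1 x) = \int[m2]_x g (p2 x))%E) ->
  forall f : U -> \bar R, measurable_fun setT f ->
    (\int[m1]_x f (p1 x) = \int[m2]_x f (p2 x))%E.
Proof.
move=> H f mf; rewrite integralE [RHS]integralE; congr (_ - _)%E.
- transitivity (\int[m1]_x (f^\+ (p1 x)))%E.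
    by apply: eq_integral => x _; rewrite !funeposE.
  rewrite H//; last exact: measurable_funepos.
  by apply: eq_integral => x _; rewrite !funeposE.
- transitivity (\int[m1]_x (f^\- (p1 x)))%E.
    by apply: eq_integral => x _; rewrite !funenegE.
  rewrite H//; last exact: measurable_funeneg.
  by apply: eq_integral => x _; rewrite !funenegE.
Qed.

Lemma pmuleBr (R : realType) (c : R) (a b : \bar R) : 0 < c ->
  (c%:E * (a - b) = c%:E * a - c%:E * b)%E.
Proof.
move=> c0; have ce : (0 < c%:E)%E by rewrite lte_fin.
by case: a b => [a| |] [b| |]; rewrite ?(gt0_muley ce, gt0_muleNy ce)//= -EFinB -!EFinM -EFinB mulrBr.
Qed.

Section rotation.
Context {R : realType}.
Notation leb := (@lebesgue_measure R).
Notation T := (measurableTypeR R).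
Notation lam n := (lebesgue_tuple R n).

Definition normT n (y : n.-tuple T) : R := Num.sqrt (sqT y).

Lemma normT_ge0 n (y : n.-tuple T) : 0 <= normT y.
Proof. exact: sqrtr_ge0. Qed.

Lemma normT_sqr n (y : n.-tuple T) : normT y ^+ 2 = sqT y.
Proof. by rewrite sqr_sqrtr// sqT_ge0. Qed.

Lemma measurable_thead n : measurable_fun setT (fun y : n.+1.-tuple T => (thead y : R)).
Proof. exact: (measurable_tnth ord0). Qed.

Lemma sqT_eq0 n (y z : n.-tuple T) : sqT y = 0 -> dotT y z = 0.
Proof.
move=> /eqP; rewrite /sqT psumr_eq0; last by move=> i _; exact: sqr_ge0.
move=> /allP h; rewrite /dotT big1// => i _.
by have := h i (mem_index_enum i); rewrite /= sqrf_eq0 => /eqP ->; rewrite mul0r.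
Qed.

Local Open Scope ereal_scope.

(* Rotation invariance of the Lebesgue measure, in the form used for functions of
   (x . xi, |xi|^2); coordinates are merged two at a time into the norm of x. *)
Lemma ge0_integral_rot n (x : n.+1.-tuple T) (f : R * R -> \bar R) :
  measurable_fun setT f -> (forall p, 0 <= f p) ->
  \int[lam n.+1]_y f (dotT x y, sqT y) =
  \int[lam n.+1]_y f (normT x * (thead y : R), sqT y)%R.
Proof.
have mL m (x' : m.-tuple T) (g : R * R -> \bar R) : measurable_fun setT g ->
    measurable_fun setT (fun y => g (dotT x' y, sqT y)).
  move=> mg; apply: (measurableT_comp mg); apply/measurable_fun_pair => /=.
    exact: measurable_dotT.
  exact: measurable_sqT.
have mH m c (g : R * R -> \bar R) : measurable_fun setT g ->
    measurable_fun setT (fun y : m.+1.-tuple T => g (c * (thead y : R), sqT y)%R).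
  move=> mg; apply: (measurableT_comp mg); apply/measurable_fun_pair => /=.
    by apply: measurable_funM => //; exact: measurable_thead.
  exact: measurable_sqT.
elim: n x f => [|n IH] x f mf f0.
  rewrite (lamS (mL _ _ _ mf)); last by move=> ?; exact: f0.
  rewrite (lamS (mH _ _ _ mf)); last by move=> ?; exact: f0.
  have -> : normT x = `|thead x|%R.
    by rewrite /normT {1}(tuple_consE x) sqT_cons /sqT big_ord0 addr0 sqrtr_sqr.
  have E (c a : R) : \int[lam 0]_e f (c * (thead (tuple_cons (a : T, e)) : R), sqT (tuple_cons (a : T, e)))%R =
      f (c * a, a ^+ 2)%R.
    rewrite lam0E.
      by rewrite sqT_cons /sqT big_ord0 addr0.
    have := @measurable_consr R 0 a _ (mH _ c _ mf); exact.
  have E' (a : R) : \int[lam 0]_e f (dotT x (tuple_cons (a : T, e)), sqT (tuple_cons (a : T, e)))%R =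
      f (thead x * a, a ^+ 2)%R.
    rewrite lam0E.
      by rewrite {1}(tuple_consE x) dotT_cons sqT_cons /sqT /dotT !big_ord0 !addr0.
    have := @measurable_consr R 0 a _ (mL _ x _ mf); exact.
  under eq_integral do rewrite E'; under [RHS]eq_integral do rewrite E.
  have [c0|c0] := leP 0%R (thead x : R).
    by apply: eq_integral => a _; rewrite ger0_norm.
  have N1 : (-1 != 0 :> R)%R by rewrite oppr_eq0 oner_eq0.
  have mg : measurable_fun setT (fun a : R => f (thead x * a, a ^+ 2)%R).
    by apply: (measurableT_comp mf); apply/measurable_fun_pair => /=; mfun.
  have := ge0_integral_affine 0%R N1 mg.
  rewrite normrN1 invr1 mul1e => <-; last by move=> a; exact: f0.
  by apply: eq_integral => a _; rewrite ltr0_norm//; congr (f (_, _)); ring.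
pose x0 : R := thead x; pose x' : n.+1.-tuple T := [tuple of behead x].
have rE : normT x = Num.sqrt (x0 ^+ 2 + normT x' ^+ 2)%R.
  by rewrite /normT {1}(tuple_consE x) sqT_cons sqr_sqrtr// sqT_ge0.
(* For x = 0 both linear forms vanish; otherwise the rotation of the plane applies. *)
have [r0|r0] := eqVneq (x0 ^+ 2 + normT x' ^+ 2)%R 0%R.
  apply: eq_integral => y _; congr (f (_, _)).
  by rewrite rE r0 sqrtr0 mul0r sqT_eq0// (tuple_consE x) sqT_cons -r0 normT_sqr.
have mS (c d : R) : measurable_fun setT (fun z : T * n.+2.-tuple T =>
    f (c * (z.1 : R) + d * (thead z.2 : R), z.1 ^+ 2 + sqT z.2)%R).
  apply: (measurableT_comp mf); apply/measurable_fun_pair => /=.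
    apply: measurable_funD; first by mfun.
    apply: measurable_funM => //.
    exact: (measurableT_comp (@measurable_thead _)).
  apply: measurable_funD; first by mfun.
  exact: (measurableT_comp (@measurable_sqT _ _)).
have key (c d : R) :
    \int[leb]_a \int[lam n.+1]_e f (c * a + d * (thead e : R), a ^+ 2 + sqT e)%R =
    \int[lam n]_h \int[leb]_a \int[leb]_b
      f (c * a + d * b, a ^+ 2 + b ^+ 2 + sqT h)%R.
  transitivity (\int[leb]_a \int[lam n]_h \int[leb]_b
      f (c * a + d * b, a ^+ 2 + b ^+ 2 + sqT h)%R).
    apply: eq_integral => a _.
    rewrite lamS'; last 2 first.
    - apply: (measurableT_comp mf); apply/measurable_fun_pair => /=.
        by apply: measurable_funD => //; apply: measurable_funM => //; exact: measurable_thead.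
      by apply: measurable_funD => //; exact: measurable_sqT.
    - by move=> ?; exact: f0.
    apply: eq_integral => h _; apply: eq_integral => b _.
    by rewrite sqT_cons addrA.
  rewrite (@tonelli_swap _ _ T _ R leb (lam n)
    (fun a h => \int[leb]_b f (c * a + d * b, a ^+ 2 + b ^+ 2 + sqT h)%R))//.
    apply: (@measurable_integral_snd _ _ (T * n.-tuple T)%type T R leb
      (fun z b => f (c * z.1 + d * b, z.1 ^+ 2 + b ^+ 2 + sqT z.2)%R)) => //.
    apply: (measurableT_comp mf); apply/measurable_fun_pair => /=; first by mfun.
    apply: measurable_funD; first by mfun.
    apply: (measurableT_comp (@measurable_sqT _ _)); mfun.
  by move=> a h; exact: integral_ge0.
rewrite (lamS (mL _ _ _ mf)); last by move=> ?; exact: f0.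
rewrite (lamS (mH _ _ _ mf)); last by move=> ?; exact: f0.
(* Induction rotates the tail onto its first coordinate; [key] isolates that coordinate together
   with the leading one as the plane to be rotated. *)
transitivity (\int[leb]_a \int[lam n.+1]_e
    f (x0 * a + normT x' * (thead e : R), a ^+ 2 + sqT e)%R).
  apply: eq_integral => a _.
  rewrite -(IH x' (fun z => f (x0 * a + z.1, a ^+ 2 + z.2)%R)); last 2 first.
  - by apply: (measurableT_comp mf); apply/measurable_fun_pair => /=; mfun.
  - by move=> ?; exact: f0.
  by apply: eq_integral => e _; rewrite {1}(tuple_consE x) dotT_cons sqT_cons.
rewrite key.
transitivity (\int[leb]_a \int[lam n.+1]_e
    f (normT x * a + 0 * (thead e : R), a ^+ 2 + sqT e)%R); last first.
  by apply: eq_integral => a _; apply: eq_integral => e _; rewrite sqT_cons mul0r addr0.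
rewrite key; apply: eq_integral => h _.
rewrite (@ge0_rotation2 R x0 (normT x') (fun z => f (z.1, z.2 + sqT h)%R))//.
- by rewrite -rE; apply: eq_integral => a _; apply: eq_integral => b _; rewrite mul0r addr0.
- by apply: (measurableT_comp mf); apply/measurable_fun_pair => /=; mfun.
Qed.

Lemma integral_rot n (x : n.+1.-tuple T) (f : R * R -> \bar R) :
  measurable_fun setT f ->
  \int[lam n.+1]_y f (dotT x y, sqT y) =
  \int[lam n.+1]_y f (normT x * (thead y : R), sqT y)%R.
Proof.
move=> mf; have H g (mg : measurable_fun setT g) (g0 : forall u, 0 <= g u) :=
  @ge0_integral_rot n x g mg g0.
exact: (@integral_transfer _ _ _ _ _ (T * T)%type R (lam n.+1) (lam n.+1)
  (fun y => (dotT x y, sqT y)) (fun y => (normT x * (thead y : R), sqT y)%R) H f mf).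
Qed.

Lemma integral_affT n (k : R) (x : n.-tuple T) (f : n.-tuple T -> \bar R) :
  k != 0%R -> measurable_fun setT f ->
  \int[lam n]_y f (affT k x y) = (`|k| ^- n)%:E * \int[lam n]_y f y.
Proof.
move=> k0 mf.
have c0 : (0 < `|k| ^- n)%R by rewrite invr_gt0 exprn_gt0// normr_gt0.
transitivity (\int[lam n]_y f^\+ (affT k x y) - \int[lam n]_y f^\- (affT k x y)).
  by rewrite integralE; congr (_ - _); apply: eq_integral => y _; rewrite ?funeposE ?funenegE.
rewrite !ge0_integral_affT//; last 2 first.
- exact: measurable_funeneg.
- exact: measurable_funepos.
by rewrite (integralE (lam n) setT f) (pmuleBr (\int[lam n]_y f^\+ y) (\int[lam n]_y f^\- y) c0).
Qed.

End rotation.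

Section powp.
Context {R : realType}.

(* Density x^p on the positive half-line, extended by 0. *)
Definition powp (p x : R) : R := if 0 < x then x `^ p else 0.

Lemma powp_ge0 p x : 0 <= powp p x.
Proof. by rewrite /powp; case: ifP => // _; exact: powR_ge0. Qed.

Lemma powp_gt0 p x : 0 < x -> 0 < powp p x.
Proof. by move=> x0; rewrite /powp x0 powR_gt0. Qed.

Lemma powpE p x : 0 < x -> powp p x = x `^ p.
Proof. by rewrite /powp => ->. Qed.

Lemma powp_le0 p x : x <= 0 -> powp p x = 0.
Proof. by rewrite /powp ltNge => ->. Qed.

Lemma powpM p k x : 0 < k -> powp p (k * x) = k `^ p * powp p x.
Proof.
move=> k0; rewrite /powp pmulr_rgt0//; case: ifPn => [x0|]; last by rewrite mulr0.
by rewrite powRM// ltW.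
Qed.

Lemma powRDp (a p q : R) : 0 < a -> a `^ (p + q) = a `^ p * a `^ q.
Proof. by move=> a0; rewrite powRD//; apply/implyP => _; rewrite gt_eqF. Qed.

Lemma sqrt_exprn (a : R) n : 0 <= a -> Num.sqrt a ^+ n = a `^ (n%:R / 2).
Proof.
move=> a0; rewrite -powR_mulrn ?sqrtr_ge0// -powR12_sqrt// -powRrM.
by congr (_ `^ _); rewrite mulrC.
Qed.

Lemma powRV (a p : R) : 0 <= a -> a^-1 `^ p = a `^ (- p).
Proof. by move=> a0; rewrite -powR_inv1// -powRrM mulN1r. Qed.

Lemma powpD p q x : powp (p + q) x = powp p x * powp q x.
Proof.
by rewrite /powp; case: ifPn => [x0|]; rewrite ?mulr0// powRDp.
Qed.

Lemma measurable_powp p : measurable_fun setT (powp p).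
Proof.
by rewrite /powp; apply: measurable_fun_ifT => //; apply: measurable_fun_ltr => //; mfun.
Qed.

End powp.

Section scalar.
Context d (T : measurableType d) (R : realType) (m : {measure set T -> \bar R}).
Local Open Scope ereal_scope.

Lemma ge0_integral_mull (f : T -> \bar R) (c : \bar R) : measurable_fun setT f ->
  (forall x, 0 <= f x) -> 0 <= c -> \int[m]_x (c * f x) = c * \int[m]_x f x.
Proof. by move=> mf f0 c0; rewrite ge0_integralZl. Qed.

Lemma ge0_integral_mulr (f : T -> \bar R) (c : \bar R) : measurable_fun setT f ->
  (forall x, 0 <= f x) -> 0 <= c -> \int[m]_x (f x * c) = \int[m]_x f x * c.
Proof. by move=> mf f0 c0; rewrite ge0_integralZr. Qed.

End scalar.

(** * Integration in polar coordinates *)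

Section radial.
Context {R : realType}.
Notation leb := (@lebesgue_measure R).
Notation T := (measurableTypeR R).
Notation lam n := (lebesgue_tuple R n).
Local Open Scope ereal_scope.

Lemma ge0_integral_scale (k : R) (f : R -> \bar R) : (0 < k)%R ->
  measurable_fun setT f -> (forall x, 0 <= f x) ->
  \int[leb]_x f x = k%:E * \int[leb]_x f (k * x)%R.
Proof.
move=> k0 mf f0; have k1 : (k != 0)%R by rewrite gt_eqF.
transitivity (k%:E * \int[leb]_x f (k * x + 0)%R).
  by rewrite ge0_integral_affine// muleA -EFinM gtr0_norm// mulfV// mul1e.
by congr (_ * _); apply: eq_integral => x _; rewrite addr0.
Qed.

Definition zT n : n.-tuple T := [tuple (0%R : R) | i < n].

Lemma ge0_integral_dil n (k : R) (f : n.-tuple T -> \bar R) : (0 < k)%R ->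
  measurable_fun setT f -> (forall y, 0 <= f y) ->
  \int[lam n]_y f y = (k ^+ n)%:E * \int[lam n]_y f (affT k (zT n) y).
Proof.
move=> k0 mf f0; have k1 : (k != 0)%R by rewrite gt_eqF.
by rewrite ge0_integral_affT// muleA -EFinM gtr0_norm// mulfV ?mul1e// expf_neq0.
Qed.

Lemma sqT_dil n k (y : n.-tuple T) :
  sqT (affT k (zT n) y) = (k ^+ 2 * sqT y)%R.
Proof.
rewrite /sqT mulr_sumr; apply: eq_bigr => i _.
by rewrite !tnth_mktuple addr0 exprMn.
Qed.

Lemma dotT_dil n k (x y : n.-tuple T) :
  dotT x (affT k (zT n) y) = (k * dotT x y)%R.
Proof.
rewrite /dotT mulr_sumr; apply: eq_bigr => i _.
by rewrite !tnth_mktuple addr0; ring.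
Qed.

Lemma measurable_box n (J : set R) : measurable J ->
  measurable [set x : n.-tuple T | forall i, J (tnth x i)].
Proof.
move=> mJ; rewrite (_ : mkset _ = \big[setI/setT]_(i < n)
    ((fun x : n.-tuple T => tnth x i) @^-1` J)).
  apply: bigsetI_measurable => i _.
  by rewrite -[X in measurable X]setTI; apply: measurable_tnth.
rewrite -bigcap_seq; apply/seteqP; split => x /=; first by move=> h i _; exact: h.
by move=> h i; apply: h; rewrite /= mem_index_enum.
Qed.

Lemma sqT_ae n : {ae lam n.+1, forall y, (0 < sqT y)%R}.
Proof.
exists [set y | forall i, [set 0%R : R]%classic (tnth y i)]; split.
- exact: measurable_box.
- have -> := @lebesgue_tuple_box R n.+1 (fun=> [set 0%R : R]) (fun=> @measurable_set1 R 0%R).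
  by rewrite big_ord_recl lebesgue_measure_set1 mul0e.
- move=> y /= /negP; rewrite -leNgt => y0 i.
  have : sqT y == 0%R by rewrite eq_le y0 sqT_ge0.
  rewrite /sqT psumr_eq0; last by move=> j _; exact: sqr_ge0.
  by move=> /allP/(_ i (mem_index_enum i)); rewrite /= sqrf_eq0 => /eqP.
Qed.

Lemma lam_setT_gt0 n : 0 < lam n setT.
Proof.
apply: (@lt_le_trans _ _ (lam n [set x | forall i, `[0%R, 1%R]%classic (tnth x i)])); last first.
  by apply: le_measure => //; rewrite inE//; exact: measurable_box.
have -> := @lebesgue_tuple_box R n (fun=> `[0%R, 1%R]%classic) (fun=> @measurable_itv R _).
rewrite (eq_bigr (fun=> 1%E)) ?big1//.
by move=> i _; rewrite lebesgue_measure_itv/= lte_fin ltr01 sube0.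
Qed.

(** Cutoff to the shell 1 <= |y|^2 <= 2, which makes the two constants compared in [radial] finite
    and positive. *)
Let k (u : R) : R := ((1 <= u) && (u <= 2))%R%:R.

Let mk : measurable_fun setT k.
Proof.
apply: (measurableT_comp (f := fun b : bool => (b%:R : R))) => //.
by apply: measurable_and; apply: measurable_fun_ler => //; mfun.
Qed.

Let k0 u : (0 <= k u)%R. Proof. exact: ler0n. Qed.

Let mkq (M : nat) (p : R) : measurable_fun setT (fun y : M.-tuple T => k (sqT y) * powp p (sqT y))%R.
Proof.
apply: measurable_funM.
  by apply: (measurableT_comp mk); exact: measurable_sqT.
by apply: (measurableT_comp (@measurable_powp R p)); exact: measurable_sqT.
Qed.

Let A M := \int[lam M]_y (k (sqT y) * powp (- (M%:R / 2)) (sqT y))%:E.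
Let B := \int[leb]_t (powp (-1) t * k t^-1)%:E.

Let mkV : measurable_fun setT (fun t : R => powp (-1) t * k t^-1)%R.
Proof.
rewrite (_ : (fun t => _) = fun t => (powp (-1) t * k (powp (-1) t))%R).
  apply: measurable_funM; first exact: measurable_powp.
  by apply: (measurableT_comp mk); exact: measurable_powp.
apply/funext => t; rewrite /powp; case: ifP; last by rewrite !mul0r.
by move=> t0; rewrite powR_inv1// ltW.
Qed.

Let B_gt0 : 0 < B.
Proof.
apply: (@lt_le_trans _ _ (\int[leb]_(t in `[2^-1%R, 1%R]) 1)).
  rewrite integral_cst//= lebesgue_measure_itv/= lte_fin mul1e.
  by rewrite ifT -?EFinB ?lte_fin; lra.
rewrite integral_mkcond; apply: ge0_le_integral => //.
- by move=> t _; rewrite patchE; case: ifP => //; rewrite lee_fin.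
- by apply/(measurable_restrictT _ _).1 => //; exact: measurable_cst.
- by apply/measurable_EFinP; exact: mkV.
move=> t _; rewrite patchE; case: ifP => [|_]; last by rewrite lee_fin mulr_ge0// powp_ge0.
rewrite inE/= in_itv/= => /andP[t1 t2].
have t0 : (0 < t)%R by lra.
rewrite powpE// (powR_inv1 (ltW t0)) lee_fin /k invf_ge1// t2/=.
by rewrite invf_ple ?posrE// t1 mulr1 invf_ge1.
Qed.

Let B_fin : B < +oo.
Proof.
apply: (@le_lt_trans _ _ (\int[leb]_(t in `[2^-1%R, 1%R]) 2%:E)); last first.
  by rewrite integral_cst//= lebesgue_measure_itv/= lte_fin; case: ifP; rewrite ?mule0// -EFinB -EFinM ltry.
rewrite [leRHS]integral_mkcond; apply: ge0_le_integral => //.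
- by move=> t _; rewrite lee_fin mulr_ge0// powp_ge0.
- by apply/measurable_EFinP; exact: mkV.
- by apply/(measurable_restrictT _ _).1 => //; exact: measurable_cst.
move=> t _; rewrite patchE; case: ifPn => [|].
  rewrite inE/= in_itv/= => /andP[t1 t2].
  have t0 : (0 < t)%R by lra.
  rewrite powpE// (powR_inv1 (ltW t0)) lee_fin.
  have t3 : (t^-1 <= 2)%R by rewrite invf_ple ?posrE.
  by rewrite /k; case: (_ && _); rewrite ?mulr1 ?mulr0.
rewrite notin_setE/= in_itv/= => /negP H; rewrite lee_fin; move: H; rewrite /powp; case: ifP => t0; last by rewrite mul0r.
rewrite /k invf_ge1// invf_ple ?posrE// andbC => /negbTE ->.
by rewrite mulr0.
Qed.

(** The double integral of k(|y|^2) s^(M/2-1) g(|y|^2 s) over y and s is evaluated twice. Rescaling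
    s by |y|^2 splits off [A M]; dilating y by s^(-1/2) and using the invariance of ds/s splits off
    [B]. Hence C = A M / B. *)
Lemma radial (M : nat) : (0 < M)%N -> exists2 C : R, (0 < C)%R &
  forall g : R -> \bar R, measurable_fun setT g -> (forall r, 0 <= g r) ->
  \int[lam M]_y g (sqT y) = C%:E * \int[leb]_r ((powp (M%:R / 2 - 1) r)%:E * g r).
Proof.
case: M => // M' _; set M := M'.+1.
have key (g : R -> \bar R) : measurable_fun setT g -> (forall r, 0 <= g r) ->
    A M * \int[leb]_r ((powp (M%:R / 2 - 1) r)%:E * g r) = B * \int[lam M]_y g (sqT y).
  move=> mg g0.
  have mpg : measurable_fun setT (fun r => (powp (M%:R / 2 - 1) r)%:E * g r).
    by apply: emeasurable_funM => //; apply/measurable_EFinP; exact: measurable_powp.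
  have pg0 r : 0 <= (powp (M%:R / 2 - 1) r)%:E * g r by rewrite mule_ge0// lee_fin powp_ge0.
  transitivity (\int[lam M]_y \int[leb]_s ((k (sqT y))%:E * ((powp (M%:R / 2 - 1) s)%:E * g (sqT y * s)%R))).
    rewrite /A -ge0_integral_mulr; last 3 first.
    - by apply/measurable_EFinP; exact: mkq.
    - by move=> y; rewrite lee_fin mulr_ge0// powp_ge0.
    - by apply: integral_ge0.
    apply: eq_integral => y _.
    rewrite /k; have [/andP[y1 y2]|_] := boolP (1 <= sqT y <= 2)%R; last first.
      by rewrite mul0r mul0e integral0_eq// => s _; rewrite mul0e.
    have y0 : (0 < sqT y)%R by lra.
    rewrite (ge0_integral_scale y0)// !mul1r.
    under [RHS]eq_integral do rewrite mul1e.
    rewrite muleA -EFinM -ge0_integral_mull; last 3 first.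
    - apply: (@measurableT_comp _ _ _ T T _ _ setT _ mpg).
      by mfun.
    - by move=> s; exact: pg0.
    - by rewrite lee_fin mulr_ge0 ?powp_ge0// ltW.
    apply: eq_integral => s _; rewrite muleA -EFinM; congr (_%:E * _).
    rewrite powpM// powpE//.
    have e : (sqT y `^ (- (M%:R / 2)) * sqT y * sqT y `^ (M%:R / 2 - 1) = 1)%R.
      rewrite -{2}(powRr1 (ltW y0)) -!powRDp//.
      by rewrite (_ : _ + _ = 0)%R ?powRr0//; ring.
    by rewrite mulrA e mul1r.
  have mj : measurable_fun setT (fun z : M.-tuple T * T =>
      (k (sqT z.1))%:E * ((powp (M%:R / 2 - 1) z.2)%:E * g (sqT z.1 * z.2)%R)).
    apply: emeasurable_funM.
      apply/measurable_EFinP; apply: (measurableT_comp mk).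
      exact: (measurableT_comp (@measurable_sqT _ _)).
    apply: emeasurable_funM.
      apply/measurable_EFinP; apply: (measurableT_comp (@measurable_powp _ _)); mfun.
    apply: (measurableT_comp mg); apply: measurable_funM; last by mfun.
    exact: (measurableT_comp (@measurable_sqT _ _)).
  rewrite (@tonelli_swap _ _ _ T R (lam M) leb (fun y s =>
    (k (sqT y))%:E * ((powp (M%:R / 2 - 1) s)%:E * g (sqT y * s)%R)))//; last first.
    by move=> y s; rewrite mule_ge0 ?lee_fin// mule_ge0// lee_fin powp_ge0.
  have mi (s : R) : measurable_fun setT (fun y : M.-tuple T => (k (s * sqT y))%:E * g (sqT y)).
    apply: emeasurable_funM; last by apply: (measurableT_comp mg); exact: measurable_sqT.
    apply/measurable_EFinP; apply: (measurableT_comp mk).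
    by apply: measurable_funM => //; exact: measurable_sqT.
  (* Replacing y by y / sqrt s leaves the scale-invariant density s^(-1). *)
  transitivity (\int[leb]_s \int[lam M]_y ((powp (-1) s)%:E * ((k (s^-1 * sqT y))%:E * g (sqT y)))).
    apply: eq_integral => s _; rewrite /powp; case: ifP => s0; last first.
      rewrite !integral0_eq// => y _; first by rewrite !mul0e.
      by rewrite mul0e mule0.
    have s1 : (0 < Num.sqrt s^-1)%R by rewrite sqrtr_gt0 invr_gt0.
    transitivity ((s `^ (M%:R / 2 - 1))%:E * \int[lam M]_y ((k (sqT y))%:E * g (s * sqT y)%R)).
      rewrite -ge0_integral_mull; last 3 first.
      - apply: emeasurable_funM; last first.
          apply: (measurableT_comp mg); apply: measurable_funM => //; exact: measurable_sqT.
        apply/measurable_EFinP; apply: (measurableT_comp mk); exact: measurable_sqT.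
      - by move=> y; rewrite mule_ge0// lee_fin.
      - by rewrite lee_fin powR_ge0.
      by apply: eq_integral => y _; rewrite muleCA (mulrC (sqT y)).
    rewrite (ge0_integral_dil s1)//; last 2 first.
    - apply: emeasurable_funM; last first.
        apply: (measurableT_comp mg); apply: measurable_funM => //; exact: measurable_sqT.
      apply/measurable_EFinP; apply: (measurableT_comp mk); exact: measurable_sqT.
    - by move=> y; rewrite mule_ge0// lee_fin.
    rewrite muleA -EFinM -ge0_integral_mull; last 3 first.
    - apply: emeasurable_funM; last first.
        apply: (measurableT_comp mg); apply: measurable_funM => //.
        by apply: (measurableT_comp (@measurable_sqT _ _)); exact: measurable_affT.
      apply/measurable_EFinP; apply: (measurableT_comp mk).
      by apply: (measurableT_comp (@measurable_sqT _ _)); exact: measurable_affT.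
    - by move=> y; rewrite mule_ge0// lee_fin.
    - by rewrite lee_fin mulr_ge0// ?powR_ge0// exprn_ge0// ltW.
    apply: eq_integral => y _; rewrite sqT_dil sqr_sqrtr ?invr_ge0 ?ltW//; congr (_%:E * (_ * _)).
      by rewrite sqrt_exprn ?invr_ge0 ?(ltW s0)// powRV ?(ltW s0)// -powRDp//; congr (_ `^ _)%R; field.
    by congr g; rewrite mulrA mulfV ?mul1r// gt_eqF.
  rewrite -(@tonelli_swap _ _ _ T R (lam M) leb (fun y s =>
    (powp (-1) s)%:E * ((k (s^-1 * sqT y))%:E * g (sqT y))))//; last 2 first.
  - rewrite (_ : (fun z => _) = fun z : M.-tuple T * T => (powp (-1) z.2)%:E * ((k (powp (-1) z.2 * sqT z.1))%:E * g (sqT z.1))).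
      apply: emeasurable_funM.
        apply/measurable_EFinP; apply: (measurableT_comp (@measurable_powp _ _)); mfun.
      apply: emeasurable_funM; last first.
        by apply: (measurableT_comp mg); exact: (measurableT_comp (@measurable_sqT _ _)).
      apply/measurable_EFinP; apply: (measurableT_comp mk); apply: measurable_funM.
        by apply: (measurableT_comp (@measurable_powp _ _)); mfun.
      exact: (measurableT_comp (@measurable_sqT _ _)).
    apply/funext => z; rewrite /powp; case: ifP => z0; last by rewrite !mul0e.
    by rewrite powR_inv1// ltW.
  - by move=> y s; rewrite mule_ge0 ?lee_fin ?powp_ge0// mule_ge0// lee_fin.
  rewrite -ge0_integral_mull; last 3 first.
  - by apply: (measurableT_comp mg); exact: measurable_sqT.
  - by move=> y; exact: g0.
  - by apply: integral_ge0 => t _; rewrite lee_fin mulr_ge0// powp_ge0.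
  have mC (q : R) : measurable_fun setT (fun s : R => powp (-1) s * k (s^-1 * q))%R.
    rewrite (_ : (fun t => _) = fun t => (powp (-1) t * k (powp (-1) t * q))%R).
      apply: measurable_funM; first exact: measurable_powp.
      by apply: (measurableT_comp mk); apply: measurable_funM => //; exact: measurable_powp.
    apply/funext => t; rewrite /powp; case: ifP; last by rewrite !mul0r.
    by move=> t0; rewrite powR_inv1// ltW.
  have E1 (y : M.-tuple T) : \int[leb]_s ((powp (-1) s)%:E * ((k (s^-1 * sqT y))%:E * g (sqT y))) =
      (\int[leb]_s (powp (-1) s * k (s^-1 * sqT y))%:E) * g (sqT y).
    rewrite -ge0_integral_mulr; last 3 first.
    - by apply/measurable_EFinP; exact: mC.
    - by move=> s; rewrite lee_fin mulr_ge0// powp_ge0.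
    - exact: g0.
    by apply: eq_integral => s _; rewrite muleA EFinM.
  transitivity (\int[lam M]_y ((\int[leb]_s (powp (-1) s * k (s^-1 * sqT y))%:E) * g (sqT y))).
    by apply: eq_integral => y _; exact: E1.
  apply: ge0_ae_eq_integral => //.
  - apply: emeasurable_funM; last by apply: (measurableT_comp mg); exact: measurable_sqT.
    apply: (@measurable_integral_snd _ _ _ T R leb (fun (y : M.-tuple T) s => (powp (-1) s * k (s^-1 * sqT y))%:E)).
      rewrite (_ : (fun z => _) = fun z : M.-tuple T * T => (powp (-1) z.2 * k (powp (-1) z.2 * sqT z.1))%:E).
        apply/measurable_EFinP; apply: measurable_funM.
          by apply: (measurableT_comp (@measurable_powp _ _)); mfun.
        apply: (measurableT_comp mk); apply: measurable_funM.
          by apply: (measurableT_comp (@measurable_powp _ _)); mfun.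
        exact: (measurableT_comp (@measurable_sqT _ _)).
      apply/funext => z; rewrite /powp; case: ifP => z0; last by rewrite !mul0r.
      by rewrite powR_inv1// ltW.
    by move=> y s; rewrite lee_fin mulr_ge0// powp_ge0.
  - apply: emeasurable_funM => //; apply: (measurableT_comp mg); exact: measurable_sqT.
  - by move=> y _; rewrite mule_ge0//; apply: integral_ge0 => s _; rewrite lee_fin mulr_ge0// powp_ge0.
  - by move=> y _; rewrite mule_ge0//; apply: integral_ge0 => s _; rewrite lee_fin mulr_ge0// powp_ge0.
  apply: filterS (@sqT_ae M') => y y0 _; congr (_ * _).
  rewrite (ge0_integral_scale y0)//; last 2 first.
  - by apply/measurable_EFinP; exact: mC.
  - by move=> s; rewrite lee_fin mulr_ge0// powp_ge0.
  rewrite -ge0_integral_mull; last 3 first.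
  - apply/measurable_EFinP; apply: (@measurableT_comp _ _ _ T T _ _ setT _ (mC _)); mfun.
  - by move=> s; rewrite lee_fin mulr_ge0// powp_ge0.
  - by rewrite lee_fin ltW.
  apply: eq_integral => s _; rewrite -EFinM; congr (_%:E).
  rewrite powpM// powR_inv1 ?ltW// !mulrA mulfV ?gt_eqF// mul1r invfM.
  by congr (_ * k _)%R; rewrite mulrAC mulVf ?mul1r// gt_eqF.
(* The shell lies in the box [-2, 2]^M, and there |y|^(-M) is at most 1. *)
have Afin : A M < +oo.
  apply: (@le_lt_trans _ _ (\int[lam M]_(y in [set x | forall i, `[(- 2)%R, 2%R]%classic (tnth x i)]) 1)).
    rewrite [leRHS]integral_mkcond; apply: ge0_le_integral => //.
    - by move=> y _; rewrite lee_fin mulr_ge0// powp_ge0.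
    - by apply/measurable_EFinP; exact: mkq.
    - by apply/(measurable_restrictT _ _).1 => //; exact: measurable_box.
    move=> y _; rewrite patchE /k; have [/andP[y1 y2]|] := boolP (1 <= sqT y <= 2)%R; last first.
      by move=> _; rewrite mul0r; case: ifP.
    have y0 : (0 < sqT y)%R by lra.
    rewrite mem_set/=; last first.
      move=> i; rewrite in_itv/= -ler_norml.
      have yi : ((tnth y i : R) ^+ 2 <= sqT y)%R.
        rewrite /sqT (bigD1 i)//= lerDl; apply: sumr_ge0 => j _; exact: sqr_ge0.
      rewrite -(@ler_pXn2r _ 2)// ?nnegrE// real_normK ?num_real//.
      by apply: (le_trans yi); lra.
    rewrite mul1r powpE// lee_fin powRN invf_le1 ?powR_gt0//.
    have h : (0 <= M%:R / 2 :> R)%R by rewrite divr_ge0.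
    by have := ler_powR y1 h; rewrite powRr0.
  rewrite integral_cst; last exact: measurable_box.
  have E := @lebesgue_tuple_box R M (fun=> `[(-2)%R, 2%R]%classic) (fun=> @measurable_itv R _).
  apply: (@le_lt_trans _ _ (\prod_(i < M) (@lebesgue_measure R `[(-2)%R, 2%R]%classic))).
    by rewrite -E mul1e.
  rewrite (eq_bigr (fun=> 4%:E)).
    by rewrite prodEFin ltry.
  by move=> i _; rewrite lebesgue_measure_itv/= lte_fin ifT -?EFinB; [congr EFin|]; lra.
have A0 : 0 < A M.
  rewrite lt_neqAle; apply/andP; split; last first.
    by apply: integral_ge0 => y _; rewrite lee_fin mulr_ge0// powp_ge0.
  (* With g = 1, a vanishing [A M] would force [B] times the total measure to vanish. *)
  apply/eqP => A0; have /esym := key (cst 1) (measurable_cst _) (fun=> @lee01 R).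
  rewrite -A0 mul0e integral_cst// mul1e => /eqP.
  by rewrite mule_eq0 gt_eqF// gt_eqF// lam_setT_gt0.
have [a aE] : exists a, A M = a%:E.
  by exists (fine (A M)); rewrite fineK// ge0_fin_numE// ltW.
have [b bE] : exists b, B = b%:E.
  by exists (fine B); rewrite fineK// ge0_fin_numE// ltW.
have a0 : (0 < a)%R by rewrite -lte_fin -aE.
have b0 : (0 < b)%R by rewrite -lte_fin -bE.
exists (b^-1 * a)%R; first by rewrite mulr_gt0// invr_gt0.
move=> g mg g0; rewrite EFinM -muleA -aE key// bE muleA -EFinM mulVf ?mul1e//.
by rewrite gt_eqF.
Qed.

End radial.

(** * Real-valued integrals: domination, strict positivity, Fubini *)

Section measure_generic.
Context d (T : measurableType d) (R : realType) (m : {measure set T -> \bar R}).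

Lemma integrable_dom (f g : T -> R) : measurable_fun setT f ->
  m.-integrable setT (EFin \o g) -> (forall x, `|f x| <= g x) ->
  m.-integrable setT (EFin \o f).
Proof.
move=> mf ig fg; apply: (le_integrable measurableT _ _ ig).
  exact/measurable_EFinP.
move=> x _ /=; rewrite lee_fin (le_trans (fg x))//.
exact: ler_norm.
Qed.

Lemma integrable_ge0P (f : T -> R) : measurable_fun setT f -> (forall x, 0 <= f x) ->
  (\int[m]_x (f x)%:E < +oo)%E -> m.-integrable setT (EFin \o f).
Proof.
move=> mf f0 fi; apply/integrableP; split; first exact/measurable_EFinP.
by under eq_integral => x _ do rewrite /= ger0_norm//.
Qed.

Lemma integrable_lty_fin (f : T -> R) : m.-integrable setT (EFin \o f) -> (forall x, 0 <= f x) ->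
  (\int[m]_x (f x)%:E < +oo)%E.
Proof.
move=> /integrableP[_]; under eq_integral => x _ do rewrite /=; move=> h f0.
by move: h; under eq_integral => x _ do rewrite ger0_norm//.
Qed.

Lemma RintE (f : T -> R) : m.-integrable setT (EFin \o f) ->
  ((\int[m]_x f x)%R%:E = \int[m]_x (f x)%:E)%E.
Proof. by move=> fi; rewrite /Rintegral fineK//; exact: integrable_fin_num. Qed.

(** A zero integral would place D inside a null set. *)
Lemma Rintegral_gt0 (D : set T) (f : T -> R) : m.-integrable setT (EFin \o f) ->
  (forall x, 0 <= f x) -> measurable D -> (0 < m D)%E -> (forall x, D x -> 0 < f x) ->
  0 < \int[m]_x f x.
Proof.
move=> fi f0 mD mD0 fD.
rewrite lt_neqAle Rintegral_ge0// andbT eq_sym; apply/eqP => f00.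
have mf : measurable_fun setT (EFin \o f) by case/integrableP : fi.
have : (\int[m]_x `|(EFin \o f) x| = 0)%E.
  under eq_integral => x _ do rewrite /= ger0_norm//.
  by rewrite -RintE// f00.
move=> /(ae_eq_integral_abs m measurableT mf)[N [mN N0 hN]].
have DN : D `<=` N.
  move=> x Dx; apply: hN => /= /(_ I) [] /eqP; rewrite gt_eqF//; exact: fD.
by move: mD0; rewrite (subset_measure0 mD mN DN N0) ltxx.
Qed.

Lemma Rintegral_bound (f g : T -> R) : measurable_fun setT f ->
  m.-integrable setT (EFin \o g) -> (forall x, `|f x| <= g x) ->
  `|\int[m]_x f x| <= \int[m]_x g x.
Proof.
move=> mf ig fg; have fi := integrable_dom mf ig fg.
apply: (le_trans (le_normr_Rintegral measurableT fi)).
apply: le_Rintegral => //; exact: integrable_norm.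
Qed.

End measure_generic.

Section fubini_real.
Context d1 d2 (T1 : measurableType d1) (T2 : measurableType d2) (R : realType).
Variables (m1 : {sigma_finite_measure set T1 -> \bar R})
  (m2 : {sigma_finite_measure set T2 -> \bar R}).

Lemma RintegrableP (f : T1 -> T2 -> R) : measurable_fun setT (fun z => f z.1 z.2) ->
  (\int[m1]_x \int[m2]_y `|f x y|%:E < +oo)%E ->
  (m1 \x m2)%E.-integrable setT (fun z => (f z.1 z.2)%:E).
Proof.
move=> mf fi; apply/integrable12ltyP; first exact/measurable_EFinP.
by [].
Qed.

(** The inner integrals are made real by [fine]; they agree with the extended ones wherever the
    section is integrable, that is, almost everywhere. *)
Lemma Rfubini (f : T1 -> T2 -> R) : measurable_fun setT (fun z => f z.1 z.2) ->
  (\int[m1]_x \int[m2]_y `|f x y|%:E < +oo)%E ->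
  \int[m1]_x \int[m2]_y f x y = \int[m2]_y \int[m1]_x f x y.
Proof.
move=> mf fi; have fI := RintegrableP mf fi.
have E1 : (\int[m1]_x (\int[m2]_y f x y)%R%:E = \int[m1]_x \int[m2]_y (f x y)%:E)%E.
  apply: ae_eq_integral => //.
  - apply/measurable_EFinP; apply: measurableT_comp => //.
    exact: (@measurable_fubini_F _ _ _ _ _ m1 m2 _ fI).
  - exact: (@measurable_fubini_F _ _ _ _ _ m1 m2 _ fI).
  - apply: filterS (ae_integrable1 fI) => x xi _; exact: RintE.
have E2 : (\int[m2]_y (\int[m1]_x f x y)%R%:E = \int[m2]_y \int[m1]_x (f x y)%:E)%E.
  apply: ae_eq_integral => //.
  - apply/measurable_EFinP; apply: measurableT_comp => //.
    exact: (@measurable_fubini_G _ _ _ _ _ m1 m2 _ fI).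
  - exact: (@measurable_fubini_G _ _ _ _ _ m1 m2 _ fI).
  - apply: filterS (ae_integrable2 fI) => x xi _; exact: RintE.
rewrite /Rintegral; congr fine; rewrite [LHS]E1 [RHS]E2.
exact: (@Fubini _ _ _ _ _ m1 m2 _ fI).
Qed.

Lemma Rfubini1 (f : T1 -> T2 -> R) : measurable_fun setT (fun z => f z.1 z.2) ->
  (\int[m1]_x \int[m2]_y `|f x y|%:E < +oo)%E ->
  \int[m1]_x \int[m2]_y f x y = \int[(m1 \x m2)%E]_z f z.1 z.2.
Proof.
move=> mf fi; have fI := RintegrableP mf fi.
rewrite /Rintegral; congr fine; rewrite -[RHS](integral12_prod_meas1 fI).
apply: ae_eq_integral => //.
- apply/measurable_EFinP; apply: measurableT_comp => //.
  exact: (@measurable_fubini_F _ _ _ _ _ m1 m2 _ fI).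
- exact: (@measurable_fubini_F _ _ _ _ _ m1 m2 _ fI).
- apply: filterS (ae_integrable1 fI) => x xi _; exact: RintE.
Qed.

Lemma Rintegral_fubini_integrable (f : T1 -> T2 -> R) : measurable_fun setT (fun z => f z.1 z.2) ->
  (\int[m1]_x \int[m2]_y `|f x y|%:E < +oo)%E ->
  m1.-integrable setT (fun x => (\int[m2]_y f x y)%R%:E).
Proof.
move=> mf fi; have fI := RintegrableP mf fi.
have mF := @measurable_fubini_F _ _ _ _ _ m1 m2 _ fI.
apply: (le_integrable measurableT _ _ (integrable_fubini_F fI)).
  by apply/measurable_EFinP; apply: measurableT_comp.
move=> x _; rewrite /= /Rintegral /fubini_F.
by case: (\int[m2]_y _)%E => [r| |]//=; rewrite normr0 leey.
Qed.

End fubini_real.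

(** * Integrability on the half-line *)

Section halfline.
Context {R : realType}.
Notation leb := (@lebesgue_measure R).

Lemma FTC2_simple (f F : R -> R) (a b : R) : a < b ->
  (forall x, a <= x <= b -> is_derive x 1 F (f x)) ->
  (forall x, a <= x <= b -> {for x, continuous f}) ->
  (\int[leb]_(x in `[a, b]) (f x)%:E = (F b - F a)%:E)%E.
Proof.
move=> ab dF cf.
have cF x : a <= x <= b -> {for x, continuous F}.
  move=> xab; apply: differentiable_continuous; apply/derivable1_diffP.
  by have [] := dF x xab.
rewrite (@continuous_FTC2 R f F a b ab)//.
- apply: continuous_in_subspaceT => x; rewrite inE/= in_itv/= => xab; exact: cf.
- split.
  + move=> x; rewrite in_itv/= => /andP[/ltW ax /ltW xb]; have [] := dF x; by rewrite ?ax.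
  + by apply: cvg_at_right_filter; apply: cF; rewrite lexx ltW.
  + by apply: cvg_at_left_filter; apply: cF; rewrite lexx ltW.
- move=> x; rewrite in_itv/= => /andP[/ltW ax /ltW xb]; rewrite derive1E.
  by apply: derive_val; apply: dF; rewrite ax.
Qed.

(** Exhaustion by the intervals [1/n, n]: on each the integral is F(n) - F(1/n), at most 2 B. *)
Lemma ge0_halfline_bound (f F : R -> R) (B : R) :
  (forall x : R, 0 < x -> is_derive x 1 F (f x)) ->
  (forall x : R, 0 < x -> {for x, continuous f}) ->
  (forall x : R, 0 < x -> 0 <= f x) -> (forall x : R, 0 < x -> `|F x| <= B) ->
  (\int[leb]_(x in `]0%R, +oo[) (f x)%:E <= (2 * B)%:E)%E.
Proof.
move=> dF cf f0 FB.
pose I n : set R := `[n.+2%:R^-1, n.+2%:R]%classic.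
have I0 n x : I n x -> 0 < x.
  by rewrite /I/= in_itv/= => /andP[h _]; apply: lt_le_trans h; rewrite invr_gt0.
have nI : nondecreasing_seq I.
  move=> n k nk; rewrite subsetEset => x; rewrite /I/= !in_itv/= => /andP[h1 h2].
  have nk2 : n.+2%:R <= k.+2%:R :> R by rewrite ler_nat !ltnS.
  rewrite (le_trans h2)// andbT (le_trans _ h1)// lef_pV2// posrE//.
have UI : \bigcup_n I n = `]0, +oo[%classic.
  apply/seteqP; split => x /=; first by move=> [n _ /I0 x0]; rewrite in_itv/= x0.
  rewrite in_itv/= andbT => x0.
  pose n := maxn (Num.truncn x) (Num.truncn x^-1).
  have h (y : R) : 0 < y -> (Num.truncn y <= n)%N -> y <= n.+2%:R.
    by move=> y0; rewrite Num.Theory.truncn_le_nat => yn; rewrite (le_trans (ltW yn))// ler_nat.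
  exists n => //; rewrite /I/= in_itv/=; apply/andP; split.
    by rewrite -(invrK x) lef_pV2 ?posrE ?invr_gt0//; apply: h; rewrite ?invr_gt0// leq_maxr.
  by apply: h => //; rewrite leq_maxl.
have mI i : measurable_fun (I i) (EFin \o f).
  apply/measurable_EFinP.
  have : {within I i, continuous f} by apply: continuous_in_subspaceT => x; rewrite inE => /I0; exact: cf.
  by move=> h; exact: (@subspace_continuous_measurable_fun R (I i) f (measurable_itv _) h).
have C := @ge0_nondecreasing_set_cvg_integral _ (measurableTypeR R) R I (EFin \o f) leb nI (fun=> measurable_itv _) mI _.
rewrite -UI; apply: (@cvge_le _ _ _ _ _ _ _ _ (C _)); last first.
  by move=> i x /I0 x0; rewrite lee_fin f0.
near=> n.
have lt1 : n.+2%:R^-1 < n.+2%:R :> R by rewrite (@lt_trans _ _ 1)// ?invf_lt1// ltr1n.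
have -> := FTC2_simple lt1 (fun x h => dF x (I0 n x h)) (fun x h => cf x (I0 n x h)).
rewrite lee_fin (le_trans (ler_norm _))// (le_trans (ler_normB _ _))// mulr2n mulrDl mul1r.
by rewrite lerD// FB// invr_gt0.
Unshelve. all: end_near. Qed.

Lemma integral_halfline (f : R -> R) p : 
  (\int[leb]_x (powp p x * f x)%:E = \int[leb]_(x in `]0%R, +oo[) (x `^ p * f x)%:E)%E.
Proof.
rewrite [RHS]integral_mkcond; apply: eq_integral => x _; rewrite patchE /powp.
by rewrite mem_setE in_itv/= andbT; case: ifP => // _; rewrite mul0r.
Qed.

(* The antiderivative is -1/(p (1 + x^p)), bounded on the half-line; this
   integrand dominates both x^(p-1) e^(-cx) and x^(-p-1) e^(-c/x). *)
Lemma integrable_cauchy (p : R) : 0 < p ->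
  leb.-integrable setT (fun x => (powp (p - 1) x * (1 + x `^ p) ^- 2)%:E).
Proof.
move=> p0.
have h x : 0 < 1 + x `^ p by rewrite ltr_pwDl// powR_ge0.
apply: integrable_ge0P.
- apply: measurable_funM; first exact: measurable_powp.
  rewrite (_ : (fun x => _) = fun x : R => (1 + x `^ p) `^ (-2)).
    by mfun; exact: measurable_powR.
  by apply/funext => x; rewrite powR_invn// ltW.
- by move=> x; rewrite mulr_ge0 ?powp_ge0// invr_ge0 exprn_ge0// ltW.
rewrite integral_halfline.
apply: (@le_lt_trans _ _ (2 * p^-1)%:E%E); last by rewrite ltry.
apply: (@ge0_halfline_bound _ (fun x => - p^-1 * (1 + x `^ p)^-1)).
- move=> x x0; have hx : 1 + x `^ p != 0 by rewrite gt_eqF.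
  have := is_derive1_powR p x0 => dp.
  apply: is_derive_eq; rewrite /GRing.scale/=.
  by field; rewrite gt_eqF//= gt_eqF.
- move=> x x0; apply: continuousM.
    apply: differentiable_continuous; apply/derivable1_diffP.
    by have [] := is_derive1_powR (p - 1) x0.
  apply: continuousV; first by rewrite expf_neq0// gt_eqF.
  apply: (@continuous_comp _ _ _ (fun x => 1 + x `^ p) (fun y => y ^+ 2)); last exact: exprn_continuous.
  apply: continuousD; first exact: cst_continuous.
  apply: differentiable_continuous; apply/derivable1_diffP.
  by have [] := is_derive1_powR p x0.
- by move=> x x0; rewrite mulr_ge0 ?powR_ge0// invr_ge0 exprn_ge0// ltW.
- move=> x x0; rewrite normrM normrN gtr0_norm ?invr_gt0// gtr0_norm ?invr_gt0//.
  apply: ler_piMr; first by rewrite invr_ge0 ltW.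
  by rewrite invf_le1// lerDl powR_ge0.
Qed.

(** In logarithms this is ln y <= y at y = c q / s. *)
Lemma powR_le_expR (s c q : R) : 0 <= s -> 0 < c -> 0 <= q ->
  q `^ s <= (s / c) `^ s * expR (c * q).
Proof.
move=> s0 c0; rewrite le_eqVlt => /predU1P[<-|q0].
  rewrite mulr0 expR0 mulr1; have [->|sn] := eqVneq s 0; first by rewrite !powRr0.
  by rewrite powR0// powR_ge0.
move: s0; rewrite le_eqVlt => /predU1P[<-|s0].
  by rewrite !powRr0 mul1r -[leLHS]expR0 ler_expR mulr_ge0// ltW.
have k0 : 0 < s / c by rewrite divr_gt0.
rewrite /powR !gt_eqF// -expRD ler_expR.
have -> : c * q = s * (q / (s / c)) by field; rewrite !gt_eqF.
rewrite -mulrDr ler_pM2l//.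
have e : ln q = ln (q / (s / c)) + ln (s / c).
  by rewrite -lnM ?posrE ?divr_gt0// divfK// gt_eqF.
rewrite e addrC lerD2l.
by apply/ltW/ln_sublinear; rewrite divr_gt0.
Qed.

(** Compares the integrands of Gamma type below with that of [integrable_cauchy]. *)
Lemma cauchy_dom (p c : R) : 0 < p -> 0 < c -> exists K : R, forall x, 0 < x ->
  (1 + x `^ p) ^+ 2 * expR (- (c * x)) <= K.
Proof.
move=> p0 c0; exists (2 * (1 + (2 * p / c) `^ (2 * p))) => x x0.
have h := @powR_le_expR (2 * p) c x (mulr_ge0 (ler0n _ _) (ltW p0)) c0 (ltW x0).
have e : x `^ (2 * p) = x `^ p ^+ 2 by rewrite -powR_mulrn ?powR_ge0// -powRrM mulrC.
rewrite expRN ler_pdivrMr ?expR_gt0//.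
have h1 : 1 <= expR (c * x) by rewrite -[leLHS]expR0 ler_expR mulr_ge0// ltW.
have h2 : (1 + x `^ p) ^+ 2 <= 2 * (1 + x `^ p ^+ 2) by have := sqr_ge0 (1 - x `^ p); nra.
rewrite (le_trans h2)// -e; nra.
Qed.

Lemma integrable_gamma (p c : R) : 0 < p -> 0 < c ->
  leb.-integrable setT (fun x => (powp (p - 1) x * expR (- (c * x)))%:E).
Proof.
move=> p0 c0; have [K hK] := cauchy_dom p0 c0.
apply: (@integrable_dom _ (measurableTypeR R) R leb _ (fun x : R => K * (powp (p - 1) x * (1 + x `^ p) ^- 2))).
- by apply: measurable_funM; [exact: measurable_powp|mfun].
- have := integrableZl measurableT K (integrable_cauchy p0).
  by apply: eq_integrable => // x _; rewrite /= EFinM.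
move=> x; have [x0|x0] := leP x 0; first by rewrite powp_le0// !mul0r normr0 mulr0.
rewrite ger0_norm; last by rewrite mulr_ge0 ?powp_ge0// expR_ge0.
rewrite mulrCA ler_wpM2l ?powp_ge0// ler_pdivlMr; first by rewrite mulrC hK.
by rewrite exprn_gt0// ltr_pwDl// powR_ge0.
Qed.

(** The bound of [cauchy_dom] is used at 1/x, where x^(-2p) (1 + x^p)^2 = (1 + x^(-p))^2. *)
Lemma integrable_invgamma (p c : R) : 0 < p -> 0 < c ->
  leb.-integrable setT (fun x => (powp (- p - 1) x * expR (- (c / x)))%:E).
Proof.
move=> p0 c0; have [K hK] := cauchy_dom p0 c0.
apply: (@integrable_dom _ (measurableTypeR R) R leb _ (fun x : R => K * (powp (p - 1) x * (1 + x `^ p) ^- 2))).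
- rewrite (_ : (fun x => _) = fun x => powp (- p - 1) x * expR (- (c * powp (-1) x))).
    apply: measurable_funM; first exact: measurable_powp.
    by apply: (measurableT_comp (@measurable_expR _)); mfun; exact: measurable_powp.
  apply/funext => x; rewrite /powp; case: ifP => x0; last by rewrite !mul0r.
  by rewrite powR_inv1// ltW.
- have := integrableZl measurableT K (integrable_cauchy p0).
  by apply: eq_integrable => // x _; rewrite /= EFinM.
move=> x; have [x0|x0] := leP x 0; first by rewrite !powp_le0// !mul0r normr0 mulr0.
rewrite ger0_norm; last by rewrite mulr_ge0 ?powp_ge0// expR_ge0.
have xi : 0 < x^-1 by rewrite invr_gt0.
have h0 : 0 < 1 + x `^ p by rewrite ltr_pwDl// powR_ge0.
have xp : 0 < x `^ p by rewrite powR_gt0.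
have e : powp (- p - 1) x = powp (p - 1) x * (x `^ p) ^- 2.
  rewrite !powpE// -powR_invn ?powR_ge0// -powRrM -powRDp//; congr (_ `^ _); ring.
rewrite e -mulrA [leRHS]mulrCA ler_wpM2l ?powp_ge0// ler_pdivlMr ?exprn_gt0//.
have := hK _ xi; rewrite (powRV _ (ltW x0)) powRN => h.
apply: le_trans h; rewrite le_eqVlt; apply/orP; left; apply/eqP.
by field; rewrite gt_eqF.
Qed.

End halfline.

(** * Fourier integrals of Gaussian and quartic weights *)

Section dct.
Context d (T : measurableType d) (R : realType) (m : {measure set T -> \bar R}).

Lemma Rdct (f_ : nat -> T -> R) (f g : T -> R) :
  (forall n, measurable_fun setT (f_ n)) ->
  (forall x, f_ n x @[n --> \oo] --> f x) ->
  m.-integrable setT (EFin \o g) -> (forall n x, `|f_ n x| <= g x) ->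
  \int[m]_x f_ n x @[n --> \oo] --> \int[m]_x f x.
Proof.
move=> mf cf ig fg.
have mff : measurable_fun setT f by apply: (measurable_fun_cvg mf) => x _; exact: cf.
have [] := @dominated_convergence _ _ _ m setT measurableT (fun n x => (f_ n x)%:E)
  (fun x => (f x)%:E) (fun x => (g x)%:E).
- by move=> n; exact/measurable_EFinP.
- exact/measurable_EFinP.
- by apply: aeW => x _; apply: cvg_EFin; [exact: nearW|exact: cf].
- exact: ig.
- by apply: aeW => x n _; rewrite lee_fin.
move=> fi _ h.
by apply: fine_cvg; rewrite fineK//; exact: integrable_fin_num.
Qed.

End dct.

Section ibp.
Context {R : realType}.
Notation leb := (@lebesgue_measure R).

(** The integral over [-n, n] is F(n) - F(-n), and the weighted bound on F makes it O(1/n). *)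
Lemma Rintegral_derive_eq0 (F f : R -> R) (B : R) :
  (forall x : R, is_derive x 1 F (f x)) -> continuous f ->
  leb.-integrable setT (EFin \o f) -> (forall x, `|F x| * (1 + `|x|) <= B) ->
  \int[leb]_x f x = 0.
Proof.
move=> dF cf fi FB.
have mf : measurable_fun setT f by exact: continuous_measurable_fun.
pose f_ n x := f x * (\1_(`[(- n.+1%:R)%R, n.+1%:R]%classic : set R) x : R).
have C : \int[leb]_x f_ n x @[n --> \oo] --> \int[leb]_x f x.
  apply: (@Rdct _ (measurableTypeR R) R leb f_ f (fun x => `|f x|)).
  - move=> n; apply: measurable_funM => //; exact: measurable_indic.
  - move=> x; apply: cvg_near_cst; exists (Num.truncn `|x|) => // n /= xn.
    rewrite /f_ indicE mem_set ?mulr1//= in_itv/= -ler_norml ltW//.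
    by rewrite -Num.Theory.truncn_le_nat.
  - exact: integrable_norm.
  - move=> n x; rewrite /f_ normrM ler_piMr// indicE; case: (_ \in _) => /=; by rewrite ?normr1 ?normr0.
have E n : \int[leb]_x f_ n x = F n.+1%:R - F (- n.+1%:R).
  have lt1 : - n.+1%:R < n.+1%:R :> R by rewrite (@lt_trans _ _ 0)// oppr_lt0.
  have := FTC2_simple lt1 (fun x _ => dF x) (fun x _ => cf x).
  rewrite /Rintegral => h.
  rewrite (_ : (\int[leb]_x (f_ n x)%:E)%E = (F n.+1%:R - F (- n.+1%:R))%:E)//.
  rewrite -h [RHS]integral_mkcond; apply: eq_integral => x _.
  by rewrite patchE /f_ indicE; case: (_ \in _); rewrite ?mulr1 ?mulr0.
have C0 : \int[leb]_x f_ n x @[n --> \oo] --> 0.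
  apply: norm_cvg0.
  have B0 : 0 <= B by rewrite (le_trans _ (FB 0))// mulr_ge0// addr_ge0.
  apply: (@squeeze_cvgr _ _ _ _ (fun=> 0) (fun n => 2 * B * n.+1%:R^-1)).
  - apply: nearW => n; rewrite normr_ge0/= E (le_trans (ler_normB _ _))//.
    have h (x : R) : `|x| = n.+1%:R -> `|F x| <= B / n.+1%:R.
      move=> xn; rewrite ler_pdivlMr// (le_trans _ (FB x))// xn ler_wpM2l// lerDr//.
    by rewrite -mulrA mulr2n mulrDl mul1r lerD// h// ?normrN ger0_norm.
  - exact: cvg_cst.
  - rewrite -[X in _ --> X](mulr0 (2 * B)); apply: cvgM; first exact: cvg_cst.
    exact: cvg_harmonic.
exact: (cvg_unique _ C C0).
Qed.

(* |f|, |f'| <= B e^{-x^2} is preserved by all the integrations by parts below. *)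
Lemma Rintegral_parts (g g' c c' : R -> R) (B r : R) :
  (forall x : R, is_derive x 1 g (g' x)) -> continuous g' ->
  (forall x : R, is_derive x 1 c (r * c' x)) -> continuous c' ->
  (forall x, `|c x| <= 1) -> (forall x, `|c' x| <= 1) ->
  leb.-integrable setT (EFin \o g) -> leb.-integrable setT (EFin \o g') ->
  (forall x, `|g x| * (1 + `|x|) <= B) ->
  r * \int[leb]_x (c' x * g x) = - \int[leb]_x (c x * g' x).
Proof.
move=> dg cg' dc cc' c1 c'1 gi g'i gB.
have cont (F f : R -> R) : (forall x : R, is_derive x 1 F (f x)) -> continuous F.
  move=> dF x; apply: differentiable_continuous; apply/derivable1_diffP.
  by have [] := dF x.
have cg := cont _ _ dg; have cc := cont _ _ dc.
have I1 : leb.-integrable setT (EFin \o (fun x => c' x * g x)).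
  apply: (@integrable_dom _ (measurableTypeR R) R leb _ (fun x => `|g x|)).
  - by apply: measurable_funM; exact: continuous_measurable_fun.
  - exact: integrable_norm.
  - by move=> x; rewrite normrM ler_piMl.
have I2 : leb.-integrable setT (EFin \o (fun x => c x * g' x)).
  apply: (@integrable_dom _ (measurableTypeR R) R leb _ (fun x => `|g' x|)).
  - by apply: measurable_funM; exact: continuous_measurable_fun.
  - exact: integrable_norm.
  - by move=> x; rewrite normrM ler_piMl.
have I3 : leb.-integrable setT (EFin \o (fun x => r * (c' x * g x))).
  have := integrableZl measurableT r I1.
  by apply: eq_integrable => // x _; rewrite /= EFinM.
have H : \int[leb]_x (r * (c' x * g x) + c x * g' x) = 0.
  apply: (@Rintegral_derive_eq0 (fun x => c x * g x) _ B).
  - move=> x; have d1 := dg x; have d2 := dc x; apply: is_derive_eq.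
    by rewrite /GRing.scale/=; ring.
  - move=> x; apply: cvgD; last by apply: cvgM; [exact: cc|exact: cg'].
    by apply: cvgM; [exact: cvg_cst|apply: cvgM; [exact: cc'|exact: cg]].
  - have := integrableD measurableT I3 I2.
    by apply: eq_integrable => // x _; rewrite /= EFinD.
  - move=> x; rewrite normrM (le_trans _ (gB x))// ler_wpM2r ?addr_ge0//.
    by rewrite ler_piMl.
move: H; rewrite RintegralD// RintegralZl// => /eqP; rewrite addr_eq0 => /eqP.
exact.
Qed.

End ibp.

Section gauss.
Context {R : realType}.
Notation leb := (@lebesgue_measure R).
Notation T := (measurableTypeR R).
Notation lam n := (lebesgue_tuple R n).

Lemma integrable_gauss1 (s : R) : 0 < s ->
  leb.-integrable setT (EFin \o (fun x => expR (- (s * x ^+ 2)))).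
Proof.
move=> s0.
apply: (@integrable_ge0P _ T R leb); [by mfun|by move=> x; exact: expR_ge0|].
have k0 : 0 < Num.sqrt s^-1 by rewrite sqrtr_gt0 invr_gt0.
rewrite (ge0_integral_scale k0); last 2 first.
- by apply/measurable_EFinP; mfun.
- by move=> x; rewrite lee_fin expR_ge0.
have E : (\int[leb]_x (expR (- (s * (Num.sqrt s^-1 * x) ^+ 2)))%:E = (Num.sqrt pi)%:E)%E.
  rewrite -(@integralT_gauss R); apply: eq_integral => x _; rewrite /gauss_fun.
  by rewrite exprMn sqr_sqrtr ?invr_ge0 ?(ltW s0)// mulrA mulfV ?mul1r// gt_eqF.
by rewrite E -EFinM ltry.
Qed.

Lemma norm_le_expR (s x : R) : 0 < s -> 1 + `|x| <= (2 + 2 / s) * expR (s / 2 * x ^+ 2).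
Proof.
move=> s0; have h := expR_ge1Dx (s / 2 * x ^+ 2).
have c0 : 0 <= 2 + 2 / s by rewrite addr_ge0// divr_ge0// ltW.
apply: (@le_trans _ _ ((2 + 2 / s) * (1 + s / 2 * x ^+ 2))); last by rewrite ler_wpM2l.
have -> : (2 + 2 / s) * (1 + s / 2 * x ^+ 2) = 2 + 2 / s + s * x ^+ 2 + x ^+ 2 by field; rewrite gt_eqF.
have h1 : 0 < 2 / s by rewrite divr_gt0.
have h2 : 0 <= s * x ^+ 2 by rewrite mulr_ge0 ?sqr_ge0// ltW.
have h3 := sqr_ge0 (`|x| - 1); have h4 : `|x| ^+ 2 = x ^+ 2 by rewrite real_normK// num_real.
by nra.
Qed.

Let cos_le1 (x : R) : `|cos x| <= 1.
Proof. by rewrite ler_norml cos_geN1 cos_le1. Qed.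
Let sin_le1 (x : R) : `|sin x| <= 1.
Proof. by rewrite ler_norml sin_geN1 sin_le1. Qed.

(** As a function of b, the left side F satisfies F' = -(b / (2 s)) F: differentiate under the
    integral and integrate by parts. Hence F(b) exp(b^2 / (4 s)) is constant. *)
Lemma gauss_fourier1 (s b : R) : 0 < s ->
  \int[leb]_x (cos (b * x) * expR (- (s * x ^+ 2))) =
  expR (- (b ^+ 2 / (4 * s))) * \int[leb]_x expR (- (s * x ^+ 2)).
Proof.
move=> s0.
pose e x : R := expR (- (s * x ^+ 2)).
(* Dominates both e and x e, the latter bounding the derivative in b; half of the Gaussian decay
   pays for the factor 1 + |x|. *)
pose e2 x : R := (2 + 2 / s) * expR (- (s / 2 * x ^+ 2)).
pose f b x := cos (b * x) * e x.
pose F b := \int[leb]_x f b x.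
have ei : leb.-integrable setT (EFin \o e) by exact: integrable_gauss1.
have me : measurable_fun setT e by rewrite /e; mfun.
have e2i : leb.-integrable setT (EFin \o e2).
  have := integrableZl measurableT (2 + 2 / s) (@integrable_gauss1 (s / 2) (divr_gt0 s0 (ltr0n _ 2))).
  by apply: eq_integrable => // x _; rewrite /= EFinM.
have xe x : (1 + `|x|) * e x <= e2 x.
  have -> : e2 x = (2 + 2 / s) * expR (s / 2 * x ^+ 2) * e x.
    by rewrite /e2 /e -[RHS]mulrA -expRD; congr (_ * expR _); field.
  by rewrite ler_wpM2r ?expR_ge0// norm_le_expR.
have fi b' : leb.-integrable setT (EFin \o f b').
  apply: (@integrable_dom _ T R leb _ e) => //.
    by rewrite /f; mfun.
  by move=> x; rewrite normrM [X in _ * X]ger0_norm ?expR_ge0// ler_piMl ?expR_ge0.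
have de (x : R) : is_derive x 1 e (- (2 * s * x) * e x).
  by rewrite /e; apply: is_derive_eq; rewrite /GRing.scale/= ?expr1; ring.
have ce : continuous e.
  by move=> x; apply: differentiable_continuous; apply/derivable1_diffP; have [] := de x.
have se x : `|x * e x| <= e2 x.
  rewrite normrM (ger0_norm (expR_ge0 _)) (le_trans _ (xe x))// ler_wpM2r ?expR_ge0//.
  by rewrite lerDr.
have xei : leb.-integrable setT (EFin \o (fun x => - (2 * s * x) * e x)).
  have I1 : leb.-integrable setT (EFin \o (fun x => x * e x)).
    by apply: (@integrable_dom _ T R leb _ e2) => //; mfun.
  have := integrableZl measurableT (- (2 * s)) I1.
  by apply: eq_integrable => // x _; rewrite /= -EFinM; congr EFin; ring.
have dfb (b' x : R) : is_derive b' 1 (f ^~ x) (- x * sin (b' * x) * e x).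
  by rewrite /f; apply: is_derive_eq; rewrite /GRing.scale/= ?scaler0; ring.
have dF (b' : R) : is_derive b' 1 F (- (b' / (2 * s)) * F b').
  have I : b' \in `]b' - 1, b' + 1[ by rewrite in_itv/=; lra.
  have d1 (y x : R) : partial1of2 f y x = - x * sin (y * x) * e x.
    by rewrite partial1of2E; apply: derive_val; exact: dfb.
  have ub (y x : R) : `|partial1of2 f y x| <= e2 x.
    rewrite d1 mulrAC normrM (le_trans _ (se x))// -normrN mulNr opprK ler_piMr//.
  have H1 : derivable F b' 1.
    apply: (@derivable_under_integral R _ T leb f setT measurableT b' (b' - 1) (b' + 1) I
      (fun y _ => fi y) _ e2 _ e2i (fun y x _ _ => ub y x)).
    - by move=> y x _ _; have [] := dfb y x.
    - by move=> x; rewrite mulr_ge0 ?expR_ge0// addr_ge0// divr_ge0// ltW.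
  have H2 : derive1 F b' = \int[leb]_x (partial1of2 f b' x).
    apply: (@differentiation_under_integral R _ T leb f setT measurableT b' (b' - 1) (b' + 1) I
      (fun y _ => fi y) _ e2 _ e2i (fun y x _ _ => ub y x)).
    - by move=> y x _ _; have [] := dfb y x.
    - by move=> x; rewrite mulr_ge0 ?expR_ge0// addr_ge0// divr_ge0// ltW.
  apply: DeriveDef => //; rewrite -derive1E H2.
  have bd (x : R) : `|e x| * (1 + `|x|) <= 2 + 2 / s.
    rewrite ger0_norm ?expR_ge0// mulrC (le_trans (xe x))//.
    apply: ler_piMr; first by rewrite addr_ge0// divr_ge0// ltW.
    by rewrite expR_le1 oppr_le0 mulr_ge0 ?sqr_ge0// divr_ge0// ltW.
  have c1 : continuous (fun x : R => cos (b' * x)).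
    move=> x; apply: (@continuous_comp _ _ _ (fun x => b' * x) cos); last exact: continuous_cos.
    exact: mulrl_continuous.
  have d2 (x : R) : is_derive x 1 (fun x => sin (b' * x)) (b' * cos (b' * x)).
    by apply: is_derive_eq; rewrite /GRing.scale/=; ring.
  have c2 : continuous (fun x => - (2 * s * x) * e x).
    move=> x; apply: cvgM; last exact: ce.
    by apply: cvgN; apply: cvgM; [exact: cvg_cst|exact: cvg_id].
  have P := Rintegral_parts de c2 d2 c1 (fun x => sin_le1 _) (fun x => cos_le1 _) ei xei bd.
  rewrite /F mulNr mulrAC P.
  rewrite mulNr opprK -RintegralZr//; last first.
    apply: (@integrable_dom _ T R leb _ (fun x => `|- (2 * s * x) * e x|)).
    - by mfun.
    - exact: integrable_norm.
    - by move=> x; rewrite normrM ler_piMl.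
  apply: eq_Rintegral => x _; rewrite d1; field.
  by rewrite gt_eqF.
pose H b' := F b' * expR (b' ^+ 2 / (4 * s)).
have dH (b' : R) : is_derive b' 1 H 0.
  have dFb := dF b'; rewrite /H; apply: is_derive_eq; rewrite /GRing.scale/= ?expr1.
  by field; rewrite gt_eqF.
have := @is_derive_0_is_cst R H b 0 dH.
rewrite /H expr0n/= mul0r expR0 mulr1 => Hb.
have -> : \int[leb]_x (cos (b * x) * expR (- (s * x ^+ 2))) = F b by [].
have -> : \int[leb]_x expR (- (s * x ^+ 2)) = F 0.
  by apply: eq_Rintegral => x _; rewrite /f mul0r cos0 mul1r.
by rewrite -Hb mulrCA -expRD addNr expR0 mulr1.
Qed.

End gauss.

Section slices.
Context {R : realType}.
Notation leb := (@lebesgue_measure R).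
Notation T := (measurableTypeR R).
Notation lam n := (lebesgue_tuple R n).

Lemma integrable_lamSP n (f : n.+1.-tuple T -> R) :
  (lam n.+1).-integrable setT (EFin \o f) ->
  (\int[leb]_a \int[lam n]_e `|f (tuple_cons (a, e))|%:E < +oo)%E.
Proof.
move=> /integrableP[mf]; rewrite (lamS (f := fun y => `|f y|%:E))//.
by apply/measurable_EFinP; apply: measurableT_comp => //; exact/measurable_EFinP.
Qed.

Lemma RlamS n (f : n.+1.-tuple T -> R) :
  (lam n.+1).-integrable setT (EFin \o f) ->
  \int[lam n.+1]_y f y = \int[leb]_a \int[lam n]_e f (tuple_cons (a, e)).
Proof.
move=> fi; have mf : measurable_fun setT f by case/integrableP : fi => /measurable_EFinP.
have mF : measurable_fun setT (fun z : T * n.-tuple T => f (tuple_cons (z.1, z.2))).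
  have := measurable_tuple_consE ((measurable_EFinP _ _).2 mf) => /measurable_EFinP.
  by apply: eq_measurable_fun => -[].
rewrite (@Rfubini1 _ _ T _ R leb (lam n) (fun a e => f (tuple_cons (a, e))) mF (integrable_lamSP fi)).
rewrite /Rintegral; congr fine.
have H (g : n.+1.-tuple T -> \bar R) : measurable_fun setT g -> (forall u, (0 <= g u)%E) ->
    (\int[lam n.+1]_x g (id x) = \int[(leb \x lam n)%E]_p g (tuple_cons p))%E.
  by move=> mg g0; rewrite lamS_prod.
rewrite (@integral_transfer _ _ _ _ _ _ R (lam n.+1) (leb \x lam n)%E id (@tuple_cons R n) H (EFin \o f)).
  by apply: eq_integral => -[].
exact/measurable_EFinP.
Qed.

Lemma RlamS' n (f : n.+1.-tuple T -> R) :
  (lam n.+1).-integrable setT (EFin \o f) ->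
  \int[lam n.+1]_y f y = \int[lam n]_e \int[leb]_a f (tuple_cons (a, e)).
Proof.
move=> fi; have mf : measurable_fun setT f by case/integrableP : fi => /measurable_EFinP.
rewrite RlamS//; apply: (@Rfubini _ _ T _ R leb (lam n) (fun a e => f (tuple_cons (a, e)))).
  have := measurable_tuple_consE ((measurable_EFinP _ _).2 mf) => /measurable_EFinP.
  by apply: eq_measurable_fun => -[].
exact: integrable_lamSP.
Qed.

Lemma RlamS'_integrable n (f : n.+1.-tuple T -> R) :
  (lam n.+1).-integrable setT (EFin \o f) ->
  (lam n).-integrable setT (EFin \o (fun e => \int[leb]_a f (tuple_cons (a, e)))).
Proof.
move=> fi; have mf : measurable_fun setT f by case/integrableP : fi => /measurable_EFinP.
have mF : measurable_fun setT (fun z : T * n.-tuple T => f (tuple_cons (z.1, z.2))).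
  have := measurable_tuple_consE ((measurable_EFinP _ _).2 mf) => /measurable_EFinP.
  by apply: eq_measurable_fun => -[].
apply: (@Rintegral_fubini_integrable _ _ _ T R (lam n) leb (fun e a => f (tuple_cons (a, e)))).
  exact: (measurableT_comp mF (@measurable_swap _ _ (n.-tuple T) T)).
rewrite -(@tonelli_swap _ _ T _ R leb (lam n) (fun a e => `|f (tuple_cons (a, e))|%:E)%E)//.
  exact: integrable_lamSP.
by apply/measurable_EFinP; exact: measurableT_comp.
Qed.

Lemma Rintegral_rot n (x : n.+1.-tuple T) (f : R * R -> R) :
  measurable_fun setT f ->
  \int[lam n.+1]_y f (dotT x y, sqT y) =
  \int[lam n.+1]_y f (normT x * (thead y : R), sqT y).
Proof.
move=> mf; rewrite /Rintegral; congr fine.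
by apply: (integral_rot x (f := fun z => (f z)%:E)); exact/measurable_EFinP.
Qed.

Lemma integrable_gaussN n (s : R) : 0 < s ->
  (lam n).-integrable setT (fun y => (expR (- (s * sqT y)))%:E).
Proof.
move=> s0; elim: n => [|n IH].
  apply: integrable_ge0P => [|y|]; last 2 first.
  - exact: expR_ge0.
  - by rewrite lam0E ?ltry//; apply/measurable_EFinP; mfun; exact: measurable_sqT.
  by mfun; exact: measurable_sqT.
have m1 k : measurable_fun setT (fun y : k.-tuple T => expR (- (s * sqT y))).
  by mfun; exact: measurable_sqT.
apply: integrable_ge0P => [|y|]; [exact: m1|exact: expR_ge0|].
rewrite (lamS (f := fun y => (expR (- (s * sqT y)))%:E)); last 2 first.
- by apply/measurable_EFinP; exact: m1.
- by move=> y; rewrite lee_fin expR_ge0.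
have -> : (\int[leb]_a \int[lam n]_e (expR (- (s * sqT (tuple_cons (a, e)))))%:E =
   \int[leb]_a ((expR (- (s * a ^+ 2)))%:E * \int[lam n]_e (expR (- (s * sqT e)))%:E))%E.
  apply: eq_integral => a _; rewrite -ge0_integral_mull; last 3 first.
  - by apply/measurable_EFinP; exact: m1.
  - by move=> e; rewrite lee_fin expR_ge0.
  - by rewrite lee_fin expR_ge0.
  by apply: eq_integral => e _; rewrite sqT_cons -EFinM -expRD; congr (expR _)%:E; ring.
rewrite ge0_integral_mulr; last 3 first.
- by apply/measurable_EFinP; mfun.
- by move=> e; rewrite lee_fin expR_ge0.
- by apply: integral_ge0 => e _; rewrite lee_fin expR_ge0.
apply: lte_mul_pinfty.
- by apply: integral_ge0 => e _; rewrite lee_fin expR_ge0.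
- by apply: integrable_fin_num => //; exact: integrable_gauss1.
- by apply: integrable_lty_fin => // y; exact: expR_ge0.
Qed.

Lemma gaussN_gt0 n (s : R) : 0 < s -> 0 < \int[lam n]_y expR (- (s * sqT y)).
Proof.
move=> s0; apply: (Rintegral_gt0 (D := setT)) => //.
- exact: integrable_gaussN.
- exact: lam_setT_gt0.
- by move=> y _; exact: expR_gt0.
Qed.

Lemma normr_cos (x : R) : `|cos x| <= 1.
Proof. by rewrite ler_norml cos_geN1 cos_le1. Qed.

Lemma normr_sin (x : R) : `|sin x| <= 1.
Proof. by rewrite ler_norml sin_geN1 sin_le1. Qed.

Lemma integrable_cos d (U : measurableType d) (m : {measure set U -> \bar R}) (h : U -> R) (g : U -> R) :
  measurable_fun setT h -> m.-integrable setT (EFin \o g) ->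
  m.-integrable setT (EFin \o (fun y => cos (h y) * g y)).
Proof.
move=> mh ig; have mg : measurable_fun setT g by case/integrableP : ig => /measurable_EFinP.
apply: (@integrable_dom _ _ _ _ _ (fun y => `|g y|)).
- by mfun.
- exact: integrable_norm.
- by move=> y; rewrite normrM ler_piMl// normr_cos.
Qed.

(** A rotation moves the frequency onto the first coordinate, where the one-dimensional formula
    applies on every line. *)
Lemma gauss_fourierN n (x : n.+1.-tuple T) (s : R) : 0 < s ->
  \int[lam n.+1]_y (cos (dotT x y) * expR (- (s * sqT y))) =
  expR (- (sqT x / (4 * s))) * \int[lam n.+1]_y expR (- (s * sqT y)).
Proof.
move=> s0.
rewrite (Rintegral_rot x (f := fun z => cos z.1 * expR (- (s * z.2)))); last by mfun.
have E (b : R) : \int[lam n.+1]_y (cos (b * (thead y : R)) * expR (- (s * sqT y))) =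
    expR (- (b ^+ 2 / (4 * s))) * (\int[leb]_x expR (- (s * x ^+ 2)) * \int[lam n]_y expR (- (s * sqT y))).
  rewrite RlamS'; last first.
    apply: integrable_cos; last exact: integrable_gaussN.
    by apply: measurable_funM => //; exact: measurable_thead.
  rewrite mulrA -RintegralZl//; last exact: integrable_gaussN.
  apply: eq_Rintegral => e _; rewrite -gauss_fourier1// -RintegralZr//; last first.
    by apply: integrable_cos; [mfun|exact: integrable_gauss1].
  apply: eq_Rintegral => a _; rewrite sqT_cons -mulrA -expRD; congr (_ * expR _).
  by ring.
rewrite E normT_sqr; congr (_ * _).
(* The case b = 0 identifies the product of the lower-dimensional Gaussian integrals with the full
   one. *)
transitivity (\int[lam n.+1]_y (cos (0 * (thead y : R)) * expR (- (s * sqT y)))).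
  by rewrite E expr0n/= mul0r oppr0 expR0 mul1r.
by apply: eq_Rintegral => y _; rewrite mul0r cos0 mul1r.
Qed.

End slices.

(** * Rapid decay of the Fourier transform of exp(-|xi|^4) *)

Section quartic.
Context {R : realType}.
Notation leb := (@lebesgue_measure R).
Notation T := (measurableTypeR R).
Notation lam n := (lebesgue_tuple R n).
Implicit Types (P : {poly {poly R}}) (a q r : R).

(** The outer indeterminate stands for the coordinate a along the frequency, the inner one for the
    squared norm q of the remaining coordinates. *)
Definition ev P q a : R := (map_poly (horner_eval q) P).[a].

(** The action of d/da on the polynomial factor of P(a, q) exp(-(a^2 + q)^2). *)
Definition Dq P : {poly {poly R}} := P^`() - 4 * 'X * ('X ^+ 2 + 'X%:P) * P.

Definition gq P q a : R := ev P q a * expR (- (a ^+ 2 + q) ^+ 2).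

Lemma ev_Dq P q a :
  ev (Dq P) q a = ev P^`() q a - 4 * a * (a ^+ 2 + q) * ev P q a.
Proof.
rewrite /ev /Dq expr2 rmorphB/= !rmorphM/= rmorph_nat rmorphD/= rmorphM/= !map_polyX map_polyC/=.
rewrite /horner_eval hornerX -polyC_natr !hornerE; ring.
Qed.

Lemma is_derive_gq P q a : is_derive a 1 (gq P q) (gq (Dq P) q a).
Proof.
have d1 : is_derive a 1 (ev P q) (ev P^`() q a).
  by rewrite /ev -deriv_map; exact: is_derive_poly.
rewrite /gq ev_Dq; apply: is_derive_eq; rewrite /GRing.scale/= ?expr1; ring.
Qed.

Lemma continuous_gq P q : continuous (gq P q).
Proof.
move=> a; apply: differentiable_continuous; apply/derivable1_diffP.
by have [] := is_derive_gq P q a.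
Qed.

(** Growth is measured by 1 + a^2 + q, which dominates 1, |a| and q; the inner induction treats the
    coefficients, polynomials in q. *)
Lemma ev_bound P : exists C, exists m : nat, 0 <= C /\
  forall q a, 0 <= q -> `|ev P q a| <= C * (1 + a ^+ 2 + q) ^+ m.
Proof.
have w1 q a : 0 <= q -> 1 <= 1 + a ^+ 2 + q by have := sqr_ge0 a; lra.
have comb (C1 C2 : R) (m1 m2 : nat) (w x y z : R) : 0 <= C1 -> 0 <= C2 -> 1 <= w ->
    `|x| <= C1 * w ^+ m1 -> `|y| <= C2 * w ^+ m2 -> `|z| <= w ->
    `|x * z + y| <= (C1 + C2) * w ^+ (m1 + m2).+1.
  move=> C10 C20 w0 hx hy hz; have w00 : 0 <= w by lra.
  rewrite (le_trans (ler_normD _ _))// mulrDl lerD//.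
    rewrite normrM; apply: (@le_trans _ _ (C1 * w ^+ m1 * w)); first by rewrite ler_pM.
    by rewrite -mulrA -exprSr ler_wpM2l// ler_weXn2l// ltnS leq_addr.
  rewrite (le_trans hy)// ler_wpM2l// ler_weXn2l//.
  by rewrite leqW// leq_addl.
elim/poly_ind : P => [|P c [C1 [m1 [C10 h1]]]].
  exists 0, 0%N; split => // q a _; by rewrite /ev rmorph0 horner0 normr0 mul0r.
have [C2 [m2 [C20 h2]]] : exists C, exists m : nat, 0 <= C /\
    forall q a, 0 <= q -> `|c.[q]| <= C * (1 + a ^+ 2 + q) ^+ m.
  elim/poly_ind : c => [|c e [C2 [m2 [C20 h2]]]].
    by exists 0, 0%N; split => // q a _; rewrite horner0 normr0 mul0r.
  exists (C2 + `|e|), (m2 + 0).+1; split; first by rewrite addr_ge0.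
  move=> q a q0; rewrite hornerMXaddC; apply: comb => //.
  - exact: w1.
  - exact: h2.
  - by rewrite expr0 mulr1.
  - by rewrite ger0_norm//; have := sqr_ge0 a; lra.
exists (C1 + C2), (m1 + m2).+1; split; first by rewrite addr_ge0.
move=> q a q0; rewrite /ev rmorphD rmorphM/= map_polyX map_polyC/= hornerMXaddC.
apply: comb => //.
- exact: w1.
- exact: h1.
- exact: h2.
- rewrite ler_norml; have h := sqr_ge0 (a - 1); have h' := sqr_ge0 (a + 1).
  by apply/andP; split; nra.
Qed.

Lemma gq_bound P : exists2 C, 0 <= C &
  forall q a, 0 <= q -> `|gq P q a| <= C * expR (- a ^+ 2) * expR (- q).
Proof.
have [C [m [C0 h]]] := ev_bound P.
pose k : R := (m%:R / 1) `^ m%:R * expR 1.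
exists (C * (k * expR 1)).
  by rewrite mulr_ge0// mulr_ge0 ?expR_ge0// mulr_ge0 ?expR_ge0// powR_ge0.
move=> q a q0; rewrite /gq normrM [X in _ * X]ger0_norm ?expR_ge0//.
set u := a ^+ 2 + q; have u0 : 0 <= u by rewrite addr_ge0// sqr_ge0.
have w0 : 0 <= 1 + u by lra.
have h1 : (1 + u) ^+ m <= k * expR u.
  rewrite -powR_mulrn// (le_trans (powR_le_expR (ler0n _ m) ltr01 w0))//.
  by rewrite mul1r expRD /k -mulrA.
(* One factor e^(-u) absorbs the polynomial, the other is the decay that remains. *)
have h2 : expR (- u ^+ 2) <= expR 1 * expR (- u) * expR (- u).
  rewrite -!expRD ler_expR; have := sqr_ge0 (u - 1); nra.
rewrite -[leRHS]mulrA -expRD -opprD -/u.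
apply: (@le_trans _ _ (C * (k * expR u) * (expR 1 * expR (- u) * expR (- u)))).
  apply: ler_pM => //; rewrite ?expR_ge0//.
  by rewrite (le_trans (h q a q0))// -addrA ler_wpM2l.
have e : expR u * expR (- u) = 1 by rewrite -expRD subrr expR0.
rewrite le_eqVlt; apply/orP; left; apply/eqP.
transitivity (C * (k * expR 1) * expR (- u) * (expR u * expR (- u))); first by ring.
by rewrite e mulr1.
Qed.

Lemma integrable_gq P q : 0 <= q -> leb.-integrable setT (EFin \o gq P q).
Proof.
move=> q0; have [C C0 h] := gq_bound P.
apply: (@integrable_dom _ T R leb _ (fun a => C * expR (- q) * expR (- (1 * a ^+ 2)))).
- exact: (continuous_measurable_fun (@continuous_gq P q)).
- have := integrableZl measurableT (C * expR (- q)) (@integrable_gauss1 R 1 ltr01).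
  by apply: eq_integrable => // x _; rewrite /= EFinM.
- by move=> a; rewrite (le_trans (h q a q0))// mul1r mulrAC.
Qed.

(** Each integration by parts trades a factor r for one application of [Dq] and exchanges sine and
    cosine, so the two bounds are proved together. *)
Lemma gq_fourier (k : nat) P q r : 0 <= q ->
  `|r| ^+ k * `|\int[leb]_a (cos (r * a) * gq P q a)| <= \int[leb]_a `|gq (iter k Dq P) q a| /\
  `|r| ^+ k * `|\int[leb]_a (sin (r * a) * gq P q a)| <= \int[leb]_a `|gq (iter k Dq P) q a|.
Proof.
move=> q0; have mg P' : measurable_fun setT (gq P' q).
  exact: (continuous_measurable_fun (@continuous_gq P' q)).
have bd P' : exists B, forall a, `|gq P' q a| * (1 + `|a|) <= B.
  have [C C0 h] := gq_bound P'; exists (C * expR (- q) * (2 + 2 / 1)) => a.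
  have h1 := @norm_le_expR R 1 a ltr01.
  have h2 := h q a q0.
  have e1 : 0 <= expR (- a ^+ 2) by exact: expR_ge0.
  have e2 : expR (- a ^+ 2) * (1 + `|a|) <= 2 + 2 / 1.
    apply: (@le_trans _ _ (expR (- a ^+ 2) * ((2 + 2 / 1) * expR (1 / 2 * a ^+ 2)))).
      by rewrite ler_wpM2l.
    rewrite mulrCA; apply: ler_piMr; first by lra.
    by rewrite -expRD -[leRHS]expR0 ler_expR; have := sqr_ge0 a; lra.
  apply: (@le_trans _ _ (C * expR (- a ^+ 2) * expR (- q) * (1 + `|a|))).
    by rewrite ler_wpM2r// addr_ge0.
  rewrite (_ : _ * (1 + `|a|) = C * expR (- q) * (expR (- a ^+ 2) * (1 + `|a|))); last by ring.
  by rewrite ler_wpM2l// mulr_ge0 ?expR_ge0.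
have c1 : continuous (fun x : R => cos (r * x)).
  move=> x; apply: (@continuous_comp _ _ _ (fun x => r * x) cos); last exact: continuous_cos.
  exact: mulrl_continuous.
have s1 : continuous (fun x : R => sin (r * x)).
  move=> x; apply: (@continuous_comp _ _ _ (fun x => r * x) sin); last exact: continuous_sin.
  exact: mulrl_continuous.
have ds (x : R) : is_derive x 1 (fun x => sin (r * x)) (r * cos (r * x)).
  by apply: is_derive_eq; rewrite /GRing.scale/=; ring.
have dc (x : R) : is_derive x 1 (fun x => - cos (r * x)) (r * sin (r * x)).
  by apply: is_derive_eq; rewrite /GRing.scale/=; ring.
elim: k P => [|k IH] P.
  have mgP := mg P; rewrite !expr0 !mul1r/=; split.
    apply: Rintegral_bound; first by mfun.
      by apply: integrable_norm => //; exact: integrable_gq.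
    by move=> a; rewrite normrM ler_piMl// normr_cos.
  apply: Rintegral_bound; first by mfun.
    by apply: integrable_norm => //; exact: integrable_gq.
  by move=> a; rewrite normrM ler_piMl// normr_sin.
have [B hB] := bd P; have [IHc IHs] := IH (Dq P).
rewrite !exprSr -!mulrA -!normrM iterSr; split.
  rewrite (Rintegral_parts (@is_derive_gq P q) (@continuous_gq (Dq P) q) ds c1
    (fun x => normr_sin _) (fun x => normr_cos _) (integrable_gq P q0) (integrable_gq _ q0) hB).
  by rewrite normrN.
have nc (x : R) : `|- cos (r * x)| <= 1 by rewrite normrN normr_cos.
rewrite (Rintegral_parts (@is_derive_gq P q) (@continuous_gq (Dq P) q) dc s1
    nc (fun x => normr_sin _) (integrable_gq P q0) (integrable_gq _ q0) hB).
rewrite normrN (_ : \int[leb]_x (- cos (r * x) * gq (Dq P) q x) =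
  - \int[leb]_x (cos (r * x) * gq (Dq P) q x)) ?normrN//.
rewrite -[RHS]mulN1r -RintegralZl//.
  by apply: eq_Rintegral => x _; rewrite mulN1r mulNr.
by apply: integrable_cos; [mfun|exact: integrable_gq].
Qed.

Lemma integrable_quartic n : (lam n).-integrable setT (fun y => (expR (- (sqT y) ^+ 2))%:E).
Proof.
apply: (@integrable_dom _ _ _ _ _ (fun y => expR 1 * expR (- (1 * sqT y)))).
- by mfun; exact: measurable_sqT.
- have := integrableZl measurableT (expR 1) (@integrable_gaussN R n 1 ltr01).
  by apply: eq_integrable => // x _; rewrite /= EFinM.
- move=> y; rewrite ger0_norm ?expR_ge0// -expRD ler_expR.
  by have := sqr_ge0 (sqT y - 1); nra.
Qed.

(** A rotation puts all oscillation into the first coordinate. [gq_fourier] acts on each line, and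
    the factor e^(-q) of [gq_bound] makes the result integrable over the lines. *)
Lemma quartic_fourier_decay n (k : nat) : exists2 C : R, 0 <= C & forall x : n.+1.-tuple T,
  normT x ^+ k * `|\int[lam n.+1]_y (cos (dotT x y) * expR (- (sqT y) ^+ 2))| <= C.
Proof.
have [C C0 h] := gq_bound (iter k Dq 1).
pose G1 := \int[leb]_a expR (- (1 * a ^+ 2)).
pose Gn := \int[lam n]_y expR (- (1 * sqT y)).
have G10 : 0 <= G1 by apply: Rintegral_ge0 => a _; exact: expR_ge0.
have Gn0 : 0 <= Gn by apply: Rintegral_ge0 => a _; exact: expR_ge0.
exists (C * G1 * Gn); first by rewrite !mulr_ge0.
move=> x.
rewrite (Rintegral_rot x (f := fun z => cos z.1 * expR (- z.2 ^+ 2))); last by mfun.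
have mth : measurable_fun setT (fun y : n.+1.-tuple T => normT x * (thead y : R)).
  by apply: measurable_funM => //; exact: measurable_thead.
rewrite RlamS'; last by apply: integrable_cos => //; exact: integrable_quartic.
have -> : normT x ^+ k = `|normT x ^+ k| by rewrite ger0_norm// exprn_ge0// normT_ge0.
have E (e : n.-tuple T) : \int[leb]_a (cos (normT x * (thead (tuple_cons (a, e)) : R)) *
    expR (- (sqT (tuple_cons (a, e))) ^+ 2)) = \int[leb]_a (cos (normT x * a) * gq 1 (sqT e) a).
  by apply: eq_Rintegral => a _; rewrite sqT_cons /gq /ev rmorph1 hornerC mul1r.
have fi : (lam n).-integrable setT (EFin \o (fun e : n.-tuple T =>
    \int[leb]_a (cos (normT x * a) * gq 1 (sqT e) a))).
  have := RlamS'_integrable (integrable_cos mth (integrable_quartic n.+1)).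
  by apply: eq_integrable => // y _; congr EFin; exact: E.
rewrite -normrM (_ : \int[lam n]_e _ = \int[lam n]_e \int[leb]_a (cos (normT x * a) * gq 1 (sqT e) a)); last by apply: eq_Rintegral => e _; exact: E.
rewrite -RintegralZl// /Gn -RintegralZl//; last first.
  by have := @integrable_gaussN R n 1 ltr01.
apply: Rintegral_bound.
- apply: measurable_funM => //.
  by case/integrableP : fi => /measurable_EFinP.
- have := integrableZl measurableT (C * G1) (@integrable_gaussN R n 1 ltr01).
  by apply: eq_integrable => // y _; rewrite /= EFinM.
move=> e; rewrite normrM normrX.
have [H _] := gq_fourier k 1 (normT x) (sqT_ge0 e).
apply: (le_trans H).
apply: (@le_trans _ _ (\int[leb]_a (C * expR (- sqT e) * expR (- (1 * a ^+ 2))))).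
  apply: le_Rintegral => //.
  - by apply: integrable_norm => //; apply: integrable_gq; exact: sqT_ge0.
  - have := integrableZl measurableT (C * expR (- sqT e)) (@integrable_gauss1 R 1 ltr01).
    by apply: eq_integrable => // y _; rewrite /= EFinM.
  - by move=> a _; rewrite (le_trans (h _ a (sqT_ge0 e)))// mul1r mulrAC.
rewrite RintegralZl//; last exact: integrable_gauss1.
by rewrite -/G1 mul1r mulrAC.
Qed.

End quartic.

(** * The solution at time 1 *)

Section measurable_param.
Context d1 d2 (T1 : measurableType d1) (T2 : measurableType d2) (R : realType).
Variables (m2 : {sigma_finite_measure set T2 -> \bar R}).

(** Splitting into positive and negative parts gives measurability in x even where the section is
    not integrable. *)
Lemma measurable_Rintegral_snd (f : T1 -> T2 -> R) :
  measurable_fun setT (fun z => f z.1 z.2) ->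
  measurable_fun setT (fun x => \int[m2]_y f x y).
Proof.
move=> mf; rewrite /Rintegral; apply: (measurableT_comp (@fine_measurable R setT measurableT)).
rewrite (_ : (fun x => _) = fun x =>
    ((\int[m2]_y maxe (f x y)%:E 0) - (\int[m2]_y maxe (- (f x y)%:E) 0))%E).
  apply: emeasurable_funB; apply: (@measurable_integral_snd _ _ T1 T2 R m2).
  - by apply: measurable_maxe => //; exact/measurable_EFinP.
  - by move=> x y; rewrite le_max lexx orbT.
  - by apply: measurable_maxe => //; apply: measurableT_comp => //; exact/measurable_EFinP.
  - by move=> x y; rewrite le_max lexx orbT.
apply/funext => x; rewrite integralE; congr (_ - _)%E; apply: eq_integral => y _.
  by rewrite funeposE.
by rewrite funenegE.
Qed.

End measurable_param.

(** * Weighted bounds for Riesz potentials *)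

Section potential.
Context {R : realType}.
Notation leb := (@lebesgue_measure R).
Notation T := (measurableTypeR R).
Notation lam n := (lebesgue_tuple R n).

(** A positive factor preserves an infinite integral, which [fine] sends to 0 on both sides, so only
    measurability is asked for. *)
Lemma Rintegral_scale (k : R) (f : R -> R) : 0 < k -> measurable_fun setT f ->
  \int[leb]_x f x = k * \int[leb]_x f (k * x).
Proof.
move=> k0 mf.
have H (g : R -> \bar R) : measurable_fun setT g ->
    (\int[leb]_x g x = k%:E * \int[leb]_x g (k * x)%R)%E.
  move=> mg; rewrite integralE [in RHS]integralE.
  have E1 : (\int[leb]_x g^\+ x = k%:E * \int[leb]_x (fun x => g (k * x)%R)^\+ x)%E.
    rewrite (ge0_integral_scale k0)//; last exact: measurable_funepos.
    by congr (_ * _)%E; apply: eq_integral => x _; rewrite !funeposE.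
  have E2 : (\int[leb]_x g^\- x = k%:E * \int[leb]_x (fun x => g (k * x)%R)^\- x)%E.
    rewrite (ge0_integral_scale k0)//; last exact: measurable_funeneg.
    by congr (_ * _)%E; apply: eq_integral => x _; rewrite !funenegE.
  rewrite E1 E2.
  by rewrite (pmuleBr (\int[leb]_x (fun x => g (k * x)%R)^\+ x) (\int[leb]_x (fun x => g (k * x)%R)^\- x) k0).
rewrite /Rintegral H; last exact/measurable_EFinP.
by case: (\int[leb]_x _)%E => [r| |]//=; rewrite ?gt0_muley ?gt0_muleNy ?lte_fin//= mulr0.
Qed.

Lemma Rintegral_affT n (k : R) (x : n.-tuple T) (f : n.-tuple T -> R) :
  k != 0 -> measurable_fun setT f ->
  \int[lam n]_y f (affT k x y) = `|k| ^- n * \int[lam n]_y f y.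
Proof.
move=> k0 mf; rewrite /Rintegral (integral_affT x (f := EFin \o f) k0); last exact/measurable_EFinP.
have c0 : 0 < `|k| ^- n by rewrite invr_gt0 exprn_gt0// normr_gt0.
by case: (\int[lam n]_x _)%E => [r| |]//=; rewrite ?gt0_muley ?gt0_muleNy ?lte_fin//= mulr0.
Qed.

Lemma Rintegral_dil n (k : R) (f : n.-tuple T -> R) : 0 < k ->
  measurable_fun setT f ->
  \int[lam n]_y f y = k ^+ n * \int[lam n]_y f (affT k (zT n) y).
Proof.
move=> k0 mf; rewrite Rintegral_affT ?gt_eqF// mulrA gtr0_norm// mulfV ?mul1r//.
by rewrite expf_neq0// gt_eqF.
Qed.

Lemma integrable_affT n (k : R) (x : n.-tuple T) (f : n.-tuple T -> R) :
  k != 0 -> (lam n).-integrable setT (EFin \o f) ->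
  (lam n).-integrable setT (EFin \o (fun y => f (affT k x y))).
Proof.
move=> k0 /integrableP[/measurable_EFinP mf fi]; apply/integrableP; split.
  by apply/measurable_EFinP; apply: (measurableT_comp mf); exact: measurable_affT.
rewrite (ge0_integral_affT x (f := fun y => `|f y|%:E) k0)//.
- by rewrite lte_mul_pinfty// lee_fin invr_ge0 exprn_ge0.
- by apply/measurable_EFinP; exact: measurableT_comp.
Qed.

Definition subT n (x y : n.-tuple T) := affT (-1) x y.

Lemma dotT_sub n (x y z : n.-tuple T) : dotT (subT x y) z = dotT x z - dotT y z.
Proof.
rewrite /dotT -sumrB; apply: eq_bigr => i _; rewrite tnth_mktuple; ring.
Qed.

Lemma dotTC n (x y : n.-tuple T) : dotT x y = dotT y x.
Proof. by apply: eq_bigr => i _; rewrite mulrC. Qed.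

Lemma sqT_sub n (x y : n.-tuple T) : sqT x <= 2 * (sqT (subT x y) + sqT y).
Proof.
rewrite /sqT -big_split/= mulr_sumr; apply: ler_sum => i _; rewrite tnth_mktuple.
by have := sqr_ge0 (2 * (tnth y i : R) - tnth x i); nra.
Qed.

Lemma measurable_subT2 d (U : measurableType d) n (f g : U -> n.-tuple T) :
  measurable_fun setT f -> measurable_fun setT g ->
  measurable_fun setT (fun u => subT (f u) (g u)).
Proof. exact: measurable_affT2. Qed.

(** The exponent is the dimension: large enough for integrability, and for the product with |y|^g to
    stay bounded whenever 0 <= g <= n. *)
Definition decayT n (y : n.-tuple T) : R := (1 + sqT y) ^- n.

Lemma decayT_ge0 n (y : n.-tuple T) : 0 <= decayT y.
Proof. by rewrite invr_ge0 exprn_ge0// addr_ge0// sqT_ge0. Qed.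

Lemma decayT_le1 n (y : n.-tuple T) : decayT y <= 1.
Proof.
have h := sqT_ge0 y; rewrite invf_le1 ?exprn_gt0//; last by lra.
by rewrite exprn_ege1//; lra.
Qed.

Lemma measurable_decayT n : measurable_fun setT (@decayT n).
Proof.
rewrite (_ : @decayT n = fun y => (1 + sqT y) `^ (- n%:R)).
  by mfun.
by apply/funext => y; rewrite powR_invn// addr_ge0// sqT_ge0.
Qed.

Lemma integrable_radial n (g : R -> R) : measurable_fun setT g -> (forall r, 0 <= g r) ->
  leb.-integrable setT (fun r => (powp (n.+1%:R / 2 - 1) r * g r)%:E) ->
  (lam n.+1).-integrable setT (fun y => (g (sqT y))%:E).
Proof.
move=> mg g0 gi; have [C C0 rad] := @radial R n.+1 isT.
apply: integrable_ge0P => [|y|]; last 2 first.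
- exact: g0.
- rewrite (rad (EFin \o g)); last 2 first.
  + exact/measurable_EFinP.
  + by move=> r; rewrite lee_fin.
  apply: lte_mul_pinfty => //; first by rewrite lee_fin ltW.
  have := integrable_lty_fin gi; apply => r.
  by rewrite mulr_ge0// powp_ge0.
by apply: (measurableT_comp mg); exact: measurable_sqT.
Qed.

Lemma integrable_powp_exp n (a c : R) : a < n.+1%:R -> 0 < c ->
  (lam n.+1).-integrable setT (fun y => (powp (- (a / 2)) (sqT y) * expR (- (c * sqT y)))%:E).
Proof.
move=> aN c0; apply: (@integrable_radial n (fun r => powp (- (a / 2)) r * expR (- (c * r)))).
- by mfun; exact: measurable_powp.
- by move=> r; rewrite mulr_ge0 ?powp_ge0// expR_ge0.
have p0 : 0 < (n.+1%:R - a) / 2 by lra.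
have := integrable_gamma p0 c0; apply: eq_integrable => // r _.
by rewrite mulrA -powpD; congr (powp _ _ * _)%:E; field.
Qed.

Lemma integrable_decayT n : (lam n.+1).-integrable setT (fun y => (decayT y)%:E).
Proof.
(* The maximum with 0 makes the profile nonnegative on the whole line, as [integrable_radial] asks;
   on squared norms it changes nothing. *)
pose g (r : R) := (1 + Num.max 0 r) ^- n.+1.
have g0 r : 0 <= g r by rewrite invr_ge0 exprn_ge0// addr_ge0// le_max lexx.
have mg : measurable_fun setT g.
  rewrite (_ : g = fun r => (1 + Num.max 0 r) `^ (- n.+1%:R)).
    by mfun; exact: measurable_maxr.
  by apply/funext => y; rewrite powR_invn// addr_ge0// le_max lexx.
have p0 : 0 < n.+1%:R / 2 :> R by rewrite divr_gt0.
have : (lam n.+1).-integrable setT (fun y => (g (sqT y))%:E).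
  apply: integrable_radial => //.
  apply: (@integrable_dom _ T R leb _ (fun r =>
     4 * (powp (n.+1%:R / 2 - 1) r * (1 + r `^ (n.+1%:R / 2)) ^- 2))).
  - by apply: measurable_funM => //; exact: measurable_powp.
  - have := integrableZl measurableT 4 (integrable_cauchy p0).
    by apply: eq_integrable => // x _; rewrite /= EFinM.
  move=> r; have [r0|r0] := leP r 0; first by rewrite powp_le0// !mul0r normr0 mulr0.
  rewrite ger0_norm; last by rewrite mulr_ge0// powp_ge0.
  rewrite mulrCA ler_wpM2l ?powp_ge0// /g (max_r (ltW r0)).
  have h1 : 0 < (1 + r) `^ (n.+1%:R / 2) by rewrite powR_gt0// addr_gt0.
  have h2 : 0 < 1 + r `^ (n.+1%:R / 2) by rewrite ltr_pwDl// powR_ge0.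
  have h3 : 1 + r `^ (n.+1%:R / 2) <= 2 * (1 + r) `^ (n.+1%:R / 2).
    rewrite mulr2n mulrDl mul1r lerD//.
      have e1 : 1 `^ (n.+1%:R / 2) = 1 :> R by rewrite powR1.
      by rewrite -[leLHS]e1 ge0_ler_powR ?nnegrE//; lra.
    by rewrite ge0_ler_powR ?nnegrE//; lra.
  have -> : (1 + r) ^+ n.+1 = ((1 + r) `^ (n.+1%:R / 2)) ^+ 2.
    rewrite -powR_mulrn ?addr_ge0 ?(ltW r0)// -powR_mulrn ?powR_ge0// -powRrM.
    by congr (_ `^ _); field.
  rewrite -[leLHS]mul1r ler_pdivrMr ?exprn_gt0// mulrAC ler_pdivlMr ?exprn_gt0// mul1r.
  have h4 := ltW h2; nra.
apply: eq_integrable => // y _; rewrite /g /decayT max_r//; exact: sqT_ge0.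
Qed.

(** A bound uniform in g: on (0, 1] the power with exponent b dominates and e^(1-q) >= 1; beyond 1
    the left side is at most 1. *)
Lemma powp_split (g b q : R) : 0 <= g -> g <= b ->
  powp (- (g / 2)) q <= expR 1 * (powp (- (b / 2)) q * expR (- (1 * q))) + 1.
Proof.
move=> g0 gb; have [q0|q0] := leP q 0.
  by rewrite !powp_le0// mul0r mulr0 add0r.
have [q1|q1] := leP q 1.
  have h1 : powp (- (g / 2)) q <= powp (- (b / 2)) q.
    by rewrite !powpE//; apply: ger_powR; [rewrite q0|lra].
  have h2 : 1 <= expR 1 * expR (- (1 * q)).
    by rewrite -expRD -[leLHS]expR0 ler_expR; lra.
  have h3 := powp_ge0 (- (b / 2)) q.
  by rewrite mulrCA; nra.
have h1 : powp (- (g / 2)) q <= 1.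
  rewrite powpE// powRN invf_le1 ?powR_gt0//.
  have g2 : 0 <= g / 2 by lra.
  by have := ler_powR (ltW q1) g2; rewrite powRr0.
apply: (le_trans h1); rewrite lerDr mulr_ge0 ?expR_ge0// mulr_ge0 ?expR_ge0// powp_ge0//.
Qed.

Lemma integrable_decayT_powp n (b : R) (x : n.+1.-tuple T) : b < n.+1%:R ->
  (lam n.+1).-integrable setT (EFin \o (fun y =>
     expR 1 * (powp (- (b / 2)) (sqT y) * expR (- (1 * sqT y))) + decayT (subT x y))).
Proof.
move=> bN.
have I1 := integrableZl measurableT (expR 1) (integrable_powp_exp bN ltr01).
have N1 : (-1 != 0 :> R) by rewrite oppr_eq0 oner_eq0.
have I2 := integrable_affT x N1 (integrable_decayT n).
have := integrableD measurableT I1 I2.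
by apply: eq_integrable => // y _; rewrite /= EFinD EFinM.
Qed.

Lemma measurable_decayT_powp n (x : n.+1.-tuple T) (p : R) :
  measurable_fun setT (fun y => decayT (subT x y) * powp p (sqT y)).
Proof.
apply: measurable_funM.
  by apply: (measurableT_comp (@measurable_decayT _)); exact: measurable_affT.
by apply: (measurableT_comp (@measurable_powp _ _)); exact: measurable_sqT.
Qed.

Lemma decayT_powp_le n (g b : R) (x y : n.+1.-tuple T) : 0 <= g -> g <= b ->
  `|decayT (subT x y) * powp (- (g / 2)) (sqT y)| <=
  expR 1 * (powp (- (b / 2)) (sqT y) * expR (- (1 * sqT y))) + decayT (subT x y).
Proof.
move=> g0 gb; rewrite ger0_norm ?mulr_ge0 ?decayT_ge0 ?powp_ge0//.
have h := powp_split (sqT y) g0 gb.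
have w0 := decayT_ge0 (subT x y); have w1 := decayT_le1 (subT x y).
set E := expR 1 * _ in h *.
have E0 : 0 <= E by rewrite mulr_ge0 ?expR_ge0// mulr_ge0 ?expR_ge0// powp_ge0.
by nra.
Qed.

(** By [powp_split] the singularity is integrated with b in place of g, so C depends neither on g
    nor on x. *)
Lemma riesz_bound n (b : R) : b < n.+1%:R -> exists2 C : R, 0 <= C &
  forall (g : R) (x : n.+1.-tuple T), 0 <= g -> g <= b ->
    \int[lam n.+1]_y (decayT (subT x y) * powp (- (g / 2)) (sqT y)) <= C.
Proof.
move=> bN.
have I1 := integrable_powp_exp bN ltr01.
have N1 : (-1 != 0 :> R) by rewrite oppr_eq0 oner_eq0.
exists (expR 1 * (\int[lam n.+1]_y (powp (- (b / 2)) (sqT y) * expR (- (1 * sqT y)))) +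
  \int[lam n.+1]_y decayT y).
  rewrite addr_ge0//; last by apply: Rintegral_ge0 => y _; exact: decayT_ge0.
  by rewrite mulr_ge0 ?expR_ge0//; apply: Rintegral_ge0 => y _; rewrite mulr_ge0 ?expR_ge0 ?powp_ge0.
move=> g x g0 gb; rewrite (le_trans (ler_norm _))//.
apply: (le_trans (Rintegral_bound (measurable_decayT_powp x _) (integrable_decayT_powp x bN) (fun y => decayT_powp_le x y g0 gb))).
have I2 := integrable_affT x N1 (integrable_decayT n).
rewrite RintegralD//; last first.
  have := integrableZl measurableT (expR 1) I1.
  by apply: eq_integrable => // y _; rewrite /= EFinM.
rewrite RintegralZl// lerD2l Rintegral_affT//; last exact: measurable_decayT.
by rewrite normrN1 expr1n invr1 mul1r.
Qed.

Lemma powR_sq_split n (g : R) (x y : n.-tuple T) : 0 <= g -> g <= n%:R ->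
  sqT x `^ (g / 2) <= 2 ^+ n * (sqT (subT x y) `^ (g / 2) + sqT y `^ (g / 2)).
Proof.
move=> g0 gn; set a := sqT (subT x y); set c := sqT y.
have a0 : 0 <= a by exact: sqT_ge0.
have c0 : 0 <= c by exact: sqT_ge0.
have g2 : 0 <= g / 2 by lra.
have h : sqT x <= 4 * Num.max a c.
  by rewrite (le_trans (sqT_sub x y))//; case: (leP a c) => ac; rewrite -/a -/c; lra.
have m0 : 0 <= Num.max a c by rewrite le_max a0.
have e4 : (4 : R) `^ (g / 2) <= 2 ^+ n.
  have -> : 4 = (2 : R) `^ 2 by rewrite powR_mulrn// ; ring.
  rewrite -powRrM -powR_mulrn// ler_powR//; first by rewrite ler1n.
  by lra.
apply: (@le_trans _ _ ((4 * Num.max a c) `^ (g / 2))).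
  by rewrite ge0_ler_powR ?nnegrE ?sqT_ge0// mulr_ge0.
rewrite powRM// ler_pM ?powR_ge0//.
by case: (leP a c) => ac; rewrite ?lerDl ?lerDr powR_ge0.
Qed.

(** [powR_sq_split] bounds |x|^g by |x - y|^g, which one factor [decayT] absorbs, plus |y|^g, which
    cancels the singularity. *)
Lemma riesz_bound_decay n (b : R) : b < n.+1%:R -> exists2 C : R, 0 <= C &
  forall (g : R) (x : n.+1.-tuple T), 0 <= g -> g <= b ->
    (1 + sqT x `^ (g / 2)) * \int[lam n.+1]_y (decayT (subT x y) ^+ 2 * powp (- (g / 2)) (sqT y)) <= C.
Proof.
move=> bN; have [C C0 hC] := riesz_bound bN.
have N1 : (-1 != 0 :> R) by rewrite oppr_eq0 oner_eq0.
pose W := \int[lam n.+1]_y decayT y.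
have W0 : 0 <= W by apply: Rintegral_ge0 => y _; exact: decayT_ge0.
exists (C + 2 ^+ n.+1 * (C + W)).
  by rewrite !addr_ge0// mulr_ge0// addr_ge0.
move=> g x g0 gb.
have Iw : (lam n.+1).-integrable setT (EFin \o (fun y => decayT (subT x y) * powp (- (g / 2)) (sqT y))).
  apply: (integrable_dom (measurable_decayT_powp x _) (integrable_decayT_powp x bN) (fun y => decayT_powp_le x y g0 gb)).
have Iw2 := integrable_affT x N1 (integrable_decayT n).
have m2 : measurable_fun setT (fun y => decayT (subT x y) ^+ 2 * powp (- (g / 2)) (sqT y)).
  apply: measurable_funM.
    by apply: measurable_funX; apply: (measurableT_comp (@measurable_decayT _)); exact: measurable_affT.
  by apply: (measurableT_comp (@measurable_powp _ _)); exact: measurable_sqT.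
have p0 y : 0 <= decayT (subT x y) ^+ 2 * powp (- (g / 2)) (sqT y).
  by rewrite mulr_ge0 ?powp_ge0// exprn_ge0// decayT_ge0.
have le1 y : decayT (subT x y) ^+ 2 * powp (- (g / 2)) (sqT y) <= decayT (subT x y) * powp (- (g / 2)) (sqT y).
  rewrite ler_wpM2r ?powp_ge0// expr2 ler_piMr ?decayT_ge0// decayT_le1//.
have I2 : (lam n.+1).-integrable setT (EFin \o (fun y => decayT (subT x y) ^+ 2 * powp (- (g / 2)) (sqT y))).
  by apply: (integrable_dom m2 Iw) => y; rewrite ger0_norm.
have A1 : \int[lam n.+1]_y (decayT (subT x y) ^+ 2 * powp (- (g / 2)) (sqT y)) <= C.
  by apply: le_trans (hC g x g0 gb); apply: le_Rintegral => // y _; exact: le1.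
rewrite mulrDl mul1r lerD//.
rewrite -RintegralZl//.
apply: (@le_trans _ _ (\int[lam n.+1]_y (2 ^+ n.+1 * (decayT (subT x y) * powp (- (g / 2)) (sqT y) + decayT (subT x y))))).
  have I3 := integrableD measurableT Iw Iw2.
  apply: le_Rintegral => //.
  - have := integrableZl measurableT (sqT x `^ (g / 2)) I2.
    by apply: eq_integrable => // y _; rewrite /= EFinM.
  - have := integrableZl measurableT (2 ^+ n.+1) I3.
    by apply: eq_integrable => // y _; rewrite /= EFinM EFinD.
  move=> y _; have gn : g <= n.+1%:R by lra.
  have h := powR_sq_split x y g0 gn.
  have q0 := sqT_ge0 (subT x y); set s := sqT (subT x y) in h q0 *.
  have w0 := decayT_ge0 (subT x y); set w := decayT (subT x y) in w0 *.
  have pp0 := powp_ge0 (- (g / 2)) (sqT y); set p := powp _ _ in pp0 *.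
  have e1 : sqT y `^ (g / 2) * p <= 1.
    rewrite /p /powp; case: ifP => y0; last by rewrite mulr0.
    by rewrite -powRDp// subrr powRr0.
  have e2 : w * s `^ (g / 2) <= 1.
    rewrite /w /decayT -/s mulrC ler_pdivrMr ?mul1r; last by rewrite exprn_gt0//; lra.
    rewrite -powR_mulrn; last by lra.
    apply: (@le_trans _ _ ((1 + s) `^ (g / 2))).
      by rewrite ge0_ler_powR ?nnegrE//; lra.
    by rewrite ler_powR//; lra.
  have w1 : w <= 1 by exact: decayT_le1.
  set Sg := s `^ (g / 2) in h e2 *; set X := sqT x `^ _ in h *; set Y := sqT y `^ _ in h e1 *.
  have S0 : 0 <= Sg by exact: powR_ge0.
  have Y0 : 0 <= Y by exact: powR_ge0.
  apply: (@le_trans _ _ ((2 ^+ n.+1 * (Sg + Y)) * (w ^+ 2 * p))).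
    by rewrite ler_wpM2r// mulr_ge0// exprn_ge0.
  rewrite -mulrA ler_wpM2l ?exprn_ge0//.
  have -> : (Sg + Y) * (w ^+ 2 * p) = (w * Sg) * (w * p) + w * (w * (Y * p)) by ring.
  apply: lerD; first by rewrite ler_piMl// mulr_ge0.
  rewrite ler_piMr//.
  by apply: (le_trans _ w1); rewrite ler_piMr.
rewrite RintegralZl//; last first.
  have := integrableD measurableT Iw Iw2.
  by apply: eq_integrable => // y _; rewrite /= EFinD.
rewrite ler_wpM2l ?exprn_ge0// RintegralD// lerD//; first exact: hC.
by rewrite Rintegral_affT// ?normrN1 ?expr1n ?invr1 ?mul1r//; exact: measurable_decayT.
Qed.

End potential.

Section iterated.
Context d1 d2 (T1 : measurableType d1) (T2 : measurableType d2) (R : realType).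
Variables (m1 : {sigma_finite_measure set T1 -> \bar R})
  (m2 : {sigma_finite_measure set T2 -> \bar R}).

(** Supplies the finiteness hypothesis of [Rfubini] from a bound on the inner L^1 norms. Almost
    every x suffices, since the sections may be singular at the origin. *)
Lemma iter_dom_ae (f : T1 -> T2 -> R) (g : T1 -> R) :
  measurable_fun setT (fun z => f z.1 z.2) ->
  m1.-integrable setT (EFin \o g) ->
  {ae m1, forall x, m2.-integrable setT (EFin \o f x) /\ \int[m2]_y `|f x y| <= g x} ->
  (\int[m1]_x \int[m2]_y `|f x y|%:E < +oo)%E.
Proof.
move=> mf gi ae.
have mg : measurable_fun setT g by case/integrableP : gi => /measurable_EFinP.
apply: (@le_lt_trans _ _ (\int[m1]_x `|g x|%:E)%E); last first.
  by case/integrableP : gi.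
apply: ae_ge0_le_integral => //.
- by move=> x _; apply: integral_ge0.
- apply: (@measurable_integral_snd _ _ _ _ R m2 (fun x y => `|f x y|%:E)) => //.
  by apply/measurable_EFinP; exact: measurableT_comp.
- by apply/measurable_EFinP; exact: measurableT_comp.
apply: filterS ae => x [fi fg] _.
rewrite -RintE; last exact: integrable_norm.
by rewrite lee_fin (le_trans fg)// ler_norm.
Qed.

Lemma iter_dom (f : T1 -> T2 -> R) (a : T1 -> R) (b : T2 -> R) :
  measurable_fun setT (fun z => f z.1 z.2) ->
  m1.-integrable setT (EFin \o a) -> m2.-integrable setT (EFin \o b) ->
  (forall x y, `|f x y| <= a x * b y) ->
  (\int[m1]_x \int[m2]_y `|f x y|%:E < +oo)%E.
Proof.
move=> mf ai bi fab.
have abi x : m2.-integrable setT (EFin \o (fun y => a x * b y)).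
  have := integrableZl measurableT (a x) bi.
  by apply: eq_integrable => // y _; rewrite /= EFinM.
have fi x : m2.-integrable setT (EFin \o f x).
  exact: (integrable_dom (measurable_curry1 x mf) (abi x)).
apply: (@iter_dom_ae _ (fun x => a x * \int[m2]_y b y)) => //.
  have := integrableZr measurableT (\int[m2]_y b y) ai.
  by apply: eq_integrable => // y _; rewrite /= EFinM.
apply: aeW => x; split; first exact: fi.
rewrite -RintegralZl//; apply: le_Rintegral => //.
by apply: integrable_norm; exact: fi.
Qed.

Lemma ae_eq_Rintegral (f g : T1 -> R) : measurable_fun setT f -> measurable_fun setT g ->
  {ae m1, forall x, f x = g x} -> \int[m1]_x f x = \int[m1]_x g x.
Proof.
move=> mf mg ae; rewrite /Rintegral; congr fine; apply: ae_eq_integral => //.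
- exact/measurable_EFinP.
- exact/measurable_EFinP.
- by apply: filterS ae => x -> _.
Qed.

End iterated.

(** * Reduction to a Fourier integral *)

Section riesz_transform.
Context {R : realType} (n : nat).
Notation leb := (@lebesgue_measure R).
Notation T := (measurableTypeR R).
Notation lam n := (lebesgue_tuple R n).
Notation N := (n.+1%:R : R).

(* The kernel at time 1 without its factor (2 pi)^-N, hence also [riesz_heat1]. *)
Definition heat1 (x : n.+1.-tuple T) : R :=
  \int[lam n.+1]_y (cos (dotT x y) * expR (- (sqT y) ^+ 2)).

Lemma measurable_heat1 : measurable_fun setT heat1.
Proof.
apply: (@measurable_Rintegral_snd _ _ _ _ R (lam n.+1)
  (fun x y : n.+1.-tuple T => cos (dotT x y) * expR (- (sqT y) ^+ 2))).
by mfun.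
Qed.

(** The three powers of [decayT] have separate uses: one for integrability, one for the weight |x|^g
    in [riesz_bound_decay], one for the powers of |x - y| in [heat1_ratio_bound]. *)
Lemma heat1_bound : exists2 A : R, 0 <= A & forall x, `|heat1 x| <= A * decayT x ^+ 3.
Proof.
pose k := (n.+1 * 3)%N.
have [C0 C00 h0] := @quartic_fourier_decay R n 0.
have [C1 C10 h1] := @quartic_fourier_decay R n (2 * k).
exists (2 ^+ k * (C0 + C1)); first by rewrite mulr_ge0// addr_ge0.
move=> x; set s := sqT x; have s0 : 0 <= s by exact: sqT_ge0.
have {}h0 := h0 x; have {}h1 := h1 x; rewrite -/(heat1 x) in h0 h1.
rewrite expr0 mul1r in h0; rewrite exprM normT_sqr -/s in h1.
rewrite /decayT -/s exprVn -exprM ler_pdivlMr; last by rewrite exprn_gt0//; lra.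
have h2 : (1 + s) ^+ k <= 2 ^+ k * (1 + s ^+ k).
  have [s1|s1] := leP s 1.
    apply: (@le_trans _ _ (2 ^+ k * 1)).
      by rewrite mulr1 lerXn2r ?nnegrE//; lra.
    by rewrite ler_wpM2l// lerDl exprn_ge0.
  apply: (@le_trans _ _ (2 ^+ k * s ^+ k)).
    by rewrite -exprMn lerXn2r ?nnegrE//; lra.
  by rewrite ler_wpM2l// lerDr.
apply: (@le_trans _ _ (`|heat1 x| * (2 ^+ k * (1 + s ^+ k)))); first by rewrite ler_wpM2l.
rewrite mulrCA ler_wpM2l// mulrDr mulr1 lerD// mulrC//.
Qed.

Definition riesz_heat1 (b : R) (x : n.+1.-tuple T) : R :=
  \int[lam n.+1]_y (heat1 (subT x y) * powp (- (b / 2)) (sqT y)).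

Lemma measurable_heat1_powp x p :
  measurable_fun setT (fun y => heat1 (subT x y) * powp p (sqT y)).
Proof.
apply: measurable_funM.
  by apply: (measurableT_comp measurable_heat1); exact: measurable_affT.
by apply: (measurableT_comp (@measurable_powp _ _)); exact: measurable_sqT.
Qed.

Lemma decayT3 (x : n.+1.-tuple T) : decayT x ^+ 3 <= decayT x ^+ 2 /\ decayT x ^+ 2 <= decayT x.
Proof.
have w0 := decayT_ge0 x; have w1 := decayT_le1 x.
by split; rewrite ?exprSr ?expr1 ?expr0 ?mul1r; rewrite ler_piMr// ?mulr_ge0.
Qed.

Lemma integrable_decayT_powp1 (b : R) x : 0 <= b -> b < N ->
  (lam n.+1).-integrable setT (EFin \o (fun y => decayT (subT x y) * powp (- (b / 2)) (sqT y))).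
Proof.
move=> b0 bN.
exact: (integrable_dom (measurable_decayT_powp x _) (integrable_decayT_powp x bN)
  (fun y => decayT_powp_le x y b0 (lexx b))).
Qed.

Lemma integrable_riesz_heat1 (b : R) x : 0 <= b -> b < N ->
  (lam n.+1).-integrable setT (EFin \o (fun y => heat1 (subT x y) * powp (- (b / 2)) (sqT y))).
Proof.
move=> b0 bN; have [A A0 hA] := heat1_bound.
apply: (@integrable_dom _ _ _ _ _ (fun y => A * (decayT (subT x y) * powp (- (b / 2)) (sqT y)))).
- exact: measurable_heat1_powp.
- have := integrableZl measurableT A (integrable_decayT_powp1 x b0 bN).
  by apply: eq_integrable => // y _; rewrite /= EFinM.
- move=> y; rewrite normrM (ger0_norm (powp_ge0 _ _)) mulrA ler_wpM2r ?powp_ge0//.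
  rewrite (le_trans (hA _))// ler_wpM2l//.
  by have [h1 h2] := decayT3 (subT x y); exact: le_trans h1 h2.
Qed.

Definition riesz_weight (b : R) (y : n.+1.-tuple T) : R :=
  powp ((b - N) / 2) (sqT y) * expR (- (sqT y) ^+ 2).

Lemma measurable_riesz_weight b : measurable_fun setT (riesz_weight b).
Proof.
rewrite /riesz_weight; apply: measurable_funM; last by mfun.
by apply: (measurableT_comp (@measurable_powp _ _)); exact: measurable_sqT.
Qed.

Lemma riesz_weight_ge0 b y : 0 <= riesz_weight b y.
Proof. by rewrite mulr_ge0 ?powp_ge0 ?expR_ge0. Qed.

Lemma quartic_le_exp (q : R) : expR (- q ^+ 2) <= expR 1 * expR (- (1 * q)).
Proof. by rewrite -expRD ler_expR; have := sqr_ge0 (q - 1); nra. Qed.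

Lemma integrable_riesz_weight (b : R) : 0 < b -> (lam n.+1).-integrable setT (EFin \o riesz_weight b).
Proof.
move=> b0; have aN : N - b < N by lra.
apply: (@integrable_dom _ _ _ _ _ (fun y => expR 1 * (powp (- ((N - b) / 2)) (sqT y) * expR (- (1 * sqT y))))).
- exact: measurable_riesz_weight.
- have := integrableZl measurableT (expR 1) (integrable_powp_exp aN ltr01).
  by apply: eq_integrable => // y _; rewrite /= EFinM.
- move=> y; rewrite ger0_norm ?riesz_weight_ge0// /riesz_weight mulrCA.
  rewrite (_ : - ((N - b) / 2) = (b - N) / 2); last by ring.
  by rewrite ler_wpM2l ?powp_ge0// quartic_le_exp.
Qed.

(** The function F of the overview, whose U is [riesz_heat1]. *)
Definition riesz_ft (b : R) (x : n.+1.-tuple T) : R :=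
  \int[lam n.+1]_y (cos (dotT x y) * riesz_weight b y).

Lemma integrable_riesz_ft b x : 0 < b ->
  (lam n.+1).-integrable setT (EFin \o (fun y => cos (dotT x y) * riesz_weight b y)).
Proof. by move=> b0; apply: integrable_cos; [exact: measurable_dotT|exact: integrable_riesz_weight]. Qed.

(** Gamma(p) q^(-p), with Gamma(p) left as an integral. Read from right to left, a power of |y|^2
    becomes a mixture of Gaussians. *)
Lemma gammaE (p q : R) : 0 < p -> 0 < q ->
  \int[leb]_s (powp (p - 1) s * expR (- (s * q))) =
  powp (- p) q * \int[leb]_s (powp (p - 1) s * expR (- (1 * s))).
Proof.
move=> p0 q0; have qi : 0 < q^-1 by rewrite invr_gt0.
rewrite (Rintegral_scale qi); last by mfun; exact: measurable_powp.
rewrite (_ : powp (- p) q = q^-1 * q^-1 `^ (p - 1)); last first.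
  rewrite powpE// powRV ?(ltW q0)// -(powR_inv1 (ltW q0)) -powRDp//.
  by congr (_ `^ _); ring.
rewrite -mulrA -[in RHS]RintegralZl//; last exact: integrable_gamma.
congr (_ * _); apply: eq_Rintegral => x _; rewrite powpM// -mulrA; congr (_ * (_ * expR (- _))).
by field; rewrite gt_eqF.
Qed.

(** The companion on the Fourier side: the transformed Gaussians e^(-q/(4s)) again mix to a power of
    q. *)
Lemma invgammaE (p q : R) : 0 < p -> 0 < q ->
  \int[leb]_s (powp (- p - 1) s * expR (- (q / (4 * s)))) =
  powp (- p) q * \int[leb]_s (powp (- p - 1) s * expR (- (4^-1 / s))).
Proof.
move=> p0 q0; have i4 : 0 < 4^-1 :> R by rewrite invr_gt0.
rewrite (Rintegral_scale q0); last first.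
  rewrite (_ : (fun x => _) = fun x => powp (- p - 1) x * expR (- (q * (4^-1 * powp (-1) x)))).
    apply: measurable_funM; first exact: measurable_powp.
    by apply: (measurableT_comp (@measurable_expR _)); mfun; exact: measurable_powp.
  apply/funext => x; rewrite /powp; case: ifP => x0; last by rewrite !mul0r.
  by rewrite powR_inv1 ?(ltW x0)// invfM.
rewrite (_ : powp (- p) q = q * q `^ (- p - 1)); last first.
  rewrite powpE// -{2}(powRr1 (ltW q0)) -powRDp//.
  by congr (_ `^ _); ring.
rewrite -mulrA -[in RHS]RintegralZl//; last exact: integrable_invgamma.
congr (_ * _); apply: eq_Rintegral => x _; rewrite powpM// -mulrA; congr (_ * _).
rewrite /powp; case: ifP => x0; last by rewrite !mul0r.
by congr (_ * expR (- _)); field; rewrite !gt_eqF.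
Qed.

Lemma gaussN_scale k (s : R) : 0 < s ->
  \int[lam k]_y expR (- (s * sqT y)) = s `^ (- (k%:R / 2)) * \int[lam k]_y expR (- (1 * sqT y)).
Proof.
move=> s0; have k0 : 0 < Num.sqrt s^-1 by rewrite sqrtr_gt0 invr_gt0.
rewrite (Rintegral_dil k0); last by mfun; exact: measurable_sqT.
have -> : Num.sqrt s^-1 ^+ k = s `^ (- (k%:R / 2)).
  by rewrite sqrt_exprn ?invr_ge0 ?(ltW s0)// powRV ?(ltW s0).
congr (_ * _).
apply: eq_Rintegral => y _; rewrite sqT_dil sqr_sqrtr ?invr_ge0 ?(ltW s0)//.
by congr (expR (- _)); field; rewrite gt_eqF.
Qed.

Lemma odd_sin_gauss k (x : k.-tuple T) (s : R) : 0 < s ->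
  \int[lam k]_y (sin (dotT y x) * expR (- (s * sqT y))) = 0.
Proof.
move=> s0; set I := LHS; have N1 : (-1 != 0 :> R) by rewrite oppr_eq0 oner_eq0.
suff : I = -1 * I by rewrite mulN1r => /eqP; rewrite -addr_eq0 -mulr2n mulrn_eq0/= => /eqP.
have mf : measurable_fun setT (fun y : k.-tuple T => sin (dotT y x) * expR (- (s * sqT y))).
  by mfun.
have fi : (lam k).-integrable setT (EFin \o (fun y => sin (dotT y x) * expR (- (s * sqT y)))).
  apply: (integrable_dom mf (integrable_gaussN k s0)) => y.
  by rewrite normrM (ger0_norm (expR_ge0 _)) ler_piMl ?expR_ge0// normr_sin.
have := Rintegral_affT (zT k) N1 mf; rewrite normrN1 expr1n invr1 mul1r -/I => E.
rewrite -[LHS]E /I -(RintegralZl _ measurableT fi); apply: eq_Rintegral => y _.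
by rewrite sqT_dil dotTC dotT_dil mulN1r sinN sqrrN expr1n mul1r (dotTC x) mulN1r mulNr.
Qed.

(** After Fubini, cos((x - y).z) is expanded; the sine part is odd in y and vanishes, the cosine
    part is the Gaussian transform at z. *)
Lemma gauss_conv x (s : R) : 0 < s ->
  \int[lam n.+1]_y (heat1 (subT x y) * expR (- (s * sqT y))) =
  (\int[lam n.+1]_y expR (- (s * sqT y))) *
  \int[lam n.+1]_y (cos (dotT x y) * (expR (- (sqT y) ^+ 2) * expR (- (sqT y / (4 * s))))).
Proof.
move=> s0.
pose f (y z : n.+1.-tuple T) := cos (dotT (subT x y) z) * expR (- (sqT z) ^+ 2) * expR (- (s * sqT y)).
have mf : measurable_fun setT (fun z => f z.1 z.2).
  rewrite /f; apply: measurable_funM; last by mfun.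
  apply: measurable_funM; last by mfun.
  apply: (measurableT_comp (continuous_measurable_fun (@continuous_cos R))).
  by apply: measurable_dotT2 => //; apply: measurable_subT2 => //; mfun.
have Ig := @integrable_gaussN R n.+1 s s0.
have fin : (\int[lam n.+1]_y \int[lam n.+1]_z `|f y z|%:E < +oo)%E.
  apply: (iter_dom mf Ig (integrable_quartic n.+1)) => y z.
  rewrite /f normrM (ger0_norm (expR_ge0 (- (s * _)))) mulrC ler_wpM2l ?expR_ge0//.
  by rewrite normrM (ger0_norm (expR_ge0 _)) ler_piMl ?expR_ge0// normr_cos.
transitivity (\int[lam n.+1]_y \int[lam n.+1]_z f y z).
  apply: eq_Rintegral => y _; rewrite /f RintegralZr//.
  apply: integrable_cos; [exact: measurable_dotT|exact: integrable_quartic].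
rewrite (Rfubini mf fin) -RintegralZl//; last first.
  apply: integrable_cos; first exact: measurable_dotT.
  apply: (@integrable_dom _ _ _ _ _ (fun y => expR (- (sqT y) ^+ 2))).
  - by mfun.
  - exact: integrable_quartic.
  - move=> y; rewrite ger0_norm ?mulr_ge0 ?expR_ge0// ler_piMr ?expR_ge0//.
    by rewrite -[leRHS]expR0 ler_expR oppr_le0 divr_ge0 ?sqT_ge0// mulr_ge0// ltW.
apply: eq_Rintegral => z _.
pose e (y : n.+1.-tuple T) : R := expR (- (s * sqT y)).
have Is : (lam n.+1).-integrable setT (EFin \o (fun y => sin (dotT y z) * e y)).
  apply: (@integrable_dom _ _ _ _ _ e).
  - by rewrite /e; mfun.
  - exact: Ig.
  - by move=> y; rewrite normrM (ger0_norm (expR_ge0 _)) ler_piMl ?expR_ge0// normr_sin.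
have Ic : (lam n.+1).-integrable setT (EFin \o (fun y => cos (dotT z y) * e y)).
  by apply: integrable_cos; [exact: measurable_dotT|exact: Ig].
have E : forall y, f y z = (cos (dotT x z) * expR (- sqT z ^+ 2)) * (cos (dotT z y) * e y) +
    (sin (dotT x z) * expR (- sqT z ^+ 2)) * (sin (dotT y z) * e y).
  by move=> y; rewrite /f dotT_sub cosB -/(e y) (dotTC z y); ring.
under eq_Rintegral do rewrite E.
rewrite RintegralD//; last 2 first.
- have := integrableZl measurableT (cos (dotT x z) * expR (- sqT z ^+ 2)) Ic.
  by apply: eq_integrable => // y _; rewrite /= EFinM.
- have := integrableZl measurableT (sin (dotT x z) * expR (- sqT z ^+ 2)) Is.
  by apply: eq_integrable => // y _; rewrite /= EFinM.
rewrite !RintegralZl// odd_sin_gauss// mulr0 addr0 /e gauss_fourierN//; ring.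
Qed.

End riesz_transform.

Section riesz_transform.
Context {R : realType} (n : nat).
Notation leb := (@lebesgue_measure R).
Notation T := (measurableTypeR R).
Notation lam n := (lebesgue_tuple R n).
Notation N := (n.+1%:R : R).

Lemma riesz_fourier (b : R) : 0 < b -> b < N ->
  exists2 C : R, 0 < C & forall x : n.+1.-tuple T, riesz_heat1 b x = C * riesz_ft b x.
Proof.
move=> b0 bN.
pose p := (N - b) / 2; have p0 : 0 < p by rewrite /p; lra.
have b20 : 0 < b / 2 by lra.
have i4 : 0 < 4^-1 :> R by rewrite invr_gt0.
pose G := \int[leb]_s (powp (b / 2 - 1) s * expR (- (1 * s))).
pose G' := \int[leb]_s (powp (- p - 1) s * expR (- (4^-1 / s))).
pose G1 := \int[lam n.+1]_y expR (- (1 * sqT y)).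
have G10 : 0 < G1 by exact: gaussN_gt0.
have pos (f : R -> R) (q : R) : (forall s, 0 < f s) -> leb.-integrable setT (fun s => (powp q s * f s)%:E) ->
    0 < \int[leb]_s (powp q s * f s).
  move=> f0 fi; apply: (@Rintegral_gt0 _ T R leb `]0%R, 1%R[%classic) => //.
  - by move=> s; rewrite mulr_ge0 ?powp_ge0// ltW.
  - by have := @lebesgue_measure_itv R `]0, 1[; rewrite /= lte_fin ltr01 sube0 => ->; rewrite lte_fin.
  - by move=> s /=; rewrite in_itv/= => /andP[s0 _]; rewrite mulr_gt0 ?powp_gt0.
have G0 : 0 < G by apply: pos; [move=> s; exact: expR_gt0|exact: integrable_gamma].
have G'0 : 0 < G' by apply: pos; [move=> s; exact: expR_gt0|exact: integrable_invgamma].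
(* [G] normalises the mixture for |y|^(-b), [G'] the one for |z|^(b-N), and [G1] is the Gaussian
   mass at s = 1. *)
exists (G^-1 * (G1 * G')); first by rewrite !mulr_gt0// invr_gt0.
move=> x; rewrite -mulrA; apply: (mulfI (x := G)); first by rewrite gt_eqF.
rewrite [RHS]mulrA mulfV ?mul1r; last by rewrite gt_eqF.
pose f (y : n.+1.-tuple T) (s : R) := heat1 (subT x y) * (powp (b / 2 - 1) s * expR (- (s * sqT y))).
have mf : measurable_fun setT (fun z => f z.1 z.2).
  apply: measurable_funM.
    by apply: (measurableT_comp (@measurable_heat1 R n)); apply: measurable_subT2; mfun.
  apply: measurable_funM; last by mfun.
  by apply: (measurableT_comp (@measurable_powp _ _)); mfun.
have gi (y : n.+1.-tuple T) : 0 < sqT y -> leb.-integrable setT (fun s => (powp (b / 2 - 1) s * expR (- (s * sqT y)))%:E).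
  move=> y0; have := integrable_gamma b20 y0; apply: eq_integrable => // s _.
  by rewrite (mulrC s).
have fin : (\int[lam n.+1]_y \int[leb]_s `|f y s|%:E < +oo)%E.
  apply: (@iter_dom_ae _ _ _ T R (lam n.+1) leb f (fun y => `|heat1 (subT x y) * powp (- (b / 2)) (sqT y)| * G) mf).
    have I := @integrable_norm _ _ _ _ _ _ (integrable_riesz_heat1 x (ltW b0) bN).
    have := integrableZr measurableT G I.
    by apply: eq_integrable => // y _; rewrite /= EFinM.
  apply: filterS (sqT_ae n) => y y0; split.
    have := integrableZl measurableT (heat1 (subT x y)) (gi y y0).
    by apply: eq_integrable => // s _; rewrite /= EFinM.
  rewrite (_ : \int[leb]_s `|f y s| = `|heat1 (subT x y)| * \int[leb]_s (powp (b / 2 - 1) s * expR (- (s * sqT y)))).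
    by rewrite gammaE// normrM (ger0_norm (powp_ge0 _ _)) -mulrA.
  rewrite -RintegralZl//; last exact: gi.
  by apply: eq_Rintegral => s _; rewrite /f normrM [X in _ * X]ger0_norm// mulr_ge0 ?powp_ge0 ?expR_ge0.
have E1 : G * riesz_heat1 b x = \int[lam n.+1]_y \int[leb]_s f y s.
  rewrite /riesz_heat1 -RintegralZl//; last exact: (integrable_riesz_heat1 x (ltW b0) bN).
  apply: (@ae_eq_Rintegral _ _ R (lam n.+1)).
  - by apply: measurable_funM => //; exact: measurable_heat1_powp.
  - exact: (@measurable_Rintegral_snd _ _ _ T R leb f mf).
  - apply: filterS (sqT_ae n) => y y0; rewrite /f RintegralZl//; last exact: gi.
    by rewrite gammaE// -/G; ring.
rewrite E1 (@Rfubini _ _ _ T R (lam n.+1) leb f mf fin).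
pose g (z : n.+1.-tuple T) (s : R) := (cos (dotT x z) * expR (- (sqT z) ^+ 2)) *
  (powp (- p - 1) s * expR (- (sqT z / (4 * s)))).
have mg : measurable_fun setT (fun z => g z.1 z.2).
  rewrite (_ : (fun z => _) = fun z => (cos (dotT x z.1) * expR (- (sqT z.1) ^+ 2)) *
    (powp (- p - 1) z.2 * expR (- (sqT z.1 * (4^-1 * powp (-1) z.2))))).
    apply: measurable_funM; first by mfun.
    apply: measurable_funM; first by apply: (measurableT_comp (@measurable_powp _ _)); mfun.
    mfun; apply: (measurableT_comp (@measurable_powp _ _)); mfun.
  apply/funext => z; rewrite /g /powp; case: ifP => x0; last by rewrite !mul0r.
  by rewrite powR_inv1 ?(ltW x0)// invfM.
have hi (z : n.+1.-tuple T) : 0 < sqT z -> leb.-integrable setT (fun s => (powp (- p - 1) s * expR (- (sqT z / (4 * s))))%:E).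
  move=> z0; have z4 : 0 < sqT z / 4 by lra.
  have := integrable_invgamma p0 z4; apply: eq_integrable => // s _.
  by rewrite invfM mulrA.
have IF := integrable_riesz_ft x b0.
have FE (z : n.+1.-tuple T) : cos (dotT x z) * riesz_weight b z = cos (dotT x z) * expR (- (sqT z) ^+ 2) * powp (- p) (sqT z).
  by rewrite /riesz_weight (_ : (b - N) / 2 = - p); [ring|rewrite /p; ring].
have fing : (\int[lam n.+1]_y \int[leb]_s `|g y s|%:E < +oo)%E.
  apply: (@iter_dom_ae _ _ _ T R (lam n.+1) leb g (fun y => `|cos (dotT x y) * riesz_weight b y| * G') mg).
    have I := @integrable_norm _ _ _ _ _ _ IF.
    have := integrableZr measurableT G' I.
    by apply: eq_integrable => // y _; rewrite /= EFinM.
  apply: filterS (sqT_ae n) => y y0; split.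
    have := integrableZl measurableT (cos (dotT x y) * expR (- (sqT y) ^+ 2)) (hi y y0).
    by apply: eq_integrable => // s _; rewrite /= EFinM.
  rewrite (_ : \int[leb]_s `|g y s| = `|cos (dotT x y) * expR (- (sqT y) ^+ 2)| *
      \int[leb]_s (powp (- p - 1) s * expR (- (sqT y / (4 * s))))).
    by rewrite invgammaE// FE [in leRHS]normrM (ger0_norm (powp_ge0 _ _)) -mulrA.
  rewrite -RintegralZl//; last exact: hi.
  by apply: eq_Rintegral => s _; rewrite /g normrM [X in _ * X]ger0_norm// mulr_ge0 ?powp_ge0 ?expR_ge0.
transitivity (\int[leb]_s (G1 * \int[lam n.+1]_z g z s)).
  apply: eq_Rintegral => s _; rewrite /f /g /powp; have [s0|s0] := ltP 0 s; last first.
    under eq_Rintegral do rewrite mul0r mulr0.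
    under [in RHS]eq_Rintegral do rewrite mul0r mulr0.
    by rewrite /Rintegral !integral0 mulr0.
  transitivity (s `^ (b / 2 - 1) * \int[lam n.+1]_y (heat1 (subT x y) * expR (- (s * sqT y)))).
    rewrite -RintegralZl//; first by apply: eq_Rintegral => y _; ring.
    have [A A0 hA] := @heat1_bound R n.
    apply: (@integrable_dom _ _ _ _ _ (fun y => A * expR (- (s * sqT y)))).
    - apply: measurable_funM; last by mfun.
      by apply: (measurableT_comp (@measurable_heat1 R n)); exact: measurable_affT.
    - have := integrableZl measurableT A (integrable_gaussN n.+1 s0).
      by apply: eq_integrable => // y _; rewrite /= EFinM.
    - move=> y; rewrite normrM (ger0_norm (expR_ge0 _)) ler_wpM2r ?expR_ge0//.
      by rewrite (le_trans (hA _))// ler_piMr// exprn_ile1 ?decayT_ge0 ?decayT_le1.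
  rewrite gauss_conv// gaussN_scale// -/G1.
  have -> : \int[lam n.+1]_z (cos (dotT x z) * expR (- sqT z ^+ 2) *
      (s `^ (- p - 1) * expR (- (sqT z / (4 * s))))) = s `^ (- p - 1) *
      \int[lam n.+1]_y (cos (dotT x y) * (expR (- sqT y ^+ 2) * expR (- (sqT y / (4 * s))))).
    rewrite -RintegralZl//; first by apply: eq_Rintegral => y _; ring.
    apply: integrable_cos; first exact: measurable_dotT.
    apply: (@integrable_dom _ _ _ _ _ (fun y => expR (- (sqT y) ^+ 2))).
    - by mfun.
    - exact: integrable_quartic.
    - move=> y; rewrite ger0_norm ?mulr_ge0 ?expR_ge0// ler_piMr ?expR_ge0//.
      by rewrite -[leRHS]expR0 ler_expR oppr_le0 divr_ge0 ?sqT_ge0// mulr_ge0// ltW.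
  (* The Gaussian mass s^(-N/2) moves the mixing exponent from b/2 - 1 to -p - 1, the one of
     [invgammaE]. *)
  have -> : s `^ (- p - 1) = s `^ (b / 2 - 1) * s `^ (- (N / 2)).
    by rewrite -powRDp//; congr (_ `^ _); rewrite /p; ring.
  by ring.
have mgi : leb.-integrable setT (EFin \o (fun s => \int[lam n.+1]_z g z s)).
  apply: (@Rintegral_fubini_integrable _ _ T _ R leb (lam n.+1) (fun s z => g z s)).
    exact: (measurableT_comp mg (@measurable_swap _ _ T (n.+1.-tuple T))).
  rewrite (@tonelli_swap _ _ T _ R leb (lam n.+1) (fun s z => `|g z s|%:E)%E)//.
  apply/measurable_EFinP; apply: measurableT_comp => //.
  exact: (measurableT_comp mg (@measurable_swap _ _ T (n.+1.-tuple T))).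
rewrite RintegralZl// -mulrA; congr (_ * _); rewrite -(@Rfubini _ _ _ T R (lam n.+1) leb g mg fing).
rewrite -(RintegralZl _ measurableT (integrable_riesz_ft x b0)); apply: (@ae_eq_Rintegral _ _ R (lam n.+1)).
- exact: (@measurable_Rintegral_snd _ _ _ T R leb g mg).
- apply: measurable_funM => //; apply: measurable_funM; last exact: measurable_riesz_weight.
  by mfun.
- apply: filterS (sqT_ae n) => y y0; rewrite /g RintegralZl//; last exact: hi.
  by rewrite invgammaE// -/G' FE; ring.
Qed.

End riesz_transform.

(** * Behaviour at infinity and dependence on the exponent *)

Section norm.
Context {R : realType}.
Notation T := (measurableTypeR R).

(** Cauchy-Schwarz, from 2 u v <= k u^2 + v^2 / k in each coordinate with the optimal k = |y| /
    |x|. *)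
Lemma dotT_le n (x y : n.-tuple T) : dotT x y <= normT x * normT y.
Proof.
have [x0|x0] := eqVneq (normT x) 0.
  by rewrite x0 mul0r sqT_eq0// -normT_sqr x0 expr0n.
have [y0|y0] := eqVneq (normT y) 0.
  by rewrite y0 mulr0 dotTC sqT_eq0// -normT_sqr y0 expr0n.
have xp : 0 < normT x by rewrite lt_neqAle eq_sym x0 normT_ge0.
have yp : 0 < normT y by rewrite lt_neqAle eq_sym y0 normT_ge0.
pose k := normT y / normT x; have k0 : 0 < k by rewrite divr_gt0.
have h : 2 * dotT x y <= k * sqT x + k^-1 * sqT y.
  rewrite /dotT /sqT !mulr_sumr -big_split/=; apply: ler_sum => i _.
  have := sqr_ge0 (k * (tnth x i : R) - tnth y i) => h.
  rewrite -(ler_pM2l k0) (_ : k * (_ + _) = k ^+ 2 * (tnth x i : R) ^+ 2 + (tnth y i : R) ^+ 2).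
    by nra.
  by field; rewrite gt_eqF.
have e : k * sqT x + k^-1 * sqT y = 2 * (normT x * normT y).
  by rewrite -!normT_sqr /k; field; rewrite x0 y0.
by rewrite e in h; lra.
Qed.

Lemma normT_triangle n (x y : n.-tuple T) : `|normT x - normT y| <= normT (subT x y).
Proof.
have E : sqT (subT x y) = sqT x - 2 * dotT x y + sqT y.
  rewrite /sqT /dotT mulr_sumr -sumrB -big_split/=; apply: eq_bigr => i _.
  by rewrite tnth_mktuple; ring.
rewrite -(@ler_pXn2r _ 2)// ?nnegrE ?normT_ge0// real_normK ?num_real//.
rewrite normT_sqr E -!normT_sqr; have := dotT_le x y; nra.
Qed.

Lemma normT_gt0 n (x : n.-tuple T) : 0 < sqT x -> 0 < normT x.
Proof. by rewrite sqrtr_gt0. Qed.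

Lemma sqT_powR n (x : n.-tuple T) (p : R) : sqT x `^ (p / 2) = normT x `^ p.
Proof.
by rewrite -normT_sqr -powR_mulrn ?normT_ge0// -powRrM; congr (_ `^ _); field.
Qed.

(** For q >= 1 both r^b and 1 are O(q^b). For q < 1, |r^b - 1| <= |r^k - 1| = O(q), and q <=
    q^(1/2). The small exponent 1/2 matters because q will be |x - y| / |y|, and |y|^(-1/2) is
    integrable near 0 in every dimension. *)
Lemma powR_ratio (k : nat) (b r q : R) : 0 < b -> b <= k%:R -> 0 <= r -> 0 <= q ->
  `|r - 1| <= q -> `|r `^ b - 1| <= 2 ^+ k.+1 * (q `^ 2^-1 + q `^ b).
Proof.
move=> b0 bk r0 q0 rq.
have rb0 := powR_ge0 r b.
have k2 : (0 : R) < 2 ^+ k by rewrite exprn_gt0.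
have qh := powR_ge0 q 2^-1; have qb := powR_ge0 q b.
have [q1|q1] := leP 1 q.
  have r2 : r <= 2 * q by move: rq; rewrite ler_norml => /andP[_]; lra.
  have h1 : r `^ b <= 2 ^+ k * q `^ b.
    apply: (@le_trans _ _ ((2 * q) `^ b)).
      by rewrite ge0_ler_powR ?nnegrE ?(ltW b0)// mulr_ge0.
    rewrite powRM// ler_wpM2r// -powR_mulrn// ler_powR//; lra.
  have h2 : 1 <= q `^ b by have := ler_powR q1 (ltW b0); rewrite powRr0.
  have k1 : (1 : R) <= 2 ^+ k by rewrite exprn_ege1//; lra.
  have h3 : 1 <= 2 ^+ k * q `^ b by nra.
  rewrite exprS ler_norml; apply/andP; split; nra.
have r2 : r <= 2 by move: rq; rewrite ler_norml => /andP[_]; lra.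
have rp : 0 < r by move: rq; rewrite ler_norml => /andP[]; lra.
have hk j : `|r ^+ j - 1| <= (2 ^+ j - 1) * q.
  elim: j => [|j IH]; first by rewrite !expr0 !subrr normr0 mul0r.
  have -> : r ^+ j.+1 - 1 = r * (r ^+ j - 1) + (r - 1) by rewrite exprS; ring.
  rewrite (le_trans (ler_normD _ _))// exprS normrM (ger0_norm r0).
  have h0 := normr_ge0 (r ^+ j - 1).
  have : r * `|r ^+ j - 1| <= 2 * ((2 ^+ j - 1) * q) by rewrite ler_pM.
  by move: rq; lra.
have h1 : `|r `^ b - 1| <= `|r ^+ k - 1|.
  rewrite -powR_mulrn//; have [r1|r1] := leP 1 r.
    have h2 : r `^ b <= r `^ k%:R by apply: ler_powR.
    have h3 : 1 <= r `^ b by have := ler_powR r1 (ltW b0); rewrite powRr0.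
    by rewrite !ger0_norm; lra.
  have rl : 0 < r <= 1 by rewrite rp ltW.
  have h2 : r `^ k%:R <= r `^ b by apply: ger_powR.
  have h3 : r `^ b <= 1 by have := ger_powR rl (ltW b0); rewrite powRr0.
  by rewrite !ler0_norm; lra.
apply: (le_trans h1); apply: (le_trans (hk k)).
have h2 : q <= q `^ 2^-1.
  have [->|qn] := eqVneq q 0; first by rewrite powR_ge0.
  have qp : 0 < q by rewrite lt_neqAle eq_sym qn.
  have ql : 0 < q <= 1 by rewrite qp ltW.
  by rewrite -[leLHS]powRr1//; apply: ger_powR => //; lra.
rewrite exprS; nra.
Qed.

End norm.

Section estimates.
Context {R : realType} (n : nat).
Notation leb := (@lebesgue_measure R).
Notation T := (measurableTypeR R).
Notation lam n := (lebesgue_tuple R n).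
Notation N := (n.+1%:R : R).

Let N1 : (-1 != 0 :> R). Proof. by rewrite oppr_eq0 oner_eq0. Qed.

Lemma integrable_w2 (g b : R) (x : n.+1.-tuple T) : 0 <= g -> g <= b -> b < N ->
  (lam n.+1).-integrable setT (EFin \o (fun y => decayT (subT x y) ^+ 2 * powp (- (g / 2)) (sqT y))).
Proof.
move=> g0 gb bN; have gN : g < N by lra.
apply: (integrable_dom _ (integrable_decayT_powp1 x g0 gN)).
  apply: measurable_funM.
    by apply: measurable_funX; apply: (measurableT_comp (@measurable_decayT _ _)); exact: measurable_affT.
  by apply: (measurableT_comp (@measurable_powp _ _)); exact: measurable_sqT.
move=> y; rewrite ger0_norm; last by rewrite mulr_ge0 ?powp_ge0// exprn_ge0// decayT_ge0.
by rewrite ler_wpM2r ?powp_ge0//; have [] := decayT3 (subT x y).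
Qed.

Lemma riesz_heat1_bound (b : R) : 0 < b -> b < N -> exists2 C : R, 0 <= C &
  forall x : n.+1.-tuple T, (1 + sqT x `^ (b / 2)) * `|riesz_heat1 b x| <= C.
Proof.
move=> b0 bN; have [A A0 hA] := @heat1_bound R n.
have [C C0 hC] := riesz_bound_decay bN.
exists (A * C); first by rewrite mulr_ge0.
move=> x; have I2 := integrable_w2 x (ltW b0) (lexx b) bN.
have p0 : 0 <= 1 + sqT x `^ (b / 2) by rewrite addr_ge0 ?powR_ge0.
apply: (@le_trans _ _ ((1 + sqT x `^ (b / 2)) * (A * \int[lam n.+1]_y (decayT (subT x y) ^+ 2 * powp (- (b / 2)) (sqT y))))); last first.
  by rewrite mulrCA ler_wpM2l// hC// ltW.
rewrite ler_wpM2l// -RintegralZl//; apply: Rintegral_bound.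
- exact: measurable_heat1_powp.
- have := integrableZl measurableT A I2.
  by apply: eq_integrable => // y _; rewrite /= EFinM.
- move=> y; rewrite normrM (ger0_norm (powp_ge0 _ _)) mulrA ler_wpM2r ?powp_ge0//.
  rewrite (le_trans (hA _))// ler_wpM2l//; by have [] := decayT3 (subT x y).
Qed.

(** The limit of |x|^b U(x) at infinity, as [riesz_heat1_asympt] shows. *)
Definition kappa : R := \int[lam n.+1]_y heat1 (y : n.+1.-tuple T).

Lemma integrable_heat1 : (lam n.+1).-integrable setT (EFin \o (@heat1 R n)).
Proof.
have [A A0 hA] := @heat1_bound R n.
apply: (@integrable_dom _ _ _ _ _ (fun y => A * decayT y)).
- exact: measurable_heat1.
- have := integrableZl measurableT A (integrable_decayT n).
  by apply: eq_integrable => // y _; rewrite /= EFinM.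
- move=> y; rewrite (le_trans (hA _))// ler_wpM2l//.
  by have [h1 h2] := decayT3 y; exact: le_trans h1 h2.
Qed.

Lemma kappaE (x : n.+1.-tuple T) : kappa = \int[lam n.+1]_y heat1 (subT x y).
Proof. by rewrite Rintegral_affT ?normrN1 ?expr1n ?invr1 ?mul1r//; exact: measurable_heat1. Qed.

Lemma integrable_quartic_gaussN (s : R) : 0 <= s ->
  (lam n.+1).-integrable setT (EFin \o (fun y => expR (- (s * (sqT y) ^+ 2)) * expR (- (4^-1 * sqT y)))).
Proof.
have i4 : 0 < 4^-1 :> R by rewrite invr_gt0.
move=> s0; apply: (@integrable_dom _ _ _ _ _ (fun y => expR (- (4^-1 * sqT y)))).
- by mfun.
- exact: integrable_gaussN.
- move=> y; rewrite ger0_norm ?mulr_ge0 ?expR_ge0// ler_piMl ?expR_ge0//.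
  by rewrite -[leRHS]expR0 ler_expR oppr_le0; apply: mulr_ge0 => //; exact: sqr_ge0.
Qed.

(** The kernel is integrated against exp(-s |y|^2) with s tending to 0. By [gauss_conv] each such
    integral is an integral of positive functions, bounded below by G1 J uniformly in s <= 1. *)
Lemma kappa_gt0 : 0 < kappa.
Proof.
pose G1 := \int[lam n.+1]_y expR (- (1 * sqT y)).
pose J := \int[lam n.+1]_y (expR (- (sqT y) ^+ 2) * expR (- (4^-1 * sqT y))).
have i4 : 0 < 4^-1 :> R by rewrite invr_gt0.
have J0 : 0 < J.
  apply: (Rintegral_gt0 (D := setT)) => //.
  - have := integrable_quartic_gaussN ler01; apply: eq_integrable => // y _; by rewrite /= mul1r.
  - exact: lam_setT_gt0.
  - by move=> y _; rewrite mulr_gt0 ?expR_gt0.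
have G10 : 0 < G1 by exact: gaussN_gt0.
suff h : G1 * J <= kappa by rewrite (lt_le_trans _ h)// mulr_gt0.
have C : \int[lam n.+1]_y (heat1 (subT (zT n.+1) y) * expR (- (k.+1%:R^-1 * sqT y))) @[k --> \oo] --> kappa.
  rewrite (kappaE (zT _)); apply: (@Rdct _ _ _ _ _ _ (fun y => `|heat1 (subT (zT n.+1) y)|)).
  - move=> k; apply: measurable_funM; last by mfun.
    by apply: (measurableT_comp (@measurable_heat1 _ _)); exact: measurable_affT.
  - move=> y; rewrite [X in _ --> X](_ : _ = heat1 (subT (zT n.+1) y) * expR 0); last by rewrite expR0 mulr1.
    apply: cvgM; first exact: cvg_cst.
    apply: (@continuous_cvg _ _ _ _ _ _ expR); first exact: continuous_expR.
    rewrite -oppr0 -(mul0r (sqT y)); apply: cvgN; apply: cvgM; last exact: cvg_cst.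
    exact: cvg_harmonic.
  - by apply: integrable_norm; exact: (integrable_affT (zT n.+1) N1 integrable_heat1).
  - move=> k y; rewrite normrM ler_piMr// ger0_norm ?expR_ge0//.
    by rewrite -[leRHS]expR0 ler_expR oppr_le0 mulr_ge0 ?sqT_ge0.
apply: (@ler_cvg_to _ _ _ _ (fun=> G1 * J) _ _ _ (cvg_cst _) C).
apply: nearW => k; set s := k.+1%:R^-1.
have s0 : 0 < s by rewrite invr_gt0.
have s1 : s <= 1 by rewrite invf_le1// ler1n.
rewrite gauss_conv// gaussN_scale// -/G1.
have sq0 : 0 < Num.sqrt s by rewrite sqrtr_gt0.
rewrite [X in _ <= _ * X](_ : _ = \int[lam n.+1]_y (expR (- (sqT y) ^+ 2) * expR (- (sqT y / (4 * s))))); last first.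
  apply: eq_Rintegral => y _; rewrite (_ : dotT _ _ = 0) ?cos0 ?mul1r//.
  by rewrite sqT_eq0// /sqT big1// => i _; rewrite tnth_mktuple expr0n.
(* Scaling y by sqrt s cancels s^(-N/2) and leaves exp(-s^2 |y|^4 - |y|^2/4), which for s <= 1
   dominates the integrand of J. *)
rewrite [X in _ <= _ * X](Rintegral_dil sq0); last by mfun.
rewrite sqrt_exprn ?(ltW s0)// powRN mulrACA -mulrA.
rewrite mulrCA mulrA -[X in X <= _]mul1r mulrA.
have sp : 0 < s `^ (N / 2) by rewrite powR_gt0.
rewrite mulrA [X in _ <= X * _](_ : _ = G1); last by field; rewrite gt_eqF.
rewrite mul1r ler_wpM2l ?(ltW G10)//; apply: le_Rintegral => //.
- have := integrable_quartic_gaussN ler01; apply: eq_integrable => // y _; by rewrite /= mul1r.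
- have := integrable_quartic_gaussN (sqr_ge0 s); apply: eq_integrable => // y _; rewrite /= sqT_dil sqr_sqrtr ?(ltW s0)//.
  by congr (expR _ * expR _)%:E; [ring|field; rewrite gt_eqF].
- move=> y _; rewrite sqT_dil sqr_sqrtr ?(ltW s0)// ler_pM ?expR_ge0// ler_expR lerN2.
    rewrite exprMn ler_piMl ?sqr_ge0// expr_le1// ltW//.
  by rewrite le_eqVlt; apply/orP; left; apply/eqP; field; rewrite gt_eqF.
Qed.

Lemma decayT_powR (g s : R) (y : n.+1.-tuple T) : 0 <= g -> g <= N -> sqT y = s ->
  decayT y * s `^ (g / 2) <= 1.
Proof.
move=> g0 gN sE; have s0 : 0 <= s by rewrite -sE sqT_ge0.
rewrite /decayT sE mulrC ler_pdivrMr ?mul1r; last by rewrite exprn_gt0//; lra.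
rewrite -powR_mulrn; last by lra.
apply: (@le_trans _ _ ((1 + s) `^ (g / 2))).
  by rewrite ge0_ler_powR ?nnegrE//; lra.
by rewrite ler_powR//; lra.
Qed.

(** The left side is the kernel at x - y times (|x|/|y|)^b - 1, in absolute value. [powR_ratio]
    applies with q = |x - y| / |y|, and one factor [decayT] absorbs the powers of |x - y|. *)
Lemma heat1_ratio_bound : exists2 D : R, 0 <= D &
  forall b (x y : n.+1.-tuple T), 0 < b -> b < N -> 0 < sqT x -> 0 < sqT y ->
  `|sqT x `^ (b / 2) * (heat1 (subT x y) * powp (- (b / 2)) (sqT y)) - heat1 (subT x y)| <=
  D * (decayT (subT x y) ^+ 2 * powp (- (2^-1 / 2)) (sqT y)) +
  D * (decayT (subT x y) ^+ 2 * powp (- (b / 2)) (sqT y)).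
Proof.
have [A A0 hA] := @heat1_bound R n.
have [D DE D0] : exists2 D : R, D = A * 2 ^+ n.+2 & 0 <= D.
  by exists (A * 2 ^+ n.+2) => //; apply: mulr_ge0 => //; exact: exprn_ge0.
exists D => // b x y b0 bN x0 y0; have {hA} := hA (subT x y).
set w := decayT (subT x y); set K := heat1 _ => hA.
have -> : sqT x `^ (b / 2) * (K * powp (- (b / 2)) (sqT y)) - K =
    K * (sqT x `^ (b / 2) * powp (- (b / 2)) (sqT y) - 1) by ring.
have yp := normT_gt0 y0; have xp := normT_gt0 x0.
have q0 : 0 <= normT (subT x y) / normT y by rewrite divr_ge0 ?normT_ge0.
have r0 : 0 <= normT x / normT y by rewrite divr_ge0 ?normT_ge0.
have rq : `|normT x / normT y - 1| <= normT (subT x y) / normT y.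
  rewrite -{1}(mulfV (x := normT y)) ?gt_eqF// -mulrBl normrM [X in _ * X]ger0_norm ?invr_ge0 ?(ltW yp)//.
  by rewrite ler_wpM2r ?invr_ge0 ?(ltW yp)// normT_triangle.
have := powR_ratio b0 (ltW bN) r0 q0 rq.
have conv (p : R) (z : n.+1.-tuple T) : (normT z / normT y) `^ p = sqT z `^ (p / 2) * powp (- (p / 2)) (sqT y).
  rewrite powRM ?normT_ge0 ?invr_ge0 ?normT_ge0// powRV ?normT_ge0// sqT_powR powpE//.
  by rewrite -mulNr sqT_powR.
rewrite !conv => hr.
rewrite normrM (le_trans (ler_pM (normr_ge0 _) (normr_ge0 _) hA hr))//.
have w0 : 0 <= w by exact: decayT_ge0.
have h2 : 2^-1 <= N by rewrite (@le_trans _ _ 1)// ?ler1n// invf_le1// ler1n.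
have e1 : w * sqT (subT x y) `^ (2^-1 / 2) <= 1 by apply: decayT_powR.
have e2 : w * sqT (subT x y) `^ (b / 2) <= 1 by apply: decayT_powR => //; exact: ltW.
set X := _ `^ (2^-1 / 2) in e1 *; set Y := sqT (subT x y) `^ (b / 2) in e2 *.
set P := powp _ _; set Q := powp _ _.
have P0 : 0 <= P by exact: powp_ge0.
have Q0 : 0 <= Q by exact: powp_ge0.
rewrite [X in X <= _](_ : _ = D * ((w * X) * (w ^+ 2 * P) + (w * Y) * (w ^+ 2 * Q))); last by rewrite DE; ring.
rewrite mulrDr; apply: lerD; apply: ler_wpM2l => //; rewrite ler_piMl//; apply: mulr_ge0 => //;
  exact: exprn_ge0.
Qed.

(** Integrates [heat1_ratio_bound]; by [riesz_bound_decay] its two terms decay like |x|^(-1/2) and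
    |x|^(-b), with a constant uniform in b <= b1. *)
Lemma riesz_heat1_asympt (b1 : R) : b1 < N -> exists2 C : R, 0 <= C &
  forall b (x : n.+1.-tuple T), 0 < b -> b <= b1 -> 2^-1 <= b1 -> 0 < sqT x ->
   `|sqT x `^ (b / 2) * riesz_heat1 b x - kappa| <=
     C * ((1 + sqT x `^ (2^-1 / 2))^-1 + (1 + sqT x `^ (b / 2))^-1).
Proof.
move=> b1N; have [D D0 hD] := heat1_ratio_bound.
have [C C0 hC] := riesz_bound_decay b1N.
exists (D * C); first by rewrite mulr_ge0.
move=> b x b0 bb1 hb1 x0; have bN := le_lt_trans bb1 b1N.
have h0 : 0 <= 2^-1 :> R by rewrite invr_ge0.
have hDp := conj I (fun y => hD b x y b0 bN x0); clear hD.
have hC1 := hC _ x h0 hb1; have hC2 := hC _ x (ltW b0) bb1; move: hC1 hC2 => {hC}.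
have Ih := integrable_w2 x h0 hb1 b1N.
have Ib := integrable_w2 x (ltW b0) bb1 b1N.
set f1 := fun y : n.+1.-tuple T => decayT (subT x y) ^+ 2 * powp (- (2^-1 / 2)) (sqT y) in Ih *.
set f2 := fun y : n.+1.-tuple T => decayT (subT x y) ^+ 2 * powp (- (b / 2)) (sqT y) in Ib *.
set J1 := (\int[_]_ _ _); set J2 := (\int[_]_ _ _) => hC1 hC2.
have Ih' : (lam n.+1).-integrable setT (EFin \o (fun y => D * f1 y)).
  by have := integrableZl measurableT D Ih; apply: eq_integrable => // y _; rewrite /= EFinM.
have Ib' : (lam n.+1).-integrable setT (EFin \o (fun y => D * f2 y)).
  by have := integrableZl measurableT D Ib; apply: eq_integrable => // y _; rewrite /= EFinM.
have Iw : (lam n.+1).-integrable setT (EFin \o (fun y => D * f1 y + D * f2 y)).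
  by have := integrableD measurableT Ih' Ib'; apply: eq_integrable => // y _; rewrite /= EFinD.
have Ew : \int[lam n.+1]_y (D * f1 y + D * f2 y) <=
    D * C * ((1 + sqT x `^ (2^-1 / 2))^-1 + (1 + sqT x `^ (b / 2))^-1).
  rewrite (RintegralD measurableT Ih' Ib') (RintegralZl D measurableT Ih) (RintegralZl D measurableT Ib).
  have h (z J : R) : 0 <= z -> (1 + z) * J <= C -> D * J <= D * C * (1 + z)^-1.
    move=> z0 zJ; rewrite -mulrA; apply: ler_wpM2l => //; rewrite ler_pdivlMr; last by lra.
    by rewrite mulrC.
  rewrite mulrDr; exact: (lerD (h _ _ (powR_ge0 _ _) hC1) (h _ _ (powR_ge0 _ _) hC2)).
clear hC1 hC2; set W := _ * (_ + _) in Ew *; apply: le_trans Ew => {W}.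
have IU := integrable_riesz_heat1 x (ltW b0) bN.
pose F (y : n.+1.-tuple T) : R := sqT x `^ (b / 2) * (heat1 (subT x y) * powp (- (b / 2)) (sqT y)) - heat1 (subT x y).
have mF : measurable_fun setT F.
  apply: measurable_funB; first by apply: measurable_funM => //; exact: measurable_heat1_powp.
  by apply: (measurableT_comp (@measurable_heat1 _ _)); exact: measurable_affT.
(* The bound fails only on the null set y = 0, where powp takes the value 0. *)
pose F' (y : n.+1.-tuple T) : R := if 0 < sqT y then F y else 0.
have mF' : measurable_fun setT F'.
  apply: measurable_fun_ifT => //; apply: measurable_fun_ltr => //; exact: measurable_sqT.
have -> : sqT x `^ (b / 2) * riesz_heat1 b x - kappa = \int[lam n.+1]_y F' y.
  transitivity (\int[lam n.+1]_y F y).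
    rewrite (kappaE x) -(RintegralZl _ measurableT IU) -RintegralB//; last exact: (integrable_affT x N1 integrable_heat1).
    have := integrableZl measurableT (sqT x `^ (b / 2)) IU.
    by apply: eq_integrable => // y _; rewrite /= EFinM.
  apply: (ae_eq_Rintegral mF mF').
  by apply: filterS (sqT_ae n) => y y0; rewrite /F' y0.
apply: (Rintegral_bound mF' Iw) => y; rewrite /F'; case: ifPn => y0; first exact: (hDp.2 y).
rewrite normr0; apply: addr_ge0; apply: mulr_ge0 => //; apply: mulr_ge0; rewrite ?powp_ge0//;
  by apply: exprn_ge0; exact: decayT_ge0.
Qed.

Lemma riesz_heat1_far (b0 b1 : R) : 0 < b0 -> b1 < N -> exists2 X0 : R, 1 <= X0 &
  forall b (x : n.+1.-tuple T), b0 <= b -> b <= b1 -> X0 <= sqT x ->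
    kappa / 2 <= sqT x `^ (b / 2) * riesz_heat1 b x.
Proof.
(* The exponent 1/2 of the error term must lie below the upper bound as well. *)
move=> b00 b1N; pose b1' := Num.max b1 2^-1.
have b1'N : b1' < N.
  by rewrite /b1' gt_max b1N/= (@lt_le_trans _ _ 1)// ?ler1n// invf_lt1// ltr1n.
have [C C0 hC] := riesz_heat1_asympt b1'N.
have k0 := kappa_gt0.
(* Once |x|^(1/2) and |x|^b0 both reach M, the error is at most 2 C / M <= kappa / 2. The radius
   below is squared, whence M^4 and M^(2/b0). *)
pose M := Num.max 1 (4 * C / kappa).
have M1 : 1 <= M by rewrite le_max lexx.
have M0 : 0 < M by lra.
have MC : 4 * C <= kappa * M.
  rewrite -ler_pdivrMl//; rewrite mulrC /M le_max lexx orbT//.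
exists (Num.max (M `^ 4) (M `^ (2 / b0))).
  rewrite le_max; apply/orP; left.
  by have := ler_powR M1 (ler0n R 4); rewrite powRr0.
move=> b x bb0 bb1; rewrite ge_max => /andP[x1 x2].
have bp : 0 < b by lra.
have x0 : 0 < sqT x by apply: lt_le_trans x1; rewrite powR_gt0.
have s1 : 1 <= sqT x.
  by apply: le_trans x1; have := ler_powR M1 (ler0n R 4); rewrite powRr0.
have h1 : M <= sqT x `^ (2^-1 / 2).
  apply: (@le_trans _ _ ((M `^ 4) `^ (2^-1 / 2))).
    by rewrite -powRrM (_ : 4 * (2^-1 / 2) = 1) ?powRr1//; [lra|field].
  by rewrite ge0_ler_powR ?nnegrE ?powR_ge0 ?sqT_ge0//; lra.
have h2 : M <= sqT x `^ (b / 2).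
  apply: (@le_trans _ _ (sqT x `^ (b0 / 2))); last by rewrite ler_powR//; lra.
  apply: (@le_trans _ _ ((M `^ (2 / b0)) `^ (b0 / 2))).
    by rewrite -powRrM (_ : 2 / b0 * (b0 / 2) = 1) ?powRr1//; [lra|field; rewrite gt_eqF].
  by rewrite ge0_ler_powR ?nnegrE ?powR_ge0 ?sqT_ge0//; lra.
have bb1' : b <= b1' by rewrite /b1' le_max bb1.
have hb1' : 2^-1 <= b1' by rewrite /b1' le_max lexx orbT.
have := hC b x bp bb1' hb1' x0.
have inv (z : R) : M <= z -> (1 + z)^-1 <= M^-1.
  by move=> Mz; rewrite lef_pV2 ?posrE; lra.
have h3 : C * ((1 + sqT x `^ (2^-1 / 2))^-1 + (1 + sqT x `^ (b / 2))^-1) <= kappa / 2.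
  apply: (@le_trans _ _ (C * (M^-1 + M^-1))).
    by rewrite ler_wpM2l// lerD// inv.
  have -> : C * (M^-1 + M^-1) = (4 * C) / (2 * M) by field; rewrite gt_eqF.
  by rewrite ler_pdivrMr; [lra|lra].
by rewrite ler_norml => /andP[+ _]; lra.
Qed.

Definition riesz_ft_axis (b r : R) : R :=
  \int[lam n.+1]_y (cos (r * (thead (y : n.+1.-tuple T) : R)) * riesz_weight b y).

Lemma riesz_ftE b (x : n.+1.-tuple T) : riesz_ft b x = riesz_ft_axis b (normT x).
Proof.
rewrite /riesz_ft /riesz_weight (Rintegral_rot x (f := fun z => cos z.1 * (powp ((b - N) / 2) z.2 * expR (- z.2 ^+ 2))))//.
by mfun; apply: (measurableT_comp (@measurable_powp _ _)); mfun.
Qed.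

Lemma integrable_riesz_ft_axis b r : 0 < b ->
  (lam n.+1).-integrable setT (EFin \o (fun y : n.+1.-tuple T => cos (r * (thead y : R)) * riesz_weight b y)).
Proof.
move=> b0; apply: integrable_cos; last exact: integrable_riesz_weight.
by apply: measurable_funM => //; exact: measurable_thead.
Qed.

Lemma continuous_riesz_ft_axis b : 0 < b -> continuous (riesz_ft_axis b).
Proof.
move=> b0 r.
have I : r \in `]r - 1, r + 1[%classic by rewrite inE/= in_itv/=; lra.
have := @continuity_under_integral R _ _ (lam n.+1) (fun r (y : n.+1.-tuple T) => cos (r * (thead y : R)) * riesz_weight b y)
  setT measurableT (r - 1) (r + 1) (fun x _ => integrable_riesz_ft_axis x b0) _ (@riesz_weight R n b) (@integrable_riesz_weight R n b b0) _ r I.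
apply.
- apply: aeW => y _ z _; apply: cvgM; last exact: cvg_cst.
  apply: (@continuous_comp _ _ _ (fun x : R => x * (thead y : R)) cos); last exact: continuous_cos.
  exact: mulrr_continuous.
- by move=> z _; apply: aeW => y _; rewrite normrM (ger0_norm (riesz_weight_ge0 _ _)) ler_piMl ?riesz_weight_ge0// normr_cos.
Qed.

Definition axisT (r : R) : n.+1.-tuple T := tuple_cons (r : T, zT n).

Lemma normT_axis r : 0 <= r -> normT (axisT r) = r.
Proof.
move=> r0; rewrite /normT sqT_cons (_ : sqT (zT n) = 0) ?addr0 ?sqrtr_sqr ?ger0_norm//.
by rewrite /sqT big1// => i _; rewrite tnth_mktuple expr0n.
Qed.

(** F is radial, so the ball reduces to a segment and the extreme value theorem on the line
    applies. *)
Lemma riesz_ft_axis_min b (X : R) : 0 < b -> 0 <= X -> (forall x : n.+1.-tuple T, 0 < riesz_ft b x) ->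
  exists2 m : R, 0 < m & forall x : n.+1.-tuple T, sqT x <= X -> m <= riesz_ft b x.
Proof.
move=> b0 X0 Fp.
have c : {within `[0, Num.sqrt X], continuous (riesz_ft_axis b)}.
  by apply: continuous_subspaceT; exact: continuous_riesz_ft_axis.
have [r r1 hr] := EVT_min (sqrtr_ge0 X) c.
exists (riesz_ft_axis b r).
  move: r1; rewrite in_itv/= => /andP[r0 _].
  by rewrite -(normT_axis r0) -riesz_ftE; exact: Fp.
move=> x xX; rewrite riesz_ftE; apply: hr; rewrite in_itv/= normT_ge0/= /normT ler_sqrt//.
Qed.

Lemma riesz_heat1_lower (b : R) : 0 < b -> b < N -> (forall x : n.+1.-tuple T, 0 < riesz_heat1 b x) ->
  exists2 c : R, 0 < c & forall x : n.+1.-tuple T, c <= (1 + sqT x `^ (b / 2)) * riesz_heat1 b x.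
Proof.
move=> b0 bN Up; have [C C0 hC] := @riesz_fourier R n b b0 bN.
have Fp (x : n.+1.-tuple T) : 0 < riesz_ft b x by have := Up x; rewrite hC pmulr_rgt0.
have [X0 X1 hX] := @riesz_heat1_far b b b0 bN.
have [m m0 hm] := @riesz_ft_axis_min b X0 b0 (le_trans ler01 X1) Fp.
exists (Num.min (kappa / 2) (C * m)).
  by rewrite lt_min divr_gt0 ?kappa_gt0//= mulr_gt0.
move=> x; have p0 := powR_ge0 (sqT x) (b / 2).
have [xX|xX] := leP X0 (sqT x).
  have := hX b x (lexx _) (lexx _) xX; rewrite ge_min => h; apply/orP; left.
  by have := Up x; nra.
rewrite ge_min; apply/orP; right.
apply: (@le_trans _ _ (riesz_heat1 b x)).
  by rewrite hC ler_pM2l// hm// ltW.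
by have := Up x; nra.
Qed.

(** Without the common factor the claim is |q^(h/2) - 1| <= h ((2/b0) q^(-b0/4) + q). For q >= 1 it
    follows from ln q <= 2 sqrt q and q^(h/2) <= sqrt q, for q < 1 from -ln q <= (4/b0) q^(-b0/4).
    The shifted exponents b0/2 and b0 + 2 are positive, so the right side is integrable. *)
Lemma riesz_weight_diff (b0 h : R) (y : n.+1.-tuple T) : 0 < b0 -> 0 <= h -> h <= 1 ->
  `|riesz_weight (b0 + h) y - riesz_weight b0 y| <= h * ((2 / b0) * riesz_weight (b0 / 2) y + riesz_weight (b0 + 2) y).
Proof.
move=> b00 h0 h1; rewrite /riesz_weight; set q := sqT y.
have [q0|q0] := leP q 0; first by rewrite !powp_le0// !mul0r subrr normr0 mulr0 addr0 mulr0.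
have e1 : powp ((b0 + h - N) / 2) q = powp ((b0 - N) / 2) q * q `^ (h / 2).
  by rewrite !powpE// -powRDp//; congr (_ `^ _); ring.
have e2 : powp ((b0 / 2 - N) / 2) q = powp ((b0 - N) / 2) q * q `^ (- (b0 / 4)).
  by rewrite !powpE// -powRDp//; congr (_ `^ _); field.
have e3 : powp ((b0 + 2 - N) / 2) q = powp ((b0 - N) / 2) q * q.
  by rewrite !powpE// -{3}(powRr1 (ltW q0)) -powRDp//; congr (_ `^ _); field.
rewrite e1 e2 e3; set P := powp _ _; have P0 : 0 <= P by exact: powp_ge0.
set E := expR _; have E0 : 0 <= E by exact: expR_ge0.
rewrite (_ : P * q `^ (h / 2) * E - P * E = P * E * (q `^ (h / 2) - 1)); last by ring.
rewrite normrM ger0_norm ?mulr_ge0//.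
rewrite [X in _ <= X](_ : _ = P * E * (h * (2 / b0 * q `^ (- (b0 / 4)) + q))); last by ring.
rewrite ler_wpM2l ?mulr_ge0//.
have qE : q `^ (h / 2) = expR (h / 2 * ln q) by rewrite /powR gt_eqF.
have [q1|q1] := leP 1 q.
  have l0 : 0 <= ln q by exact: ln_ge0.
  have s0 : 0 < Num.sqrt q by rewrite sqrtr_gt0.
  have lq : ln q <= 2 * Num.sqrt q.
    rewrite -{1}(sqr_sqrtr (ltW q0)) lnXn// -[_ *+ 2]mulr_natl ler_wpM2l//.
    by apply/ltW/ln_sublinear.
  have g1 : 1 <= q `^ (h / 2).
    have h2 : 0 <= h / 2 by lra.
    by have := ler_powR q1 h2; rewrite powRr0.
  have g2 : q `^ (h / 2) <= Num.sqrt q by rewrite -powR12_sqrt ?(ltW q0)//; apply: ler_powR => //; lra.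
  have g3 : q `^ (h / 2) - 1 <= h / 2 * ln q * q `^ (h / 2).
    have := expR_ge1Dx (- (h / 2 * ln q)); rewrite expRN -qE => g.
    have g4 : 0 < q `^ (h / 2) by lra.
    have : (1 - h / 2 * ln q) * q `^ (h / 2) <= 1.
      by rewrite -(ler_pdivlMr _ _ g4) mul1r; exact: g.
    by lra.
  rewrite ger0_norm; last by lra.
  apply: (le_trans g3); apply: (@le_trans _ _ (h * q)).
    have -> : h * q = h / 2 * (2 * Num.sqrt q) * Num.sqrt q.
      by rewrite -[in LHS](sqr_sqrtr (ltW q0)); field.
    apply: ler_pM => //; first by rewrite mulr_ge0//; lra.
      by lra.
    by rewrite ler_wpM2l//; lra.
  by rewrite ler_wpM2l// lerDr mulr_ge0 ?powR_ge0// divr_ge0// ltW.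
have ql : 0 < q <= 1 by rewrite q0 ltW.
have h2 : 0 <= h / 2 by lra.
have g1 : q `^ (h / 2) <= 1 by have := ger_powR ql h2; rewrite powRr0.
rewrite ler0_norm; last by lra.
have g2 := expR_ge1Dx (h / 2 * ln q); rewrite -qE in g2.
have pq : 0 < q `^ (- (b0 / 4)) by rewrite powR_gt0.
have := ltW (ln_sublinear pq); rewrite ln_powR => g3.
have g4 : - (h / 2 * ln q) <= h * (2 / b0 * q `^ (- (b0 / 4))).
  have -> : - (h / 2 * ln q) = h * (2 / b0 * (- (b0 / 4) * ln q)) by field; rewrite gt_eqF.
  by rewrite ler_wpM2l// ler_wpM2l// divr_ge0// ltW.
have g5 : 0 <= h * q by rewrite mulr_ge0// ltW.
rewrite mulrDr; lra.
Qed.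

(** Far out, [riesz_heat1_far] covers all b in [b0, b1] at once. On the remaining ball F for b0 has
    a lower bound m > 0, and passing to b changes F by at most (b - b0) D. *)
Lemma riesz_heat1_open (b0 : R) : 0 < b0 -> b0 < N -> (forall x : n.+1.-tuple T, 0 < riesz_heat1 b0 x) ->
  exists2 e : R, 0 < e & b0 + e < N /\ forall b (x : n.+1.-tuple T), b0 <= b -> b <= b0 + e -> 0 < riesz_heat1 b x.
Proof.
move=> b00 b0N Up; have [C C0 hC] := @riesz_fourier R n b0 b00 b0N.
have Fp (x : n.+1.-tuple T) : 0 < riesz_ft b0 x by have := Up x; rewrite hC pmulr_rgt0.
pose b1 := (b0 + N) / 2.
have b1N : b1 < N by rewrite /b1; lra.
have [X0 X1 hX] := @riesz_heat1_far b0 b1 b00 b1N.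
have [m m0 hm] := @riesz_ft_axis_min b0 X0 b00 (le_trans ler01 X1) Fp.
have b20 : 0 < b0 / 2 by lra.
have b22 : 0 < b0 + 2 by lra.
have I1 := @integrable_riesz_weight R n _ b20; have I2 := @integrable_riesz_weight R n _ b22.
have I3 : (lam n.+1).-integrable setT (EFin \o (fun y => 2 / b0 * riesz_weight (b0 / 2) y + riesz_weight (b0 + 2) y)).
  have := integrableD measurableT (integrableZl measurableT (2 / b0) I1) I2.
  by apply: eq_integrable => // y _; rewrite /= EFinD !EFinM.
pose D := \int[lam n.+1]_y (2 / b0 * riesz_weight (b0 / 2) (y : n.+1.-tuple T) + riesz_weight (b0 + 2) y).
have D0 : 0 <= D.
  by apply: Rintegral_ge0 => y _; rewrite addr_ge0 ?riesz_weight_ge0// mulr_ge0 ?riesz_weight_ge0// divr_ge0// ltW.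
(* 1 is the range of [riesz_weight_diff], b1 - b0 keeps b below b1, and the last entry gives e D <
   m. *)
pose e := Num.min 1 (Num.min (b1 - b0) (m / (2 * (D + 1)))).
have D1 : 0 < 2 * (D + 1) by lra.
have e0 : 0 < e by rewrite !lt_min ltr01/= divr_gt0// andbT /b1; lra.
have e1 : e <= 1 by rewrite ge_min lexx.
have e2 : e <= b1 - b0 by rewrite !ge_min lexx orbT.
have e3 : e * (2 * (D + 1)) <= m by rewrite -ler_pdivlMr// !ge_min lexx !orbT.
exists e => //; split; first by lra.
move=> b x bb0 bbe; have bN : b < N by lra.
have bp : 0 < b by lra.
have bb1 : b <= b1 by lra.
have [xX|xX] := leP X0 (sqT x).
  have := hX b x bb0 bb1 xX; have := kappa_gt0 => k0 h.
  have : 0 < sqT x `^ (b / 2) * riesz_heat1 b x by apply: lt_le_trans h; rewrite divr_gt0.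
  by rewrite pmulr_rgt0// powR_gt0//; lra.
have [C' C'0 hC'] := @riesz_fourier R n b bp bN; rewrite hC' mulr_gt0//.
have h : `|riesz_ft b x - riesz_ft b0 x| <= (b - b0) * D.
  rewrite /riesz_ft -RintegralB//; [|exact: integrable_riesz_ft..].
  rewrite /D -RintegralZl//; apply: Rintegral_bound.
  - by apply: measurable_funB; apply: measurable_funM; [mfun|exact: measurable_riesz_weight|mfun|exact: measurable_riesz_weight].
  - have := integrableZl measurableT (b - b0) I3.
    by apply: eq_integrable => // y _; rewrite /= EFinM.
  - move=> y; rewrite -mulrBr normrM (le_trans (ler_piMl _ (normr_cos _)))//.
    have hd0 : 0 <= b - b0 by lra.
    have hd1 : b - b0 <= 1 by lra.
    by have := riesz_weight_diff y b00 hd0 hd1; rewrite (_ : b0 + (b - b0) = b); [|ring].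
have := hm x (ltW xX); move: h; rewrite ler_norml => /andP[h _] hh.
have be : b - b0 <= e by lra.
have := ler_wpM2r D0 be; lra.
Qed.

End estimates.

(** * Negativity near the critical exponent *)

Section negativity.
Context {R : realType} (n : nat).
Notation leb := (@lebesgue_measure R).
Notation T := (measurableTypeR R).
Notation lam n := (lebesgue_tuple R n).
Notation N := (n.+1%:R : R).

(** The weight that remains on the Fourier side after F is paired with a Gaussian and y is rescaled;
    p will be (b - N) / 2, close to 0. *)
Let w (p : R) (y : n.+1.-tuple T) : R := powp p (sqT y) * expR (- (4^-1 * sqT y)).

Let w_ge0 p y : 0 <= w p y. Proof. by rewrite mulr_ge0 ?powp_ge0// expR_ge0. Qed.

Let measurable_w p : measurable_fun setT (w p).
Proof. by rewrite /w; mfun; apply: (measurableT_comp (@measurable_powp _ _)); exact: measurable_sqT. Qed.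

Let integrable_w (p : R) : - N < 2 * p -> (lam n.+1).-integrable setT (EFin \o w p).
Proof.
move=> pN; have i4 : 0 < 4^-1 :> R by rewrite invr_gt0.
have aN : - (2 * p) < N by lra.
have := integrable_powp_exp aN i4; apply: eq_integrable => // y _.
by rewrite /w /=; congr (powp _ _ * _)%:E; field.
Qed.

(** Together with [powp_w_ge], bounds independent of p, so that the constants of the final estimate
    do not move as b tends to N. *)
Let powp_w_le (p q : R) : - 4^-1 <= p -> p <= 0 -> powp p q <= powp (- 4^-1) q + powp 0 q.
Proof.
move=> p4 p0; have [q0|q0] := leP q 0; first by rewrite !powp_le0// addr0.
rewrite !powpE// powRr0; have [q1|q1] := leP 1 q.
  have := ler_powR q1 p0; rewrite powRr0; have := powR_ge0 q (- 4^-1); lra.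
have ql : 0 < q <= 1 by rewrite q0 ltW.
by have := ger_powR ql p4; lra.
Qed.

Let powp_w_ge (p q : R) : - 4^-1 <= p -> p <= 0 -> powp 2 q / (1 + Num.max 0 q) <= powp p q * q ^+ 2.
Proof.
move=> p4 p0; have [q0|q0] := leP q 0; first by rewrite !powp_le0// !mul0r.
rewrite !powpE// powR_mulrn ?(ltW q0)// mulrC ler_wpM2r ?sqr_ge0//.
have q1 : 0 < 1 + q by lra.
rewrite (_ : q `^ p = (q `^ (- p))^-1); last by rewrite -powRN opprK.
rewrite lef_pV2 ?posrE ?powR_gt0//.
have np : 0 <= - p by lra.
apply: (@le_trans _ _ ((1 + q) `^ (- p))).
  by rewrite ge0_ler_powR ?nnegrE//; lra.
have q1' : 1 <= 1 + q by lra.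
rewrite -[leRHS]powRr1; last by lra.
by apply: ler_powR => //; lra.
Qed.

(** The first-order terms add up to -1 + 8 - 9 = -2, the second-order bounds to 1/2 + 81/2 = 41, and
    2^d >= 1 + d costs 2 (-d). The constants 1, -2, 1 cancel. *)
Let exp_combo (u d : R) : 0 <= u -> - 4^-1 <= d -> d <= 0 ->
  expR (- u) - 2 * 2 `^ d * expR (- (4 * u)) + 3 `^ d * expR (- (9 * u)) <=
  - (2 * u) + (41 * u ^+ 2 + 2 * (- d)).
Proof.
move=> u0 d4 d0.
have up (v : R) : 0 <= v -> expR (- v) <= 1 - v + v ^+ 2 / 2.
  move=> v0; rewrite expRN -[leLHS]mul1r ler_pdivrMr ?expR_gt0//.
  have h : 1 + v + v ^+ 2 / 2 <= expR v.
    apply: le_trans (@nondecreasing_cvgn_le _ _ _ _ 3); last 2 first.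
    - by apply/nondecreasing_series => k _ _; exact: exp_coeff_ge0.
    - exact: is_cvg_series_exp_coeff.
    rewrite /series/= !big_nat_recr//= big_geq// /exp_coeff/= !factS fact0.
    by rewrite !muln1 expr0 expr1; lra.
  have v1 : 0 <= 1 - v + v ^+ 2 / 2 by nra.
  apply: (@le_trans _ _ ((1 - v + v ^+ 2 / 2) * (1 + v + v ^+ 2 / 2))); last by rewrite ler_wpM2l.
  have := sqr_ge0 (v ^+ 2); nra.
have lo (v : R) : 1 - v <= expR (- v) by have := expR_ge1Dx (- v).
have h1 := up u u0.
have h9 : expR (- (9 * u)) <= 1 - 9 * u + (9 * u) ^+ 2 / 2 by apply: up; lra.
have h4 := lo (4 * u).
have e4 : expR (- (4 * u)) <= 1 by rewrite -[leRHS]expR0 ler_expR; lra.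
have e40 := expR_ge0 (- (4 * u)); have e90 := expR_ge0 (- (9 * u)).
have t3 : 3 `^ d <= 1 :> R.
  have := @ler_powR R 3 _ _ _ d0; rewrite powRr0; apply; lra.
have t2 : 1 + d <= 2 `^ d :> R.
  rewrite /powR gt_eqF//; apply: le_trans (expR_ge1Dx _).
  have : ln 2 <= 1 :> R.
    by rewrite -[leRHS]expRK ler_ln ?posrE ?expR_gt0//; have := expR_ge1Dx (1 : R); lra.
  have : 0 <= ln 2 :> R by rewrite ln_ge0//; lra.
  by nra.
have s1 : 3 `^ d * expR (- (9 * u)) <= expR (- (9 * u)) by rewrite ler_piMl.
have s2 : (1 + d) * expR (- (4 * u)) <= 2 `^ d * expR (- (4 * u)) by rewrite ler_wpM2r.
by nra.
Qed.

Let Bs (b s : R) := \int[lam n.+1]_x (riesz_ft b (x : n.+1.-tuple T) * expR (- (s * sqT x))).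

Let fFub (b s : R) (x y : n.+1.-tuple T) : R := (cos (dotT x y) * riesz_weight b y) * expR (- (s * sqT x)).

Let mfFub b s : measurable_fun setT (fun z => fFub b s z.1 z.2).
Proof.
rewrite /fFub; apply: measurable_funM; last by mfun.
apply: measurable_funM; first by mfun.
exact: (measurableT_comp (@measurable_riesz_weight _ _ _)).
Qed.

Let finFub (b s : R) : 0 < b -> 0 < s -> (\int[lam n.+1]_x \int[lam n.+1]_y `|fFub b s x y|%:E < +oo)%E.
Proof.
move=> b0 s0; apply: (@iter_dom _ _ _ _ R (lam n.+1) (lam n.+1) (fFub b s) (fun x => expR (- (s * sqT x)))
  (@riesz_weight R n b) (@mfFub b s) (integrable_gaussN n.+1 s0) (@integrable_riesz_weight R n b b0)) => x y.
rewrite /fFub normrM (ger0_norm (expR_ge0 _)) mulrC ler_wpM2l ?expR_ge0// normrM (ger0_norm (riesz_weight_ge0 _ _)).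
by rewrite ler_piMl ?riesz_weight_ge0// normr_cos.
Qed.

Let integrable_Bs b s : 0 < b -> 0 < s ->
  (lam n.+1).-integrable setT (EFin \o (fun x : n.+1.-tuple T => riesz_ft b x * expR (- (s * sqT x)))).
Proof.
move=> b0 s0; have := Rintegral_fubini_integrable (@mfFub b s) (finFub b0 s0).
apply: eq_integrable => // x _; rewrite /= /riesz_ft /fFub RintegralZr//.
exact: integrable_riesz_ft.
Qed.

Let integrable_wM b s : 0 < b -> b <= N -> 0 <= s ->
  (lam n.+1).-integrable setT (EFin \o (fun y => w ((b - N) / 2) y * expR (- (s * sqT y ^+ 2)))).
Proof.
move=> b0 bN s0; apply: (@integrable_dom _ _ _ _ _ (w ((b - N) / 2))).
- by apply: measurable_funM; [exact: measurable_w|mfun].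
- by apply: integrable_w; lra.
- move=> y; rewrite ger0_norm; last by rewrite mulr_ge0 ?expR_ge0.
  apply: ler_piMr => //.
  by rewrite -[leRHS]expR0 ler_expR oppr_le0 mulr_ge0// sqr_ge0.
Qed.

(** After Fubini and the Gaussian transform, y is scaled by sqrt s; the homogeneity of |y|^(b-N)
    gives s^((b-N)/2), the source of the factors 2^p and 3^p below. *)
Let BsE b s : 0 < b -> b <= N -> 0 < s ->
  Bs b s = (\int[lam n.+1]_y expR (- (1 * sqT y))) * (s `^ ((b - N) / 2) *
   \int[lam n.+1]_y (w ((b - N) / 2) y * expR (- (s ^+ 2 * sqT y ^+ 2)))).
Proof.
move=> b0 bN s0; set G1 := \int[lam n.+1]_y expR _.
transitivity (\int[lam n.+1]_x \int[lam n.+1]_y fFub b s x y).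
  apply: eq_Rintegral => x _; rewrite /riesz_ft /fFub RintegralZr//.
  exact: integrable_riesz_ft.
rewrite (Rfubini (@mfFub b s) (finFub b0 s0)).
transitivity (\int[lam n.+1]_y (G1 * s `^ (- (N / 2)) * (riesz_weight b y * expR (- (sqT y / (4 * s)))))).
  apply: eq_Rintegral => y _; rewrite /fFub.
  under eq_Rintegral => x _ do rewrite mulrAC dotTC.
  rewrite RintegralZr//; last first.
    by apply: integrable_cos; [exact: measurable_dotT|exact: integrable_gaussN].
  by rewrite gauss_fourierN// gaussN_scale// -/G1; ring.
have q0 : 0 < Num.sqrt s by rewrite sqrtr_gt0.
rewrite (Rintegral_dil q0); last first.
  by apply: measurable_funM => //; apply: measurable_funM; [exact: measurable_riesz_weight|mfun].
rewrite sqrt_exprn ?(ltW s0)//.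
have IM := integrable_wM b0 bN (sqr_ge0 s).
rewrite [RHS]mulrA -(RintegralZl _ measurableT IM) -RintegralZl//; last first.
  have := integrableZl measurableT (G1 * s `^ (- (N / 2)) * s `^ ((b - N) / 2)) IM.
  apply: eq_integrable => // y _; rewrite -EFinM /riesz_weight /w /= sqT_dil sqr_sqrtr ?(ltW s0)// powpM// exprMn.
  rewrite (_ : s * sqT y / (4 * s) = 4^-1 * sqT y); last by field; rewrite gt_eqF.
  by congr (_%:E); ring.
apply: eq_Rintegral => y _; rewrite /riesz_weight /w sqT_dil sqr_sqrtr ?(ltW s0)// powpM// exprMn.
rewrite (_ : s * sqT y / (4 * s) = 4^-1 * sqT y); last by field; rewrite gt_eqF.
have : s `^ (N / 2) * s `^ (- (N / 2)) = 1 by rewrite -powRDp// subrr powRr0.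
set a := s `^ (N / 2); set c := s `^ (- _) => ac.
transitivity ((a * c) * (G1 * s `^ ((b - N) / 2) * (powp ((b - N) / 2) (sqT y) * expR (- (4^-1 * sqT y)) *
  expR (- (s ^+ 2 * sqT y ^+ 2))))); first by ring.
by rewrite ac mul1r.
Qed.

Let combo (W w1 L q s p : R) : s * L <= s * (W * q) ->
  W * (41 * (s * q) ^+ 2 + 2 * - p) <= w1 * (41 * (s * q) ^+ 2 + 2 * - p) ->
  W * (- (2 * (s * q)) + (41 * (s * q) ^+ 2 + 2 * - p)) <=
  - (2 * s) * L + (41 * s ^+ 2 * (w1 * q ^+ 2) + 2 * - p * w1).
Proof. lra. Qed.

(** If F were nonnegative, so would be its pairing with e - 2 e^2 + e^3, that is Bs(s) - 2 Bs(2s) +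
    Bs(3s). By [exp_combo] this is at most a positive multiple of -2 s^2 a + 41 s^4 A' + 2 (-p) A,
    negative for s small and then p close to 0. *)
Lemma riesz_heat1_neg : exists2 b1 : R, b1 < N & forall b, b1 < b -> b < N ->
  exists x : n.+1.-tuple T, riesz_heat1 b x < 0.
Proof.
have i4 : 0 < 4^-1 :> R by rewrite invr_gt0.
have N1 : 1 <= N by rewrite ler1n.
pose w1 y : R := w (- 4^-1) y + w 0 y.
have w1i : (lam n.+1).-integrable setT (EFin \o w1).
  have h1 : - N < 2 * (- 4^-1) by lra.
  have h2 : - N < 2 * 0 by lra.
  have := integrableD measurableT (integrable_w h1) (integrable_w h2).
  by apply: eq_integrable.
have w4i : (lam n.+1).-integrable setT (EFin \o (fun y => w1 y * sqT y ^+ 4)).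
  have h1 : - N < 2 * (- 4^-1 + 4) by lra.
  have h2 : - N < 2 * (0 + 4) by lra.
  have := integrableD measurableT (integrable_w h1) (integrable_w h2).
  apply: eq_integrable => // y _; rewrite /= /w1 /w -EFinD; congr (_%:E).
  rewrite (powpD (- 4^-1) 4) (powpD 0 4); have [q0|q0] := leP (sqT y) 0; first by rewrite !powp_le0//; ring.
  by rewrite !(powpE _ q0) powR_mulrn ?(ltW q0)//; ring.
(* A minorant of |y|^4 times the weight [w p], valid for all p in [-1/4, 0]; its integral [a] is
   therefore independent of b. *)
pose L (y : n.+1.-tuple T) : R := powp 2 (sqT y) / (1 + Num.max 0 (sqT y)) * expR (- (4^-1 * sqT y)).
have L0 y : 0 <= L y.
  by rewrite mulr_ge0 ?expR_ge0// mulr_ge0 ?powp_ge0// invr_ge0 addr_ge0// le_max lexx.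
have mL : measurable_fun setT L.
  rewrite (_ : L = fun y => powp 2 (sqT y) * (1 + Num.max 0 (sqT y)) `^ (-1) * expR (- (4^-1 * sqT y))).
    apply: measurable_funM; last by mfun.
    apply: measurable_funM; first by apply: (measurableT_comp (@measurable_powp _ _)); exact: measurable_sqT.
    apply: (measurableT_comp (measurable_powR _)).
    by apply: measurable_funD => //; apply: measurable_maxr => //; exact: measurable_sqT.
  by apply/funext => y; rewrite powR_inv1// addr_ge0// le_max lexx.
have Li : (lam n.+1).-integrable setT (EFin \o L).
  have h2 : - N < 2 * 2 by lra.
  apply: (integrable_dom mL (integrable_w h2)) => y; rewrite ger0_norm// /L /w.
  rewrite ler_wpM2r ?expR_ge0// ler_piMr ?powp_ge0// invf_le1 ?ltr_pwDl ?le_max ?lexx//.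
  by rewrite lerDl le_max lexx.
pose a := \int[lam n.+1]_y L y; pose A := \int[lam n.+1]_y w1 y.
pose A' := \int[lam n.+1]_y (w1 y * sqT y ^+ 4).
have w10 y : 0 <= w1 y by rewrite addr_ge0.
have A0 : 0 <= A by exact: Rintegral_ge0.
have A'0 : 0 <= A'.
  by apply: Rintegral_ge0 => y _; rewrite mulr_ge0// exprn_ge0// sqT_ge0.
have a0 : 0 < a.
  pose B := [set y : n.+1.-tuple T | forall i, `]0%R, 1%R]%classic (tnth y i)].
  have B0 : (0 < lam n.+1 B)%E.
    have -> := @lebesgue_tuple_box R n.+1 (fun=> `]0%R, 1%R]%classic) (fun=> @measurable_itv R _).
    rewrite big1// => i _; have := @lebesgue_measure_itv R `]0, 1].
    by rewrite /= lte_fin ltr01 sube0.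
  apply: (Rintegral_gt0 (D := B)) => //.
  - exact: measurable_box.
  - move=> y /(_ ord0) /=; rewrite in_itv/= => /andP[y0 _].
    have q0 : 0 < sqT y.
      rewrite /sqT (bigD1 ord0)//= ltr_pwDl ?exprn_gt0//.
      by apply: sumr_ge0 => i _; exact: sqr_ge0.
    rewrite /L mulr_gt0 ?expR_gt0// mulr_gt0 ?powp_gt0// invr_gt0 ltr_pwDl// le_max lexx//.
(* s2 is the square of s. This choice gives 41 s2^2 A' < s2 a, and d below gives 2 d A <= s2 a /
   2. *)
have [s2 s20 s2E] : exists2 s2 : R, 0 < s2 & s2 * (41 * A' + 1) = a.
  have A1 : 0 < 41 * A' + 1 by lra.
  by exists (a / (41 * A' + 1)); [rewrite divr_gt0|rewrite divfK// gt_eqF].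
pose d := Num.min 4^-1 (s2 * a / (4 * (A + 1))).
have A1 : 0 < 4 * (A + 1) by lra.
have d0 : 0 < d by rewrite lt_min i4/= divr_gt0// mulr_gt0.
have d4 : d <= 4^-1 by rewrite ge_min lexx.
have dA : d * (4 * (A + 1)) <= s2 * a.
  by rewrite -ler_pdivlMr; [rewrite ge_min lexx orbT|lra].
exists (N - 2 * d); first by lra.
move=> b bd bN; have b0 : 0 < b by lra.
have [C C0 hC] := @riesz_fourier R n b b0 bN.
suff [x Fx] : exists x : n.+1.-tuple T, riesz_ft b x < 0 by exists x; rewrite hC pmulr_rlt0.
apply/not_existsP => Fp.
have Fge (x : n.+1.-tuple T) : 0 <= riesz_ft b x by rewrite leNgt; apply/negP; exact: Fp.
clear Fp hC; pose s := Num.sqrt s2; have s0 : 0 < s by rewrite sqrtr_gt0.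
have sE : s ^+ 2 = s2 by rewrite sqr_sqrtr// ltW.
pose p := (b - N) / 2; have p0 : p <= 0 by rewrite /p; lra.
have np : 0 <= - p by rewrite oppr_ge0.
have p4 : - 4^-1 <= p by rewrite /p; lra.
have pd : - p < d by rewrite /p; lra.
have s20' : 0 < 2 * s by lra.
have s30' : 0 < 3 * s by lra.
have I1 := integrable_Bs b0 s0; have I2 := integrable_Bs b0 s20'; have I3 := integrable_Bs b0 s30'.
have J (k : R) := integrable_wM b0 (ltW bN) (sqr_ge0 k).
have pos : 0 <= Bs b s - 2 * Bs b (2 * s) + Bs b (3 * s).
  have I2' : (lam n.+1).-integrable setT (EFin \o (fun x : n.+1.-tuple T => 2 * (riesz_ft b x * expR (- (2 * s * sqT x))))).
    have := integrableZl measurableT 2 I2; exact: eq_integrable.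
  have I12 : (lam n.+1).-integrable setT (EFin \o (fun x : n.+1.-tuple T => riesz_ft b x * expR (- (s * sqT x)) -
      2 * (riesz_ft b x * expR (- (2 * s * sqT x))))).
    have := integrableB measurableT I1 I2'; exact: eq_integrable.
  rewrite /Bs -(RintegralZl _ measurableT I2) -(RintegralB measurableT I1 I2') -(RintegralD measurableT I12 I3).
  apply: Rintegral_ge0 => x _ /=.
  have -> : expR (- (2 * s * sqT x)) = expR (- (s * sqT x)) ^+ 2.
    by rewrite -expRM_natl; congr expR; rewrite -mulr_natl; ring.
  have -> : expR (- (3 * s * sqT x)) = expR (- (s * sqT x)) ^+ 3.
    by rewrite -expRM_natl; congr expR; rewrite -mulr_natl; ring.
  have alg (F e : R) : F * e - 2 * (F * e ^+ 2) + F * e ^+ 3 = F * e * (1 - e) ^+ 2 by ring.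
  rewrite alg.
  by rewrite mulr_ge0 ?sqr_ge0// mulr_ge0// expR_ge0.
have wi : (lam n.+1).-integrable setT (EFin \o (fun y => - (2 * s2) * L y +
    ((41 * s2 ^+ 2) * (w1 y * sqT y ^+ 4) + 2 * (- p) * w1 y))).
  have := integrableD measurableT (integrableZl measurableT (- (2 * s2)) Li)
    (integrableD measurableT (integrableZl measurableT (41 * s2 ^+ 2) w4i)
      (integrableZl measurableT (2 * (- p)) w1i)).
  by apply: eq_integrable => // y _; rewrite /= !EFinD !EFinM.
suff neg : Bs b s - 2 * Bs b (2 * s) + Bs b (3 * s) < 0 by move: (le_lt_trans pos neg); rewrite ltxx.
clear Fge pos.
rewrite !BsE ?(ltW bN)// -/p; set G1 := \int[lam n.+1]_y expR _.
have G10 : 0 < G1 by exact: gaussN_gt0.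
rewrite !powRM ?(ltW s0)// -/p.
set M1 := Rintegral _ _ _; set M2 := Rintegral _ _ _; set M3 := Rintegral _ _ _.
rewrite (_ : _ + _ = G1 * s `^ p * (M1 - 2 * 2 `^ p * M2 + 3 `^ p * M3)); last by ring.
rewrite pmulr_rlt0; last by rewrite mulr_gt0// powR_gt0.
apply: (@le_lt_trans _ _ (- (2 * s2) * a + ((41 * s2 ^+ 2) * A' + 2 * (- p) * A))); last first.
  have h1 : - p * A <= d * A by rewrite ler_wpM2r// ltW.
  by clear - h1 s2E dA d0 a0 s20; nra.
rewrite /a /A' /A.
have K2 : (lam n.+1).-integrable setT (EFin \o (fun y => 2 * 2 `^ p * (w p y * expR (- ((2 * s) ^+ 2 * sqT y ^+ 2))))).
  by have := integrableZl measurableT (2 * 2 `^ p) (J (2 * s)); apply: eq_integrable => // y _; rewrite /= EFinM.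
have K3 : (lam n.+1).-integrable setT (EFin \o (fun y => 3 `^ p * (w p y * expR (- ((3 * s) ^+ 2 * sqT y ^+ 2))))).
  by have := integrableZl measurableT (3 `^ p) (J (3 * s)); apply: eq_integrable => // y _; rewrite /= EFinM.
have K1 := J s; rewrite -/p in K1.
have K12 : (lam n.+1).-integrable setT (EFin \o (fun y => w p y * expR (- (s ^+ 2 * sqT y ^+ 2)) -
    2 * 2 `^ p * (w p y * expR (- ((2 * s) ^+ 2 * sqT y ^+ 2))))).
  by have := integrableB measurableT K1 K2; apply: eq_integrable => // y _; rewrite /= EFinB.
have E : M1 - 2 * 2 `^ p * M2 + 3 `^ p * M3 = \int[lam n.+1]_y
  (w p y * expR (- (s ^+ 2 * sqT y ^+ 2)) - 2 * 2 `^ p * (w p y * expR (- ((2 * s) ^+ 2 * sqT y ^+ 2))) +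
   3 `^ p * (w p y * expR (- ((3 * s) ^+ 2 * sqT y ^+ 2)))).
  rewrite (RintegralD measurableT K12 K3) (RintegralB measurableT K1 K2).
  by rewrite (RintegralZl _ measurableT (J (2 * s))) (RintegralZl _ measurableT (J (3 * s))).
have E' : - (2 * s2) * \int[lam n.+1]_y L y + (41 * s2 ^+ 2 * (\int[lam n.+1]_y (w1 y * sqT y ^+ 4)) +
    2 * - p * \int[lam n.+1]_y w1 y) = \int[lam n.+1]_y (- (2 * s2) * L y +
    ((41 * s2 ^+ 2) * (w1 y * sqT y ^+ 4) + 2 * (- p) * w1 y)).
  have L' : (lam n.+1).-integrable setT (EFin \o (fun y => - (2 * s2) * L y)).
    by have := integrableZl measurableT (- (2 * s2)) Li; apply: eq_integrable => // y _; rewrite /= EFinM.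
  have W4 : (lam n.+1).-integrable setT (EFin \o (fun y => 41 * s2 ^+ 2 * (w1 y * sqT y ^+ 4))).
    by have := integrableZl measurableT (41 * s2 ^+ 2) w4i; apply: eq_integrable => // y _; rewrite /= EFinM.
  have W1 : (lam n.+1).-integrable setT (EFin \o (fun y => 2 * - p * w1 y)).
    by have := integrableZl measurableT (2 * - p) w1i; apply: eq_integrable => // y _; rewrite /= EFinM.
  have W : (lam n.+1).-integrable setT (EFin \o (fun y => 41 * s2 ^+ 2 * (w1 y * sqT y ^+ 4) + 2 * - p * w1 y)).
    by have := integrableD measurableT W4 W1; apply: eq_integrable => // y _; rewrite /= EFinD.
  rewrite (RintegralD measurableT L' W) (RintegralD measurableT W4 W1).
  by rewrite (RintegralZl _ measurableT Li) (RintegralZl _ measurableT w4i) (RintegralZl _ measurableT w1i).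
rewrite E E'; apply: le_Rintegral => //.
  by have := integrableD measurableT K12 K3; apply: eq_integrable => // y _; rewrite /= EFinD.
move=> y _.
have u0 : 0 <= s2 * sqT y ^+ 2 by rewrite mulr_ge0 ?sqr_ge0// ltW.
have := exp_combo u0 p4 p0; rewrite !exprMn sE.
set e1 := expR _; set e2 := expR (- (4 * _)); set e3 := expR (- (9 * _)) => ec.
have -> : expR (- (2 ^+ 2 * s2 * sqT y ^+ 2)) = e2 by congr expR; ring.
have -> : expR (- (3 ^+ 2 * s2 * sqT y ^+ 2)) = e3 by congr expR; ring.
rewrite (_ : _ + _ = w p y * (e1 - 2 * 2 `^ p * e2 + 3 `^ p * e3)); last by ring.
apply: (le_trans (ler_wpM2l (w_ge0 p y) ec)).
have E0 := expR_ge0 (- (4^-1 * sqT y)).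
have g1 : L y <= w p y * sqT y ^+ 2.
  by rewrite /L /w [leRHS]mulrAC; apply: ler_wpM2r => //; exact: powp_w_ge.
have g2 : w p y <= w1 y by rewrite /w1 /w -mulrDl ler_wpM2r//; exact: powp_w_le.
have g3 : 0 <= 41 * (s2 * sqT y ^+ 2) ^+ 2 + 2 * - p.
  by apply: addr_ge0; [exact: mulr_ge0 (ler0n _ _) (sqr_ge0 _)|exact: mulr_ge0 (ler0n _ _) np].
have g4 := ler_wpM2r g3 g2.
have g5 : s2 * L y <= s2 * (w p y * sqT y ^+ 2) by rewrite ler_wpM2l// ltW.
have e4 : sqT y ^+ 4 = (sqT y ^+ 2) ^+ 2 by rewrite -exprM.
by rewrite e4; apply: le_trans (combo g5 g4); rewrite le_eqVlt; apply/orP; left; apply/eqP; ring.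
Qed.

End negativity.

(** * Positivity for exponents up to 1/2 *)

Section line.
Context {R : realType}.
Notation leb := (@lebesgue_measure R).
Notation T := (measurableTypeR R).

Lemma Rintegral_isom (k c : R) (f : R -> R) : `|k| = 1 -> measurable_fun setT f ->
  \int[leb]_x f (k * x + c) = \int[leb]_x f x.
Proof.
move=> k1 mf; have k0 : k != 0 by rewrite -normr_eq0 k1 oner_eq0.
rewrite /Rintegral; congr fine.
have := @integral_transfer _ _ _ T T T R leb leb (fun x : T => k * x + c : T) (fun x : T => x).
move=> /(_ _ (EFin \o f)); apply; last exact/measurable_EFinP.
by move=> g mg g0; rewrite (ge0_integral_affine c k0)// k1 invr1 mul1e.
Qed.

Lemma ae_neq (c : R) : {ae leb, forall x : R, x != c}.
Proof.
exists [set c]; split; [exact: measurable_set1|exact: lebesgue_measure_set1|].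
by move=> x /= /negP; rewrite negbK => /eqP ->.
Qed.

Lemma Rintegral_even (h : R -> R) : leb.-integrable setT (EFin \o h) ->
  (forall x, h (- x) = h x) ->
  leb.-integrable setT (EFin \o (fun x => if 0 < x then h x else 0)) /\
  \int[leb]_x h x = 2 * \int[leb]_x (if 0 < x then h x else 0).
Proof.
move=> hi he; have mh : measurable_fun setT h by case/integrableP : hi => /measurable_EFinP.
pose h1 x := if 0 < x then h x else 0.
have mh1 : measurable_fun setT h1.
  by apply: measurable_fun_ifT => //; apply: measurable_fun_ltr.
have h1i : leb.-integrable setT (EFin \o h1).
  apply: (@integrable_dom _ T R leb _ (fun x => `|h x|)) => //; first exact: integrable_norm.
  by move=> x; rewrite /h1; case: ifP => // _; rewrite normr0.
split => //.
have N1 : `|-1| = 1 :> R by rewrite normrN1.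
have mh2 : measurable_fun setT (fun x : R => h1 (-1 * x + 0)).
  by apply: (measurableT_comp mh1); mfun.
have h2i : leb.-integrable setT (EFin \o (fun x : R => h1 (-1 * x + 0))).
  apply: (@integrable_dom _ T R leb _ (fun x => `|h x|)) => //; first exact: integrable_norm.
  move=> x; rewrite /h1 addr0 mulN1r he.
  by case: ifP => // _; rewrite normr0.
rewrite (@ae_eq_Rintegral _ T R leb h (fun x : R => h1 x + h1 (-1 * x + 0)))//.
- by rewrite RintegralD// (Rintegral_isom 0 N1 mh1) mulr_natl mulr2n.
- exact: measurable_funD.
- have [A [mA A0 sub]] := ae_neq 0; exists A; split => //; apply: subset_trans sub => x /= hx x0.
  apply: hx; rewrite /h1 addr0 mulN1r oppr_gt0 he.
  by case: ltgtP x0 => // _ _; rewrite ?addr0 ?add0r.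
Qed.

(** The weighted bound forces F to 0 at infinity, so only the boundary value at a survives. *)
Lemma halfline_FTC (F f : R -> R) (a B : R) :
  (forall x : R, a <= x -> is_derive x 1 F (- f x)) ->
  (forall x : R, a <= x -> {for x, continuous f}) ->
  leb.-integrable setT (EFin \o (fun x => if a <= x then f x else 0)) ->
  (forall x, a <= x -> `|F x| * (x - a) <= B) ->
  \int[leb]_x (if a <= x then f x else 0) = F a.
Proof.
move=> dF cf fi FB; set g := fun x => _ in fi.
have mg : measurable_fun setT g by case/integrableP : fi => /measurable_EFinP.
pose g_ (n : nat) x : R := if x <= a + n.+1%:R then g x else 0.
have E n : \int[leb]_x g_ n x = F a - F (a + n.+1%:R).
  have an : a < a + n.+1%:R by rewrite ltrDl.
  have dF' (x : R) : a <= x <= a + n.+1%:R -> is_derive x 1 (fun x => - F x) (f x).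
    move=> /andP[ax _]; have := dF x ax => d.
    by apply: is_derive_eq; rewrite opprK.
  have cf' (x : R) : a <= x <= a + n.+1%:R -> {for x, continuous f}.
    by move=> /andP[ax _]; exact: cf.
  have := FTC2_simple an dF' cf'; rewrite integral_mkcond => e.
  rewrite /Rintegral (_ : (\int[leb]_x (g_ n x)%:E = (F a - F (a + n.+1%:R))%:E)%E)//.
  rewrite (_ : F a - _ = - F (a + n.+1%:R) - - F a); last by ring.
  rewrite -e; apply: eq_integral => x _; rewrite patchE mem_setE in_itv/= /g_ /g.
  by case: (a <= x) => //=; case: ifP.
have C : \int[leb]_x g_ n x @[n --> \oo] --> \int[leb]_x g x.
  apply: (@Rdct _ T R leb g_ g (fun x => `|g x|)).
  - by move=> n; apply: measurable_fun_ifT => //; apply: measurable_fun_ler.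
  - move=> x; apply: cvg_near_cst; near=> n; rewrite /g_ ifT//.
    rewrite -lerBlDl; apply: (@le_trans _ _ n%:R); last by rewrite ler_nat.
    by near: n; exact: nbhs_infty_ger.
  - exact: integrable_norm.
  - by move=> n x; rewrite /g_; case: ifP => // _; rewrite normr0.
have h0 : F (a + n.+1%:R) @[n --> \oo] --> (0 : R).
  have h n : `|F (a + n.+1%:R)| <= B * n.+1%:R^-1.
    rewrite ler_pdivlMr//; have := FB (a + n.+1%:R); rewrite (addrC a) addrK; apply.
    by rewrite lerDr.
  apply: norm_cvg0; apply: (@squeeze_cvgr _ _ _ _ (fun=> 0) (fun n => B * n.+1%:R^-1)).
  - by apply: nearW => n; rewrite normr_ge0 h.
  - exact: cvg_cst.
  - rewrite -[X in _ --> X](mulr0 B); apply: cvgM; first exact: cvg_cst.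
    exact: cvg_harmonic.
have C' : \int[leb]_x g_ n x @[n --> \oo] --> F a - 0.
  rewrite (_ : (fun n => \int[leb]_x g_ n x) = fun n => F a - F (a + n.+1%:R)); last by apply/funext.
  exact: (cvgB (cvg_cst (F a)) h0).
by rewrite [LHS](cvg_unique _ C C') ?subr0.
Unshelve. all: by end_near. Qed.

End line.

Section cosine.
Context {R : realType}.
Notation leb := (@lebesgue_measure R).
Notation T := (measurableTypeR R).

Lemma ge0_derive_ge0 (f f' : R -> R) : (forall x : R, is_derive x 1 f (f' x)) ->
  (forall x : R, 0 <= x -> 0 <= f' x) -> f 0 = 0 -> forall x : R, 0 <= x -> 0 <= f x.
Proof.
move=> df f'0 f0 x x0.
have cf : {within `[0, x], continuous f}.
  apply: continuous_subspaceT => y; apply: differentiable_continuous; apply/derivable1_diffP.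
  by have [] := df y.
have [c] := MVT_segment x0 (fun y _ => df y) cf.
rewrite in_itv/= f0 !subr0 => /andP[c0 _] ->.
by rewrite mulr_ge0// f'0.
Qed.

Lemma cos_ge_poly (x : R) : 0 <= x -> 1 - x ^+ 2 / 2 <= cos x.
Proof.
have s1 (y : R) : 0 <= y -> 0 <= y - sin y.
  apply: (@ge0_derive_ge0 (fun y => y - sin y) (fun y => 1 - cos y)).
  - by move=> z _; rewrite subr_ge0 cos_le1.
  - by rewrite sin0 subr0.
move=> x0; rewrite -subr_ge0.
apply: (@ge0_derive_ge0 (fun y => cos y - (1 - y ^+ 2 / 2)) (fun y => y - sin y)) => //.
- by move=> z; apply: is_derive_eq; rewrite /GRing.scale/=; field.
- by rewrite cos0 expr0n/=; ring.
Qed.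

Lemma cos_le_poly (x : R) : 0 <= x -> cos x <= 1 - x ^+ 2 / 2 + x ^+ 4 / 24.
Proof.
have s3 (y : R) : 0 <= y -> 0 <= sin y - (y - y ^+ 3 / 6).
  apply: (@ge0_derive_ge0 (fun y => sin y - (y - y ^+ 3 / 6)) (fun y => cos y - (1 - y ^+ 2 / 2))).
  - by move=> z; apply: is_derive_eq; rewrite /GRing.scale/=; field.
  - by move=> z z0; rewrite subr_ge0 cos_ge_poly.
  - by rewrite sin0 expr0n/=; ring.
move=> x0; rewrite -subr_ge0.
apply: (@ge0_derive_ge0 (fun y => (1 - y ^+ 2 / 2 + y ^+ 4 / 24) - cos y)
  (fun y => sin y - (y - y ^+ 3 / 6))) => //.
- by move=> z; apply: is_derive_eq; rewrite /GRing.scale/=; field.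
- by rewrite cos0 !expr0n/=; ring.
Qed.

(** At v = pi/2, 0 = cos v >= 1 - v^2/2 gives v >= sqrt 2 > 7/5. *)
Lemma pihalf_ge75 : 7 / 5 <= pi / 2 :> R.
Proof.
rewrite leNgt; apply/negP => h.
have [p0 _] := andP (@pihalf_02_cos_pihalf R).1.
have := cos_ge_poly (_ : 0 <= pi / 2 :> R); rewrite cos_pihalf => /(_ p0).
by have := @pihalf_ge1 R; move: h; set v := pi / 2; nra.
Qed.

(** Otherwise cos(9/5) would be positive, while the quartic upper bound is negative there. *)
Lemma pihalf_le95 : pi / 2 <= 9 / 5 :> R.
Proof.
rewrite leNgt; apply/negP => h.
have c0 : 0 < cos (9 / 5 : R).
  by apply: cos_gt0_pihalf; rewrite h andbT; have := @pihalf_ge1 R; lra.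
have h95 : 0 <= 9 / 5 :> R by lra.
have := cos_le_poly h95; lra.
Qed.

Variable b : R.
Hypotheses (b0 : 0 < b) (b12 : b <= 2^-1).

Let f (a : R) : R := powp (b - 1) a * cos a.

Let mf : measurable_fun setT f.
Proof. by rewrite /f; mfun; exact: measurable_powp. Qed.

Let fi (A : set T) (t : R) : measurable A -> A `<=` [set x | x <= t] -> leb.-integrable A (EFin \o f).
Proof.
move=> mA At; have G := integrable_gamma b0 (@ltr01 R).
have Gt := integrableZl measurableT (expR t) G.
have mf' : measurable_fun A f by exact: measurable_funTS.
have IG := integrableS measurableT mA (@subsetT _ A) Gt.
apply: (le_integrable mA _ _ IG); first exact/measurable_EFinP.
move=> x Ax; rewrite /= lee_fin normrM (ger0_norm (powp_ge0 _ _)) [leRHS]ger0_norm; last first.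
  by rewrite !mulr_ge0 ?powp_ge0 ?expR_ge0.
rewrite mulrCA ler_wpM2l ?powp_ge0// (le_trans (normr_cos _))// -expRD.
by rewrite -[leLHS]expR0 ler_expR mul1r subr_ge0; exact: At.
Qed.

Let D (t : R) := \int[leb]_(a in `]0%R, t]) f a.

(** Each stretch of the half-line will use its own minorant phi with an explicit primitive; s > 0
    keeps away from the singularity of a^(b-1). *)
Let D_lower (F phi : R -> R) (s t : R) : 0 < s -> s < t ->
  (forall x : R, s <= x <= t -> is_derive x 1 F (phi x)) ->
  (forall x : R, s <= x <= t -> {for x, continuous phi}) ->
  (forall x : R, s <= x <= t -> phi x <= f x) ->
  F t - F s <= D t - D s.
Proof.
move=> s0 st dF cphi le.
rewrite /D (@Rintegral_itvB _ _ (BRight 0%R) (BRight t) s); last 3 first.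
- by apply: (@fi _ t) => // x /=; rewrite in_itv/= => /andP[].
- by rewrite bnd_simp ltW.
- by rewrite bnd_simp ltW.
have f1 : leb.-integrable `]s, t] (EFin \o f).
  by apply: (@fi _ t) => // x /=; rewrite in_itv/= => /andP[].
have f2 : leb.-integrable `[s, t] (EFin \o f).
  by apply: (@fi _ t) => // x /=; rewrite in_itv/= => /andP[].
rewrite (Rintegral_itv_obnd_cbnd f1).
have := FTC2_simple st dF cphi => E.
have ci : leb.-integrable `[s, t] (EFin \o phi).
  apply: continuous_compact_integrable; first exact: segment_compact.
  by apply: continuous_in_subspaceT => x; rewrite inE/= in_itv/=; exact: cphi.
have -> : F t - F s = \int[leb]_(x in `[s, t]) phi x by rewrite /Rintegral E.
apply: (@le_Rintegral _ T R leb `[s, t]%classic phi f (measurable_itv _) ci f2) => x /=.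
by rewrite in_itv/=; exact: le.
Qed.

Let v : R := pi / 2.

(** The primitive of a^(b-1) (1 - a^2/2), a minorant of the integrand. *)
Let H1 (t : R) : R := b^-1 * t `^ b - (2 * (b + 2))^-1 * t `^ (b + 2).

Let cont_powR (p x : R) : 0 < x -> {for x, continuous (fun y => y `^ p)}.
Proof.
move=> x0; apply: differentiable_continuous; apply/derivable1_diffP.
by have [] := is_derive1_powR p x0.
Qed.

Let D_v : H1 v <= D v.
Proof.
have b0' := b0; have b12' := b12.
have v0 : 0 < v by have := pihalf_ge75; rewrite /v; lra.
(* [D_lower] must start at some m > 0: it is so small that H1(m) is at most half the supposed gap,
   and m <= v/2 makes D(m) nonnegative. *)
rewrite leNgt; apply/negP => h; pose m := Num.min (v / 2) ((b * (H1 v - D v) / 2) `^ b^-1).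
have bm : 0 < b * (H1 v - D v) / 2 by rewrite divr_gt0// mulr_gt0// subr_gt0.
have m0 : 0 < m by rewrite lt_min divr_gt0//= powR_gt0.
have mv : m < v by rewrite gt_min; apply/orP; left; lra.
have mb : b^-1 * m `^ b <= (H1 v - D v) / 2.
  rewrite ler_pdivrMl// mulrA.
  apply: (@le_trans _ _ (((b * (H1 v - D v) / 2) `^ b^-1) `^ b)).
    by rewrite ge0_ler_powR ?nnegrE ?powR_ge0 ?(ltW b0) ?(ltW m0)// ge_min lexx orbT.
  by rewrite -powRrM mulVf ?gt_eqF// powRr1// ltW.
have Dm : 0 <= D m.
  apply: Rintegral_ge0 => x /=; rewrite in_itv/= => /andP[x0 xm].
  rewrite mulr_ge0 ?powp_ge0//; apply: cos_ge0_pihalf; rewrite -/v; apply/andP; split; lra.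
have q : 0 <= (2 * (b + 2))^-1 * m `^ (b + 2).
  by rewrite mulr_ge0 ?powR_ge0// invr_ge0; lra.
suff : H1 v - H1 m <= D v - D m by rewrite {2}/H1 => ?; lra.
apply: (@D_lower H1 (fun x => x `^ (b - 1) - 2^-1 * x `^ (b + 1))) => // x /andP[mx xv]; have x0 : 0 < x by exact: lt_le_trans m0 mx.
- have d1 := is_derive1_powR b x0; have d2 := is_derive1_powR (b + 2) x0.
  apply: is_derive_eq; rewrite /GRing.scale/=.
  rewrite (_ : b + 2 - 1 = b + 1); last by ring.
  by field; rewrite ?gt_eqF//; lra.
- apply: cvgB; first exact: cont_powR.
  by apply: cvgM; [exact: cvg_cst|exact: cont_powR].
- rewrite /f powpE// (_ : b + 1 = (b - 1) + 2); last by ring.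
  rewrite (powRDp (b - 1) 2 x0) powR_mulrn ?(ltW x0)//.
  rewrite (_ : _ - _ = x `^ (b - 1) * (1 - x ^+ 2 / 2)); last by field.
  by rewrite ler_wpM2l ?powR_ge0// cos_ge_poly// ltW.
Qed.

(** The gain on (0, v] exceeds 2 v^(b-1), the largest possible loss on [v, 3v]. After division by
    v^(b-1), b <= 1/2 reduces this to 2 < 2 v - v^3/4, true for 7/5 <= v <= 9/5. *)
Let v_num : 2 * v `^ (b - 1) < H1 v.
Proof.
have b0' := b0; have b12' := b12.
have v1 := pihalf_ge75; have v2 := pihalf_le95; rewrite -/v in v1 v2.
have v0 : 0 < v by lra.
have -> : H1 v = v `^ (b - 1) * (b^-1 * v - (2 * (b + 2))^-1 * v ^+ 3).
  have e1 : v `^ b = v `^ (b - 1) * v.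
    by rewrite -{3}(powRr1 (ltW v0)) -powRDp// subrK.
  have e2 : v `^ (b + 2) = v `^ (b - 1) * v ^+ 3.
    by rewrite -powR_mulrn ?(ltW v0)// -powRDp//; congr (_ `^ _); ring.
  by rewrite /H1 e1 e2; ring.
rewrite [ltRHS]mulrC ltr_pM2r ?powR_gt0//.
have h1 : 2 <= b^-1 by rewrite -[leLHS]invrK lef_pV2 ?posrE ?invr_gt0.
have h2 : (2 * (b + 2))^-1 <= 4^-1 by rewrite lef_pV2 ?posrE; lra.
have h3 : 0 < v ^+ 3 by rewrite exprn_gt0.
have h4 : 2 < 2 * v - 4^-1 * v ^+ 3.
  have : 0 <= (v - 7 / 5) * (9 / 5 - v) by rewrite mulr_ge0; lra.
  have -> : v ^+ 3 = v * v ^+ 2 by rewrite exprS.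
  nra.
have h5 : 2 * v <= b^-1 * v by rewrite ler_wpM2r// ltW.
have h6 : (2 * (b + 2))^-1 * v ^+ 3 <= 4^-1 * v ^+ 3 by rewrite ler_wpM2r// ltW.
lra.
Qed.

Let sin3v : sin (3 * v) = -1.
Proof.
rewrite (_ : 3 * v = v + pi); last by rewrite /v; field.
by rewrite sinDpi sin_pihalf.
Qed.

Let cos_le0_v (x : R) : v <= x -> x <= 3 * v -> cos x <= 0.
Proof.
move=> x1 x2; rewrite (_ : x = (x - pi) + pi); last by ring.
rewrite cosDpi oppr_le0; apply: cos_ge0_pihalf; rewrite -/v.
have -> : pi = 2 * v :> R by rewrite /v; field.
by apply/andP; split; lra.
Qed.

(** On this range cos <= 0 and a^(b-1) <= v^(b-1), so the minorant v^(b-1) cos a loses at most 2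
    v^(b-1). *)
Let D_mid t : v <= t -> t <= 3 * v -> 0 < D t.
Proof.
have b0' := b0; have b12' := b12.
move=> vt tv; have v0 : 0 < v by have := pihalf_ge75; rewrite /v; lra.
have pv : 0 < v `^ (b - 1) by rewrite powR_gt0.
have := v_num; have := D_v; have := sin_geN1 t.
have [->|vt'] := eqVneq t v; first by lra.
have lt : v < t by rewrite lt_neqAle eq_sym vt'.
have : v `^ (b - 1) * sin t - v `^ (b - 1) * sin v <= D t - D v.
  apply: (@D_lower (fun x => v `^ (b - 1) * sin x) (fun x => v `^ (b - 1) * cos x)) => //.
  - move=> x _; apply: continuousM; [exact: cst_continuous|exact: continuous_cos].
  - move=> x /andP[vx xt]; have x0 : 0 < x by lra.
    have xv : x <= 3 * v by lra.
    rewrite /f powpE// ler_wnM2r ?cos_le0_v//.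
    rewrite -[b - 1]opprK !(powRN _ (- (b - 1))) lef_pV2 ?posrE ?powR_gt0//.
    by rewrite ge0_ler_powR ?nnegrE//; lra.
rewrite [sin v]sin_pihalf; nra.
Qed.

(** Before pi/2 the integrand is positive, and up to 3 pi/2 [D_mid] applies. Beyond, (1 + sin t)
    t^(b-1) is nonnegative, vanishes at 3 pi/2 and has derivative at most the integrand, so the
    primitive never drops below its value at 3 pi/2. *)
Lemma cos_primitive_gt0 (t : R) : 0 < t -> 0 < \int[leb]_(a in `]0%R, t]) (powp (b - 1) a * cos a).
Proof.
have b0' := b0; have b12' := b12.
move=> t0; rewrite -/(f _) -/(D t).
have v0 : 0 < v by have := pihalf_ge75; rewrite /v; lra.
have [vt|tv] := leP v t; last first.
  rewrite /D Rintegral_mkcond.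
  apply: (@Rintegral_gt0 _ T R leb `]0%R, t[%classic) => //.
  - have I : leb.-integrable `]0%R, t] (EFin \o f).
      by apply: (@fi _ t) => // x /=; rewrite in_itv/= => /andP[].
    have := (@integrable_mkcond _ T R leb `]0%R, t]%classic (EFin \o f) (measurable_itv _)).1 I.
    by apply: eq_integrable => // x _; rewrite /= !patchE; case: ifP.
  - move=> x; rewrite patchE; case: ifP => //; rewrite mem_setE in_itv/= => /andP[x0 xt].
    by rewrite mulr_ge0 ?powp_ge0//; apply/ltW/cos_gt0_pihalf; rewrite -/v; apply/andP; split; lra.
  - have := @lebesgue_measure_itv R `]0, t[; rewrite /= lte_fin t0 sube0 => ->.
    by rewrite lte_fin.
  - move=> x /=; rewrite in_itv/= => /andP[x0 xt]; rewrite patchE mem_setE in_itv/= x0 (ltW xt)/=.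
    by rewrite mulr_gt0 ?powp_gt0//; apply: cos_gt0_pihalf; rewrite -/v; apply/andP; split; lra.
have [t3|t3] := leP t (3 * v); first exact: D_mid.
have v3 : v <= 3 * v by lra.
have D3 := D_mid v3 (lexx _).
have v30 : 0 < 3 * v by lra.
have : (1 + sin t) * t `^ (b - 1) - (1 + sin (3 * v)) * (3 * v) `^ (b - 1) <= D t - D (3 * v).
  apply: (@D_lower (fun x => (1 + sin x) * x `^ (b - 1))
    (fun x => cos x * x `^ (b - 1) + (1 + sin x) * ((b - 1) * x `^ (b - 1 - 1)))) => //.
  - move=> x /andP[x1 _]; have x0 : 0 < x by lra.
    have d := is_derive1_powR (b - 1) x0.
    by apply: is_derive_eq; rewrite /GRing.scale/= add0r; ring.
  - move=> x /andP[x1 _]; have x0 : 0 < x by lra.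
    apply: continuousD; apply: continuousM.
    + exact: continuous_cos.
    + exact: cont_powR.
    + by apply: continuousD; [exact: cst_continuous|exact: continuous_sin].
    + by apply: continuousM; [exact: cst_continuous|exact: cont_powR].
  - move=> x /andP[x1 _]; have x0 : 0 < x by lra.
    have q1 : 0 <= 1 + sin x by have := sin_geN1 x; lra.
    have q2 : (b - 1) * x `^ (b - 1 - 1) <= 0.
      by apply: mulr_le0_ge0; rewrite ?powR_ge0//; lra.
    have q3 := mulr_ge0_le0 q1 q2.
    by rewrite /f powpE// [leRHS]mulrC; lra.
rewrite sin3v subrr mul0r subr0 => h.
have : 0 <= (1 + sin t) * t `^ (b - 1) by rewrite mulr_ge0 ?powR_ge0//; have := sin_geN1 t; lra.
lra.
Qed.

End cosine.

Section quartic.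
Context {R : realType}.
Notation leb := (@lebesgue_measure R).
Notation T := (measurableTypeR R).

(** Minus the derivative of exp(-k t^4): a positive density on t > 0 whose integral from a to
    infinity recovers exp(-k a^4). *)
Let d (k t : R) : R := 4 * k * t ^+ 3 * expR (- (k * t ^+ 4)).

Let exp4_le (k a : R) : 0 < k -> 0 <= a -> expR (- (k * a ^+ 4)) <= expR (1 + k^-1) * expR (- (1 * a)).
Proof.
move=> k0 a0; rewrite -expRD ler_expR.
have ki : 0 < k^-1 by rewrite invr_gt0.
have kk : k * k^-1 = 1 by rewrite mulfV ?gt_eqF.
have [a1|a1] := leP a 1.
  have : 0 <= k * a ^+ 4 by rewrite mulr_ge0 ?exprn_ge0// ltW.
  by lra.
have h1 : a ^+ 2 <= a ^+ 4 by rewrite (_ : a ^+ 4 = a ^+ 2 * a ^+ 2) ?ler_peMr ?sqr_ge0 ?exprn_ege1//; [exact: ltW|ring].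
have h2 : k * a ^+ 2 <= k * a ^+ 4 by rewrite ler_wpM2l// ltW.
have := sqr_ge0 (k * a - 2^-1); rewrite sqrrB => h3.
have : a <= k * a ^+ 2 + k^-1.
  rewrite -(ler_pM2l k0); have -> : k * (k * a ^+ 2 + k^-1) = (k * a) ^+ 2 + 1 by rewrite mulrDr kk; ring.
  by nra.
lra.
Qed.

Let integrable_d (k a : R) : 0 < k -> 0 <= a ->
  leb.-integrable setT (EFin \o (fun t => if a <= t then d k t else 0)).
Proof.
move=> k0 a0.
have G := integrableZl measurableT (4 * k * expR (1 + k^-1)) (@integrable_gamma R 4 1 (ltr0n _ 4) ltr01).
apply: (@integrable_dom _ T R leb _ (fun t => 4 * k * expR (1 + k^-1) * (powp (4 - 1) t * expR (- (1 * t))))).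
- by apply: measurable_fun_ifT; [apply: measurable_fun_ler|rewrite /d; mfun|].
- by apply: eq_integrable G.
- move=> t; case: ifP => at_; last first.
    rewrite normr0; apply: mulr_ge0; first by rewrite !mulr_ge0 ?expR_ge0// ltW.
    by rewrite mulr_ge0 ?powp_ge0 ?expR_ge0.
  have t0 : 0 <= t by lra.
  have c0 : 0 <= 4 * k * t ^+ 3 by rewrite !mulr_ge0 ?exprn_ge0// ltW.
  rewrite /d ger0_norm; last by rewrite mulr_ge0 ?expR_ge0.
  rewrite (_ : powp (4 - 1) t = t ^+ 3).
    apply: (le_trans (ler_wpM2l c0 (exp4_le k0 t0))).
    by rewrite le_eqVlt; apply/orP; left; apply/eqP; ring.
  rewrite (_ : 4 - 1 = 3%:R :> R); last by ring.
  move: t0; rewrite le_eqVlt => /predU1P[<-|t0]; first by rewrite powp_le0// expr0n.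
  by rewrite powpE// powR_mulrn// ltW.
Qed.

Let int_d (k a : R) : 0 < k -> 0 <= a ->
  \int[leb]_t (if a <= t then d k t else 0) = expR (- (k * a ^+ 4)).
Proof.
move=> k0 a0; apply: (@halfline_FTC R (fun t => expR (- (k * t ^+ 4))) (d k) a (expR (1 + k^-1))).
- by move=> x _; apply: is_derive_eq; rewrite /GRing.scale/= /d; ring.
- move=> x _; apply: differentiable_continuous; apply/derivable1_diffP.
  by rewrite /d; apply: ex_derive.
- exact: integrable_d.
- move=> x ax; have x0 : 0 <= x by lra.
  rewrite ger0_norm ?expR_ge0//.
  apply: (@le_trans _ _ (expR (1 + k^-1) * expR (- (1 * x)) * (1 + x))).
    apply: ler_pM; rewrite ?expR_ge0 ?subr_ge0 ?exp4_le//; lra.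
  rewrite -mulrA ler_piMr ?expR_ge0// expRN mul1r mulrC ler_pdivrMr ?expR_gt0// mul1r.
  exact: expR_ge1Dx.
Qed.

Lemma integrable_powp_quartic (b k : R) : 0 < b -> 0 < k ->
  leb.-integrable setT (EFin \o (fun a => powp (b - 1) a * expR (- (k * a ^+ 4)))).
Proof.
move=> b0 k0; have G := integrableZl measurableT (expR (1 + k^-1)) (integrable_gamma b0 ltr01).
apply: (@integrable_dom _ T R leb _ (fun t => expR (1 + k^-1) * (powp (b - 1) t * expR (- (1 * t))))).
- by apply: measurable_funM; [exact: measurable_powp|mfun].
- by apply: eq_integrable G.
- move=> a; have [a0|a0] := leP a 0; first by rewrite powp_le0// !mul0r normr0 mulr0.
  rewrite ger0_norm; last by rewrite mulr_ge0 ?powp_ge0 ?expR_ge0.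
  by rewrite [leRHS]mulrCA; apply: ler_wpM2l; rewrite ?powp_ge0// exp4_le// ltW.
Qed.

(** With exp(-k a^4) written as the integral of [d k] over t >= a, Fubini turns the integral into an
    average of the primitives of [cos_primitive_gt0]. *)
Lemma cos_quartic_gt0 (b k : R) : 0 < b -> b <= 2^-1 -> 0 < k ->
  0 < \int[leb]_a (cos a * (powp (b - 1) a * expR (- (k * a ^+ 4)))).
Proof.
move=> b0 b12 k0.
pose f (a t : R) : R := cos a * powp (b - 1) a * (if a <= t then d k t else 0).
have mf : measurable_fun setT (fun z : T * T => f z.1 z.2).
  apply: measurable_funM.
    by apply: measurable_funM; [mfun|apply: (measurableT_comp (@measurable_powp _ _))].
  by apply: measurable_fun_ifT; [apply: measurable_fun_ler|rewrite /d; mfun|].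
have fin : (\int[leb]_a \int[leb]_t `|f a t|%:E < +oo)%E.
  apply: (@iter_dom_ae _ _ T T R leb leb f (fun a => powp (b - 1) a * expR (- (k * a ^+ 4))) mf).
    exact: integrable_powp_quartic.
  apply: aeW => a; have [a0|a0] := leP a 0.
    have -> : f a = fun=> 0 by apply/funext => t; rewrite /f powp_le0// mulr0 mul0r.
    split; first exact: integrable0.
    by rewrite normr0 /Rintegral integral0 powp_le0// mul0r.
  have Ia := integrable_d k0 (ltW a0).
  split.
    have := integrableZl measurableT (cos a * powp (b - 1) a) Ia.
    by apply: eq_integrable => // t _; rewrite /= EFinM.
  rewrite -int_d ?(ltW a0)// -RintegralZl//; apply: le_Rintegral => //.
  - apply: integrable_norm; have := integrableZl measurableT (cos a * powp (b - 1) a) Ia.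
    by apply: eq_integrable => // t _; rewrite /= EFinM.
  - have := integrableZl measurableT (powp (b - 1) a) Ia.
    by apply: eq_integrable => // t _; rewrite /= EFinM.
  - move=> t _; rewrite /f !normrM (ger0_norm (powp_ge0 _ _)).
    have g0 : 0 <= (if a <= t then d k t else 0).
      case: ifP => // at_; rewrite /d mulr_ge0 ?expR_ge0// !mulr_ge0 ?exprn_ge0// ?(ltW k0)//; lra.
    by rewrite (ger0_norm g0) ler_wpM2r// ler_piMl ?powp_ge0// normr_cos.
have -> : \int[leb]_a (cos a * (powp (b - 1) a * expR (- (k * a ^+ 4)))) = \int[leb]_a \int[leb]_t f a t.
  apply: eq_Rintegral => a _; have [a0|a0] := leP a 0.
    have -> : f a = fun=> 0 by apply/funext => t; rewrite /f powp_le0// mulr0 mul0r.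
    by rewrite /Rintegral integral0 powp_le0// mul0r mulr0.
  by rewrite /f RintegralZl//; [rewrite int_d ?(ltW a0)// mulrA|apply: integrable_d => //; exact: ltW].
have E t : \int[leb]_a f a t = if 0 < t then d k t * \int[leb]_(a in `]0%R, t]) (powp (b - 1) a * cos a) else 0.
  case: ifPn => t0; last first.
    rewrite (_ : f^~ t = fun=> 0); first by rewrite /Rintegral integral0.
    apply/funext => a; rewrite /f; have [a0|a0] := leP a 0; first by rewrite powp_le0// mulr0 mul0r.
    by rewrite ifF ?mulr0//; apply/negbTE; rewrite -ltNge; move: t0; rewrite -leNgt; lra.
  have -> : \int[leb]_(a in `]0%R, t]) (powp (b - 1) a * cos a) =
      \int[leb]_a (if a <= t then powp (b - 1) a * cos a else 0).
    rewrite Rintegral_mkcond; apply: eq_Rintegral => a _; rewrite patchE mem_setE in_itv/=.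
    by have [a0|a0] := leP a 0; first by rewrite powp_le0//= mul0r; case: ifP.
  have G := integrableZl measurableT (expR t) (integrable_gamma b0 ltr01).
  have I : leb.-integrable setT (EFin \o (fun a => if a <= t then powp (b - 1) a * cos a else 0)).
    apply: (@integrable_dom _ T R leb _ (fun a => expR t * (powp (b - 1) a * expR (- (1 * a))))).
    - apply: measurable_fun_ifT => //; first exact: measurable_fun_ler.
      by mfun; exact: measurable_powp.
    - by apply: eq_integrable G.
    - move=> a; case: ifP => at_; last by rewrite normr0 !mulr_ge0 ?expR_ge0 ?powp_ge0.
      rewrite normrM (ger0_norm (powp_ge0 _ _)) mulrCA; apply: ler_wpM2l; first exact: powp_ge0.
      rewrite (le_trans (normr_cos _))// -expRD -[leLHS]expR0 ler_expR; lra.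
  rewrite -(RintegralZl _ measurableT I); apply: eq_Rintegral => a _.
  by rewrite /f; case: ifP => _; [ring|rewrite !mulr0].
have I := @Rintegral_fubini_integrable _ _ T T R leb leb (fun t a => f a t)
   (measurableT_comp mf (@measurable_swap _ _ T T)).
rewrite (Rfubini mf fin); apply: (@Rintegral_gt0 _ T R leb `]0%R, 1%R[%classic) => //.
- apply: I; rewrite (@tonelli_swap _ _ T T R leb leb (fun t a => `|f a t|%:E)%E)//.
  apply/measurable_EFinP; apply: measurableT_comp => //.
  exact: (measurableT_comp mf (@measurable_swap _ _ T T)).
- move=> t; rewrite E; case: ifP => // t0; apply/ltW; rewrite mulr_gt0 ?cos_primitive_gt0//.
  by rewrite /d !mulr_gt0 ?exprn_gt0 ?expR_gt0.
- by have := @lebesgue_measure_itv R `]0, 1[; rewrite /= lte_fin ltr01 sube0 => ->; rewrite lte_fin.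
- move=> t /=; rewrite in_itv/= => /andP[t0 _]; rewrite E t0 mulr_gt0 ?cos_primitive_gt0//.
  by rewrite /d !mulr_gt0 ?exprn_gt0 ?expR_gt0.
Qed.

Lemma cos_quartic_scale_gt0 (b k r : R) : 0 < b -> b <= 2^-1 -> 0 < k -> 0 <= r ->
  0 < \int[leb]_a (cos (r * a) * (powp (b - 1) a * expR (- (k * a ^+ 4)))).
Proof.
move=> b0 b12 k0; rewrite le_eqVlt => /predU1P[<-|r0].
  apply: (@Rintegral_gt0 _ T R leb `]0%R, 1%R[%classic) => //.
  - have := integrable_powp_quartic b0 k0; apply: eq_integrable => // a _.
    by rewrite /= mul0r cos0 mul1r.
  - by move=> a; rewrite mul0r cos0 mul1r mulr_ge0 ?powp_ge0 ?expR_ge0.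
  - by have := @lebesgue_measure_itv R `]0, 1[; rewrite /= lte_fin ltr01 sube0 => ->; rewrite lte_fin.
  - move=> a /=; rewrite in_itv/= => /andP[a0 _]; rewrite mul0r cos0 mul1r.
    by rewrite mulr_gt0 ?powp_gt0 ?expR_gt0.
have ri : 0 < r^-1 by rewrite invr_gt0.
rewrite (Rintegral_scale ri); last by apply: measurable_funM; [mfun|apply: measurable_funM; [exact: measurable_powp|mfun]].
have k1 : 0 < k * r^-1 ^+ 4 by rewrite mulr_gt0 ?exprn_gt0.
have I := integrable_powp_quartic b0 k1.
have Ic : leb.-integrable setT (EFin \o (fun a => cos a * (powp (b - 1) a * expR (- (k * r^-1 ^+ 4 * a ^+ 4))))).
  by apply: integrable_cos I; exact: measurable_id.
rewrite pmulr_rgt0// (_ : \int[leb]_x _ = r^-1 `^ (b - 1) *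
    \int[leb]_a (cos a * (powp (b - 1) a * expR (- (k * r^-1 ^+ 4 * a ^+ 4))))).
  by rewrite mulr_gt0 ?powR_gt0// cos_quartic_gt0.
rewrite -(RintegralZl _ measurableT Ic); apply: eq_Rintegral => a _.
have -> : r * (r^-1 * a) = a by rewrite mulrA mulfV ?mul1r// gt_eqF.
by rewrite powpM// exprMn (mulrA k); ring.
Qed.

End quartic.

Section slices.
Context {R : realType} (n : nat).
Notation leb := (@lebesgue_measure R).
Notation T := (measurableTypeR R).
Notation lam n := (lebesgue_tuple R n).
Notation N := (n.+1%:R : R).

Let f (b r : R) (a : T) (e : n.-tuple T) : R :=
  (1 + sqT e) `^ ((b - N) / 2) *
  (cos (r * (a : R)) * (powp (b - 1) a * expR (- ((1 + sqT e) ^+ 2 * (a : R) ^+ 4)))).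

Let s1 (e : n.-tuple T) : 0 < 1 + sqT e. Proof. by rewrite ltr_pwDl// sqT_ge0. Qed.

Let mf b r : measurable_fun setT (fun z : T * n.-tuple T => f b r z.1 z.2).
Proof.
apply: measurable_funM; first by mfun; exact: (measurableT_comp (@measurable_sqT _ _)).
apply: measurable_funM; first by mfun.
apply: measurable_funM; first by apply: (measurableT_comp (@measurable_powp _ _)).
by mfun; exact: (measurableT_comp (@measurable_sqT _ _)).
Qed.

Let integrable_f b r (a : R) : b <= N -> 0 < a -> (lam n).-integrable setT (EFin \o f b r a).
Proof.
move=> bN a0; have a4 : 0 < a ^+ 4 by rewrite exprn_gt0.
have G := integrableZl measurableT (powp (b - 1) a) (integrable_gaussN n a4).
apply: (@integrable_dom _ _ _ _ _ (fun e => powp (b - 1) a * expR (- (a ^+ 4 * sqT e)))).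
- exact: (measurable_curry1 (a : T) (@mf b r)).
- by apply: eq_integrable G.
- move=> e; have q0 := sqT_ge0 e; have p0 := powp_ge0 (b - 1) a.
  rewrite /f normrM (ger0_norm (powR_ge0 _ _)) normrM.
  apply: (@le_trans _ _ (1 * (1 * (powp (b - 1) a * expR (- ((1 + sqT e) ^+ 2 * a ^+ 4)))))).
    apply: ler_pM; rewrite ?powR_ge0 ?mulr_ge0//.
      have h1 : 1 <= 1 + sqT e by lra.
      have h2 : (b - N) / 2 <= 0 by lra.
      by have := ler_powR h1 h2; rewrite powRr0.
    rewrite [X in _ * X]ger0_norm; last by rewrite mulr_ge0 ?expR_ge0.
    by apply: ler_wpM2r; rewrite ?mulr_ge0 ?expR_ge0// normr_cos.
  rewrite !mul1r; apply: ler_wpM2l => //; rewrite ler_expR lerN2 mulrC.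
  by apply: ler_wpM2r; [exact: ltW|nra].
Qed.

Let h (b r : R) (a : T) : R := \int[lam n]_e (cos (r * (a : R)) * riesz_weight b (tuple_cons (a, e))).

(* e = a e' turns the slice at height a into a mixture of a^(b-1) e^(-k a^4). *)
Let slice b r (a : R) : b <= N -> 0 < a -> h b r a = \int[lam n]_e f b r a e.
Proof.
move=> bN a0; rewrite /h (Rintegral_dil a0); last first.
  apply: measurable_funM => //; apply/measurable_EFinP.
  by apply: (@measurable_consr _ _ (a : T) (EFin \o @riesz_weight R n b)); apply/measurable_EFinP; exact: measurable_riesz_weight.
have E (e : n.-tuple T) : f b r a e = a ^+ n * (cos (r * a) * riesz_weight b (tuple_cons (a : T, affT a (zT n) e))).
  rewrite /f /riesz_weight sqT_cons sqT_dil (_ : a ^+ 2 + a ^+ 2 * sqT e = a ^+ 2 * (1 + sqT e)); last by ring.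
  rewrite powpM ?exprn_gt0// !powpE// (_ : a `^ (b - 1) = a ^+ n * (a ^+ 2) `^ ((b - N) / 2)).
    by rewrite (_ : (a ^+ 2 * (1 + sqT e)) ^+ 2 = (1 + sqT e) ^+ 2 * a ^+ 4); ring.
  rewrite -(powR_mulrn n (ltW a0)) -(powR_mulrn 2 (ltW a0)) -powRrM -powRDp//; congr (_ `^ _).
  by rewrite -natr1; field.
have I : (lam n).-integrable setT (EFin \o (fun e => cos (r * a) * riesz_weight b (tuple_cons (a : T, affT a (zT n) e)))).
  have := integrableZl measurableT (a ^- n) (integrable_f r bN a0).
  apply: eq_integrable => // e _; rewrite /= -EFinM E mulKf//.
  by rewrite expf_neq0// gt_eqF.
by apply: etrans (esym (RintegralZl (a ^+ n) measurableT I)) _; apply: eq_Rintegral => e _; rewrite E.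
Qed.

Let h_spec b r : 0 < b ->
  leb.-integrable setT (EFin \o h b r) /\ riesz_ft_axis n b r = \int[leb]_a h b r a.
Proof.
move=> b0; have I := @integrable_riesz_ft_axis R n b r b0.
have mF : measurable_fun setT (fun y : n.+1.-tuple T => cos (r * (thead y : R)) * riesz_weight b y).
  by case/integrableP : I => /measurable_EFinP.
split; last by rewrite /riesz_ft_axis RlamS.
have fin := integrable_lamSP I.
apply: (@Rintegral_fubini_integrable _ _ T _ R leb (lam n)
  (fun a e => cos (r * (thead (tuple_cons (a, e)) : R)) * riesz_weight b (tuple_cons (a, e))) _ fin).
have := measurable_tuple_consE ((measurable_EFinP _ _).2 mF) => /measurable_EFinP.
by apply: eq_measurable_fun => -[].
Qed.

Let h_even b r (a : R) : h b r (- a : R) = h b r a.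
Proof.
apply: eq_Rintegral => e _; rewrite mulrN cosN; congr (_ * _).
by rewrite /riesz_weight !sqT_cons sqrrN.
Qed.

Lemma riesz_ft_gt0_half (b : R) (x : n.+1.-tuple T) : 0 < b -> b <= 2^-1 -> 0 < riesz_ft b x.
Proof.
move=> b0 b12; rewrite riesz_ftE; have := normT_ge0 x; set r := normT x => r0.
have bN : b <= N by apply: (le_trans b12); rewrite (@le_trans _ _ 1)// ?ler1n// invf_le1// ler1n.
have [hi ->] := h_spec r b0; have [_ ->] := Rintegral_even hi (@h_even b r).
(* The case r = 0 has no oscillation; its nonnegative integrand dominates the one for general r and
   justifies Fubini. *)
have [h0i _] := h_spec 0 b0; have [gi _] := Rintegral_even h0i (@h_even b 0).
rewrite pmulr_rgt0//.
have f0 b' r' a e : ~~ (0 < a :> R) -> f b' r' a e = 0.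
  by rewrite -leNgt => a0; rewrite /f (powp_le0 _ a0) mul0r !mulr0.
have fin : (\int[leb]_a \int[lam n]_e `|f b r a e|%:E < +oo)%E.
  apply: (@iter_dom_ae _ _ T _ R leb (lam n) (f b r) _ (@mf b r) gi).
  apply: aeW => a; case: ifPn => a0; last first.
    have -> : f b r a = fun=> 0 by apply/funext => e; exact: f0.
    by split; [exact: integrable0|rewrite normr0 /Rintegral integral0].
  split; first exact: integrable_f.
  rewrite slice//; apply: le_Rintegral => //.
  - by apply: integrable_norm; exact: integrable_f.
  - exact: integrable_f.
  - move=> e _; rewrite /f mul0r cos0 mul1r normrM (ger0_norm (powR_ge0 _ _)).
    apply: ler_wpM2l; rewrite ?powR_ge0// normrM [X in _ * X]ger0_norm; last by rewrite mulr_ge0 ?powp_ge0 ?expR_ge0.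
    by apply: ler_piMl; rewrite ?normr_cos// mulr_ge0 ?powp_ge0 ?expR_ge0.
have -> : \int[leb]_a (if 0 < a then h b r a else 0) = \int[leb]_a \int[lam n]_e f b r a e.
  apply: eq_Rintegral => a _; case: ifPn => a0; first exact: slice.
  have -> : f b r a = fun=> 0 by apply/funext => e; exact: f0.
  by rewrite /Rintegral integral0.
rewrite (Rfubini (@mf b r) fin).
have E (e : n.-tuple T) : 0 < \int[leb]_a f b r a e.
  have k0 : 0 < (1 + sqT e) ^+ 2 by rewrite exprn_gt0.
  rewrite /f RintegralZl//; first by rewrite mulr_gt0 ?powR_gt0// cos_quartic_scale_gt0.
  by apply: integrable_cos (integrable_powp_quartic b0 k0); mfun.
apply: (@Rintegral_gt0 _ _ R (lam n) setT) => //.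
- apply: (@Rintegral_fubini_integrable _ _ _ T R (lam n) leb (fun e a => f b r a e)).
    exact: (measurableT_comp (@mf b r) (@measurable_swap _ _ (n.-tuple T) T)).
  rewrite (@tonelli_swap _ _ _ T R (lam n) leb (fun e a => `|f b r a e|%:E)%E)//.
  apply/measurable_EFinP; apply: measurableT_comp => //.
  exact: (measurableT_comp (@mf b r) (@measurable_swap _ _ (n.-tuple T) T)).
- by move=> e; exact: ltW.
- exact: lam_setT_gt0.
Qed.

End slices.

(** * Spherical averages and their product formula *)

Section zonal.
Context {R : realType} (n : nat).
Hypothesis n1 : (1 < n)%N.
Notation leb := (@lebesgue_measure R).
Notation T := (measurableTypeR R).
Notation lam n := (lebesgue_tuple R n).
Notation mu := (n%:R / 2 - 1 : R).

(** Up to normalisation, the density of one coordinate of a uniform point on the unit sphere of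
    R^(n+1). *)
Definition zonal_weight (a : R) : R := powp mu (1 - a ^+ 2).
(** The density of the squared norm in dimension N = n + 1, as mu + 1/2 = N/2 - 1. *)
Definition zonal_radial (r : R) : R := powp (mu + 2^-1) r.

Let mu0 : 0 <= mu.
Proof. by rewrite subr_ge0 ler_pdivlMr// mul1r ler_nat. Qed.

Lemma zonal_weight_ge0 a : 0 <= zonal_weight a. Proof. exact: powp_ge0. Qed.

Lemma zonal_radial_ge0 r : 0 <= zonal_radial r. Proof. exact: powp_ge0. Qed.

Lemma measurable_zonal_weight : measurable_fun setT zonal_weight.
Proof. by apply: (measurableT_comp (@measurable_powp _ _)); mfun. Qed.

Lemma measurable_zonal_radial : measurable_fun setT zonal_radial.
Proof. exact: measurable_powp. Qed.

Lemma zonal_weight_eq0 a : 1 <= `|a| -> zonal_weight a = 0.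
Proof.
move=> a1; rewrite /zonal_weight powp_le0// subr_le0 -(@real_normK _ a) ?num_real//.
by rewrite exprn_ege1.
Qed.

Lemma zonal_weight_le a : zonal_weight a <= expR 1 * expR (- (1 * a ^+ 2)).
Proof.
have [a1|a1] := leP 1 `|a|; first by rewrite zonal_weight_eq0// mulr_ge0 ?expR_ge0.
have a2 : a ^+ 2 < 1 by rewrite -(@real_normK _ a) ?num_real// expr_lt1.
have a0 := sqr_ge0 a; rewrite /zonal_weight powpE; last by lra.
apply: (@le_trans _ _ 1); last by rewrite -expRD -[leLHS]expR0 ler_expR; lra.
have l : 0 < 1 - a ^+ 2 <= 1 by apply/andP; split; lra.
by have := ger_powR l mu0; rewrite powRr0.
Qed.

Lemma integrable_zonal_weight : leb.-integrable setT (EFin \o zonal_weight).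
Proof.
have G := integrableZl measurableT (expR 1) (@integrable_gauss1 R 1 ltr01).
apply: (@integrable_dom _ T R leb _ (fun a => expR 1 * expR (- (1 * a ^+ 2)))).
- exact: measurable_zonal_weight.
- by apply: eq_integrable G.
- by move=> a; rewrite ger0_norm ?zonal_weight_ge0// zonal_weight_le.
Qed.

Definition zonal_mass : R := \int[leb]_a zonal_weight a.

Lemma zonal_mass_gt0 : 0 < zonal_mass.
Proof.
apply: (@Rintegral_gt0 _ T R leb `]0%R, 1%R[%classic) => //.
- exact: integrable_zonal_weight.
- exact: zonal_weight_ge0.
- by have := @lebesgue_measure_itv R `]0, 1[; rewrite /= lte_fin ltr01 sube0 => ->; rewrite lte_fin.
- move=> a /=; rewrite in_itv/= => /andP[a0 a1]; apply: powp_gt0.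
  by rewrite subr_gt0 expr_lt1// ltW.
Qed.

Lemma integrable_zonal_weightM (F : R -> R) (B : R) : measurable_fun setT F -> (forall a, `|F a| <= B) ->
  leb.-integrable setT (EFin \o (fun a => zonal_weight a * F a)) /\ `|\int[leb]_a (zonal_weight a * F a)| <= zonal_mass * B.
Proof.
move=> mF FB; have m : measurable_fun setT (fun a => zonal_weight a * F a).
  by apply: measurable_funM; [exact: measurable_zonal_weight|].
have I : leb.-integrable setT (EFin \o (fun a => zonal_weight a * B)).
  by have := integrableZr measurableT B integrable_zonal_weight; apply: eq_integrable.
have le a : `|zonal_weight a * F a| <= zonal_weight a * B.
  by rewrite normrM (ger0_norm (zonal_weight_ge0 _)) ler_wpM2l ?zonal_weight_ge0.
split; first exact: (@integrable_dom _ T R leb _ _ m I).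
by rewrite /zonal_mass -RintegralZr//; [exact: (@Rintegral_bound _ T R leb _ _ m I)|exact: integrable_zonal_weight].
Qed.

Let zonal_radialE (r : R) : 0 < r -> zonal_radial r = Num.sqrt r * r `^ mu.
Proof. by move=> r0; rewrite /zonal_radial powpE// addrC powRDp// powR12_sqrt// ltW. Qed.

Section zonal_ereal.
Local Open Scope ereal_scope.

(** A rotation singles out the first coordinate a, and [radial] integrates the other n. The
    substitutions r = a^2 + s and then a = sqrt r a' produce the two densities. *)
Lemma ge0_zonal : exists2 C : R, (0 < C)%R & forall (x : n.+1.-tuple T) (F : R * R -> \bar R),
  measurable_fun setT F -> (forall z, 0 <= F z) ->
  \int[lam n.+1]_y F (dotT x y, sqT y) =
  C%:E * \int[leb]_r ((zonal_radial r)%:E * \int[leb]_a ((zonal_weight a)%:E * F (normT x * (Num.sqrt r * a), r)%R)).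
Proof.
have n0 : (0 < n)%N by exact: ltn_trans n1.
have [C C0 rad] := @radial R n n0; exists C => // x F mF F0; rewrite ge0_integral_rot//.
have mFx d (U : measurableType d) (u v : U -> R) : measurable_fun setT u -> measurable_fun setT v ->
    measurable_fun setT (fun z => F (normT x * u z, v z)%R).
  move=> m1 m2; apply: (measurableT_comp mF); apply/measurable_fun_pair => //=.
  exact: measurable_funM.
rewrite lamS; last 2 first.
- by apply: mFx; [exact: measurable_thead|exact: measurable_sqT].
- by move=> y; exact: F0.
pose G (a r : R) := (powp mu (r - a ^+ 2))%:E * F (normT x * a, r)%R.
have G0 a r : 0 <= G a r by rewrite mule_ge0// lee_fin powp_ge0.
have mG : measurable_fun setT (fun z : T * T => G z.1 z.2).
  apply: emeasurable_funM; last by apply: mFx; mfun.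
  by apply/measurable_EFinP; apply: (measurableT_comp (@measurable_powp _ _)); mfun.
transitivity (\int[leb]_a (C%:E * \int[leb]_r G a r)).
  apply: eq_integral => a _.
  under eq_integral => e _ do rewrite sqT_cons theadE.
  rewrite (rad (fun s => F (normT x * a, a ^+ 2 + s)%R)); last 2 first.
  - by apply: mFx; mfun.
  - by move=> s; exact: F0.
  apply: (congr1 (mule C%:E)).
  have mGa : measurable_fun setT (fun s : R => (powp mu s)%:E * F (normT x * a, a ^+ 2 + s)%R).
    apply: emeasurable_funM; first by apply/measurable_EFinP; exact: measurable_powp.
    by apply: mFx; mfun.
  have k1 : (1 != 0 :> R)%R by exact: oner_neq0.
  have := ge0_integral_affine (- a ^+ 2)%R k1 mGa; rewrite normr1 invr1 mul1e => <-; last first.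
    by move=> s; rewrite mule_ge0// lee_fin powp_ge0.
  by apply: eq_integral => r _; rewrite mul1r subrKC.
transitivity (C%:E * \int[leb]_a \int[leb]_r G a r).
  have mI := @measurable_integral_snd _ _ T T R leb G mG G0.
  have I0 a : 0 <= \int[leb]_r G a r by exact: integral_ge0.
  have C0' : 0 <= C%:E by rewrite lee_fin ltW.
  exact: (@ge0_integral_mull _ T R leb _ _ mI I0 C0').
congr (_ * _); rewrite (@tonelli_swap _ _ T T R leb leb G mG G0).
apply: eq_integral => r _; have [r0|r0] := leP r 0%R.
  rewrite /zonal_radial powp_le0// mul0e integral0_eq// => a _.
  by rewrite /G powp_le0 ?mul0e//; have := sqr_ge0 a; lra.
have s0 : (0 < Num.sqrt r)%R by rewrite sqrtr_gt0.
have mGr : measurable_fun setT (G ^~ r) by exact: (measurable_curry2 r mG).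
rewrite (ge0_integral_scale s0 mGr (fun a => G0 a r)).
have E a : G (Num.sqrt r * a)%R r = (r `^ mu)%:E * ((zonal_weight a)%:E * F (normT x * (Num.sqrt r * a), r)%R).
  rewrite /G muleA -EFinM; congr (_%:E * _).
  rewrite exprMn sqr_sqrtr ?(ltW r0)// /zonal_weight -powpM//; congr powp; ring.
under eq_integral do rewrite E.
clear rad; rewrite ge0_integral_mull; last 3 first.
- apply: emeasurable_funM; first by apply/measurable_EFinP; exact: measurable_zonal_weight.
  by apply: mFx; mfun.
- by move=> a; rewrite mule_ge0// lee_fin zonal_weight_ge0.
- by rewrite lee_fin powR_ge0.
rewrite muleA -EFinM; congr (_%:E * _).
by rewrite zonal_radialE.
Qed.

End zonal_ereal.

(** One choice of the constant, shared by all uses so that it can be cancelled. *)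
Definition zonal_const : R := projT1 (cid2 ge0_zonal).

Lemma zonal_const_gt0 : 0 < zonal_const. Proof. by rewrite /zonal_const; case: cid2. Qed.

Lemma ge0_zonalE (x : n.+1.-tuple T) (F : R * R -> \bar R) :
  measurable_fun setT F -> (forall z, (0 <= F z)%E) ->
  (\int[lam n.+1]_y F (dotT x y, sqT y) =
  zonal_const%:E * \int[leb]_r ((zonal_radial r)%:E * \int[leb]_a ((zonal_weight a)%:E * F (normT x * (Num.sqrt r * a), r)%R)))%E.
Proof. by rewrite /zonal_const; case: cid2 => C C0 /= h; exact: h. Qed.

Lemma integrable_zonal_radialP (G : R -> R) : measurable_fun setT G -> (forall r, 0 <= G r) ->
  (lam n.+1).-integrable setT (EFin \o (fun y => G (sqT y))) <->
  leb.-integrable setT (EFin \o (fun r => zonal_radial r * G r)).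
Proof.
move=> mG G0.
have mq : measurable_fun setT (fun r => zonal_radial r * G r) by apply: measurable_funM => //; exact: measurable_zonal_radial.
have E : (\int[lam n.+1]_y (G (sqT y))%:E = (zonal_const * zonal_mass)%:E * \int[leb]_r (zonal_radial r * G r)%:E)%E.
  rewrite (@ge0_zonalE (zT _) (fun z => (G z.2)%:E)); last 2 first.
  - by apply/measurable_EFinP; apply: (measurableT_comp mG); mfun.
  - by move=> z; rewrite lee_fin.
  rewrite EFinM -muleA; congr (_ * _)%E.
  rewrite -ge0_integral_mull; last 3 first.
  - exact/measurable_EFinP.
  - by move=> r; rewrite lee_fin mulr_ge0 ?zonal_radial_ge0.
  - by rewrite lee_fin ltW ?zonal_mass_gt0.
  apply: eq_integral => r _ /=; rewrite ge0_integral_mulr; last 3 first.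
  - by apply/measurable_EFinP; exact: measurable_zonal_weight.
  - by move=> a; rewrite lee_fin zonal_weight_ge0.
  - by rewrite lee_fin.
  by rewrite -RintE ?integrable_zonal_weight// -/zonal_mass EFinM muleCA.
split=> I; apply: integrable_ge0P => //.
- by move=> r; rewrite mulr_ge0 ?zonal_radial_ge0.
- have := integrable_lty_fin I (fun y => G0 _); rewrite E.
  have p0 : (0 < (zonal_const * zonal_mass)%:E :> \bar R)%E by rewrite lte_fin mulr_gt0 ?zonal_const_gt0 ?zonal_mass_gt0.
  have : (0 <= \int[leb]_r (zonal_radial r * G r)%:E)%E.
    by apply: integral_ge0 => r _; rewrite lee_fin mulr_ge0 ?zonal_radial_ge0.
  by case: (\int[leb]_r _)%E => [v _ _|_|//]; rewrite ?ltry// gt0_muley.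
- exact: (measurableT_comp mG (@measurable_sqT _ _)).
- rewrite E; have /integrableP[_] := I.
  under eq_integral => r _ do rewrite /= ger0_norm ?mulr_ge0 ?zonal_radial_ge0//.
  have : (0 <= \int[leb]_r (zonal_radial r * G r)%:E)%E.
    by apply: integral_ge0 => r _; rewrite lee_fin mulr_ge0 ?zonal_radial_ge0.
  by case: (\int[leb]_r _)%E => [v _ _| |//]; rewrite ?ltry// ltxx.
Qed.

(* Both F + G and G are nonnegative, so the signed case follows by subtraction. *)
Lemma zonal (x : n.+1.-tuple T) (F : R -> R -> R) (G : R -> R) :
  measurable_fun setT (fun z : R * R => F z.1 z.2) -> measurable_fun setT G ->
  (forall u r, `|F u r| <= G r) ->
  (lam n.+1).-integrable setT (EFin \o (fun y => G (sqT y))) ->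
  \int[lam n.+1]_y F (dotT x y) (sqT y) =
  zonal_const * \int[leb]_r (zonal_radial r * \int[leb]_a (zonal_weight a * F (normT x * (Num.sqrt r * a)) r)).
Proof.
move=> mF mG FG I; have G0 r : 0 <= G r by apply: le_trans (FG 0 r).
have Iq := (integrable_zonal_radialP mG G0).1 I.
have mFG : measurable_fun setT (fun z : R * R => F z.1 z.2 + G z.2).
  by apply: measurable_funD => //; apply: (measurableT_comp mG); mfun.
have ge (z : R * R) : (0 <= (F z.1 z.2 + G z.2)%:E :> \bar R)%E.
  by rewrite lee_fin; have := FG z.1 z.2; rewrite ler_norml => /andP[]; lra.
have mF2 d (U : measurableType d) (u v : U -> R) : measurable_fun setT u -> measurable_fun setT v ->
    measurable_fun setT (fun z => F (u z) (v z)).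
  move=> m1 m2; have m12 : measurable_fun setT (fun z => (u z, v z)).
    by apply/measurable_fun_pair.
  exact: (measurableT_comp mF m12).
have mFy : measurable_fun setT (fun y : n.+1.-tuple T => F (dotT x y) (sqT y)).
  by apply: mF2; [exact: measurable_dotT|exact: measurable_sqT].
have IF : (lam n.+1).-integrable setT (EFin \o (fun y => F (dotT x y) (sqT y))).
  by apply: (integrable_dom mFy I) => y; exact: FG.
pose A (r : R) := \int[leb]_a (zonal_weight a * F (normT x * (Num.sqrt r * a)) r).
have mFr (r : R) : measurable_fun setT (fun a : R => F (normT x * (Num.sqrt r * a)) r).
  by apply: mF2; mfun.
have hA (r : R) := integrable_zonal_weightM (mFr r) (fun a => FG _ r).
have mA : measurable_fun setT A.
  apply: (@measurable_Rintegral_snd _ _ T T R leb (fun r a => zonal_weight a * F (normT x * (Num.sqrt r * a)) r)).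
  apply: measurable_funM; first by apply: (measurableT_comp measurable_zonal_weight); mfun.
  apply: mF2; last by mfun.
  apply: measurable_funM; first by mfun.
  apply: measurable_funM; last by mfun.
  by apply: (measurableT_comp (continuous_measurable_fun (@sqrt_continuous R))); mfun.
have IA : leb.-integrable setT (EFin \o (fun r => zonal_radial r * A r)).
  have J := integrableZl measurableT zonal_mass Iq.
  apply: (@integrable_dom _ T R leb _ (fun r => zonal_mass * (zonal_radial r * G r))).
  - by apply: measurable_funM => //; exact: measurable_zonal_radial.
  - by apply: eq_integrable J.
  - move=> r; rewrite normrM (ger0_norm (zonal_radial_ge0 _)) mulrCA; apply: ler_wpM2l; first exact: zonal_radial_ge0.
    exact: (hA r).2.
have IPG : leb.-integrable setT (EFin \o (fun r => zonal_mass * (zonal_radial r * G r))).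
  by have := integrableZl measurableT zonal_mass Iq; apply: eq_integrable.
have EG : \int[lam n.+1]_y G (sqT y) = zonal_const * (zonal_mass * \int[leb]_r (zonal_radial r * G r)).
  apply: EFin_inj; rewrite RintE//.
  rewrite (@ge0_zonalE x (fun z => (G z.2)%:E)); last 2 first.
  - by apply/measurable_EFinP; apply: (measurableT_comp mG); mfun.
  - by move=> z; rewrite lee_fin.
  rewrite EFinM; congr (_ * _)%E; rewrite -RintegralZl// RintE//.
  apply: eq_integral => r _ /=; rewrite ge0_integral_mulr; last 3 first.
  - by apply/measurable_EFinP; exact: measurable_zonal_weight.
  - by move=> a; rewrite lee_fin zonal_weight_ge0.
  - by rewrite lee_fin.
  by rewrite -RintE ?integrable_zonal_weight// -/zonal_mass -!EFinM; congr EFin; ring.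
have EFG : \int[lam n.+1]_y (F (dotT x y) (sqT y) + G (sqT y)) =
    zonal_const * \int[leb]_r (zonal_radial r * A r + zonal_mass * (zonal_radial r * G r)).
  apply: EFin_inj; rewrite RintE; last first.
    by have := integrableD measurableT IF I; apply: eq_integrable.
  rewrite (@ge0_zonalE x (fun z => (F z.1 z.2 + G z.2)%:E))//; last exact/measurable_EFinP.
  rewrite EFinM; congr (_ * _)%E; rewrite RintE; last first.
    by have := integrableD measurableT IA IPG; apply: eq_integrable.
  apply: eq_integral => r _ /=.
  have IG : leb.-integrable setT (EFin \o (fun a => zonal_weight a * G r)).
    by have := integrableZr measurableT (G r) integrable_zonal_weight; apply: eq_integrable.
  transitivity ((zonal_radial r)%:E * (\int[leb]_a (zonal_weight a * F (normT x * (Num.sqrt r * a)) r + zonal_weight a * G r))%R%:E)%E.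
    congr (_ * _)%E; rewrite RintE; last first.
      by have := integrableD measurableT (hA r).1 IG; apply: eq_integrable.
    by apply: eq_integral => a _; rewrite -EFinM mulrDr.
  rewrite -EFinM RintegralD//; last exact: (hA r).1.
  by rewrite RintegralZr ?integrable_zonal_weight// -/zonal_mass; congr EFin; rewrite /A; ring.
move: EFG; rewrite RintegralD// RintegralD// EG RintegralZl//.
by rewrite mulrDr => /addIr.
Qed.

End zonal.

(** * Beta integrals *)

Section beta.
Context {R : realType}.
Notation leb := (@lebesgue_measure R).
Notation T := (measurableTypeR R).

Lemma integrable_isom (k c : R) (f : R -> R) : `|k| = 1 ->
  leb.-integrable setT (EFin \o f) -> leb.-integrable setT (EFin \o (fun x : R => f (k * x + c))).
Proof.
move=> k1 /integrableP[/measurable_EFinP mf fi]; have k0 : k != 0 by rewrite -normr_eq0 k1 oner_eq0.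
apply/integrableP; split; first by apply/measurable_EFinP; apply: (measurableT_comp mf); mfun.
have m : measurable_fun setT (fun x : R => `|f x|%:E).
  by apply/measurable_EFinP; exact: measurableT_comp.
by have := ge0_integral_affine c k0 m (fun x => abse_ge0 (f x)%:E); rewrite k1 invr1 mul1e => ->.
Qed.

Lemma integrable_scale (k : R) (f : R -> R) : 0 < k ->
  leb.-integrable setT (EFin \o f) -> leb.-integrable setT (EFin \o (fun x : R => f (k * x))).
Proof.
move=> k0 /integrableP[/measurable_EFinP mf fi].
apply/integrableP; split; first by apply/measurable_EFinP; apply: (measurableT_comp mf); mfun.
have m : measurable_fun setT (fun x : R => `|f x|%:E).
  by apply/measurable_EFinP; exact: measurableT_comp.
move: fi; rewrite (ge0_integral_scale k0 m (fun x => abse_ge0 (f x)%:E)).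
have : (0 <= \int[leb]_x `|f (k * x)|%:E)%E by apply: integral_ge0.
have ke : (0 < k%:E)%E by rewrite lte_fin.
by case: (\int[leb]_x _)%E => [v _ _|_|//]; rewrite ?ltry// gt0_muley.
Qed.

Let bf (p q v : R) : R := powp (p - 1) (1 - v) * powp (q - 1) v.

Let mbf p q : measurable_fun setT (bf p q).
Proof.
by apply: measurable_funM; [apply: (measurableT_comp (@measurable_powp _ _)); mfun|exact: measurable_powp].
Qed.

Let powp_half (p v : R) : 2^-1 <= v -> v <= 1 -> powp (p - 1) v <= 1 + 2 `^ (1 - p).
Proof.
move=> v1 v2; have v0 : 0 < v by lra.
have h2 : 0 <= 2 `^ (1 - p) :> R by exact: powR_ge0.
rewrite powpE//; have [p1|p1] := leP 1 p.
  have l : 0 < v <= 1 by rewrite v0.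
  by have p0 : 0 <= p - 1 by [lra]; have := ger_powR l p0; rewrite powRr0; lra.
have q0 : 0 <= 1 - p by lra.
apply: (@le_trans _ _ (2 `^ (1 - p))); last by lra.
rewrite (_ : p - 1 = - (1 - p)); last by ring.
rewrite -powRV ?(ltW v0)// ge0_ler_powR ?nnegrE ?invr_ge0 ?(ltW v0)//.
by rewrite -[leRHS]invrK lef_pV2 ?posrE ?invr_gt0.
Qed.

Let bf_half (p q v : R) : 0 <= v -> v <= 2^-1 -> bf p q v <=
  (1 + 2 `^ (1 - p)) * expR 1 * (powp (q - 1) v * expR (- (1 * v))).
Proof.
move=> v0 v1; have P0 := powp_ge0 (q - 1) v.
have h : powp (p - 1) (1 - v) <= 1 + 2 `^ (1 - p) by apply: powp_half; lra.
have e1 : 1 <= expR 1 * expR (- (1 * v)) by rewrite -expRD -[leLHS]expR0 ler_expR; lra.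
rewrite [leRHS](_ : _ = (1 + 2 `^ (1 - p)) * (expR 1 * expR (- (1 * v))) * powp (q - 1) v); last by ring.
apply: ler_wpM2r => //; apply: (le_trans h); apply: ler_peMr => //.
Qed.

(** Each half of [0, 1] carries one singularity, dominated by a Gamma integrand; v -> 1 - v
    exchanges the halves. *)
Lemma integrable_beta (p q : R) : 0 < p -> 0 < q -> leb.-integrable setT (EFin \o bf p q).
Proof.
move=> p0 q0.
pose k1 : R := (1 + 2 `^ (1 - p)) * expR 1; pose k2 : R := (1 + 2 `^ (1 - q)) * expR 1.
pose g1 (v : R) : R := powp (q - 1) v * expR (- (1 * v)).
pose g2 (v : R) : R := powp (p - 1) v * expR (- (1 * v)).
have k10 : 0 <= k1 by rewrite mulr_ge0 ?expR_ge0 ?addr_ge0 ?powR_ge0.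
have k20 : 0 <= k2 by rewrite mulr_ge0 ?expR_ge0 ?addr_ge0 ?powR_ge0.
have N1 : `|-1| = 1 :> R by rewrite normrN1.
have G1 := integrableZl measurableT k1 (integrable_gamma q0 ltr01).
have G2 := integrableZl measurableT k2 (integrable_isom 1 N1 (integrable_gamma p0 ltr01)).
have G := integrableD measurableT G1 G2.
have g10 v : 0 <= g1 v by rewrite mulr_ge0 ?powp_ge0 ?expR_ge0.
have g20 v : 0 <= g2 v by rewrite mulr_ge0 ?powp_ge0 ?expR_ge0.
apply: (@integrable_dom _ T R leb _ (fun v => k1 * g1 v + k2 * g2 (-1 * v + 1))).
- exact: mbf.
- by apply: eq_integrable G.
- move=> v; rewrite ger0_norm; last by rewrite mulr_ge0 ?powp_ge0.
  have e1 : 0 <= k1 * g1 v by rewrite mulr_ge0.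
  have e2 : 0 <= k2 * g2 (-1 * v + 1) by rewrite mulr_ge0.
  have [v0|v0] := leP v 0; first by rewrite /bf (powp_le0 _ v0) mulr0 addr_ge0.
  have [v1|v1] := leP v 2^-1.
    have := bf_half p q (ltW v0) v1; rewrite -/k1 -/(g1 v); lra.
  have [v2|v2] := leP 1 v.
    by rewrite /bf powp_le0 ?mul0r ?addr_ge0// subr_le0.
  have h1 : 0 <= 1 - v by lra.
  have h2 : 1 - v <= 2^-1 by lra.
  have := bf_half q p h1 h2; rewrite -/k2.
  rewrite [bf q p _](_ : _ = bf p q v); last by rewrite /bf subKr mulrC.
  by rewrite (_ : 1 - v = -1 * v + 1) -/(g2 _); lra.
Qed.

(** Substituting s = t + (u - t) v leaves the Beta integral B. Up to constants this is the semigroup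
    law of the kernels of fractional integration. *)
Lemma beta_conv (p q : R) : 0 < p -> 0 < q -> exists2 B : R, 0 < B & forall t u : R,
  leb.-integrable setT (EFin \o (fun s => powp (p - 1) (u - s) * powp (q - 1) (s - t))) /\
  \int[leb]_s (powp (p - 1) (u - s) * powp (q - 1) (s - t)) = B * powp (p + q - 1) (u - t).
Proof.
move=> p0 q0; have I := integrable_beta p0 q0.
exists (\int[leb]_v bf p q v).
  apply: (@Rintegral_gt0 _ T R leb `]0%R, 1%R[%classic) => //.
  - by move=> v; rewrite mulr_ge0 ?powp_ge0.
  - by have := @lebesgue_measure_itv R `]0, 1[; rewrite /= lte_fin ltr01 sube0 => ->; rewrite lte_fin.
  - move=> v /=; rewrite in_itv/= => /andP[v0 v1].
    by rewrite mulr_gt0 ?powp_gt0// subr_gt0.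
move=> t u; have [ut|tu] := leP u t.
  have E : (fun s => powp (p - 1) (u - s) * powp (q - 1) (s - t)) = fun=> 0.
    apply/funext => s; have [us|su] := leP (u - s) 0; first by rewrite (powp_le0 _ us) mul0r.
    by rewrite [X in _ * X]powp_le0 ?mulr0//; lra.
  rewrite E; split; first exact: integrable0.
  by rewrite /Rintegral integral0 powp_le0 ?mulr0//; lra.
have k0 : 0 < u - t by lra.
have ki : 0 < (u - t)^-1 by rewrite invr_gt0.
have n1 : `|1| = 1 :> R by rewrite normr1.
have Es s : powp (p - 1) (u - s) * powp (q - 1) (s - t) =
    (u - t) `^ (p + q - 2) * bf p q ((u - t)^-1 * (1 * s - t)).
  rewrite mul1r; set v := _^-1 * _.
  have e1 : u - s = (u - t) * (1 - v) by rewrite /v; field; rewrite gt_eqF.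
  have e2 : s - t = (u - t) * v by rewrite /v; field; rewrite gt_eqF.
  clearbody v; rewrite /bf e1 e2 !powpM// (_ : p + q - 2 = (p - 1) + (q - 1)); last by ring.
  by rewrite (powRDp (p - 1) (q - 1) k0); ring.
have J := integrableZl measurableT ((u - t) `^ (p + q - 2)) (integrable_isom (- t) n1 (integrable_scale ki I)).
split; first by apply: eq_integrable J => // s _; rewrite /= Es EFinM.
under eq_Rintegral do rewrite Es.
rewrite RintegralZl//; last exact: (integrable_isom (- t) n1 (integrable_scale ki I)).
have msc : measurable_fun setT (fun v : R => bf p q ((u - t)^-1 * v)).
  by apply: (measurableT_comp (@mbf p q)); mfun.
rewrite (@Rintegral_isom R 1 (- t) (fun v => bf p q ((u - t)^-1 * v)) n1 msc).
rewrite (Rintegral_scale k0 msc) mulrA [RHS]mulrC; congr (_ * _).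
  by rewrite powpE// -{2}(powRr1 (ltW k0)) -powRDp//; congr (_ `^ _); ring.
by apply: eq_Rintegral => v _; rewrite mulrA mulVf ?mul1r// gt_eqF.
Qed.

End beta.

(** * Averages over directions and the square of Y *)

Section sphere.
Context {R : realType} (n : nat).
Hypothesis n1 : (1 < n)%N.
Notation leb := (@lebesgue_measure R).
Notation T := (measurableTypeR R).
Notation lam n := (lebesgue_tuple R n).
Notation mu := (n%:R / 2 - 1 : R).
Notation zonal_weight := (@zonal_weight R n).
Notation zonal_radial := (@zonal_radial R n).
Notation zonal_mass := (@zonal_mass R n).
Notation zonal_const := (@zonal_const R n n1).

Let mu0 : 0 <= mu.
Proof. by rewrite subr_ge0 ler_pdivlMr// mul1r ler_nat. Qed.

Lemma dotT_aff k (x z y : n.+1.-tuple T) : dotT x (affT k z y) = k * dotT x y + dotT x z.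
Proof.
rewrite /dotT mulr_sumr -big_split/=; apply: eq_bigr => i _.
by rewrite tnth_mktuple; ring.
Qed.

Lemma sqT_aff k (z y : n.+1.-tuple T) : sqT (affT k z y) = k ^+ 2 * sqT y + 2 * k * dotT z y + sqT z.
Proof.
rewrite /sqT /dotT !mulr_sumr -!big_split/=; apply: eq_bigr => i _.
by rewrite tnth_mktuple; ring.
Qed.

(** The function Y of the overview; by Poisson's integral a multiple of z^(-nu) J_nu(z) with nu = mu
    + 1/2. *)
Definition zonal_ft (z : R) : R := \int[leb]_a (zonal_weight a * cos (z * a)).

Lemma zonal_ft_hyp z : leb.-integrable setT (EFin \o (fun a => zonal_weight a * cos (z * a))) /\
  `|\int[leb]_a (zonal_weight a * cos (z * a))| <= zonal_mass * 1.
Proof.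
apply: (integrable_zonal_weightM n1 (F := fun a => cos (z * a)) (B := 1)); first by mfun.
by move=> a; exact: normr_cos.
Qed.

Lemma zonal_ft_le z : `|zonal_ft z| <= zonal_mass.
Proof. by have [_] := zonal_ft_hyp z; rewrite mulr1. Qed.

Lemma measurable_zonal_ft : measurable_fun setT zonal_ft.
Proof.
apply: (@measurable_Rintegral_snd _ _ T T R leb (fun z a => zonal_weight a * cos (z * a))).
by apply: measurable_funM; [apply: (measurableT_comp (@measurable_zonal_weight R n)); mfun|mfun].
Qed.

(** For |z| <= 1 and |a| < 1 the cosine is positive. Later this makes the integral of a square of Y
    strictly positive. *)
Lemma zonal_ft_gt0 z : `|z| <= 1 -> 0 < zonal_ft z.
Proof.
move=> z1; have cpos a : `|a| < 1 -> 0 < cos (z * a).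
  move=> a1; have : `|z * a| < 1.
    by rewrite normrM (le_lt_trans _ a1)// ler_piMl.
  rewrite ltr_norml => /andP[h1 h2]; apply: cos_gt0_pihalf.
  by have := @pihalf_ge1 R => h; apply/andP; split; lra.
apply: (@Rintegral_gt0 _ T R leb `]0%R, 1%R[%classic) => //.
- exact: (zonal_ft_hyp z).1.
- move=> a; have [a1|a1] := leP 1 `|a|; first by rewrite zonal_weight_eq0// mul0r.
  by rewrite mulr_ge0 ?zonal_weight_ge0// ltW// cpos.
- by have := @lebesgue_measure_itv R `]0, 1[; rewrite /= lte_fin ltr01 sube0 => ->; rewrite lte_fin.
- move=> a /=; rewrite in_itv/= => /andP[a0 a1].
  rewrite mulr_gt0 ?cpos ?gtr0_norm//; apply: powp_gt0.
  by rewrite subr_gt0 expr_lt1// ltW.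
Qed.

Let ga (r : R) : R := expR (- (1 * r)).

Let ga0 r : 0 <= ga r. Proof. exact: expR_ge0. Qed.

Let mga : measurable_fun setT ga. Proof. by rewrite /ga; mfun. Qed.

Let gai : (lam n.+1).-integrable setT (EFin \o (fun y => ga (sqT y))).
Proof. exact: integrable_gaussN. Qed.

Let Gam : R := zonal_const * \int[leb]_r (zonal_radial r * ga r).

Let Gam_gt0 : 0 < Gam.
Proof.
rewrite /Gam mulr_gt0 ?(@zonal_const_gt0 R n n1)//; apply: (@Rintegral_gt0 _ T R leb `]0%R, 1%R[%classic) => //.
- exact: (integrable_zonal_radialP n1 mga ga0).1 gai.
- by move=> r; rewrite mulr_ge0 ?zonal_radial_ge0.
- by have := @lebesgue_measure_itv R `]0, 1[; rewrite /= lte_fin ltr01 sube0 => ->; rewrite lte_fin.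
- by move=> r /=; rewrite in_itv/= => /andP[r0 _]; rewrite mulr_gt0 ?expR_gt0// powp_gt0.
Qed.

(** The average of H(x.theta) over unit vectors theta, realised as a Gaussian integral of a function
    of y/|y|; the radial part contributes [Gam]. *)
Let ang (x : n.+1.-tuple T) (H : R -> R) (B : R) : measurable_fun setT H -> (forall u, `|H u| <= B) ->
  \int[lam n.+1]_y (H (dotT x y / normT y) * ga (sqT y)) = Gam * \int[leb]_a (zonal_weight a * H (normT x * a)).
Proof.
move=> mH HB.
(* The power -1 stands for the inverse: the two agree on nonnegative numbers, and measurability is
   that of [powR]. *)
have mF : measurable_fun setT (fun z : R * R => H (z.1 * (Num.sqrt z.2) `^ (-1)) * ga z.2).
  apply: measurable_funM; last by apply: (measurableT_comp mga); mfun.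
  apply: (measurableT_comp mH); apply: measurable_funM; first by mfun.
  apply: (measurableT_comp (measurable_powR _)).
  by apply: (measurableT_comp (continuous_measurable_fun (@sqrt_continuous R))); mfun.
have mG : measurable_fun setT (fun r => B * ga r) by apply: measurable_funM.
have FG (u r : R) : `|H (u * (Num.sqrt r) `^ (-1)) * ga r| <= B * ga r.
  by rewrite normrM (ger0_norm (ga0 _)) ler_wpM2r.
have IG : (lam n.+1).-integrable setT (EFin \o (fun y => B * ga (sqT y))).
  by have := integrableZl measurableT B gai; apply: eq_integrable.
have := zonal n1 x mF mG FG IG => E.
rewrite [LHS](_ : _ = \int[lam n.+1]_y (H (dotT x y * normT y `^ (-1)) * ga (sqT y))); last first.
  by apply: eq_Rintegral => y _; rewrite powR_inv1 ?normT_ge0.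
rewrite E -mulrA; congr (_ * _).
have mHx : measurable_fun setT (fun a : R => H (normT x * a)) by apply: (measurableT_comp mH); mfun.
have IH := integrable_zonal_weightM n1 mHx (fun a => HB _).
rewrite -(RintegralZr _ measurableT ((integrable_zonal_radialP n1 mga ga0).1 gai)).
apply: eq_Rintegral => r _; have [r0|r0] := leP r 0; first by rewrite /zonal_radial powp_le0// !mul0r.
rewrite -mulrA; congr (_ * _); rewrite -(RintegralZl _ measurableT IH.1).
apply: eq_Rintegral => a _; rewrite mulrA [_ * ga r]mulrC; congr (_ * (_ * H _)).
rewrite powR_inv1 ?sqrtr_ge0//; field.
by rewrite gt_eqF// sqrtr_gt0.
Qed.

Let angY (x : n.+1.-tuple T) : \int[lam n.+1]_y (cos (dotT x y / normT y) * ga (sqT y)) = Gam * zonal_ft (normT x).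
Proof. exact: (ang x (continuous_measurable_fun (@continuous_cos R)) normr_cos). Qed.

Let intga : \int[lam n.+1]_y ga (sqT y) = Gam * zonal_mass.
Proof.
have m1 : measurable_fun setT (fun _ : R => 1 : R) by [].
have := @ang (zT _) (fun=> 1) 1 m1 _.
under eq_Rintegral do rewrite mul1r.
move=> ->; last by move=> u; rewrite normr1.
by congr (_ * _); apply: eq_Rintegral => a _; rewrite mulr1.
Qed.

Section swap.
Variable w : n.+1.-tuple T -> R.
Hypothesis wi : (lam n.+1).-integrable setT (EFin \o w).

Let f (e y : n.+1.-tuple T) : R := w e * (cos (dotT e y / normT y) * ga (sqT y)).

Let mf : measurable_fun setT (fun z => f z.1 z.2).
Proof.
have mw : measurable_fun setT w by case/integrableP : wi => /measurable_EFinP.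
apply: measurable_funM; first by apply: (measurableT_comp mw); mfun.
apply: measurable_funM; last by apply: (measurableT_comp mga); apply: (measurableT_comp (@measurable_sqT _ _)); mfun.
apply: (measurableT_comp (continuous_measurable_fun (@continuous_cos R))).
rewrite (_ : (fun z => _) = fun z : n.+1.-tuple T * n.+1.-tuple T => dotT z.1 z.2 * normT z.2 `^ (-1)).
  apply: measurable_funM; first by apply: measurable_dotT2; mfun.
  apply: (measurableT_comp (measurable_powR _)).
  apply: (measurableT_comp (continuous_measurable_fun (@sqrt_continuous R))).
  by apply: (measurableT_comp (@measurable_sqT _ _)); mfun.
by apply/funext => z; rewrite powR_inv1 ?normT_ge0.
Qed.

Let fin : (\int[lam n.+1]_e \int[lam n.+1]_y `|f e y|%:E < +oo)%E.
Proof.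
apply: (@iter_dom _ _ _ _ R (lam n.+1) (lam n.+1) f (fun e => `|w e|) (fun y => ga (sqT y)) mf) => //.
- exact: integrable_norm.
- move=> e y; rewrite normrM; apply: ler_wpM2l => //.
  by rewrite normrM (ger0_norm (ga0 _)) ler_piMl// normr_cos.
Qed.

Let inner y : (lam n.+1).-integrable setT (EFin \o (fun e => cos (dotT e y / normT y) * w e)).
Proof.
apply: integrable_cos wi; apply: measurable_funM => //.
rewrite (_ : (fun e => _) = dotT y); first exact: measurable_dotT.
by apply/funext => e; rewrite dotTC.
Qed.

(** Exchanges e with the direction of y: an integral of w against direction averages becomes a
    direction average of Fourier integrals of w. *)
Lemma hat_swap : \int[lam n.+1]_e (w e * \int[lam n.+1]_y (cos (dotT e y / normT y) * ga (sqT y))) =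
  \int[lam n.+1]_y (ga (sqT y) * \int[lam n.+1]_e (cos (dotT e y / normT y) * w e)).
Proof.
transitivity (\int[lam n.+1]_e \int[lam n.+1]_y f e y).
  apply: eq_Rintegral => e _; rewrite /f RintegralZl//.
  apply: integrable_cos gai; rewrite (_ : (fun y => _) = fun y => dotT e y * normT y `^ (-1)).
    apply: measurable_funM; first exact: measurable_dotT.
    apply: (measurableT_comp (measurable_powR _)).
    by apply: (measurableT_comp (continuous_measurable_fun (@sqrt_continuous R))); exact: measurable_sqT.
  by apply/funext => y; rewrite powR_inv1 ?normT_ge0.
rewrite (Rfubini mf fin); apply: eq_Rintegral => y _; rewrite -RintegralZl//.
by apply: eq_Rintegral => e _; rewrite /f; ring.
Qed.

Lemma measurable_hat : measurable_fun setT
  (fun y => ga (sqT y) * \int[lam n.+1]_e (cos (dotT e y / normT y) * w e)).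
Proof.
have := @measurable_Rintegral_snd _ _ _ _ R (lam n.+1) (fun y e => f e y)
  (measurableT_comp mf (@measurable_swap _ _ (n.+1.-tuple T) (n.+1.-tuple T))).
apply: eq_measurable_fun => y _; rewrite -RintegralZl//.
by apply: eq_Rintegral => e _; rewrite /f; ring.
Qed.

End swap.

Section square.
Variable h : R -> R.
Hypotheses (mh : measurable_fun setT h) (h0 : forall r, 0 <= h r).
Hypothesis hi : (lam n.+1).-integrable setT (EFin \o (fun y => h (sqT y))).

Let hq : leb.-integrable setT (EFin \o (fun r => zonal_radial r * h r)).
Proof. exact: (integrable_zonal_radialP n1 mh h0).1 hi. Qed.

(** The Hankel transform of h in the variable s = |V|^2; [fourier_zonal] relates it to the Fourier
    transform of h(|e|^2). *)
Let K (s : R) : R := \int[leb]_r (zonal_radial r * h r * zonal_ft (Num.sqrt s * Num.sqrt r)).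

Let mf : measurable_fun setT (fun z : T * T => zonal_radial z.2 * h z.2 * zonal_ft (Num.sqrt (z.1 : R) * Num.sqrt (z.2 : R))).
Proof.
apply: measurable_funM.
  apply: measurable_funM; first by apply: (measurableT_comp (@measurable_zonal_radial R n)); mfun.
  by apply: (measurableT_comp mh); mfun.
apply: (measurableT_comp measurable_zonal_ft); apply: measurable_funM;
  by apply: (measurableT_comp (continuous_measurable_fun (@sqrt_continuous R))); mfun.
Qed.

Let mK : measurable_fun setT K.
Proof. exact: (@measurable_Rintegral_snd _ _ T T R leb _ mf). Qed.

Let BK : R := \int[leb]_r (zonal_radial r * h r * zonal_mass).

Let hqP : leb.-integrable setT (EFin \o (fun r => zonal_radial r * h r * zonal_mass)).
Proof. by have := integrableZr measurableT zonal_mass hq; apply: eq_integrable. Qed.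

Let K_le s : `|K s| <= BK.
Proof.
have m := @measurable_curry1 _ _ T T _ R
  (fun s r => zonal_radial r * h r * zonal_ft (Num.sqrt (s : R) * Num.sqrt (r : R))) (s : T) mf.
apply: (@Rintegral_bound _ T R leb _ _ m hqP) => r.
by rewrite normrM [X in X * _]ger0_norm ?mulr_ge0 ?zonal_radial_ge0// ler_wpM2l ?mulr_ge0 ?zonal_radial_ge0// zonal_ft_le.
Qed.

Lemma fourier_zonal (V : n.+1.-tuple T) :
  \int[lam n.+1]_e (cos (dotT V e) * h (sqT e)) = zonal_const * K (sqT V).
Proof.
have mF : measurable_fun setT (fun z : R * R => cos z.1 * h z.2).
  by apply: measurable_funM; [mfun|apply: (measurableT_comp mh); mfun].
have FG (u r : R) : `|cos u * h r| <= h r by rewrite normrM (ger0_norm (h0 _)) ler_piMl// normr_cos.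
rewrite (zonal n1 V mF mh FG hi); congr (_ * _); apply: eq_Rintegral => r _.
rewrite -mulrA; congr (_ * _).
rewrite /zonal_ft -(RintegralZl _ measurableT (zonal_ft_hyp _).1); apply: eq_Rintegral => a _.
rewrite (_ : normT V * (Num.sqrt r * a) = Num.sqrt (sqT V) * Num.sqrt r * a); first by ring.
by rewrite /normT mulrA.
Qed.

(** Y(|e|) is proportional to the average of cos(e.theta) over unit vectors theta. A product of two
    such averages is the average over pairs of cos(e.(theta + theta')), and |theta + theta'|^2 = 2 +
    2 theta.theta'. Integration against h(|e|^2) gives K, and theta.theta' has density
    [zonal_weight] up to normalisation. *)
Lemma zonal_ft_square : \int[leb]_r (zonal_radial r * h r * zonal_ft (Num.sqrt r) ^+ 2) = \int[leb]_a (zonal_weight a * K (2 + 2 * a)).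
Proof.
set A := RHS.
have mY : measurable_fun setT (fun e : n.+1.-tuple T => zonal_ft (normT e)).
  apply: (measurableT_comp measurable_zonal_ft).
  by apply: (measurableT_comp (continuous_measurable_fun (@sqrt_continuous R))); exact: measurable_sqT.
have w1i : (lam n.+1).-integrable setT (EFin \o (fun e => h (sqT e) * (Gam * zonal_ft (normT e)))).
  have J := integrableZr measurableT (Gam * zonal_mass) hi.
  apply: (@integrable_dom _ _ _ _ _ (fun e => h (sqT e) * (Gam * zonal_mass))).
  - apply: measurable_funM; first exact: (measurableT_comp mh (@measurable_sqT _ _)).
    by apply: measurable_funM.
  - by apply: eq_integrable J.
  - move=> e; rewrite normrM (ger0_norm (h0 _)) normrM (gtr0_norm Gam_gt0).
    by rewrite ler_wpM2l// ler_wpM2l ?(ltW Gam_gt0)// zonal_ft_le.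
have L1 : \int[lam n.+1]_e (h (sqT e) * zonal_ft (normT e) ^+ 2) = zonal_const * (zonal_mass * \int[leb]_r (zonal_radial r * h r * zonal_ft (Num.sqrt r) ^+ 2)).
  have mF : measurable_fun setT (fun z : R * R => h z.2 * zonal_ft (Num.sqrt z.2) ^+ 2).
    apply: measurable_funM; first by apply: (measurableT_comp mh); mfun.
    apply: measurable_funX; apply: (measurableT_comp measurable_zonal_ft).
    by apply: (measurableT_comp (continuous_measurable_fun (@sqrt_continuous R))); mfun.
  have mG : measurable_fun setT (fun r => h r * zonal_mass ^+ 2) by apply: measurable_funM.
  have FG (u r : R) : `|h r * zonal_ft (Num.sqrt r) ^+ 2| <= h r * zonal_mass ^+ 2.
    rewrite normrM (ger0_norm (h0 _)) ler_wpM2l// normrX.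
    by rewrite lerXn2r ?nnegrE ?(ltW (@zonal_mass_gt0 R n n1)) ?zonal_ft_le.
  have IG : (lam n.+1).-integrable setT (EFin \o (fun y => h (sqT y) * zonal_mass ^+ 2)).
    by have := integrableZr measurableT (zonal_mass ^+ 2) hi; apply: eq_integrable.
  have := zonal n1 (zT _) mF mG FG IG => /= ->; congr (_ * _).
  have I2 : leb.-integrable setT (EFin \o (fun r => zonal_radial r * h r * zonal_ft (Num.sqrt r) ^+ 2)).
    have J := integrableZr measurableT (zonal_mass ^+ 2) hq.
    apply: (@integrable_dom _ T R leb _ (fun r => zonal_radial r * h r * zonal_mass ^+ 2)).
    - apply: measurable_funM; first by apply: measurable_funM => //; exact: measurable_zonal_radial.
      apply: measurable_funX; apply: (measurableT_comp measurable_zonal_ft).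
      by apply: (continuous_measurable_fun (@sqrt_continuous R)).
    - by apply: eq_integrable J.
    - move=> r; rewrite -!mulrA normrM (ger0_norm (zonal_radial_ge0 _ _)) ler_wpM2l ?zonal_radial_ge0//.
      exact: FG 0 r.
  rewrite -(RintegralZl _ measurableT I2); apply: eq_Rintegral => r _.
  by rewrite RintegralZr ?(@integrable_zonal_weight R n n1)// -/zonal_mass; ring.
(* The two factors Y(|e|) are replaced in turn by Gaussian averages over directions, with [hat_swap]
   after each replacement. *)
have L2 : Gam ^+ 2 * \int[lam n.+1]_e (h (sqT e) * zonal_ft (normT e) ^+ 2) = Gam * zonal_mass * (Gam * (zonal_const * A)).
  have I2 : (lam n.+1).-integrable setT (EFin \o (fun e => h (sqT e) * zonal_ft (normT e) ^+ 2)).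
    have J := integrableZr measurableT (zonal_mass ^+ 2) hi.
    apply: (@integrable_dom _ _ _ _ _ (fun e => h (sqT e) * zonal_mass ^+ 2)).
    - apply: measurable_funM; first exact: (measurableT_comp mh (@measurable_sqT _ _)).
      exact: measurable_funX.
    - by apply: eq_integrable J.
    - move=> e; rewrite normrM (ger0_norm (h0 _)) ler_wpM2l// normrX.
      by rewrite lerXn2r ?nnegrE ?(ltW (@zonal_mass_gt0 R n n1)) ?zonal_ft_le.
  rewrite -(RintegralZl _ measurableT I2).
  transitivity (\int[lam n.+1]_e (h (sqT e) * (Gam * zonal_ft (normT e)) *
      \int[lam n.+1]_y (cos (dotT e y / normT y) * ga (sqT y)))).
    by apply: eq_Rintegral => e _; rewrite angY; ring.
  rewrite (hat_swap w1i) -intga -RintegralZr//.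
  apply: (@ae_eq_Rintegral _ _ R (lam n.+1)).
  - exact: (measurable_hat w1i).
  - by apply: measurable_funM => //; apply: (measurableT_comp mga); exact: measurable_sqT.
  apply: filterS (sqT_ae n) => y y0; congr (_ * _).
  have w2i : (lam n.+1).-integrable setT (EFin \o (fun e => cos (dotT e y / normT y) * h (sqT e))).
    apply: integrable_cos hi; apply: measurable_funM => //.
    rewrite (_ : (fun e => _) = dotT y); first exact: measurable_dotT.
    by apply/funext => e; rewrite dotTC.
  transitivity (\int[lam n.+1]_e (cos (dotT e y / normT y) * h (sqT e) *
      \int[lam n.+1]_z (cos (dotT e z / normT z) * ga (sqT z)))).
    by apply: eq_Rintegral => e _; rewrite angY mulrA.
  rewrite (hat_swap w2i).
  pose v := affT (normT y)^-1 (zT _) y.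
  have ny : 0 < normT y by exact: normT_gt0.
  have dv e : dotT e v = dotT e y / normT y by rewrite dotT_dil mulrC.
  have v1 : sqT v = 1 by rewrite sqT_dil -normT_sqr exprVn mulVf// gt_eqF// exprn_gt0.
  have nv : normT v = 1 by rewrite /normT v1 sqrtr1.
  clearbody v.
  (* From 2 cos A cos B = cos(A + B) + cos(A - B): for the unit vectors v and z/|z| with inner
     product u, the squared norms of their sum and difference are 2 + 2u and 2 - 2u. *)
  pose H (u : R) : R := zonal_const / 2 * (K (2 + 2 * u) + K (2 - 2 * u)).
  have mH : measurable_fun setT H.
    apply: measurable_funM => //; apply: measurable_funD; apply: (measurableT_comp mK); mfun.
  have zonal_const0 : 0 <= zonal_const / 2 by rewrite divr_ge0 ?(ltW (@zonal_const_gt0 R n n1)).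
  have HB u : `|H u| <= zonal_const / 2 * (BK + BK).
    rewrite normrM (ger0_norm zonal_const0) ler_wpM2l// (le_trans (ler_normD _ _))//.
    by apply: lerD; exact: K_le.
  transitivity (\int[lam n.+1]_z (H (dotT v z / normT z) * ga (sqT z))).
    apply: (@ae_eq_Rintegral _ _ R (lam n.+1)).
    - exact: (measurable_hat w2i).
    - apply: measurable_funM; last by apply: (measurableT_comp mga); exact: measurable_sqT.
      apply: (measurableT_comp mH); rewrite (_ : (fun z => _) = fun z => dotT v z * normT z `^ (-1)).
        apply: measurable_funM; first exact: measurable_dotT.
        apply: (measurableT_comp (measurable_powR _)).
        by apply: (measurableT_comp (continuous_measurable_fun (@sqrt_continuous R))); exact: measurable_sqT.
      by apply/funext => z; rewrite powR_inv1 ?normT_ge0.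
    apply: filterS (sqT_ae n) => z z0; rewrite mulrC; congr (_ * _).
    have nz : 0 < normT z by exact: normT_gt0.
    have sV k : k ^+ 2 * sqT z = 1 -> sqT (affT k v z) = 2 + 2 * (k * dotT v z).
      by move=> k1; rewrite sqT_aff v1 k1; ring.
    have kz : ((normT z)^-1) ^+ 2 * sqT z = 1.
      by rewrite -normT_sqr exprVn mulVf// gt_eqF// exprn_gt0.
    have kz' : (- (normT z)^-1) ^+ 2 * sqT z = 1 by rewrite sqrrN.
    have Vi (V : n.+1.-tuple T) : (lam n.+1).-integrable setT (EFin \o (fun e => cos (dotT V e) * h (sqT e))).
      by apply: integrable_cos hi; exact: measurable_dotT.
    transitivity (2^-1 * (\int[lam n.+1]_e (cos (dotT (affT (normT z)^-1 v z) e) * h (sqT e)) +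
        \int[lam n.+1]_e (cos (dotT (affT (- (normT z)^-1) v z) e) * h (sqT e)))); last first.
      rewrite !fourier_zonal (sV _ kz) (sV _ kz') /H.
      rewrite (_ : 2 + 2 * ((normT z)^-1 * dotT v z) = 2 + 2 * (dotT v z / normT z)); last by ring.
      rewrite (_ : 2 + 2 * (- (normT z)^-1 * dotT v z) = 2 - 2 * (dotT v z / normT z)); last by ring.
      move: (K (2 + _)) (K (2 - _)) zonal_const => k1 k2 c.
      by field.
    rewrite -(RintegralD measurableT (Vi _) (Vi _)) -RintegralZl//; last first.
      by have := integrableD measurableT (Vi (affT (normT z)^-1 v z)) (Vi (affT (- (normT z)^-1) v z)); apply: eq_integrable.
    apply: eq_Rintegral => e _; rewrite !(dotTC (affT _ _ _)) !dotT_aff dv mulNr !cosD.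
    rewrite cosN sinN (mulrC (normT z)^-1).
    move: (cos _) (sin _) (cos _) (sin _) (h _) => c1 s1 c2 s2 k; by field.
  rewrite (ang v mH HB) nv; congr (_ * _).
  have mK1 : measurable_fun setT (fun a : R => K (2 + 2 * a)) by apply: (measurableT_comp mK); mfun.
  have mK2 : measurable_fun setT (fun a : R => K (2 - 2 * a)) by apply: (measurableT_comp mK); mfun.
  have J1 := (integrable_zonal_weightM n1 mK1 (fun a => K_le _)).1.
  have J2 := (integrable_zonal_weightM n1 mK2 (fun a => K_le _)).1.
  (* The reflection a -> -a makes the two halves of H contribute equally. *)
  have A2 : A = \int[leb]_a (zonal_weight a * K (2 - 2 * a)).
    have N1 : `|-1| = 1 :> R by rewrite normrN1.
    have m1 : measurable_fun setT (fun a : R => zonal_weight a * K (2 + 2 * a)).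
      by apply: measurable_funM; [exact: measurable_zonal_weight|exact: mK1].
    rewrite /A; apply: etrans (esym (@Rintegral_isom R (-1) 0 _ N1 m1)) _; apply: eq_Rintegral => a _.
    rewrite addr0 mulN1r /zonal_weight sqrrN; congr (_ * K _); ring.
  transitivity (zonal_const / 2 * (A + \int[leb]_a (zonal_weight a * K (2 - 2 * a)))); last first.
    by rewrite -A2; clear A2; move: A zonal_const => k c; by field.
  have J12 : leb.-integrable setT (EFin \o (fun a : R => zonal_weight a * K (2 + 2 * a) + zonal_weight a * K (2 - 2 * a))).
    by have := integrableD measurableT J1 J2; apply: eq_integrable.
  transitivity (zonal_const / 2 * \int[leb]_a (zonal_weight a * K (2 + 2 * a) + zonal_weight a * K (2 - 2 * a))); last first.
    by congr (_ * _); exact: (RintegralD measurableT J1 J2).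
  rewrite -(RintegralZl _ measurableT J12); apply: eq_Rintegral => a _; rewrite mul1r /H.
  by move: (K (2 + _)) (K (2 - _)) zonal_const (zonal_weight a) => k1 k2 c q; ring.
have alg (g c p a k : R) : 0 < g -> 0 < c -> 0 < p ->
    g ^+ 2 * (c * (p * k)) = g * p * (g * (c * a)) -> k = a.
  move=> g0 c0 p0 e; have k0 : g ^+ 2 * c * p != 0 by rewrite gt_eqF// !mulr_gt0 ?exprn_gt0.
  by apply: (mulfI k0); rewrite -!mulrA in e *; rewrite e; ring.
apply: (alg Gam zonal_const zonal_mass) => //; [exact: zonal_const_gt0|exact: (@zonal_mass_gt0 R n n1)|by rewrite -L1].
Qed.

End square.

End sphere.

Lemma Rintegral_gt0_ae d (U : measurableType d) (R : realType) (m : {measure set U -> \bar R})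
    (D : set U) (f : U -> R) : m.-integrable setT (EFin \o f) ->
  (forall x, 0 <= f x) -> measurable D -> (0 < m D)%E -> {ae m, forall x, D x -> 0 < f x} ->
  0 < \int[m]_x f x.
Proof.
move=> fi f0 mD D0 [A [mA A0 sub]].
apply: (Rintegral_gt0 (D := D `\` A)) => //.
- exact: measurableD.
- rewrite (lt_le_trans D0)//; apply: (@le_trans _ _ (m (D `\` A `|` A))).
    apply: le_measure; rewrite ?inE//; first by apply: measurableU => //; exact: measurableD.
    by move=> x Dx; have [Ax|Ax] := pselect (A x); [right|left].
  apply: le_trans (measureU2 _ _ _) _ => //; first exact: measurableD.
  apply: (@le_trans _ _ (m (D `\` A) + 0)%E); last by rewrite adde0.
  by apply: leeD => //; rewrite le_eqVlt; apply/orP; left; apply/eqP; exact: A0.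
- by move=> x [Dx Ax]; apply: contrapT => fx; apply: Ax; apply: sub => /(_ Dx).
Qed.

(** * Positivity of Fourier integrals of fractional integrals *)

Section product_formula.
Context {R : realType} (n : nat).
Hypothesis n1 : (1 < n)%N.
Notation leb := (@lebesgue_measure R).
Notation T := (measurableTypeR R).
Notation lam n := (lebesgue_tuple R n).
Notation mu := (n%:R / 2 - 1 : R).
Notation zonal_weight := (@zonal_weight R n).
Notation zonal_radial := (@zonal_radial R n).
Notation zonal_mass := (@zonal_mass R n).
Notation zonal_const := (@zonal_const R n n1).
Notation zonal_ft := (@zonal_ft R n).

Let mu0 : 0 <= mu.
Proof. by rewrite subr_ge0 ler_pdivlMr// mul1r ler_nat. Qed.

Let mu1 : 0 < mu + 1. Proof. by rewrite ltr_wpDl. Qed.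

Let msq : measurable_fun setT (@Num.sqrt R).
Proof. exact: (continuous_measurable_fun (@sqrt_continuous R)). Qed.

(** The integral of Y(r sqrt R) against (R (S - R))^mu from the overview, with S = s. *)
Definition zonal_conv (r s : R) : R := \int[leb]_t (powp mu t * powp mu (s - t) * zonal_ft (r * Num.sqrt t)).

Let integrable_zonal_conv0 s : leb.-integrable setT (EFin \o (fun t => powp mu t * powp mu (s - t))) /\
  \int[leb]_t (powp mu t * powp mu (s - t)) = projT1 (cid2 (beta_conv mu1 mu1)) * powp (2 * mu + 1) s.
Proof.
case: cid2 => B B0 /= /(_ 0 s)[I E]; move: I E.
rewrite (_ : mu + 1 - 1 = mu); last by ring.
rewrite (_ : mu + 1 + (mu + 1) - 1 = 2 * mu + 1); last by ring.
rewrite subr0 => I E; split.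
  by apply: eq_integrable I => // t _; rewrite /= subr0 mulrC.
by rewrite -E; apply: eq_Rintegral => t _; rewrite subr0 mulrC.
Qed.

Let integrable_zonal_conv r s :
  leb.-integrable setT (EFin \o (fun t => powp mu t * powp mu (s - t) * zonal_ft (r * Num.sqrt t))).
Proof.
have J := integrableZr measurableT zonal_mass (integrable_zonal_conv0 s).1.
apply: (@integrable_dom _ T R leb _ (fun t => powp mu t * powp mu (s - t) * zonal_mass)).
- apply: measurable_funM.
    apply: measurable_funM; first exact: measurable_powp.
    by apply: (measurableT_comp (@measurable_powp _ _)); mfun.
  by apply: (measurableT_comp (@measurable_zonal_ft R n)); apply: measurable_funM.
- by apply: eq_integrable J.
- move=> t; rewrite normrM [X in X * _]ger0_norm ?mulr_ge0 ?powp_ge0//.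
  by apply: ler_wpM2l; rewrite ?mulr_ge0 ?powp_ge0// zonal_ft_le.
Qed.

Let zonal_conv_le0 r s : s <= 0 -> zonal_conv r s = 0.
Proof.
move=> s0; rewrite /zonal_conv (_ : (fun t => _) = fun=> 0) ?/Rintegral ?integral0//.
apply/funext => t; have [t0|t0] := leP t 0; first by rewrite (powp_le0 _ t0) !mul0r.
by rewrite [powp mu (s - t)]powp_le0 ?mulr0 ?mul0r//; lra.
Qed.

(* a = 2 t / s - 1 *)
Let zonal_conv_sub (r p : R) : 0 < r -> 0 < p ->
  \int[leb]_a (zonal_weight a * zonal_ft (Num.sqrt (2 + 2 * a) * Num.sqrt p)) =
  (r ^+ 2 / (2 * p)) `^ (2 * mu + 1) * zonal_conv r (4 / r ^+ 2 * p).
Proof.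
move=> r0 p0; set s := 4 / r ^+ 2 * p; pose k := r ^+ 2 / (2 * p).
have k0 : 0 < k by rewrite divr_gt0 ?exprn_gt0// mulr_gt0.
have hk : k = r ^+ 2 / (2 * p) by [].
rewrite -hk; clearbody k.
pose G (a : R) := zonal_weight a * zonal_ft (Num.sqrt (2 + 2 * a) * Num.sqrt p).
have mG : measurable_fun setT G.
  apply: measurable_funM; first exact: measurable_zonal_weight.
  apply: (measurableT_comp (@measurable_zonal_ft R n)); apply: measurable_funM => //.
  by apply: (measurableT_comp msq); mfun.
have N1 : `|1| = 1 :> R by rewrite normr1.
have mG1 : measurable_fun setT (fun a : R => G (1 * a - 1)) by apply: (measurableT_comp mG); mfun.
apply: etrans (esym (@Rintegral_isom R 1 (-1) G N1 mG)) _.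
rewrite (Rintegral_scale k0 mG1) (_ : (2 * mu + 1) = 1 + (2 * mu)); last by ring.
have kk : k `^ (1 + 2 * mu) = k * k `^ (2 * mu) by rewrite (@powRDp R k 1 (2 * mu) k0) powRr1 ?(ltW k0).
rewrite kk -mulrA; clear kk; congr (_ * _); rewrite /zonal_conv.
apply: etrans (RintegralZl (k `^ (2 * mu)) measurableT (integrable_zonal_conv r s)); apply: eq_Rintegral => t _.
have ks : k * s = 2 by rewrite hk /s; field; rewrite !gt_eqF.
rewrite /G mul1r /zonal_weight (_ : 1 - (k * t - 1) ^+ 2 = k ^+ 2 * (t * (s - t))); last first.
  transitivity (k * (k * s) * t - k ^+ 2 * t ^+ 2); last by ring.
  by rewrite ks; ring.
rewrite powpM ?exprn_gt0// -(powR_mulrn 2 (ltW k0)) -powRrM -!mulrA; congr (_ * _).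
have [t0|t0] := leP t 0.
  rewrite (powp_le0 _ t0) mul0r powp_le0 ?mul0r//.
  have s0 : 0 < s by rewrite mulr_gt0 ?divr_gt0 ?exprn_gt0.
  by apply: mulr_le0_ge0 => //; lra.
have [st|ts] := leP s t.
  by rewrite powp_le0 ?mul0r 1?[powp mu (s - t)]powp_le0 ?mul0r ?mulr0//; [lra|apply: mulr_ge0_le0; lra].
rewrite powpM// -?mulrA; congr (_ * (_ * zonal_ft _)); first by rewrite powpE.
rewrite -sqrtrM; last by rewrite (_ : 2 + 2 * (k * t - 1) = 2 * k * t); [rewrite !mulr_ge0// ltW|ring].
rewrite (_ : (2 + 2 * (k * t - 1)) * p = r ^+ 2 * t); last by rewrite hk; field; rewrite gt_eqF.
by rewrite sqrtrM ?sqr_ge0// sqrtr_sqr gtr0_norm.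
Qed.

(** [zonal_ft_square] is an identity integrated against a radial h, so positivity is obtained for
    the average against psi. The choice h(p) = psi(k p) p^(mu + 1/2) turns its weight into psi(k p)
    p^(2 mu + 1), and [zonal_conv_sub] identifies the other side. *)
Lemma zonal_conv_pos (psi : R -> R) (r : R) : 0 < r -> measurable_fun setT psi -> (forall s, 0 <= psi s) ->
  leb.-integrable setT (EFin \o (fun s => psi s * powp (2 * mu + 1) s)) ->
  (forall t : R, 0 < t -> {ae leb, forall s : R, t < s -> 0 < psi s}) ->
  0 < \int[leb]_s (psi s * zonal_conv r s).
Proof.
(* With S = k p one has r sqrt S / 2 = sqrt p, the argument of Y in the square. *)
move=> r0 mpsi psi0 Ipsi aepsi; pose k := 4 / r ^+ 2.
have k0 : 0 < k by rewrite divr_gt0 ?exprn_gt0.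
pose h (p : R) := psi (k * p) * zonal_radial p.
have mh : measurable_fun setT h.
  apply: measurable_funM; last exact: measurable_zonal_radial.
  by apply: (measurableT_comp mpsi); mfun.
have h0 p : 0 <= h p by rewrite mulr_ge0 ?zonal_radial_ge0.
have zonal_radial2 p : zonal_radial p * h p = psi (k * p) * powp (2 * mu + 1) p.
  rewrite /h mulrCA; congr (_ * _); rewrite /zonal_radial -powpD; congr (powp _ p).
  have h2 : (2:R) != 0 by [].
  by field.
have I0 : leb.-integrable setT (EFin \o (fun p => zonal_radial p * h p)).
  have J := integrableZl measurableT (k `^ (- (2 * mu + 1))) (integrable_scale k0 Ipsi).
  apply: eq_integrable J => // p _; rewrite /= zonal_radial2 powpM// -EFinM; congr EFin.
  by rewrite mulrCA [X in _ * X]mulrA -powRDp// addNr powRr0 mul1r.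
have hi := (integrable_zonal_radialP n1 mh h0).2 I0.
pose F (p : R) := zonal_radial p * h p * zonal_ft (Num.sqrt p) ^+ 2.
have mF : measurable_fun setT F.
  apply: measurable_funM; first by apply: measurable_funM => //; exact: measurable_zonal_radial.
  by apply: measurable_funX; apply: (measurableT_comp (@measurable_zonal_ft R n)); exact: msq.
have IF : leb.-integrable setT (EFin \o F).
  have J := integrableZr measurableT (zonal_mass ^+ 2) I0.
  apply: (@integrable_dom _ T R leb _ (fun p => zonal_radial p * h p * zonal_mass ^+ 2)) => //.
  - move=> p; rewrite normrM [X in X * _]ger0_norm ?mulr_ge0 ?zonal_radial_ge0//.
    apply: ler_wpM2l; first by rewrite mulr_ge0 ?zonal_radial_ge0.
    by rewrite normrX lerXn2r ?nnegrE ?(ltW (@zonal_mass_gt0 R n n1)) ?zonal_ft_le.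
have ki : 0 < k^-1 by rewrite invr_gt0.
have Fpos : 0 < \int[leb]_p F p.
  rewrite (Rintegral_scale ki mF) pmulr_rgt0//.
  (* For s in (k/2, k) the variable p = s / k is below 1, where [zonal_ft_gt0] excludes zeros of
     Y. *)
  apply: (@Rintegral_gt0_ae _ T R leb `]k / 2, k[%classic) => //.
  - exact: (integrable_scale ki IF).
  - by move=> s; rewrite /F mulr_ge0 ?sqr_ge0// mulr_ge0 ?zonal_radial_ge0.
  - have kk : k / 2 < k by lra.
    have := @lebesgue_measure_itv R `]k / 2, k[; rewrite /= lte_fin kk => ->.
    by rewrite -EFinB lte_fin; lra.
  - have k2 : 0 < k / 2 by rewrite divr_gt0.
    have [A [mA A0 sub]] := aepsi _ k2; exists A; split => //; apply: subset_trans sub => s /= hs hpsi.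
    apply: hs; rewrite in_itv/= => /andP[s1 s2].
    have p0 : 0 < k^-1 * s by rewrite mulr_gt0//; lra.
    have p1 : k^-1 * s < 1 by rewrite mulrC ltr_pdivrMr// mul1r.
    rewrite /F zonal_radial2 mulr_gt0//.
      rewrite mulr_gt0 ?powp_gt0// mulrA mulfV ?gt_eqF// mul1r; exact: hpsi.
    rewrite exprn_gt0// zonal_ft_gt0// ger0_norm ?sqrtr_ge0//.
    by rewrite -[leRHS]sqrtr1 ler_sqrt// ltW.
have := zonal_ft_square n1 mh h0 hi; rewrite -/(F _) => E; move: Fpos.
pose f (a p : R) : R := zonal_weight a * (zonal_radial p * h p * zonal_ft (Num.sqrt (2 + 2 * a) * Num.sqrt p)).
have mf : measurable_fun setT (fun z : T * T => f z.1 z.2).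
  apply: measurable_funM; first by apply: (measurableT_comp (@measurable_zonal_weight R n)); mfun.
  apply: measurable_funM.
    apply: (@measurableT_comp _ _ _ _ _ _ (fun p => zonal_radial p * h p)); last by mfun.
    by apply: measurable_funM => //; exact: measurable_zonal_radial.
  apply: (measurableT_comp (@measurable_zonal_ft R n)); apply: measurable_funM.
    by apply: (measurableT_comp msq); mfun.
  by apply: (measurableT_comp msq); mfun.
have IhP : leb.-integrable setT (EFin \o (fun p => zonal_radial p * h p * zonal_mass)).
  by have := integrableZr measurableT zonal_mass I0; apply: eq_integrable.
have fin : (\int[leb]_a \int[leb]_p `|f a p|%:E < +oo)%E.
  apply: (@iter_dom _ _ T T R leb leb f zonal_weight (fun p => zonal_radial p * h p * zonal_mass) mf (@integrable_zonal_weight R n n1) IhP) => a p.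
  rewrite /f normrM (ger0_norm (zonal_weight_ge0 _ _)); apply: ler_wpM2l; first exact: zonal_weight_ge0.
  rewrite normrM [X in X * _]ger0_norm ?mulr_ge0 ?zonal_radial_ge0//.
  by apply: ler_wpM2l; rewrite ?mulr_ge0 ?zonal_radial_ge0// zonal_ft_le.
have mi a : measurable_fun setT (fun p => zonal_radial p * h p * zonal_ft (Num.sqrt (2 + 2 * a) * Num.sqrt p)).
  apply: measurable_funM; first by apply: measurable_funM => //; exact: measurable_zonal_radial.
  by apply: (measurableT_comp (@measurable_zonal_ft R n)); apply: measurable_funM.
have Ii a : leb.-integrable setT (EFin \o (fun p => zonal_radial p * h p * zonal_ft (Num.sqrt (2 + 2 * a) * Num.sqrt p))).
  apply: (@integrable_dom _ T R leb _ _ (mi a) IhP) => p.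
  rewrite normrM [X in X * _]ger0_norm ?mulr_ge0 ?zonal_radial_ge0//.
  by apply: ler_wpM2l; rewrite ?mulr_ge0 ?zonal_radial_ge0// zonal_ft_le.
have E1 : \int[leb]_p F p = \int[leb]_a \int[leb]_p f a p.
  by rewrite E; apply: eq_Rintegral => a _; rewrite /f (RintegralZl _ measurableT (Ii a)).
rewrite E1 (Rfubini mf fin).
pose g s : R := psi s * zonal_conv r s.
have mL : measurable_fun setT (zonal_conv r).
  apply: (@measurable_Rintegral_snd _ _ T T R leb (fun s t => powp mu t * powp mu (s - t) * zonal_ft (r * Num.sqrt t))).
  apply: measurable_funM.
    by apply: measurable_funM; apply: (measurableT_comp (@measurable_powp _ _)); mfun.
  apply: (measurableT_comp (@measurable_zonal_ft R n)); apply: measurable_funM => //.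
  by apply: (measurableT_comp msq); mfun.
have mg : measurable_fun setT g by exact: measurable_funM.
have E2 p : \int[leb]_a f a p = (2 / k) `^ (2 * mu + 1) * g (k * p).
  rewrite /f; under eq_Rintegral do rewrite mulrCA.
  have [p0|p0] := leP p 0.
    rewrite /g zonal_conv_le0 ?mulr0 ?pmulr_rle0//.
    rewrite (_ : (fun a => _) = fun=> 0) ?/Rintegral ?integral0//.
    by apply/funext => a; rewrite /zonal_radial (powp_le0 _ p0) !mul0r.
  have Ia := (@integrable_zonal_weightM R n n1 (fun a => zonal_ft (Num.sqrt (2 + 2 * a) * Num.sqrt p)) zonal_mass _ (fun a => zonal_ft_le n1 _)).1.
  rewrite RintegralZl//; last first.
    apply: Ia; apply: (measurableT_comp (@measurable_zonal_ft R n)); apply: measurable_funM => //.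
    by apply: (measurableT_comp msq); mfun.
  rewrite (zonal_conv_sub r0 p0) -/k zonal_radial2 /g powpE//.
  rewrite (_ : r ^+ 2 / (2 * p) = 2 / k * p^-1); last by rewrite /k; field; rewrite !gt_eqF.
  have -> : (2 / k * p^-1) `^ (2 * mu + 1) = (2 / k) `^ (2 * mu + 1) * p `^ (- (2 * mu + 1)).
    have k2 : 0 <= 2 / k by apply: ltW; apply: divr_gt0.
    have p2 : 0 <= p^-1 by rewrite invr_ge0 ltW.
    rewrite (powRM _ k2 p2); congr (_ * _).
    by rewrite -(powR_inv1 (ltW p0)) -powRrM mulN1r.
  set A := (2 / k) `^ _; set P := p `^ (2 * mu + 1); set Q := p `^ _.
  have PQ : P * Q = 1 by rewrite /P /Q -powRDp// addrN powRr0.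
  transitivity ((P * Q) * (A * (psi (k * p) * zonal_conv r (k * p)))); first by ring.
  by rewrite PQ mul1r.
have Ig : leb.-integrable setT (EFin \o (fun p => \int[leb]_a f a p)).
  apply: (@Rintegral_fubini_integrable _ _ T T R leb leb (fun p a => f a p)).
    exact: (measurableT_comp mf (@measurable_swap _ _ T T)).
  rewrite (@tonelli_swap _ _ T T R leb leb (fun p a => `|f a p|%:E)%E)//.
  apply/measurable_EFinP; apply: measurableT_comp => //.
  exact: (measurableT_comp mf (@measurable_swap _ _ T T)).
have c0 : 0 < (2 / k) `^ (2 * mu + 1) by apply: powR_gt0; apply: divr_gt0.
have Igk : leb.-integrable setT (EFin \o (fun p => g (k * p))).
  have J := integrableZl measurableT ((2 / k) `^ (2 * mu + 1))^-1 Ig.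
  by apply: eq_integrable J => // p _; rewrite /= E2 -EFinM mulKf// gt_eqF.
rewrite [X in 0 < X -> _](_ : _ = (2 / k) `^ (2 * mu + 1) * \int[leb]_p g (k * p)); last first.
  by apply: etrans (RintegralZl _ measurableT Igk); apply: eq_Rintegral => p _; exact: E2.
rewrite (pmulr_rgt0 _ c0) => gp; clear Igk Ig E2 E1 Ii mi fin IhP mf IF.
by rewrite (Rintegral_scale k0 mg) (pmulr_rgt0 _ k0).
Qed.

(** Multiplied by [zonal_radial], g becomes t^mu times a fractional integral of psi; Fubini in t and
    s then produces the average of [zonal_conv_pos]. *)
Lemma sphere_pos (psi g : R -> R) (x : n.+1.-tuple T) : 0 < normT x ->
  measurable_fun setT psi -> (forall s, 0 <= psi s) ->
  measurable_fun setT g -> (forall t, 0 <= g t) ->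
  (forall t : R, 0 < t -> leb.-integrable setT (EFin \o (fun s => psi s * powp mu (s - t)))) ->
  (forall t : R, 0 < t -> g t = powp (- 2^-1) t * \int[leb]_s (psi s * powp mu (s - t))) ->
  (lam n.+1).-integrable setT (EFin \o (fun y => g (sqT y))) ->
  (forall t : R, 0 < t -> {ae leb, forall s : R, t < s -> 0 < psi s}) ->
  0 < \int[lam n.+1]_y (cos (dotT x y) * g (sqT y)).
Proof.
move=> r0 mpsi psi0 mg g0 Ipsi gE gi aepsi.
rewrite (fourier_zonal n1 mg g0 gi) pmulr_rgt0 ?(@zonal_const_gt0 R n n1)// -/(normT x).
have Iq := (integrable_zonal_radialP n1 mg g0).1 gi.
have zqg t : 0 < t -> zonal_radial t * g t = powp mu t * \int[leb]_s (psi s * powp mu (s - t)).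
  by move=> t0; rewrite gE// mulrA /zonal_radial -powpD; congr (powp _ _ * _); field.
pose f0 (t s : R) : R := psi s * (powp mu t * powp mu (s - t)).
have mf0 : measurable_fun setT (fun z : T * T => f0 z.1 z.2).
  apply: measurable_funM; first by apply: (measurableT_comp mpsi); mfun.
  by apply: measurable_funM; apply: (measurableT_comp (@measurable_powp _ _)); mfun.
have f00 t s : 0 <= f0 t s by rewrite mulr_ge0 ?mulr_ge0 ?powp_ge0.
have If0 t : leb.-integrable setT (EFin \o f0 t) /\ \int[leb]_s f0 t s = zonal_radial t * g t.
  have [t0|t0] := leP t 0.
    have -> : f0 t = fun=> 0 by apply/funext => s; rewrite /f0 (powp_le0 _ t0) mul0r mulr0.
    by split; [exact: integrable0|rewrite /Rintegral integral0 /zonal_radial (powp_le0 _ t0) mul0r].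
  have J := integrableZl measurableT (powp mu t) (Ipsi t t0).
  split; first by apply: eq_integrable J => // s _; rewrite /f0 /= -EFinM; congr EFin; ring.
  rewrite zqg// -(RintegralZl _ measurableT (Ipsi t t0)); apply: eq_Rintegral => s _.
  by rewrite /f0; ring.
have fin0 : (\int[leb]_t \int[leb]_s `|f0 t s|%:E < +oo)%E.
  apply: (@iter_dom_ae _ _ T T R leb leb f0 (fun t => zonal_radial t * g t) mf0 Iq); apply: aeW => t.
  split; first exact: (If0 t).1.
  rewrite -(If0 t).2 le_eqVlt; apply/orP; left; apply/eqP; apply: eq_Rintegral => s _.
  by rewrite ger0_norm.
(* The same exchange without the oscillating factor, combined with [beta_conv], shows that psi(s)
   s^(2 mu + 1) is integrable. *)
have I2 : leb.-integrable setT (EFin \o (fun s => psi s * powp (2 * mu + 1) s)).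
  have J : leb.-integrable setT (EFin \o (fun s => \int[leb]_t f0 t s)).
    apply: (@Rintegral_fubini_integrable _ _ T T R leb leb (fun s t => f0 t s)).
      exact: (measurableT_comp mf0 (@measurable_swap _ _ T T)).
    rewrite (@tonelli_swap _ _ T T R leb leb (fun s t => `|f0 t s|%:E)%E)//.
    apply/measurable_EFinP; apply: measurableT_comp => //.
    exact: (measurableT_comp mf0 (@measurable_swap _ _ T T)).
  have B0 : 0 < projT1 (cid2 (beta_conv mu1 mu1)) by case: cid2.
  have J' := integrableZl measurableT (projT1 (cid2 (beta_conv mu1 mu1)))^-1 J.
  apply: eq_integrable J' => // s _; rewrite /f0 /= -EFinM; congr EFin.
  rewrite (RintegralZl _ measurableT (integrable_zonal_conv0 s).1) (integrable_zonal_conv0 s).2 mulrCA.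
  by rewrite mulKf// gt_eqF.
pose f (t s : R) : R := f0 t s * zonal_ft (normT x * Num.sqrt t).
have mf : measurable_fun setT (fun z : T * T => f z.1 z.2).
  apply: measurable_funM => //; apply: (measurableT_comp (@measurable_zonal_ft R n)).
  by apply: measurable_funM => //; apply: (measurableT_comp msq); mfun.
have fi t : leb.-integrable setT (EFin \o f t) /\ \int[leb]_s f t s = zonal_radial t * g t * zonal_ft (normT x * Num.sqrt t).
  have J := integrableZr measurableT (zonal_ft (normT x * Num.sqrt t)) (If0 t).1.
  split; first by apply: eq_integrable J.
  by rewrite (RintegralZr _ measurableT (If0 t).1) (If0 t).2.
have fin : (\int[leb]_t \int[leb]_s `|f t s|%:E < +oo)%E.
  have Iz := integrableZr measurableT zonal_mass Iq.
  apply: (@iter_dom_ae _ _ T T R leb leb f (fun t => zonal_radial t * g t * zonal_mass) mf); first by apply: eq_integrable Iz.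
  apply: aeW => t; split; first exact: (fi t).1.
  rewrite -(If0 t).2 -(RintegralZr _ measurableT (If0 t).1); apply: le_Rintegral => //.
  - by apply: integrable_norm; exact: (fi t).1.
  - by have J := integrableZr measurableT zonal_mass (If0 t).1; apply: eq_integrable J.
  - by move=> s _; rewrite /f normrM ger0_norm// ler_wpM2l// zonal_ft_le.
rewrite (_ : \int[leb]_t _ = \int[leb]_t \int[leb]_s f t s); last first.
  by apply: eq_Rintegral => t _; rewrite (fi t).2.
rewrite (Rfubini mf fin).
rewrite (_ : \int[leb]_s _ = \int[leb]_s (psi s * zonal_conv (normT x) s)); first exact: zonal_conv_pos.
apply: eq_Rintegral => s _; rewrite -(RintegralZl _ measurableT (integrable_zonal_conv (normT x) s)).
by apply: eq_Rintegral => t _; rewrite /f /f0; ring.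
Qed.

End product_formula.

(** * Fractional integrals of positive functions *)

Section ladder.
Context {R : realType}.

(** The Pochhammer symbol z (z + 1) ... (z + k - 1). *)
Definition rising (k : nat) (z : R) : R := \prod_(i < k) (z + i%:R).

Lemma risingS (k : nat) (z : R) : rising k.+1 z = rising k z * (z + k%:R).
Proof. by rewrite /rising big_ord_recr. Qed.

Lemma risingSl (k : nat) (z : R) : rising k.+1 z = z * rising k (z + 1).
Proof.
rewrite /rising big_ord_recl/= addr0; congr (_ * _); apply: eq_bigr => i _.
by rewrite /bump /= natrD addrA.
Qed.

(** The sum over 0 <= i <= j of binomial(j, i) times [rising k (c - i)]. *)
Fixpoint rising_sum (k j : nat) (c : R) : R :=
  if j is j'.+1 then rising_sum k j' c + rising_sum k j' (c - 1) else rising k c.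

(** A discrete Leibniz rule: multiplication by c, moved past j sums, leaves j extra terms. *)
Lemma rising_sum_shift (k j : nat) (c : R) : c * rising_sum k j (c + 1) = rising_sum k.+1 j c + j%:R * rising_sum k j.-1 c.
Proof.
elim: j c => [c|j IH c]; first by rewrite /= -risingSl mul0r addr0.
rewrite [rising_sum k _ _]/= addrK mulrDr IH.
have -> : c * rising_sum k j c = (c - 1) * rising_sum k j (c - 1 + 1) + rising_sum k j c by rewrite subrK; ring.
have h : j%:R * rising_sum k j c = j%:R * rising_sum k j.-1 c + j%:R * rising_sum k j.-1 (c - 1).
  by case: (j) => [|i]; rewrite ?mul0r ?addr0//= mulrDr.
rewrite IH -[j.+1.-1]/j -natr1 mulrDl mul1r h [rising_sum k.+1 j.+1 c]/=; ring.
Qed.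

(** For j = 0 this is the backward difference of a rising factorial; binomial sums commute with
    differences. *)
Lemma rising_sum_diff (k j : nat) (c : R) : rising_sum k.+1 j c - rising_sum k.+1 j (c - 1) = k.+1%:R * rising_sum k j c.
Proof.
elim: j c => [c|j IH c].
  by rewrite /= risingS risingSl subrK -natr1; ring.
have hS i x : rising_sum i j.+1 x = rising_sum i j x + rising_sum i j (x - 1) by [].
by rewrite !hS mulrDr -!IH; ring.
Qed.

Lemma rising_sum0 (j : nat) (c : R) : rising_sum 0 j c = 2 ^+ j.
Proof. by elim: j c => [c|j IH c]; rewrite /= ?IH ?/rising ?big_ord0// exprS; ring. Qed.

Lemma rising_sum1 (j : nat) (c : R) : rising_sum 1 j c = 2 ^+ j * (c - j%:R / 2).
Proof.
elim: j c => [c|j IH c]; rewrite [LHS]/=; first by rewrite risingS /rising big_ord0; ring.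
by rewrite !IH exprS -natr1; field.
Qed.

Lemma rising_sum2 (j : nat) (c : R) : rising_sum 2 j c = 2 ^+ j * ((c - j%:R / 2) * (c - j%:R / 2 + 1) + j%:R / 4).
Proof.
elim: j c => [c|j IH c]; rewrite [LHS]/=; first by rewrite !risingS /rising big_ord0; ring.
by rewrite !IH exprS -natr1; field.
Qed.

(** For t >= 0, |z - t + i| <= z + t + i in every factor. *)
Lemma rising_pair (k : nat) (z t : R) : 0 <= z -> 0 <= rising k (z + t) + rising k (z - t).
Proof.
wlog t0 : t / 0 <= t => [hw|] z0.
  have [/hw|t0] := leP 0 t; first exact.
  by have := hw (- t); rewrite opprK addrC; apply => //; rewrite oppr_ge0 ltW.
rewrite -[rising k (z - t)]opprK subr_ge0; apply: (le_trans (ler_norm _)); rewrite normrN /rising normr_prod.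
apply: ler_prod => i _; rewrite normr_ge0/= ler_norml.
have i0 : (0 : R) <= i%:R by []; apply/andP; split; lra.
Qed.

(** At c = z + j/2 the arguments c - i are symmetric about z and the terms pair off; the offset t is
    what the induction carries. *)
Lemma rising_sum_pair (k j : nat) (z t : R) : 0 <= z -> 0 <= rising_sum k j (z + t + j%:R / 2) + rising_sum k j (z - t + j%:R / 2).
Proof.
move=> z0; elim: j t => [t|j IH t]; first by rewrite mul0r !addr0 rising_pair.
have h1 := IH (t + 2^-1); have h2 := IH (t - 2^-1); rewrite [X in X + _]/= [X in _ + X]/=.
rewrite (_ : z + t + _ / 2 = z + (t + 2^-1) + j%:R / 2); last by rewrite -natr1; field.
rewrite (_ : z + (t + 2^-1) + j%:R / 2 - 1 = z + (t - 2^-1) + j%:R / 2); last by field.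
rewrite (_ : z - t + _ / 2 = z - (t - 2^-1) + j%:R / 2); last by rewrite -natr1; field.
rewrite (_ : z - (t - 2^-1) + j%:R / 2 - 1 = z - (t + 2^-1) + j%:R / 2); last by field.
lra.
Qed.

Lemma rising_sum_ge0 (k j : nat) (c : R) : j%:R / 2 <= c -> 0 <= rising_sum k j c.
Proof.
rewrite -subr_ge0 => /(rising_sum_pair k j 0); rewrite subr0 addr0 subrK; lra.
Qed.

(** The polynomial in q = x^2 left after m applications of -d/dx to x^(-c) exp(-x^2), once x^(-c-m)
    exp(-x^2) is taken out. *)
Fixpoint ladder (m : nat) (c q : R) : R :=
  if m is m'.+1 then c * ladder m' (c + 1) q + 2 * q * ladder m' (c - 1) q else 1.

(** Induction by Pascal's rule. The surplus from [rising_sum_shift] becomes, by [rising_sum_diff], a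
    difference of sums at c and c - 1; twice the sum at c - 1 from the second summand completes it
    to the next binomial sum. *)
Lemma ladderE (m : nat) (c q : R) : ladder m c q = \sum_(j < m.+1) 'C(m, j)%:R * rising_sum (m - j) j c * q ^+ j.
Proof.
elim: m c => [c|m IH c]; first by rewrite big_ord1 /= /rising big_ord0 bin0 expr0; ring.
rewrite [LHS]/= !IH [RHS]big_ord_recl bin0 expr0 subn0 mul1r mulr1.
under [X in _ = _ + X]eq_bigr => i _ do
  rewrite lift0 binS natrD subSS !mulrDl.
rewrite big_split/= addrA.
have -> : c * \sum_(j < m.+1) 'C(m, j)%:R * rising_sum (m - j) j (c + 1) * q ^+ j =
   \sum_(j < m.+1) 'C(m, j)%:R * rising_sum (m - j).+1 j c * q ^+ j +
   \sum_(j < m.+1) 'C(m, j)%:R * j%:R * rising_sum (m - j) j.-1 c * q ^+ j.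
  rewrite mulr_sumr -big_split; apply: eq_bigr => j _ /=.
  transitivity ('C(m, j)%:R * (c * rising_sum (m - j) j (c + 1)) * q ^+ j); first by ring.
  by rewrite rising_sum_shift; ring.
rewrite -[LHS]addrA; congr (_ + _).
  rewrite big_ord_recl bin0 expr0 subn0 mul1r mulr1; congr (_ + _).
  rewrite big_ord_recr/= bin_small// !mul0r addr0; apply: eq_bigr => i _.
  by rewrite /bump /= add1n subnS prednK// subn_gt0.
rewrite big_ord_recl/= mulr0 !mul0r add0r.
have -> : \sum_(i < m) 'C(m, bump 0 i)%:R * (bump 0 i)%:R * rising_sum (m - bump 0 i) (bump 0 i).-1 c * q ^+ bump 0 i =
   \sum_(i < m.+1) 'C(m, i)%:R * (rising_sum (m - i) i c - rising_sum (m - i) i (c - 1)) * q ^+ i.+1.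
  rewrite big_ord_recr/= subnn !rising_sum0 subrr mulr0 mul0r addr0; apply: eq_bigr => i _.
  rewrite /bump /= add1n; congr (_ * _).
  have -> : (m - i = (m - i.+1).+1)%N by rewrite subnS prednK// subn_gt0.
  rewrite rising_sum_diff -natrM mulrA -natrM; congr (_%:R * _).
  by rewrite mulnC mul_bin_left mulnC subnS prednK// subn_gt0.
rewrite mulr_sumr -big_split; apply: eq_bigr => i _ /=.
by rewrite exprS; ring.
Qed.

(** The coefficient of q^j is nonnegative for c >= j/2, and the leading one is 2^m for every c. *)
Lemma ladder_gt0 (m : nat) (c q : R) : (0 < m)%N -> (m.-1)%:R / 2 <= c -> 0 < q -> 0 < ladder m c q.
Proof.
move=> m0 hc q0; rewrite ladderE big_ord_recr/= subnn rising_sum0 binn mul1r.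
apply: ltr_wpDl; last by rewrite mulr_gt0 ?exprn_gt0.
apply: sumr_ge0 => i _; rewrite mulr_ge0 ?exprn_ge0 ?(ltW q0)// mulr_ge0//; apply: rising_sum_ge0.
apply: le_trans hc; rewrite ler_pM2r// ler_nat -ltnS prednK//.
Qed.

Arguments rising_sum : simpl never.

(* The coefficient of [q ^+ m.-1] may be negative; the quadratic formed with its two
   neighbours has negative discriminant. *)
Lemma ladder_gt0_even (m : nat) (c q : R) : (1 < m)%N -> (m.-1)%:R / 2 - 4^-1 <= c -> 0 < q -> 0 < ladder m c q.
Proof.
move=> m1 hc q0.
have [hc'|hc'] := leP ((m.-1)%:R / 2) c; first by apply: ladder_gt0 => //; exact: ltnW.
case: m m1 hc hc' => [//|[//|m]] _; rewrite -[m.+2.-1]/m.+1 => hc hc'.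
rewrite ladderE !big_ord_recr/= subnn (_ : m.+2 - m = 2)%N; last by rewrite -addn2 addKn.
rewrite (_ : m.+2 - m.+1 = 1)%N; last by rewrite -[m.+2]addn1 addKn.
rewrite rising_sum0 rising_sum1 rising_sum2 -addrA -addrA; apply: ltr_wpDl.
  apply: sumr_ge0 => i _; rewrite mulr_ge0 ?exprn_ge0 ?(ltW q0)// mulr_ge0//; apply: rising_sum_ge0.
  have : (i%:R : R) <= m%:R by rewrite ler_nat ltnW.
  by move: hc; rewrite -natr1; lra.
rewrite binn binSn.
have -> : ('C(m.+2, m)%:R : R) = m.+1%:R * m.+2%:R / 2.
  clear; elim: m => [|m IH]; first by rewrite bin0 mul1r divff.
  by rewrite binS binSn natrD IH -!natr1; field.
rewrite !exprS; set Q := q ^+ m; set P := 2 ^+ m.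
have PQ : 0 < P * Q by rewrite mulr_gt0 ?exprn_gt0.
have M0 : (0 : R) <= m%:R by [].
have hc1 : (m%:R + 1) / 2 - 4^-1 <= c by rewrite natr1.
have hc2 : c < (m%:R + 1) / 2 by rewrite natr1.
clear hc hc'; rewrite -!natr1; set M : R := m%:R in M0 hc1 hc2 *.
rewrite [ltRHS](_ : _ = P * Q * ((M + 1) * (M + 1 + 1) / 2 * ((c - M / 2) * (c - M / 2 + 1) + M / 4) +
   2 * (M + 1 + 1) * (c - (M + 1) / 2) * q + 4 * q ^+ 2)); last by field.
rewrite pmulr_rgt0//.
(* d is the deficit with respect to [ladder_gt0]; completing the square in q leaves a remainder that
   is positive for d <= 1/4. *)
pose d := (M + 1) / 2 - c; have d0 : 0 < d by rewrite /d; lra.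
have d1 : d <= 4^-1 by rewrite /d; lra.
have -> : c = (M + 1) / 2 - d by rewrite /d; ring.
clear - M0 q0 d0 d1.
rewrite [ltRHS](_ : _ = (2 * q - (M + 2) * d / 2) ^+ 2 + (M + 2) / 4 *
  (2 * (M + 1) * ((2^-1 - d) * (3 / 2 - d) + M / 4) - (M + 2) * d ^+ 2)); last by field.
apply: ltr_wpDl; first exact: sqr_ge0.
apply: mulr_gt0; first lra.
have : d ^+ 2 <= 16^-1 by nra.
have : 5 / 16 <= (2^-1 - d) * (3 / 2 - d) by nra.
nra.
Qed.

End ladder.

Section gaussian_ladder.
Context {R : realType}.
Notation leb := (@lebesgue_measure R).
Notation T := (measurableTypeR R).

Definition phi (c x : R) : R := powp (- c) x * expR (- x ^+ 2).

(** For x > 0, the m-th iterate of -d/dx on [phi c]: one step sends [phi c] to c times [phi (c + 1)]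
    plus 2 times [phi (c - 1)]. *)
Fixpoint psi (m : nat) (c x : R) : R :=
  if m is m'.+1 then c * psi m' (c + 1) x + 2 * psi m' (c - 1) x else phi c x.

Lemma measurable_phi c : measurable_fun setT (phi c).
Proof. by apply: measurable_funM; [exact: measurable_powp|mfun]. Qed.

Lemma measurable_psi m c : measurable_fun setT (psi m c).
Proof.
elim: m c => [c|m IH c]; first exact: measurable_phi.
by apply: measurable_funD; apply: measurable_funM => //; exact: IH.
Qed.

Lemma phi_ge0 (c x : R) : 0 <= phi c x.
Proof. by rewrite mulr_ge0 ?powp_ge0. Qed.

Lemma psi_le0 (m : nat) (c x : R) : x <= 0 -> psi m c x = 0.
Proof.
by move=> x0; elim: m c => [c|m IH c] /=; rewrite ?IH ?mulr0 ?addr0// /phi powp_le0 ?mul0r.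
Qed.

Lemma psiE (m : nat) (c x : R) : 0 < x -> psi m c x = x `^ (- c - m%:R) * expR (- x ^+ 2) * ladder m c (x ^+ 2).
Proof.
move=> x0; elim: m c => [c|m IH c] /=; first by rewrite /phi powpE// subr0 mulr1.
rewrite !IH (_ : - c - m.+1%:R = - (c + 1) - m%:R); last by rewrite -natr1; ring.
rewrite (_ : - (c - 1) - m%:R = - (c + 1) - m%:R + 2); last by ring.
rewrite (@powRDp R x (- (c + 1) - m%:R) 2 x0) (@powR_mulrn _ x 2 (ltW x0)).
by move: (_ `^ _) (expR _) (ladder _ _ _) (ladder _ _ _) => a b d e; ring.
Qed.

Lemma psi_gt0 (m : nat) (c x : R) : (0 < m)%N -> (m.-1)%:R / 2 <= c -> 0 < x -> 0 < psi m c x.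
Proof.
move=> m0 hc x0; rewrite psiE// mulr_gt0 ?ladder_gt0 ?exprn_gt0//.
by rewrite mulr_gt0 ?powR_gt0 ?expR_gt0.
Qed.

Lemma psi_gt0_even (m : nat) (c x : R) : (1 < m)%N -> (m.-1)%:R / 2 - 4^-1 <= c -> 0 < x -> 0 < psi m c x.
Proof.
move=> m0 hc x0; rewrite psiE// mulr_gt0 ?ladder_gt0_even ?exprn_gt0//.
by rewrite mulr_gt0 ?powR_gt0 ?expR_gt0.
Qed.

Let gauss_le (x : R) : expR (- x ^+ 2) <= expR 1 * expR (- (1 * x)).
Proof. by rewrite -expRD ler_expR; have := sqr_ge0 (x - 2^-1); rewrite sqrrB; lra. Qed.

Lemma powp_gauss_le (p t : R) : 0 < t -> exists C s : R, [/\ 0 <= C, 0 <= s &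
  forall x, t <= x -> powp p x * expR (- x ^+ 2) <= C * (powp (s + 1 - 1) x * expR (- (1 * x)))].
Proof.
move=> t0; exists (t `^ (Num.min p 0) * expR 1), (Num.max p 0); split.
- by rewrite mulr_ge0 ?powR_ge0 ?expR_ge0.
- by rewrite le_max lexx orbT.
move=> x tx; have x0 : 0 < x by exact: lt_le_trans tx.
rewrite addrK mulrACA; apply: ler_pM; rewrite ?powp_ge0 ?expR_ge0//.
have [p0|p0] := leP p 0; last by rewrite powRr0 mul1r.
have V y : 0 < y -> y `^ p = y^-1 `^ (- p) by move=> y0; rewrite powRV ?opprK// ltW.
rewrite !powpE// powRr0 mulr1 (V x x0) (V t t0).
by rewrite ge0_ler_powR ?nnegrE ?invr_ge0 ?(ltW x0) ?(ltW t0) ?oppr_ge0// lef_pV2 ?posrE.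
Qed.

Lemma integrable_tail (c p t : R) (g : R -> R) : 0 < t -> measurable_fun setT g ->
  (forall x, x <= t -> g x = 0) -> (forall x, t <= x -> `|g x| <= powp p x * expR (- x ^+ 2)) ->
  leb.-integrable setT (EFin \o g).
Proof.
move=> t0 mg g0 gle; have [C [s [C0 s0 h]]] := powp_gauss_le p t0.
have s1 : 0 < s + 1 by lra.
have J := integrableZl measurableT C (integrable_gamma s1 (ltr01 : 0 < 1 :> R)).
apply: (@integrable_dom _ T R leb _ (fun x => C * (powp (s + 1 - 1) x * expR (- (1 * x))))) => //.
move=> x; have [xt|tx] := leP x t.
  by rewrite g0// normr0 mulr_ge0// mulr_ge0 ?powp_ge0 ?expR_ge0.
by apply: (le_trans (gle _ (ltW tx))); apply: h; exact: ltW.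
Qed.

Lemma integrable_phi (c p t : R) : 0 < t -> 0 <= p ->
  leb.-integrable setT (EFin \o (fun s => phi c s * powp p (s - t))).
Proof.
move=> t0 p0; apply: (@integrable_tail 0 (p - c) t) => //.
- by apply: measurable_funM; [exact: measurable_phi|apply: (measurableT_comp (@measurable_powp _ _)); mfun].
- by move=> x xt; rewrite [powp p _]powp_le0 ?mulr0// subr_le0.
- move=> x tx; rewrite ger0_norm ?mulr_ge0 ?powp_ge0 ?phi_ge0//.
  rewrite /phi mulrAC -mulrA mulrCA mulrA; apply: ler_wpM2r; first exact: expR_ge0.
  rewrite powpD; apply: ler_wpM2r; first exact: powp_ge0.
  have x0 : 0 < x by exact: lt_le_trans tx.
  have [xt|xt] := leP (x - t) 0; first by rewrite powp_le0// powp_ge0.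
  by rewrite !powpE// ge0_ler_powR ?nnegrE ?(ltW xt) ?(ltW x0)// lerBlDr lerDl ltW.
Qed.

Lemma integrable_psi (m : nat) (c p t : R) : 0 < t -> 0 <= p ->
  leb.-integrable setT (EFin \o (fun s => psi m c s * powp p (s - t))).
Proof.
move=> t0 p0; elim: m c => [c|m IH c]; first exact: integrable_phi.
have := integrableD measurableT (integrableZl measurableT c (IH (c + 1))) (integrableZl measurableT 2 (IH (c - 1))).
apply: eq_integrable => // s _ /=; rewrite -EFinM -EFinD; congr EFin; ring.
Qed.

Lemma is_derive_phi (c x : R) : 0 < x -> is_derive x 1 (phi c) (- psi 1 c x).
Proof.
move=> x0; apply: (@near_eq_is_derive _ _ _ (fun y => y `^ (- c) * expR (- y ^+ 2))).
  by near=> y; rewrite /phi powpE//; near: y; exact: lt_nbhsr.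
have d := is_derive1_powR (- c) x0.
apply: is_derive_eq; rewrite /GRing.scale/= /phi !powpE// ?expr1.
rewrite (_ : - (c - 1) = - c + 1); last by ring.
rewrite (_ : - (c + 1) = - c - 1); last by ring.
rewrite (@powRDp R x (- c) 1 x0) powRr1 ?(ltW x0)//.
by move: (_ `^ _) (_ `^ _) (expR _) => a b e; ring.
Unshelve. all: by end_near. Qed.

Lemma continuous_psi1 (c x : R) : 0 < x -> {for x, continuous (psi 1 c)}.
Proof.
have cphi d : 0 < x -> {for x, continuous (phi d)}.
  move=> x0; apply: differentiable_continuous; apply/derivable1_diffP.
  by have [] := is_derive_phi d x0.
move=> x0; apply: continuousD; apply: continuousM; try exact: cst_continuous; exact: cphi.
Qed.

(** [powp 0] is the indicator of the positive half-line, so this is the fundamental theorem of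
    calculus from t to infinity. *)
Lemma psi_rep0 (c t : R) : 0 < t -> \int[leb]_s (psi 1 c s * powp 0 (s - t)) = phi c t.
Proof.
move=> t0.
have mI : measurable_fun setT (fun s : R => if t <= s then psi 1 c s else 0).
  apply: measurable_fun_ifT => //; [exact: measurable_fun_ler|exact: measurable_psi].
have ae : {ae leb, forall s : R, psi 1 c s * powp 0 (s - t) = if t <= s then psi 1 c s else 0}.
  have [A [mA A0 sub]] := @ae_neq R t; exists A; split => //; apply: subset_trans sub => s /= hs /eqP st.
  apply: hs; have [ts|ts|ts] := ltgtP t s; last by rewrite ts in st.
    by rewrite powpE ?subr_gt0// powRr0 mulr1.
  by rewrite powp_le0 ?mulr0// subr_le0 ltW.
have mP : measurable_fun setT (fun s : R => psi 1 c s * powp 0 (s - t)).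
  apply: measurable_funM; first exact: measurable_psi.
  by apply: (measurableT_comp (@measurable_powp _ _)); mfun.
rewrite (@ae_eq_Rintegral _ T R leb _ _ mP mI ae).
have [C [s [C0 s0 h]]] := powp_gauss_le (1 - c) t0.
apply: (@halfline_FTC R (phi c) (psi 1 c) t (C * (s / 1) `^ s)).
- by move=> x tx; apply: is_derive_phi; exact: lt_le_trans tx.
- by move=> x tx; apply: continuous_psi1; exact: lt_le_trans tx.
- have t2 : 0 < t / 2 by rewrite divr_gt0.
  have J := integrable_norm (integrable_psi 1 c t2 (lexx 0)).
  apply: (@integrable_dom _ T R leb _ (fun x => `|psi 1 c x * powp 0 (x - t / 2)|) mI); first by apply: eq_integrable J.
  move=> x; case: ifP => [tx|_]; last by rewrite normr0.
  rewrite [X in _ * X]powpE ?powRr0 ?mulr1//; lra.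
- move=> x tx; have x0 : 0 < x by exact: lt_le_trans tx.
  rewrite ger0_norm ?phi_ge0//; apply: (@le_trans _ _ (powp (1 - c) x * expR (- x ^+ 2))).
    rewrite powpD -mulrA [leRHS]mulrC; apply: (ler_wpM2l (phi_ge0 c x)).
     by rewrite powpE// powRr1 ?(ltW x0)// lerBlDr lerDl ltW.
  apply: (le_trans (h x tx)); apply: ler_wpM2l => //.
  rewrite addrK powpE// expRN ler_pdivrMr ?expR_gt0//.
  by apply: powR_le_expR => //; exact: ltW.
Qed.

(** Cauchy's formula for repeated integration, with K in the role of m!. The recursion for [psi]
    passes to c + 1 and c - 1, hence K is required to be the same for all c. *)
Lemma psi_rep m : exists2 K : R, 0 < K & forall c t : R, 0 < t ->
  \int[leb]_s (psi m.+1 c s * powp m%:R (s - t)) = K * phi c t.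
Proof.
elim: m => [|m [K K0 IH]]; first by exists 1 => // c t t0; rewrite psi_rep0// mul1r.
have m1 : 0 < m.+1%:R :> R by [].
have [B B0 hB] := beta_conv m1 (ltr01 : 0 < 1 :> R).
exists (K / B); first exact: divr_gt0.
move=> c t t0.
have hB1 s : leb.-integrable setT (EFin \o (fun u => powp m%:R (s - u) * powp 0 (u - t))) /\
    \int[leb]_u (powp m%:R (s - u) * powp 0 (u - t)) = B * powp m.+1%:R (s - t).
  have := hB t s; rewrite (_ : m.+1%:R - 1 = m%:R); last by rewrite -natr1; ring.
  by rewrite subrr addrK.
pose f (s u : R) : R := psi m.+2 c s * (powp m%:R (s - u) * powp 0 (u - t)).
have mf : measurable_fun setT (fun z : T * T => f z.1 z.2).
  apply: measurable_funM; first by apply: (measurableT_comp (@measurable_psi _ _)); mfun.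
  by apply: measurable_funM; apply: (measurableT_comp (@measurable_powp _ _)); mfun.
have mn : 0 <= m%:R :> R by []. have mS : 0 <= m.+1%:R :> R by [].
have Ig : leb.-integrable setT (EFin \o (fun s => `|psi m.+2 c s| * (B * powp m.+1%:R (s - t)))).
  have J := integrableZl measurableT B (integrable_norm (integrable_psi m.+2 c t0 mS)).
  apply: eq_integrable J => // s _; rewrite /= -EFinM normrM (ger0_norm (powp_ge0 _ _)); congr EFin.
  by rewrite mulrCA.
have fin : (\int[leb]_s \int[leb]_u `|f s u|%:E < +oo)%E.
  apply: (@iter_dom_ae _ _ T T R leb leb f _ mf Ig); apply: aeW => s; split.
    by have := integrableZl measurableT (psi m.+2 c s) (hB1 s).1; apply: eq_integrable.
  rewrite -(hB1 s).2 -(RintegralZl _ measurableT (hB1 s).1) le_eqVlt; apply/orP; left; apply/eqP.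
  by apply: eq_Rintegral => u _; rewrite /f normrM [X in _ * X]ger0_norm// mulr_ge0 ?powp_ge0.
have E1 : \int[leb]_s \int[leb]_u f s u = B * \int[leb]_s (psi m.+2 c s * powp m.+1%:R (s - t)).
  rewrite -(RintegralZl _ measurableT (integrable_psi m.+2 c t0 mS)); apply: eq_Rintegral => s _.
  by rewrite /f (RintegralZl _ measurableT (hB1 s).1) (hB1 s).2 mulrCA.
have E2 : \int[leb]_u \int[leb]_s f s u = K * phi c t.
  rewrite -(psi_rep0 c t0) -(RintegralZl _ measurableT (integrable_psi 1 c t0 (lexx 0))).
  apply: eq_Rintegral => u _; have [ut|tu] := leP u t.
    rewrite [powp 0 _]powp_le0 ?subr_le0// !mulr0.
    rewrite (_ : (fun s => _) = fun=> 0) ?/Rintegral ?integral0//.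
    by apply/funext => s; rewrite /f [powp 0 _]powp_le0 ?subr_le0// !mulr0.
  have u0 : 0 < u by exact: lt_trans tu.
  have I1 := integrable_psi m.+1 (c + 1) u0 mn; have I2 := integrable_psi m.+1 (c - 1) u0 mn.
  have J1 : leb.-integrable setT (EFin \o (fun s => c * (psi m.+1 (c + 1) s * powp m%:R (s - u)))).
    by have := integrableZl measurableT c I1; apply: eq_integrable.
  have J2 : leb.-integrable setT (EFin \o (fun s => 2 * (psi m.+1 (c - 1) s * powp m%:R (s - u)))).
    by have := integrableZl measurableT 2 I2; apply: eq_integrable.
  have hS k d (x : R) : psi k.+1 d x = d * psi k (d + 1) x + 2 * psi k (d - 1) x by [].
  have h0 d (x : R) : psi 0 d x = phi d x by [].
  transitivity (\int[leb]_s (c * (psi m.+1 (c + 1) s * powp m%:R (s - u)) + 2 * (psi m.+1 (c - 1) s * powp m%:R (s - u)))).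
    apply: eq_Rintegral => s _; rewrite /f [powp 0 _]powpE ?subr_gt0// powRr0 mulr1 hS; ring.
  rewrite (RintegralD measurableT J1 J2) (RintegralZl _ measurableT I1) (RintegralZl _ measurableT I2) !IH//.
  by rewrite [powp 0 _]powpE ?subr_gt0// powRr0 mulr1 hS !h0; ring.
have E : B * \int[leb]_s (psi m.+2 c s * powp m.+1%:R (s - t)) = K * phi c t.
  by rewrite -E1 (Rfubini mf fin); exact: E2.
by rewrite mulrAC -E mulrAC mulfV ?mul1r// gt_eqF.
Qed.

End gaussian_ladder.

(** * Positivity for N >= 3 and exponents up to (N+1)/2 *)

Section high_dimension.
Context {R : realType} (n : nat).
Hypothesis n1 : (1 < n)%N.
Notation leb := (@lebesgue_measure R).
Notation T := (measurableTypeR R).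
Notation lam n := (lebesgue_tuple R n).
Notation mu := (n%:R / 2 - 1 : R).
Notation N := (n.+1%:R : R).

Let mu0 : 0 <= mu.
Proof. by rewrite subr_ge0 ler_pdivlMr// mul1r ler_nat. Qed.

Let mu1 : 0 < mu + 1. Proof. by rewrite ltr_wpDl. Qed.

Let ge0_RintegralZl (c : R) (f : R -> R) : 0 <= c -> measurable_fun setT f -> (forall x, 0 <= f x) ->
  \int[leb]_x (c * f x) = c * \int[leb]_x f x.
Proof.
move=> c0 mf f0; rewrite /Rintegral.
under eq_integral do rewrite EFinM.
rewrite ge0_integralZl_EFin//; [|by move=> x _; rewrite lee_fin|exact/measurable_EFinP].
have : (0 <= \int[leb]_x (f x)%:E)%E by apply: integral_ge0 => x _; rewrite lee_fin.
case: (\int[leb]_x _)%E => [r _||//]; first by rewrite -EFinM.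
move=> _; have [->|c1] := eqVneq c 0; first by rewrite mul0e mul0r.
by rewrite gt0_muley ?lte_fin ?mulr0// lt_neqAle eq_sym c1.
Qed.

(* Half-integral version of the ladder: the missing half derivative is a beta convolution. *)
Lemma psi_half (m : nat) (c : R) : n%:R = 2 * m%:R + 1 :> R -> (forall s, 0 < s -> 0 < psi m.+1 c s) ->
  exists h : R -> R, [/\ measurable_fun setT h, (forall s, 0 <= h s),
    (forall t : R, 0 < t -> leb.-integrable setT (EFin \o (fun s => h s * powp mu (s - t))) /\
       phi c t = \int[leb]_s (h s * powp mu (s - t))) &
    (forall t : R, 0 < t -> {ae leb, forall s : R, t < s -> 0 < h s})].
Proof.
move=> nm psi0; have [K K0 rep] := @psi_rep R m.
have h2 : 0 < 2^-1 :> R by [].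
(* For n = 2m + 1 the orders 1/2 and mu + 1 add up to the integer m + 1 of [psi_rep]. *)
have [B B0 hB] := beta_conv h2 mu1.
have psi_ge0 s : 0 <= psi m.+1 c s.
  by have [s0|s0] := leP s 0; [rewrite psi_le0|rewrite ltW// psi0].
have hB1 t s : leb.-integrable setT (EFin \o (fun u => powp (- 2^-1) (s - u) * powp mu (u - t))) /\
    \int[leb]_u (powp (- 2^-1) (s - u) * powp mu (u - t)) = B * powp m%:R (s - t).
  have := hB t s; rewrite (_ : 2^-1 - 1 = - 2^-1 :> R); last by lra.
  rewrite (_ : 2^-1 + (mu + 1) - 1 = m%:R); last by rewrite nm; lra.
  by rewrite (_ : mu + 1 - 1 = mu)//; ring.
pose k (u s : R) : R := psi m.+1 c s * powp (- 2^-1) (s - u).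
have mk : measurable_fun setT (fun z : T * T => k z.1 z.2).
  apply: measurable_funM; first by apply: (measurableT_comp (@measurable_psi _ _ _)); mfun.
  by apply: (measurableT_comp (@measurable_powp _ _)); mfun.
have k_ge0 u s : 0 <= k u s by rewrite mulr_ge0 ?powp_ge0.
have mk1 u : measurable_fun setT (k u).
  apply: measurable_funM; first exact: measurable_psi.
  by apply: (measurableT_comp (@measurable_powp _ _)); mfun.
pose f (t s u : R) : R := psi m.+1 c s * (powp (- 2^-1) (s - u) * powp mu (u - t)).
have mf t : measurable_fun setT (fun z : T * T => f t z.1 z.2).
  apply: measurable_funM; first by apply: (measurableT_comp (@measurable_psi _ _ _)); mfun.
  by apply: measurable_funM; apply: (measurableT_comp (@measurable_powp _ _)); mfun.
have f_ge0 t s u : 0 <= f t s u by rewrite mulr_ge0 ?mulr_ge0 ?powp_ge0.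
have mn : 0 <= m%:R :> R by [].
have Ig t : 0 < t -> leb.-integrable setT (EFin \o (fun s => psi m.+1 c s * (B * powp m%:R (s - t)))).
  move=> t0; have J := integrableZl measurableT B (integrable_psi m.+1 c t0 mn).
  by apply: eq_integrable J => // s _; rewrite /= -EFinM mulrCA.
have fin t : 0 < t -> (\int[leb]_s \int[leb]_u `|f t s u|%:E < +oo)%E.
  move=> t0; apply: (@iter_dom_ae _ _ T T R leb leb (f t) _ (mf t) (Ig t t0)); apply: aeW => s; split.
    by have := integrableZl measurableT (psi m.+1 c s) (hB1 t s).1; apply: eq_integrable.
  rewrite -(hB1 t s).2 -(RintegralZl _ measurableT (hB1 t s).1) le_eqVlt; apply/orP; left; apply/eqP.
  by apply: eq_Rintegral => u _; rewrite ger0_norm.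
have E1 t : 0 < t -> \int[leb]_s \int[leb]_u f t s u = B * K * phi c t.
  move=> t0; rewrite -mulrA -(rep c t t0) -(RintegralZl _ measurableT (integrable_psi m.+1 c t0 mn)).
  apply: eq_Rintegral => s _.
  by rewrite /f (RintegralZl _ measurableT (hB1 t s).1) (hB1 t s).2 mulrCA.
have E2 t u : \int[leb]_s f t s u = powp mu (u - t) * \int[leb]_s k u s.
  apply: etrans (ge0_RintegralZl (powp_ge0 mu (u - t)) (mk1 u) (k_ge0 u)).
  by apply: eq_Rintegral => s _; rewrite /f /k; ring.
have BK : 0 < B * K by rewrite mulr_gt0.
exists (fun u => (B * K)^-1 * \int[leb]_s k u s); split.
- by apply: measurable_funM => //; apply: (@measurable_Rintegral_snd _ _ T T R leb k).
- by move=> s; rewrite mulr_ge0 ?invr_ge0 ?(ltW BK)//; apply: Rintegral_ge0.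
- move=> t t0.
  have J : leb.-integrable setT (EFin \o (fun u => \int[leb]_s f t s u)).
    apply: (@Rintegral_fubini_integrable _ _ T T R leb leb (fun u s => f t s u)).
      exact: (measurableT_comp (mf t) (@measurable_swap _ _ T T)).
    rewrite (@tonelli_swap _ _ T T R leb leb (fun u s => `|f t s u|%:E)%E)//; first exact: fin.
    apply/measurable_EFinP; apply: measurableT_comp => //.
    exact: (measurableT_comp (mf t) (@measurable_swap _ _ T T)).
  have J1 := integrableZl measurableT (B * K)^-1 J.
  split; first by apply: eq_integrable J1 => // u _; rewrite /= -EFinM E2 mulrAC mulrA.
  transitivity ((B * K)^-1 * \int[leb]_u \int[leb]_s f t s u); last first.
    rewrite -(RintegralZl _ measurableT J); apply: eq_Rintegral => u _; rewrite E2.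
    by rewrite mulrA mulrAC.
  by rewrite -(Rfubini (mf t) (fin t t0)) (E1 t t0) mulKf// gt_eqF.
move=> t t0.
(* The integral defining h(u) might diverge, and [fine] would then return 0. Integrability of almost
   all sections is why positivity holds only almost everywhere. *)
have ae := ae_integrable2 (RintegrableP (mf t) (fin t t0)).
apply: filterS ae => u Iu tu; rewrite mulr_gt0 ?invr_gt0//.
have p0 : 0 < powp mu (u - t) by rewrite powp_gt0// subr_gt0.
apply: (@Rintegral_gt0 _ T R leb `]u, (u + 1)[%classic) => //.
- have J1 := integrableZl measurableT (powp mu (u - t))^-1 Iu.
  apply: eq_integrable J1 => // s _; rewrite /= -EFinM /f /k; congr EFin.
  by rewrite [X in _ * X]mulrA mulrC mulfK// gt_eqF.
- have uu : u < u + 1 by rewrite ltrDl.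
  by have := @lebesgue_measure_itv R `]u, (u + 1)[; rewrite /= lte_fin uu => ->; rewrite -EFinB lte_fin subr_gt0.
- move=> s /=; rewrite in_itv/= => /andP[us _]; rewrite /k mulr_gt0 ?powp_gt0 ?subr_gt0//.
  by apply: psi0; apply: lt_trans us; exact: lt_trans tu.
Qed.

(** Here mu = m is an integer, and the density is [psi m.+1 c] itself up to the factor of
    [psi_rep]. *)
Lemma psi_full (m : nat) (c : R) : n%:R = 2 * m%:R + 2 :> R -> (forall s, 0 < s -> 0 < psi m.+1 c s) ->
  exists h : R -> R, [/\ measurable_fun setT h, (forall s, 0 <= h s),
    (forall t : R, 0 < t -> leb.-integrable setT (EFin \o (fun s => h s * powp mu (s - t))) /\
       phi c t = \int[leb]_s (h s * powp mu (s - t))) &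
    (forall t : R, 0 < t -> {ae leb, forall s : R, t < s -> 0 < h s})].
Proof.
move=> nm psi0; have [K K0 rep] := @psi_rep R m.
have muE : mu = m%:R by rewrite nm; lra.
have Ki : 0 < K^-1 by rewrite invr_gt0.
exists (fun s => K^-1 * psi m.+1 c s); split.
- by apply: measurable_funM => //; exact: measurable_psi.
- move=> s; apply: mulr_ge0; first exact: ltW.
  by have [s0|s0] := leP s 0; [rewrite psi_le0|rewrite ltW// psi0].
- move=> t t0; have I := integrable_psi m.+1 c t0 (ler0n R m); rewrite muE; split.
    have J := integrableZl measurableT K^-1 I.
    by apply: eq_integrable J => // s _; rewrite /= -EFinM mulrA.
  transitivity (K^-1 * \int[leb]_s (psi m.+1 c s * powp m%:R (s - t))).
    by rewrite (rep c t t0) mulKf// gt_eqF.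
  by rewrite -(RintegralZl _ measurableT I); apply: eq_Rintegral => s _; rewrite mulrA.
- by move=> t t0; apply: aeW => s ts; rewrite mulr_gt0// psi0// (lt_trans t0).
Qed.

(** b <= (N+1)/2 means c >= mu/2. For n even this is the condition of [psi_gt0]; for n odd it is 1/4
    less than that, the range of [psi_gt0_even]. *)
Lemma riesz_ft_gt0_high (b : R) (x : n.+1.-tuple T) : 0 < b -> b <= (N + 1) / 2 -> 0 < riesz_ft b x.
Proof.
(* At x = 0 the integrand is nonnegative; the product formula is used only for |x| > 0. *)
move=> b0 bN; have [x0|x0] := leP (normT x) 0.
  have d0 (y : n.+1.-tuple T) : dotT x y = 0.
    have nx : normT x = 0 by apply/eqP; rewrite eq_le x0 normT_ge0.
    by rewrite sqT_eq0// -normT_sqr nx expr0n.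
  apply: (@Rintegral_gt0_ae _ _ R (lam n.+1) setT) => //.
  - exact: integrable_riesz_ft.
  - by move=> y; rewrite d0 cos0 mul1r mulr_ge0 ?powp_ge0 ?expR_ge0.
  - exact: lam_setT_gt0.
  - apply: filterS (@sqT_ae R n) => y y0 _.
    by rewrite d0 cos0 mul1r mulr_gt0 ?powp_gt0 ?expR_gt0.
pose c : R := (N - b - 1) / 2.
have NE : N = n%:R + 1 by rewrite natr1.
have [h [mh h0 hr hae]] : exists h : R -> R, [/\ measurable_fun setT h, (forall s, 0 <= h s),
    (forall t : R, 0 < t -> leb.-integrable setT (EFin \o (fun s => h s * powp mu (s - t))) /\
       phi c t = \int[leb]_s (h s * powp mu (s - t))) &
    (forall t : R, 0 < t -> {ae leb, forall s : R, t < s -> 0 < h s})].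
  pose m := n./2; have := odd_double_half n; case: (odd n) => nm.
    have nR : n%:R = 2 * m%:R + 1 :> R by rewrite -nm -muln2 natrD natrM mulrC addrC.
    apply: (@psi_half m c nR) => s s0; apply: psi_gt0_even => //.
      by move: n1; rewrite -nm /m; case: (n./2).
    by rewrite /c -[m.+1.-1]/m; rewrite NE in bN *; lra.
  have m0 : (0 < m)%N by move: n1; rewrite -nm /m; case: (n./2).
  have mE : m.-1%:R + 1 = m%:R :> R by rewrite natr1 prednK.
  have nR : n%:R = 2 * m.-1%:R + 2 :> R.
    by rewrite -{1}nm add0n -muln2 natrM -/m -mE; ring.
  apply: (@psi_full m.-1 c nR) => s s0; apply: psi_gt0 => //.
  by rewrite /c -[m.-1.+1.-1]/m.-1; rewrite NE in bN *; lra.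
pose g t := powp (- 2^-1) t * phi c t.
have gE (y : n.+1.-tuple T) : riesz_weight b y = g (sqT y).
  rewrite /riesz_weight /g /phi mulrA -powpD; by congr (powp _ _ * _); rewrite /c; field.
have -> : riesz_ft b x = \int[lam n.+1]_y (cos (dotT x y) * g (sqT y)) by apply: eq_Rintegral => y _; rewrite gE.
apply: (@sphere_pos R n n1 h g) => //.
- by apply: measurable_funM; [exact: measurable_powp|exact: measurable_phi].
- by move=> t; rewrite mulr_ge0 ?powp_ge0 ?phi_ge0.
- by move=> t /hr[].
- by move=> t t0; rewrite /g (hr t t0).2.
- by have := @integrable_riesz_weight R n b b0; apply: eq_integrable => // y _; rewrite /= gE.
Qed.

End high_dimension.

(** * Scaling *)

Section transfer.
Context {R : realType} (n : nat).
Notation T := (measurableTypeR R).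
Notation lam n := (lebesgue_tuple R n).
Notation N := (n.+1%:R : R).

Definition tuple_of_row (x : 'rV[R]_n.+1) : n.+1.-tuple T := [tuple (x ord0 i : T) | i < n.+1].

Let row_of_tupleK (y : n.+1.-tuple T) : tuple_of_row (row_of_tuple y) = y.
Proof. by apply: eq_from_tnth => i; rewrite tnth_mktuple mxE. Qed.

Let dotRNE (x : 'rV[R]_n.+1) (y : n.+1.-tuple T) : dotRN x (row_of_tuple y) = dotT (tuple_of_row x) y.
Proof. by apply: eq_bigr => i _; rewrite tnth_mktuple mxE. Qed.

Lemma normRNE (x : 'rV[R]_n.+1) : normRN x = normT (tuple_of_row x).
Proof. by congr Num.sqrt; apply: eq_bigr => i _; rewrite tnth_mktuple expr2. Qed.

Let tuple_of_rowB (x : 'rV[R]_n.+1) (y : n.+1.-tuple T) :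
  tuple_of_row (x - row_of_tuple y) = subT (tuple_of_row x) y.
Proof. by apply: eq_from_tnth => i; rewrite !tnth_mktuple !mxE mulN1r addrC. Qed.

(** At the origin both conventions give the value 0, since b is not 0. *)
Let rieszE (b : R) (y : n.+1.-tuple T) : 0 < b -> riesz b (row_of_tuple y) = powp (- (b / 2)) (sqT y).
Proof.
move=> b0; rewrite /riesz normRNE row_of_tupleK; have [y0|y0] := leP (sqT y) 0.
  rewrite powp_le0// /normT (_ : sqT y = 0) ?sqrtr0 ?powR0//.
    by rewrite oppr_eq0 gt_eqF.
  by apply/eqP; rewrite eq_le y0 sqT_ge0.
rewrite powpE// -normT_sqr -powR_mulrn ?normT_ge0// -powRrM; congr (_ `^ _); by field.
Qed.

Let kernelE (x : 'rV[R]_n.+1) (t : R) : biheat_kernel x t =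
  (2 * pi) ^- n.+1 * \int[lam n.+1]_y (cos (dotT (tuple_of_row x) y) * expR (- (t * normT y ^+ 4))).
Proof.
rewrite /biheat_kernel /integralCN /integralRN /= !mul0r subr0; congr (_ * _).
apply: eq_Rintegral => y _; rewrite dotRNE normRNE row_of_tupleK /=.
by rewrite [X in _ - X]mul0r subr0 mulrC; congr (cos _ * expR _); ring.
Qed.

Notation dil k x := (affT k (zT n.+1) x).

Let kernel_scale (x : 'rV[R]_n.+1) (s : R) : 0 < s -> biheat_kernel x (s ^+ 4) =
  (2 * pi) ^- n.+1 * s ^- n.+1 * heat1 (dil s^-1 (tuple_of_row x)).
Proof.
move=> s0; rewrite kernelE -mulrA; congr (_ * _).
have si : 0 < s^-1 by rewrite invr_gt0.
rewrite (Rintegral_dil si); last by mfun; apply: (measurableT_comp (continuous_measurable_fun (@sqrt_continuous R))); exact: measurable_sqT.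
rewrite exprVn; congr (_ * _); apply: eq_Rintegral => y _.
rewrite dotT_dil; congr (cos _ * expR (- _)).
  by rewrite [RHS]dotTC dotT_dil dotTC.
have e4 (u : R) : u ^+ 4 = (u ^+ 2) ^+ 2 by rewrite -exprM.
by rewrite !e4 normT_sqr sqT_dil -exprMn mulrA -exprMn mulfV ?gt_eqF// expr1n mul1r.
Qed.

Lemma biheatE (b s : R) (x : 'rV[R]_n.+1) : 0 < b -> b < N -> 0 < s ->
  biheat (s ^+ 4) (riesz b) x = (2 * pi) ^- n.+1 * s `^ (- b) * riesz_heat1 b (dil s^-1 (tuple_of_row x)).
Proof.
move=> b0 bN s0; have s2 : 0 < s ^+ 2 by rewrite exprn_gt0.
rewrite /biheat /integralRN.
pose X := dil s^-1 (tuple_of_row x).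
pose c : R := (2 * pi) ^- n.+1 * s ^- n.+1.
pose f (y : n.+1.-tuple T) := c * heat1 (dil s^-1 (subT (tuple_of_row x) y)) * powp (- (b / 2)) (sqT y).
have -> : \int[lam n.+1]_y (biheat_kernel (x - row_of_tuple y) (s ^+ 4) * riesz b (row_of_tuple y)) =
    \int[lam n.+1]_y f y.
  by apply: eq_Rintegral => y _; rewrite kernel_scale// tuple_of_rowB rieszE.
have mf : measurable_fun setT f.
  apply: measurable_funM; last by apply: (measurableT_comp (@measurable_powp _ _)); exact: measurable_sqT.
  apply: measurable_funM => //; apply: (measurableT_comp (@measurable_heat1 R n)).
  by apply: (measurableT_comp (@measurable_affT _ _ _ _)); exact: measurable_affT.
have I := @integrable_riesz_heat1 R n b X (ltW b0) bN.
rewrite (Rintegral_dil s0 mf).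
have -> : \int[lam n.+1]_y f (dil s y) = c * s `^ (- b) * riesz_heat1 b X.
  rewrite /riesz_heat1 -(RintegralZl (c * s `^ (- b)) measurableT I); apply: eq_Rintegral => y _.
  rewrite /f sqT_dil powpM//.
  rewrite (_ : dil s^-1 (subT (tuple_of_row x) (dil s y)) = subT X y); last first.
    apply: eq_from_tnth => i; rewrite !tnth_mktuple !addr0; field; by rewrite gt_eqF.
  have -> : (s ^+ 2) `^ (- (b / 2)) = s `^ (- b).
    by rewrite -powR_mulrn ?(ltW s0)// -powRrM; congr (_ `^ _); field.
  by move: (heat1 _) (powp _ _) (_ `^ _) => k p q; ring.
rewrite /c -/X; move: (riesz_heat1 b X) (_ `^ _) => u p.
have sn : s ^+ n.+1 * s ^- n.+1 = 1 by rewrite mulfV// expf_neq0// gt_eqF.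
transitivity ((s ^+ n.+1 * s ^- n.+1) * ((2 * pi) ^- n.+1 * p * u)); first by ring.
by rewrite sn mul1r.
Qed.

Let q_gt0 : 0 < (2 * pi) ^- n.+1 :> R.
Proof. by rewrite invr_gt0 exprn_gt0// mulr_gt0// pi_gt0. Qed.

(** Times are written s^4, so that space scales by s. *)
Let root4 (t : R) : 0 < t -> exists s : R, [/\ 0 < s, s ^+ 4 = t & forall b, s `^ b = t `^ (b / 4)].
Proof.
move=> t0; exists (t `^ 4^-1); split; first exact: powR_gt0.
  by rewrite -powR_mulrn ?powR_ge0// -powRrM mulVf// powRr1// ltW.
by move=> b; rewrite -powRrM mulrC.
Qed.

Lemma biheat_gt0P (b : R) : 0 < b -> b < N ->
  ((forall (x : 'rV[R]_n.+1) (t : R), 0 < t -> 0 < biheat t (riesz b) x) <->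
   (forall x : n.+1.-tuple T, 0 < riesz_heat1 b x)).
Proof.
move=> b0 bN; split => [h x|h x t /root4[s [s0 <- _]]]; last first.
  by rewrite biheatE// mulr_gt0 ?mulr_gt0 ?powR_gt0.
have := h (row_of_tuple x) (1 ^+ 4); rewrite biheatE// expr1n => /(_ ltr01).
have p0 : 0 < (2 * pi) ^- n.+1 * 1 `^ (- b) :> R by rewrite mulr_gt0// powR_gt0.
rewrite (pmulr_rgt0 _ p0) row_of_tupleK (_ : dil _ _ = x)//.
by apply: eq_from_tnth => i; rewrite !tnth_mktuple invr1 mul1r addr0.
Qed.

Lemma biheat_lt0 (b : R) (x : n.+1.-tuple T) : 0 < b -> b < N -> riesz_heat1 b x < 0 ->
  biheat (1 ^+ 4) (riesz b) (row_of_tuple x) < 0.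
Proof.
move=> b0 bN u0; have p0 : 0 < (2 * pi) ^- n.+1 * 1 `^ (- b) :> R by rewrite mulr_gt0// powR_gt0.
rewrite (biheatE _ b0 bN ltr01) (pmulr_rlt0 _ p0) row_of_tupleK (_ : dil _ _ = x)//.
by apply: eq_from_tnth => i; rewrite !tnth_mktuple invr1 mul1r addr0.
Qed.

(** Relates the denominator of the final bounds to the weight 1 + |X|^b at the self-similar variable
    X = x / s. *)
Let denomE (b s : R) (x : 'rV[R]_n.+1) : 0 < s ->
  s `^ b * (1 + sqT (dil s^-1 (tuple_of_row x)) `^ (b / 2)) = normRN x `^ b + s `^ b.
Proof.
move=> s0; rewrite mulrDr mulr1 addrC; congr (_ + _).
rewrite sqT_dil -normT_sqr -exprMn -normRNE.
have r0 : 0 <= normRN x by exact: sqrtr_ge0.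
have sr : 0 <= s^-1 * normRN x by rewrite mulr_ge0 ?invr_ge0 ?(ltW s0).
rewrite -powR_mulrn// -powRrM (_ : 2%:R * (b / 2) = b); last by field.
by rewrite -powRM ?(ltW s0)// mulrA mulfV ?mul1r// gt_eqF.
Qed.

Let denom_gt0 (b t r : R) : 0 < t -> 0 < r `^ b + t `^ (b / 4).
Proof. by move=> t0; rewrite ltr_wpDl ?powR_ge0 ?powR_gt0. Qed.

Let biheat_denom (b s : R) (x : 'rV[R]_n.+1) : 0 < b -> b < N -> 0 < s ->
  biheat (s ^+ 4) (riesz b) x * (normRN x `^ b + s `^ b) = (2 * pi) ^- n.+1 *
  ((1 + sqT (dil s^-1 (tuple_of_row x)) `^ (b / 2)) * riesz_heat1 b (dil s^-1 (tuple_of_row x))).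
Proof.
move=> b0 bN s0; rewrite biheatE// -denomE//.
have sb : s `^ (- b) * s `^ b = 1 by rewrite -powRDp// addNr powRr0.
move: (riesz_heat1 _ _) (_ + _) ((2 * pi) ^- _) => u d q.
transitivity (q * (s `^ (- b) * s `^ b) * (d * u)); first by ring.
by rewrite sb mulr1.
Qed.

Lemma biheat_lower (b : R) : 0 < b -> b < N -> (forall x : n.+1.-tuple T, 0 < riesz_heat1 b x) ->
  exists K : R, 0 < K /\ forall (x : 'rV[R]_n.+1) (t : R), 0 < t ->
    K / (normRN x `^ b + t `^ (b / 4)) <= biheat t (riesz b) x.
Proof.
move=> b0 bN /(riesz_heat1_lower b0 bN)[c c0 hc]; exists ((2 * pi) ^- n.+1 * c); split; first exact: mulr_gt0.
move=> x t t0; have := @denom_gt0 b t (normRN x) t0; have [s [s0 <- <-]] := root4 t0 => d0.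
by rewrite ler_pdivrMr// biheat_denom// ler_wpM2l ?(ltW q_gt0).
Qed.

Lemma biheat_upper (b : R) : 0 < b -> b < N ->
  exists K : R, 0 < K /\ forall (x : 'rV[R]_n.+1) (t : R), 0 < t ->
    `|biheat t (riesz b) x| <= K / (normRN x `^ b + t `^ (b / 4)).
Proof.
move=> b0 bN; have [c c0 hc] := @riesz_heat1_bound R n b b0 bN.
exists ((2 * pi) ^- n.+1 * (c + 1)); split; first by rewrite mulr_gt0// ltr_wpDl.
move=> x t t0; have := @denom_gt0 b t (normRN x) t0; have [s [s0 <- <-]] := root4 t0 => d0.
rewrite ler_pdivlMr// -[X in _ * X](gtr0_norm d0) -normrM biheat_denom// normrM (gtr0_norm q_gt0).
apply: ler_wpM2l; first exact: ltW.
rewrite normrM [X in X * _]ger0_norm; last by rewrite addr_ge0 ?powR_ge0.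
by apply: le_trans (hc _) _; rewrite lerDl.
Qed.

End transfer.

Theorem theorem1p2 (R : realType) (N : nat) (hN : (1 <= N)%N) :
  (exists beta1 beta2 : R,
      0 < beta1 < N%:R /\
      0 < beta2 < N%:R /\
      beta1 <= beta2 /\
      beta_threshold R N < beta1 /\
      (forall beta : R, 0 < beta < beta1 ->
        forall (x : 'rV[R]_N) (t : R), 0 < t -> 0 < biheat t (riesz beta) x) /\
      (forall beta : R, beta2 < beta < N%:R ->
        (ereal_inf [set (biheat p.2 (@riesz R N beta) p.1)%:E
                   | p in [set p : 'rV[R]_N * R | (0 < p.2)%R]] < 0)%E)) /\
  (forall beta : R, 0 < beta < N%:R ->
    (forall (x : 'rV[R]_N) (t : R), 0 < t -> 0 < biheat t (riesz beta) x) ->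
    exists K : R, 0 < K /\
      forall (x : 'rV[R]_N) (t : R), 0 < t ->
        K / (normRN x `^ beta + t `^ (beta / 4)) <= biheat t (riesz beta) x) /\
  (forall beta : R, 0 < beta < N%:R ->
    exists K : R, 0 < K /\
      forall (x : 'rV[R]_N) (t : R), 0 < t ->
        `|biheat t (riesz beta) x| <= K / (normRN x `^ beta + t `^ (beta / 4))).
Proof.
case: N hN => [//|n] _; split; last first.
  split=> b /andP[b0 bN]; last exact: biheat_upper.
  by move=> /(biheat_gt0P b0 bN); exact: biheat_lower.
have N1 : 1 <= n.+1%:R :> R by rewrite ler1n.
(* Positivity on a closed range (0, b0] that reaches the threshold; strictness will come from
   openness at b0. *)
have [b0 [b00 b0N b0t Up]] : exists b0 : R, [/\ 0 < b0, b0 < n.+1%:R, beta_threshold R n.+1 <= b0 &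
    forall b (x : n.+1.-tuple (measurableTypeR R)), 0 < b -> b <= b0 -> 0 < riesz_heat1 b x].
  have Up (b0 : R) : b0 < n.+1%:R ->
      (forall b (x : n.+1.-tuple (measurableTypeR R)), 0 < b -> b <= b0 -> 0 < riesz_ft b x) ->
      forall b (x : n.+1.-tuple (measurableTypeR R)), 0 < b -> b <= b0 -> 0 < riesz_heat1 b x.
    move=> b0N Fp b x bp bb; have [C C0 ->] := @riesz_fourier R n b bp (le_lt_trans bb b0N).
    by rewrite mulr_gt0// Fp.
  have [n1|n1] := ltnP 1 n.
    have N3 : 3 <= n.+1%:R :> R by rewrite ler_nat.
    have bN : (n.+1%:R + 1) / 2 < n.+1%:R :> R by lra.
    exists ((n.+1%:R + 1) / 2); split; [lra|exact: bN| |].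
      by clear -n1; case: n n1 => [|[|k]].
    by apply: Up bN _ => b x bp bb; exact: riesz_ft_gt0_high.
  have bN : 2^-1 < n.+1%:R :> R by lra.
  (* This equals the threshold for N = 2 and exceeds 7/16, the one for N = 1. *)
  exists 2^-1; split; [by []|exact: bN| |].
    by clear -n1; case: n n1 => [|[|k]]//= _; lra.
  by apply: Up bN _ => b x bp bb; exact: riesz_ft_gt0_half.
have [e e0 [eN Ue]] := @riesz_heat1_open R n b0 b00 b0N (fun x => Up b0 x b00 (lexx _)).
have [b1 b1N Un] := @riesz_heat1_neg R n.
have be : 0 < b0 + e by lra.
(* The maximum enforces beta1 <= beta2; both entries stay below N. *)
exists (b0 + e), (Num.max (b0 + e) b1); split; [by rewrite be eN|split; [|split; [|split; [|split]]]].
- by rewrite lt_max be/= gt_max eN b1N.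
- by rewrite le_max lexx.
- by lra.
- move=> b /andP[bp bb].
  have bN : b < n.+1%:R by exact: lt_trans eN.
  apply/(biheat_gt0P bp bN) => x; have [h|h] := leP b b0; first exact: Up.
  by apply: Ue; exact: ltW.
- move=> b /andP[]; rewrite gt_max => /andP[bb b1b] bN.
  have bp : 0 < b by exact: lt_trans bb.
  have [x ux] := Un b b1b bN.
  (* The infimum is at most the value at time 1 at a point where U is negative. *)
  apply: (@le_lt_trans _ _ (biheat (1 ^+ 4) (riesz b) (row_of_tuple x))%:E).
    by apply: ereal_inf_lbound; exists (row_of_tuple x, 1 ^+ 4) => //=; rewrite expr1n.
  by rewrite lte_fin biheat_lt0.
Qed.
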